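(* Let $M,N$ be smooth manifolds and $\Phi\in C^\infty(M,N)$. A given closed relative 3-form $(\tau,\kappa)\in\Omega^3(\Phi)=\Omega^2(M)\oplus\Omega^3(N)$ arises as the curvature of some relative gerbe with connection for $\Phi$ if and only if $(\tau,\kappa)$ is integral.
   Context: Relative forms: $\Omega^n(\Phi)=\Omega^{n-1}(M)\oplus\Omega^n(N)$ with $d(\alpha,\beta)=(\Phi^*\beta-d\alpha,d\beta)$; so $(\tau,\kappa)$ is closed iff $d\kappa=0$ and $d\tau=\Phi^*\kappa$. A closed relative form is integral if its class in $H^n(\Phi,\mathbb R)$ lies in the image of $H^n(\Phi,\mathbb Z)\to H^n(\Phi,\mathbb R)$, where $H^n(\Phi,R)$ is the cohomology of the mapping cone of $\Phi^*$ on singular cochains and de Rham relative cohomology is identified with $H^n(\Phi,\mathbb R)$ by integration. Notation. For an open cover $\{U_i\}$ and Hermitian line bundles $L_{ii'}$ on $U_{ii'}=U_i\cap U_{i'}$ put $(\delta L)_{ii'i''}=L_{i'i''}\otimes L_{ii''}^{-1}\otimes L_{ii'}$; for $E_i$ on $U_i$ put $(\delta E)_{ii'}=E_{i'}\otimes E_i^{-1}$; likewise for sections, connections and (additively) forms. Curvature of a Hermitian line bundle with connection is the real 2-form $F$ with $F=dA$ where $\nabla\sigma=2\pi\sqrt{-1}A\sigma$ for a local unitary section $\sigma$. A gerbe $\mathcal G=(\mathcal V,L,\theta)$ on $N$: an open cover, Hermitian line bundles $L_{jj'}$ on $V_{jj'}$ with $L_{jj'}\cong L_{j'j}^{-1}$,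 unitary sections $\theta$ of $\delta L$ with $\delta\theta=1$ (up to refinement of covers). A gerbe connection $(\nabla,\varpi)$: connections $\nabla_{jj'}$ on $L_{jj'}$ with $(\delta\nabla)\theta=0$ and 2-forms $\varpi_j\in\Omega^2(V_j)$ with $\varpi_{j'}-\varpi_j=F_{jj'}=\operatorname{curv}(\nabla_{jj'})$; its curvature is the global 3-form $\kappa|_{V_j}=d\varpi_j$. A quasi-line bundle $\mathcal L=(E,\psi)$ for a gerbe $(\mathcal U,L,\theta)$ on $M$: Hermitian line bundles $E_i\to U_i$ and unitary sections $\psi_{ii'}$ of $(\delta E^{-1})_{ii'}\otimes L_{ii'}$ with $\delta\psi=\theta$. A connection on it: connections $\nabla^E_i$ on $E_i$ (curvature $F^E_i$) with $(\delta\nabla^E)_{ii'}\cong\nabla_{ii'}$ via $\psi$. A relative gerbe with connection for $\Phi$ is $(\mathcal L,\mathcal G)$ with $\mathcal G$ a gerbe with connection on $N$ and $\mathcal L$ a quasi-line bundle with connection for $\Phi^*\mathcal G$ (covers with $\Phi(U_i)\subset V_{r(i)}$). Its curvature is $(\tau,\kappa)$, where $\kappa$ is the curvature of $\mathcal G$ and $\tau|_{U_i}=\Phi^*\varpi_{r(i)}-F^E_i$. *)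

(* Defs.v *)
From HB Require Import structures.
From mathcomp Require Import all_boot all_order all_algebra.
From mathcomp Require Import complex.
From mathcomp Require Import all_classical all_reals all_analysis.

Set Implicit Arguments.
Unset Strict Implicit.
Unset Printing Implicit Defensive.

Import Order.TTheory GRing.Theory Num.Theory.
Import numFieldNormedType.Exports.

Local Open Scope classical_set_scope.
Local Open Scope ring_scope.

Section SmoothEuclidean.
Context {R : realType} {V W : normedModType R}.

Fixpoint iter_derive (vs : seq V) (f : V -> W) : V -> W :=
  if vs is v :: vs' then 'D_v (iter_derive vs' f) else f.

(* C^oo on the open set U: every iterated directional derivative exists and
   is continuous at every point of U *)
Definition smooth_on (U : set V) (f : V -> W) : Prop :=
  forall (vs : seq V) (x : V), U x ->
    {for x, continuous (iter_derive vs f)} /\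
    (forall v : V, derivable (iter_derive vs f) x v).
End SmoothEuclidean.

Section Manifolds.
Context {R : realType}.

Record chart (X : topologicalType) (n : nat) := Chart {
  cdom : set X;
  cto : X -> 'rV[R]_n;
  cfrom : 'rV[R]_n -> X }.

Definition is_chart (X : topologicalType) (n : nat) (c : chart X n) : Prop :=
  [/\ open (cdom c),
      open (cto c @` cdom c),
      forall p, cdom c p -> cfrom c (cto c p) = p,
      {within cdom c, continuous (cto c)} &
      {within cto c @` cdom c, continuous (cfrom c)}].

(* [mchart p] is a preferred chart of the atlas around p; it serves only to
   identify the tangent space at p with R^n *)
Record manifold (n : nat) := Manifold {
  mspace :> topologicalType;
  matlas : set (chart mspace n);
  mchart : mspace -> chart mspace n;
  m_hausdorff : hausdorff_space mspace;
  m_second_countable : @second_countable mspace;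
  m_is_chart : forall c, matlas c -> is_chart c;
  m_compatible : forall c c', matlas c -> matlas c' ->
    smooth_on (cto c @` (cdom c `&` cdom c')) (cto c' \o cfrom c);
  m_chart_at : forall p, matlas (mchart p) /\ cdom (mchart p) p }.

Record smooth_map (m n : nat) (M : manifold m) (N : manifold n) := SmoothMap {
  smap :> M -> N;
  smap_continuous : continuous smap;
  smap_smooth : forall c c', matlas c -> matlas c' ->
    smooth_on (cto c @` (cdom c `&` smap @^-1` cdom c'))
      (cto c' \o smap \o cfrom c) }.

Definition smooth_fun (n : nat) (M : manifold n) (W : set M) (f : M -> R) :=
  forall c, matlas c ->
    smooth_on (cto c @` (cdom c `&` W)) (f \o cfrom c : 'rV[R]_n -> R^o).

Definition smooth_cfun (n : nat) (M : manifold n) (W : set M) (f : M -> R[i]) :=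
  smooth_fun W (fun p => complex.Re (f p)) /\
  smooth_fun W (fun p => complex.Im (f p)).

(* differentials; tangent vectors at p are given by their coordinates in the
   chart [mchart p] *)
Definition diff_fun (n : nat) (M : manifold n) (f : M -> R) (p : M)
    (v : 'rV[R]_n) : R :=
  'D_v (f \o cfrom (mchart p) : 'rV[R]_n -> R^o) (cto (mchart p) p).

Definition diff_cfun (n : nat) (M : manifold n) (f : M -> R[i]) (p : M)
    (v : 'rV[R]_n) : R[i] :=
  Complex (diff_fun (fun q => complex.Re (f q)) p v)
          (diff_fun (fun q => complex.Im (f q)) p v).

Definition tangent_map (m n : nat) (M : manifold m) (N : manifold n)
    (Phi : M -> N) (p : M) (v : 'rV[R]_m) : 'rV[R]_n :=
  'D_v (cto (mchart (Phi p)) \o Phi \o cfrom (mchart p)) (cto (mchart p) p).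
End Manifolds.

Arguments manifold R n : clear implicits.

Section DifferentialForms.
Context {R : realType}.

(* a k-form evaluated at p on k tangent vectors, stored as the rows of a
   matrix; only the values at points of the domain of the form matter *)
Definition diff_form (n : nat) (M : manifold R n) (k : nat) :=
  M -> 'M[R]_(k, n) -> R.

Definition alternating (k n : nat) (f : 'M[R]_(k, n) -> R) : Prop :=
  (forall (i : 'I_k) (A B C : 'M[R]_(k, n)) (b c : R),
     row i A = b *: row i B + c *: row i C ->
     row' i B = row' i A -> row' i C = row' i A ->
     f A = b * f B + c * f C) /\
  (forall (i j : 'I_k) (A : 'M[R]_(k, n)),
     i != j -> row i A = row j A -> f A = 0).

Section OneManifold.
Context {n : nat} {M : manifold R n}.

(* the coefficients of w in the chart c *)
Definition form_in_chart (k : nat) (w : diff_form M k) (c : chart (R := R) M n)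
    (x : 'rV[R]_n) (v : 'M[R]_(k, n)) : R :=
  w (cfrom c x)
    (\matrix_(i < k) 'D_(row i v) (cto (mchart (cfrom c x)) \o cfrom c) x).

Definition is_form (k : nat) (W : set M) (w : diff_form M k) : Prop :=
  (forall p, W p -> alternating (w p)) /\
  (forall c, matlas c -> forall v : 'M[R]_(k, n),
     smooth_on (cto c @` (cdom c `&` W))
       (form_in_chart w c ^~ v : 'rV[R]_n -> R^o)).

(* exterior derivative, computed at p in the chart [mchart p]:
   dw(v_0,..,v_k) = sum_i (-1)^i d/dv_i (w(v_0,..,omit v_i,..,v_k)) *)
Definition ext_d (k : nat) (w : diff_form M k) : diff_form M k.+1 := fun p v =>
  \sum_(i < k.+1) (-1) ^+ i *
    'D_(row i v) (fun x => form_in_chart w (mchart p) x (row' i v) : R^o)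
      (cto (mchart p) p).
End OneManifold.

Definition pull_form (m n : nat) (M : manifold R m)
    (N : manifold R n) (Phi : M -> N) (k : nat) (w : diff_form N k) :
    diff_form M k :=
  fun p v => w (Phi p) (\matrix_(i < k) tangent_map Phi p (row i v)).

Definition closed_relative_form (m n : nat) (M : manifold R m)
    (N : manifold R n) (Phi : M -> N) (k : nat)
    (tau : diff_form M k.+1) (kappa : diff_form N k.+2) : Prop :=
  (forall p v, pull_form Phi kappa p v - ext_d tau p v = 0) /\
  (forall q v, ext_d kappa q v = 0).
End DifferentialForms.

Section SingularCohomology.
Context {R : realType}.

Definition simplex (k : nat) : set 'rV[R]_k.+1 :=
  [set t | (forall i, 0 <= t 0 i) /\ \sum_i t 0 i = 1].

Definition insert_zero (k : nat) (i : 'I_k.+2) (t : 'rV[R]_k.+1) :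
    'rV[R]_k.+2 :=
  \row_j (if unlift i j is Some j' then t 0 j' else 0).

Lemma insert_zero_simplex (k : nat) (i : 'I_k.+2) (t : set_type (@simplex k)) :
  insert_zero i (set_val t) \in @simplex k.+1.
Proof.
have [t0 t1] : simplex (set_val t) by exact: set_valP.
rewrite inE; split=> [j|].
  by rewrite mxE; case: unliftP.
rewrite (bigD1_ord i)//= mxE unlift_none add0r -t1.
by apply: eq_bigr => j _; rewrite mxE liftK.
Qed.

Definition face (k : nat) (i : 'I_k.+2) (t : set_type (@simplex k)) :
    set_type (@simplex k.+1) := 
  @exist _ (fun x => x \in @simplex k.+1) _ (insert_zero_simplex i t).

Lemma continuous_insert_zero (k : nat) (i : 'I_k.+2) :
  continuous (@insert_zero k i).
Proof.
move=> t s /= /(nbhs_ballP (insert_zero i t)) [e /= e0 es].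
apply/nbhs_ballP; exists e => //= u [_ tu]; apply: es; split=> // a b.
rewrite /insert_zero !mxE; case: unliftP => [b' _|_]; last exact: ballxx.
exact: tu.
Qed.

Lemma continuous_face (k : nat) (i : 'I_k.+2) : continuous (@face k i).
Proof.
have c : continuous (fun t : set_type (@simplex k) => set_val (face i t)).
  rewrite (_ : (fun _ => _) = @insert_zero k i \o set_val).
    by move=> t; apply: continuous_comp;
      [exact: initial_continuous|exact: continuous_insert_zero].
  by apply/funext => t; rewrite /= set_valE.
apply/continuousP => _ [A oA <-].
by move/continuousP : c => /(_ A oA).
Qed.

Lemma vertex_simplex (k : nat) : delta_mx 0 0 \in @simplex k.
Proof.
rewrite inE; split=> [i|]; first by rewrite mxE ler0n.
rewrite (bigD1 0)//= mxE !eqxx big1 ?addr0// => i i0.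
by rewrite mxE (negPf i0) andbF.
Qed.

Definition vertex (k : nat) : set_type (@simplex k) :=
  @exist _ (fun x => x \in @simplex k) _ (vertex_simplex k).

Record singular (X : topologicalType) (k : nat) := Singular {
  sing :> set_type (@simplex k) -> X;
  sing_continuous : continuous sing }.

Definition sing_face (X : topologicalType) (k : nat) (i : 'I_k.+2)
    (s : singular X k.+1) : singular X k :=
  @Singular X k (s \o face i)
    (fun t => continuous_comp (@continuous_face k i t)
                (@sing_continuous _ _ s _)).

Definition sing_comp (m n : nat) (M : manifold R m) (N : manifold R n)
    (Phi : smooth_map M N) (k : nat) (s : singular M k) : singular N k :=
  @Singular N k (Phi \o s)
    (fun t => continuous_comp (@sing_continuous _ _ s t)
                (@smap_continuous _ _ _ _ _ Phi _)).

Definition cochain (A : nzRingType) (X : topologicalType) (k : nat) :=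
  singular X k -> A.

Definition coboundary (A : nzRingType) (X : topologicalType) (k : nat)
    (c : cochain A X k) : cochain A X k.+1 :=
  fun s => \sum_(i < k.+2) (-1) ^+ i * c (sing_face i s).

(* [rel_cochain Phi A k] is the group of relative cochains of degree k + 1 *)
Definition rel_cochain (m n : nat) (M : manifold R m) (N : manifold R n)
    (Phi : smooth_map M N) (A : nzRingType) (k : nat) : Type :=
  cochain A M k * cochain A N k.+1.

Definition rel_coboundary (m n : nat) (M : manifold R m) (N : manifold R n)
    (Phi : smooth_map M N) (A : nzRingType) (k : nat)
    (c : rel_cochain Phi A k) : rel_cochain Phi A k.+1 :=
  (fun s => c.2 (sing_comp Phi s) - coboundary c.1 s, coboundary c.2).

Definition rel_cocycle (m n : nat) (M : manifold R m) (N : manifold R n)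
    (Phi : smooth_map M N) (A : nzRingType) (k : nat)
    (c : rel_cochain Phi A k) : Prop :=
  (forall s, (rel_coboundary c).1 s = 0) /\
  (forall s, (rel_coboundary c).2 s = 0).

(* s extends to a smooth map on an open neighbourhood of the simplex *)
Definition smooth_simplex (n : nat) (M : manifold R n) (k : nat)
    (s : singular M k) : Prop :=
  exists (W : set 'rV[R]_k.+1) (g : 'rV[R]_k.+1 -> M),
    [/\ open W,
        @simplex k `<=` W,
        {within W, continuous g},
        forall c, matlas c ->
          smooth_on (W `&` g @^-1` cdom c) (cto c \o g) &
        forall t, s t = g (set_val t)].

(* s in the coordinates x = (t_1,..,t_k) of the simplex, t_0 = 1 - sum x;
   the value at x outside the coordinate simplex is irrelevant *)
Definition sing_coord (X : topologicalType) (k : nat) (s : singular X k)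
    (x : 'rV[R]_k) : X :=
  s (insubd (vertex k) (row_mx (1 - \sum_i x 0 i)%:M x : 'rV[R]_k.+1)).

(* iterated Lebesgue integral over {x | 0 < x_i, sum x < b} *)
Fixpoint simplex_integral (k : nat) (b : R) : ('rV[R]_k -> R) -> R :=
  match k with
  | 0%N => fun f => f 0
  | k'.+1 => fun f =>
      \int[lebesgue_measure]_(t in `]0, b[)
        simplex_integral (b - t) (fun x : 'rV[R]_k' => f (row_mx t%:M x))
  end.

Definition integrate (n : nat) (M : manifold R n) (k : nat) (w : diff_form M k)
    (s : singular M k) : R :=
  simplex_integral 1 (fun x : 'rV[R]_k =>
    w (sing_coord s x)
      (\matrix_(i < k) 'D_(delta_mx 0 i)
         (cto (mchart (sing_coord s x)) \o sing_coord s) x)).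

(* the class of z in H^(k+2)(Phi, R) is the image of the de Rham class of
   (tau, kappa): on smooth simplices, integration of (tau, kappa) and z differ
   by a relative coboundary. Integration is only defined on smooth simplices,
   whose inclusion into all singular simplices is a homology equivalence; the
   values of b on the other simplices play no role. *)
Definition de_rham_representative (m n : nat) (M : manifold R m)
    (N : manifold R n) (Phi : smooth_map M N) (k : nat)
    (tau : diff_form M k.+1) (kappa : diff_form N k.+2)
    (z : rel_cochain Phi R k.+1) : Prop :=
  rel_cocycle z /\
  exists b : rel_cochain Phi R k,
    (forall s, smooth_simplex s ->
       integrate tau s = z.1 s + (rel_coboundary b).1 s) /\
    (forall s, smooth_simplex s ->
       integrate kappa s = z.2 s + (rel_coboundary b).2 s).

Definition integral_relative_form (m n : nat) (M : manifold R m)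
    (N : manifold R n) (Phi : smooth_map M N) (k : nat)
    (tau : diff_form M k.+1) (kappa : diff_form N k.+2) : Prop :=
  exists z : rel_cochain Phi R k.+1, de_rham_representative tau kappa z /\
  exists zi : rel_cochain Phi int k.+1, rel_cocycle zi /\
  exists b : rel_cochain Phi R k,
    (forall s, z.1 s = (zi.1 s)%:~R + (rel_coboundary b).1 s) /\
    (forall s, z.2 s = (zi.2 s)%:~R + (rel_coboundary b).2 s).
End SingularCohomology.

Arguments simplex R k : clear implicits.
Arguments singular R X k : clear implicits.
Arguments cochain R A X k : clear implicits.

Section LineBundles.
Context {R : realType}.

(* A Hermitian line bundle over an open set U of M, as a family of lines with
   Hermitian inner products (only fibres over U matter), whose smooth structure
   is given by an atlas of local unitary frames. *)
Record line_bundle (n : nat) (M : manifold R n) := LineBundle {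
  fib : M -> vectType R[i];
  herm : forall p, fib p -> fib p -> R[i];
  frame_idx : Type;
  frame_dom : frame_idx -> set M;
  frame : frame_idx -> forall p, fib p }.

Section OneManifold.
Context {n : nat} {M : manifold R n}.
Implicit Types (U W : set M) (L : line_bundle M).

Definition unit_vector L (p : M) (u : fib L p) : Prop := herm u u = 1.

Record is_line_bundle U L : Prop := {
  lb_line : forall p, U p -> \dim (fullv : {vspace fib L p}) = 1%N;
  lb_linear : forall p, U p -> forall (a : R[i]) (u v w : fib L p),
    herm (a *: u + v) w = a * herm u w + herm v w;
  lb_conj : forall p, U p -> forall u v : fib L p,
    herm u v = Num.conj (herm v u);
  lb_pos : forall p, U p -> forall u : fib L p, u != 0 -> 0 < herm u u;
  lb_dom : forall a : frame_idx L, open (frame_dom a) /\ frame_dom a `<=` U;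
  lb_cover : forall p, U p -> exists a : frame_idx L, frame_dom a p;
  lb_unitary : forall (a : frame_idx L) p, frame_dom a p ->
    unit_vector (frame a p);
  lb_smooth : forall a b : frame_idx L,
    smooth_cfun (frame_dom a `&` frame_dom b)
      (fun p => herm (frame b p) (frame a p)) }.

Definition smooth_section W L (s : forall p, fib L p) : Prop :=
  forall a : frame_idx L,
    smooth_cfun (W `&` frame_dom a) (fun p => herm (s p) (frame a p)).

(* [D s p v] is the covariant derivative at p, in the direction v, of the local
   section s (whose values away from p are irrelevant) *)
Definition connection L :=
  forall s : (forall p, fib L p), forall p : M, 'rV[R]_n -> fib L p.

Record is_connection U L (D : connection L) : Prop := {
  conn_form : forall W s, open W -> W `<=` U -> smooth_section W s ->
    forall a : frame_idx L,
      is_form (W `&` frame_dom a)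
        (fun p (v : 'M[R]_(1, n)) => complex.Re (herm (D s p v) (frame a p))) /\
      is_form (W `&` frame_dom a)
        (fun p (v : 'M[R]_(1, n)) => complex.Im (herm (D s p v) (frame a p)));
  conn_local : forall W s t, open W -> W `<=` U ->
    smooth_section W s -> smooth_section W t ->
    (forall p, W p -> s p = t p) -> forall p v, W p -> D s p v = D t p v;
  conn_add : forall W s t, open W -> W `<=` U ->
    smooth_section W s -> smooth_section W t ->
    forall p v, W p -> D (fun q => s q + t q) p v = D s p v + D t p v;
  conn_leibniz : forall W s f, open W -> W `<=` U ->
    smooth_section W s -> smooth_cfun W f ->
    forall p v, W p ->
      D (fun q => f q *: s q) p v = diff_cfun f p v *: s p + f p *: D s p v;
  conn_metric : forall W s t, open W -> W `<=` U ->
    smooth_section W s -> smooth_section W t ->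
    forall p v, W p ->
      diff_cfun (fun q => herm (s q) (t q)) p v =
      herm (D s p v) (t p) + herm (s p) (D t p v) }.

(* the real 1-form A on the domain of the unitary frame e with
   D e = 2 pi sqrt(-1) A e *)
Definition conn_potential L (D : connection L) (a : frame_idx L) :
    diff_form M 1 :=
  fun p v => complex.Im (herm (D (frame a) p v) (frame a p)) / (2 * pi).

Definition frame_at L (p : M) : option (frame_idx L) :=
  if pselect (exists a : frame_idx L, frame_dom a p) is left h
  then Some (projT1 (cid h)) else None.

(* the values of dA for different frames at p agree *)
Definition curv L (D : connection L) : diff_form M 2 := fun p v =>
  if frame_at L p is Some a then ext_d (conn_potential D a) p v else 0.

(* Sections t of L1 (x) L2^-1 (x) L3 of norm 1, given by their components:
   t(p) = [t p u1 u2 u3] u1 (x) u2^-1 (x) u3 for unit vectors u1, u2, u3 *)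
Definition tensor_section L1 L2 L3 :=
  forall p : M, fib L1 p -> fib L2 p -> fib L3 p -> R[i].

Definition frame_component L1 L2 L3 (t : tensor_section L1 L2 L3)
    (a : frame_idx L1) (b : frame_idx L2) (c : frame_idx L3) (p : M) : R[i] :=
  t p (frame a p) (frame b p) (frame c p).

Record unitary_section W L1 L2 L3 (t : tensor_section L1 L2 L3) : Prop := {
  us_tensor : forall p, W p ->
    forall (z1 z2 z3 : R[i]) (u1 : fib L1 p) (u2 : fib L2 p) (u3 : fib L3 p),
    `|z1| = 1 -> `|z2| = 1 -> `|z3| = 1 ->
    unit_vector u1 -> unit_vector u2 -> unit_vector u3 ->
    t p (z1 *: u1) (z2 *: u2) (z3 *: u3) = z1^-1 * z2 * z3^-1 * t p u1 u2 u3;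
  us_unitary : forall p, W p ->
    forall (u1 : fib L1 p) (u2 : fib L2 p) (u3 : fib L3 p),
    unit_vector u1 -> unit_vector u2 -> unit_vector u3 -> `|t p u1 u2 u3| = 1;
  us_smooth : forall (a : frame_idx L1) (b : frame_idx L2) (c : frame_idx L3),
    smooth_cfun (W `&` frame_dom a `&` frame_dom b `&` frame_dom c)
      (frame_component t a b c) }.

(* t is parallel for the connection D1 (x) D2^-1 (x) D3: if f is its component
   in local unitary frames, df + 2 pi sqrt(-1) (A1 - A2 + A3) f = 0 *)
Definition parallel W L1 L2 L3 (D1 : connection L1) (D2 : connection L2)
    (D3 : connection L3) (t : tensor_section L1 L2 L3) : Prop :=
  forall (a : frame_idx L1) (b : frame_idx L2) (c : frame_idx L3) p v,
    W p -> frame_dom a p -> frame_dom b p -> frame_dom c p ->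
    diff_cfun (frame_component t a b c) p v +
    Complex 0 (2 * pi * (conn_potential D1 a p v - conn_potential D2 b p v
                         + conn_potential D3 c p v)) *
    frame_component t a b c p = 0.

(* an isomorphism from L to the dual of L', as a fibrewise bilinear pairing *)
Definition iso_dual W L L' : Prop :=
  exists beta : forall p, fib L p -> fib L' p -> R[i],
    [/\ forall p, W p -> forall (a : R[i]) (u v : fib L p) (w : fib L' p),
          beta p (a *: u + v) w = a * beta p u w + beta p v w,
        forall p, W p -> forall (a : R[i]) (u : fib L p) (v w : fib L' p),
          beta p u (a *: v + w) = a * beta p u v + beta p u w,
        forall p, W p -> forall (u : fib L p) (v : fib L' p),
          unit_vector u -> unit_vector v -> `|beta p u v| = 1 &
        forall (a : frame_idx L) (b : frame_idx L'),
          smooth_cfun (W `&` frame_dom a `&` frame_dom b)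
            (fun p => beta p (frame a p) (frame b p))].

Definition open_cover (I : Type) (U : I -> set M) : Prop :=
  (forall i, open (U i)) /\ (forall p, exists i, U i p).

End OneManifold.

Section Pullback.
Context {m n : nat} {M : manifold R m} {N : manifold R n}.
Variable Phi : M -> N.

Definition pull_bundle (L : line_bundle N) : line_bundle M :=
  @LineBundle m M (fun p => fib L (Phi p)) (fun p => @herm _ _ L (Phi p))
    (frame_idx L) (fun a => Phi @^-1` frame_dom a)
    (fun a p => frame a (Phi p)).

(* for a section s = f (e o Phi) with e a frame of L around Phi p, the value
   (df (e o Phi) + f (D e) o dPhi)(v); it does not depend on e *)
Definition pull_connection (L : line_bundle N) (D : connection L) :
    connection (pull_bundle L) := fun s p v =>
  if frame_at L (Phi p) is Some a then
    let f := fun q => @herm _ _ L (Phi q) (s q) (frame a (Phi q)) in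
    diff_cfun f p v *: frame a (Phi p) +
    f p *: D (frame a) (Phi p) (tangent_map Phi p v)
  else 0.
End Pullback.
End LineBundles.

Arguments pull_connection {R m n M N} Phi {L} D.

Section Gerbes.
Context {R : realType}.

Record gerbe_data (n : nat) (M : manifold R n) := GerbeData {
  g_idx : Type;
  g_cover : g_idx -> set M;
  g_line : g_idx -> g_idx -> line_bundle M;
  g_theta : forall i j k,
    tensor_section (g_line j k) (g_line i k) (g_line i j) }.
Arguments g_theta {n M} g i j k.

Record gerbe_connection_data (n : nat) (M : manifold R n)
    (G : gerbe_data M) := GerbeConnectionData {
  g_nabla : forall i j : g_idx G, connection (g_line i j);
  g_varpi : g_idx G -> diff_form M 2 }.
Arguments g_nabla {n M G} _ i j.

Section OneManifold.
Context {n : nat} {M : manifold R n}.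

Record is_gerbe (G : gerbe_data M) : Prop := {
  gerbe_cover : open_cover (@g_cover _ _ G);
  gerbe_line : forall i j : g_idx G,
    is_line_bundle (g_cover i `&` g_cover j) (g_line i j);
  gerbe_inv : forall i j : g_idx G,
    iso_dual (g_cover i `&` g_cover j) (g_line i j) (g_line j i);
  gerbe_theta : forall i j k : g_idx G,
    unitary_section (g_cover i `&` g_cover j `&` g_cover k)
      (g_theta G i j k);
  (* delta theta = 1: in any unit vectors u_ab of L_ab, the components satisfy
     theta_jkl theta_ikl^-1 theta_ijl theta_ijk^-1 = 1 *)
  gerbe_cocycle : forall (i j k l : g_idx G) p,
    g_cover i p -> g_cover j p -> g_cover k p -> g_cover l p ->
    forall (uij : fib (g_line i j) p) (uik : fib (g_line i k) p)
           (uil : fib (g_line i l) p) (ujk : fib (g_line j k) p)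
           (ujl : fib (g_line j l) p) (ukl : fib (g_line k l) p),
    unit_vector uij -> unit_vector uik -> unit_vector uil ->
    unit_vector ujk -> unit_vector ujl -> unit_vector ukl ->
    g_theta G j k l p ukl ujl ujk * (g_theta G i k l p ukl uil uik)^-1 *
    g_theta G i j l p ujl uil uij * (g_theta G i j k p ujk uik uij)^-1 = 1 }.

Record is_gerbe_connection (G : gerbe_data M)
    (D : gerbe_connection_data G) : Prop := {
  gconn_nabla : forall i j : g_idx G,
    is_connection (g_cover i `&` g_cover j) (g_nabla D i j);
  gconn_theta : forall i j k : g_idx G,
    parallel (g_cover i `&` g_cover j `&` g_cover k)
      (g_nabla D j k) (g_nabla D i k) (g_nabla D i j)
      (g_theta G i j k);
  gconn_varpi : forall i : g_idx G, is_form (g_cover i) (g_varpi D i);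
  gconn_curv : forall (i j : g_idx G) p v, g_cover i p -> g_cover j p ->
    g_varpi D j p v - g_varpi D i p v = curv (g_nabla D i j) p v }.

Record quasi_line_data (G : gerbe_data M) := QuasiLineData {
  q_line : g_idx G -> line_bundle M;
  (* psi_ij is a section of E_j^-1 (x) E_i (x) L_ij *)
  q_psi : forall i j, tensor_section (q_line i) (q_line j) (g_line i j) }.
Arguments q_psi {G} _ i j.

Record is_quasi_line (G : gerbe_data M) (Q : quasi_line_data G) : Prop := {
  quasi_line : forall i : g_idx G, is_line_bundle (g_cover i) (q_line Q i);
  quasi_psi : forall i j : g_idx G,
    unitary_section (g_cover i `&` g_cover j) (q_psi Q i j);
  (* delta psi = theta, in any unit vectors e_a of E_a and u_ab of L_ab:
     psi_jk psi_ik^-1 psi_ij = theta_ijk *)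
  quasi_delta : forall (i j k : g_idx G) p,
    g_cover i p -> g_cover j p -> g_cover k p ->
    forall (ei : fib (q_line Q i) p) (ej : fib (q_line Q j) p)
           (ek : fib (q_line Q k) p) (uij : fib (g_line i j) p)
           (uik : fib (g_line i k) p) (ujk : fib (g_line j k) p),
    unit_vector ei -> unit_vector ej -> unit_vector ek ->
    unit_vector uij -> unit_vector uik -> unit_vector ujk ->
    q_psi Q j k p ej ek ujk * (q_psi Q i k p ei ek uik)^-1 *
    q_psi Q i j p ei ej uij = g_theta G i j k p ujk uik uij }.

(* the isomorphism E_j (x) E_i^-1 = L_ij given by psi_ij respects connections *)
Record is_quasi_line_connection (G : gerbe_data M)
    (D : gerbe_connection_data G) (Q : quasi_line_data G)
    (DE : forall i, connection (q_line Q i)) : Prop := {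
  qconn_nabla : forall i : g_idx G, is_connection (g_cover i) (DE i);
  qconn_psi : forall i j : g_idx G,
    parallel (g_cover i `&` g_cover j) (DE i) (DE j) (g_nabla D i j)
      (q_psi Q i j) }.
End OneManifold.

Section Relative.
Context {m n : nat} {M : manifold R m} {N : manifold R n}.

(* pullback of a gerbe along Phi, for a cover U of M with a refinement map r
   such that Phi(U_i) is contained in V_(r i) *)
Definition pull_gerbe (Phi : M -> N) (I : Type) (U : I -> set M)
    (G : gerbe_data N) (r : I -> g_idx G) : gerbe_data M :=
  @GerbeData m M I U (fun i j => pull_bundle Phi (g_line (r i) (r j)))
    (fun i j k p => g_theta G (r i) (r j) (r k) (Phi p)).

Definition pull_gerbe_connection (Phi : M -> N) (I : Type) (U : I -> set M)
    (G : gerbe_data N) (D : gerbe_connection_data G) (r : I -> g_idx G) :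
    gerbe_connection_data (pull_gerbe Phi U r) :=
  @GerbeConnectionData m M (pull_gerbe Phi U r)
    (fun i j => pull_connection Phi (g_nabla D (r i) (r j)))
    (fun i => pull_form Phi (g_varpi D (r i))).

Record relative_gerbe (Phi : smooth_map M N) := RelativeGerbe {
  rg_gerbe : gerbe_data N;
  rg_conn : gerbe_connection_data rg_gerbe;
  rg_idx : Type;
  rg_cover : rg_idx -> set M;
  rg_ref : rg_idx -> g_idx rg_gerbe;
  rg_quasi : quasi_line_data (pull_gerbe Phi rg_cover rg_ref);
  rg_quasi_conn : forall i : rg_idx, connection (q_line rg_quasi i);
  rg_is_gerbe : is_gerbe rg_gerbe;
  rg_is_conn : is_gerbe_connection rg_conn;
  rg_is_cover : open_cover rg_cover;
  rg_refines : forall i, Phi @` rg_cover i `<=` g_cover (rg_ref i);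
  rg_is_quasi : is_quasi_line rg_quasi;
  rg_is_quasi_conn : is_quasi_line_connection
    (pull_gerbe_connection Phi rg_cover rg_conn rg_ref) rg_quasi_conn }.
Arguments rg_quasi_conn {Phi} r i.

Definition has_curvature (Phi : smooth_map M N) (X : relative_gerbe Phi)
    (tau : diff_form M 2) (kappa : diff_form N 3) : Prop :=
  (forall (i : rg_idx X) p v, rg_cover i p ->
     tau p v = pull_form Phi (g_varpi (rg_conn X) (rg_ref i)) p v
               - curv (rg_quasi_conn X i) p v) /\
  (forall (j : g_idx (rg_gerbe X)) q v, g_cover j q ->
     kappa q v = ext_d (g_varpi (rg_conn X) j) q v).
End Relative.
End Gerbes.

Arguments g_theta {R n M} g i j k.
Arguments g_nabla {R n M G} _ i j.
Arguments q_psi {R n M G} _ i j.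
Arguments rg_quasi_conn {R m n M N Phi} r i.

(* Main.v *)
From HB Require Import structures.
From mathcomp Require Import all_boot all_order all_algebra.
From mathcomp Require Import complex.
From mathcomp Require Import all_classical all_reals all_analysis.
From mathcomp Require Import ring lra zify.
Require Import Defs.

(* No good covers or partitions of unity are used; line bundles are handled through their holonomy along smooth paths.

   Integral => curvature. Integrality gives cochains al on M and be on N such that, on smooth simplices, the integrals of
   tau and kappa agree modulo Z with be o Phi - d al and d be. On a chart ball V_j the Poincare lemma gives varpi_j with
   d varpi_j = kappa, and the cocycle (int varpi_j - be) mod Z is the coboundary of some y_j. On V_i n V_j the path
   cochain y_j - y_i has coboundary int (varpi_j - varpi_i) mod Z, so it is the holonomy of a line bundle with connection
   of curvature varpi_j - varpi_i. In the same way y_i o Phi + al is the holonomy of a bundle E_i on the preimage of V_i.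

   Curvature => integral. Trivialise the gerbe and the quasi-line bundle pointwise by unit vectors, so that each local
   frame becomes a phase, and refine the covers until these phases exist on double overlaps and their Cech coboundaries
   have real lifts on triple overlaps. A Cech-singular zigzag, choosing an index for each small simplex, then produces an
   integral relative cocycle on small simplices together with cochains that compare it with the integrals of (tau, kappa)
   on small smooth simplices. Barycentric subdivision extends all of them to arbitrary simplices. *)

Set Implicit Arguments.
Unset Strict Implicit.
Unset Printing Implicit Defensive.

Import Order.TTheory GRing.Theory Num.Theory.
Import numFieldNormedType.Exports.

Local Open Scope classical_set_scope.
Local Open Scope ring_scope.

(** * Calculus and differential forms on open sets of R^n *)

Section EuclideanCalculus.
Context {R : realType}.

(** In both directions the phases are discontinuous functions known modulo Z. A bundle built from a
    path cochain is the product fibre by fibre, and a given gerbe is trivial over each single point,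
    so only differences of phases along smooth paths carry information; smoothness always comes back
    through [cis] of such a difference. Two obstacles shape the rest. Forms are integrated over
    smooth simplices only, whereas an integral class lives on all simplices; the extension lemma is
    therefore stated for any class of simplices closed under affine reparametrisation, and for any
    subgroup of R, so that 0 serves for equations and Z for integrality. Secondly, overlaps of the
    cover need not be connected, so an integer-valued function on them is not constant a priori;
    real lifts of oscillation below 1/8 are kept for this reason, since an alternating sum of four
    of them varies by less than 1. *)

Lemma scale_regE (a : R) (b : R^o) : a *: b = a * b. Proof. by []. Qed.

Definition dotr (n : nat) (c : 'I_n -> R) (h : 'rV[R]_n) : R^o :=
  \sum_i h 0 i * c i.

Lemma dotr_is_linear n (c : 'I_n -> R) : linear (dotr c).
Proof.
move=> a u v; rewrite /dotr scaler_sumr -big_split /=; apply: eq_bigr => i _.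
by rewrite !mxE mulrDl -mulrA.
Qed.

HB.instance Definition _ n (c : 'I_n -> R) :=
  GRing.isLinear.Build R 'rV[R]_n R^o _ (dotr c) (dotr_is_linear c).

Lemma continuous_coord n (i : 'I_n) : continuous (fun x : 'rV[R]_n => x 0 i).
Proof. by move=> x; apply: (@coord_continuous R 1 n 0 i). Qed.

Lemma cvg_sumr (V : normedModType R) (T : Type) (F : set_system T) (I : Type)
    (r : seq I) (f : I -> T -> V) (l : I -> V) : Filter F ->
  (forall i, f i x @[x --> F] --> l i) ->
  \sum_(i <- r) f i x @[x --> F] --> \sum_(i <- r) l i.
Proof.
move=> FF H; elim: r => [|i r IH].
  by rewrite big_nil; under eq_fun do rewrite big_nil; exact: cvg_cst.
by rewrite big_cons; under eq_fun do rewrite big_cons; exact: cvgD.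
Qed.

Lemma continuous_dotr n (c : 'I_n -> R) : continuous (dotr c).
Proof.
move=> x; apply: (@cvg_sumr R^o _ (nbhs x)) => i.
by apply: cvgM; [exact: continuous_coord|exact: cvg_cst].
Qed.

Lemma norm_coord n (x : 'rV[R]_n) i : `|x 0 i| <= `|x|.
Proof.
rewrite [leRHS]/Num.norm /= mx_normrE.
exact: (le_bigmax _ (fun ij => `|x ij.1 ij.2|) (0, i)).
Qed.

Lemma norm_rV_le n (x : 'rV[R]_n) e : 0 <= e -> (forall i, `|x 0 i| <= e) -> `|x| <= e.
Proof.
move=> e0 H; rewrite [leLHS]/Num.norm /= mx_normrE (bigmax_le _ e0)//= => -[i j] _ /=.
by rewrite ord1.
Qed.

Section OneFunction.
Context {V W : normedModType R}.

Lemma is_derive_line (f : V -> W) (x v : V) t :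
  derivable f (x + t *: v) v ->
  is_derive t 1 (fun h : R => f (x + h *: v)) ('D_v f (x + t *: v)).
Proof.
move=> df.
have E : (fun h : R => h^-1 *: (((fun h0 : R => f (x + h0 *: v)) \o shift t) (h *: 1) - f (x + t *: v))) =
  (fun h : R => h^-1 *: ((f \o shift (x + t *: v)) (h *: v) - f (x + t *: v))).
  apply/funext => h /=; congr (_ *: (f _ - _)).
  by rewrite [h *: 1 : R]mulr1 scalerDl addrCA.
by apply: DeriveDef; rewrite /derivable /derive E.
Qed.

End OneFunction.

Lemma is_derive_scale (V W : normedModType R) (f : V -> W) x v a :
  derivable f x v -> is_derive x (a *: v) f (a *: 'D_v f x).
Proof.
have [-> _|a0 df] := eqVneq a 0; first by rewrite !scale0r; exact: is_derive0.
suff H : (fun h => h^-1 *: ((f \o shift x) (h *: (a *: v)) - f x)) @ 0^' --> a *: 'D_v f x.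
  apply: DeriveDef; first by apply/cvg_ex; exists (a *: 'D_v f x).
  exact: cvg_lim H.
have -> : (fun h : R => h^-1 *: ((f \o shift x) (h *: (a *: v)) - f x)) =
  (fun h => a *: (h^-1 *: ((f \o shift x) (h *: v) - f x))) \o (fun h : R => h * a).
  by apply/funext => h /=; rewrite [LHS]/= invfM !scalerA mulrCA mulfV// mulr1.
apply: (@cvg_comp _ _ _ (fun h => h * a) _ _ (0^')); last first.
  by apply: cvgZl_tmp; exact: df.
move=> A /nbhs_ballP[e /= e0 eA]; apply/nbhs_ballP; exists (e / `|a|) => /=.
  by rewrite divr_gt0// normr_gt0.
move=> h; rewrite /ball /= sub0r normrN ltr_pdivlMr ?normr_gt0// => hA h0.
apply: eA; last by rewrite mulf_neq0.
by rewrite /ball /= sub0r normrN normrM.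
Qed.

Lemma MVT_line (V : normedModType R) (f : V -> R^o) (x v : V) :
  (forall t, 0 <= t <= 1 -> derivable f (x + t *: v) v) ->
  exists2 c, 0 <= c <= 1 & f (x + v) - f x = 'D_v f (x + c *: v).
Proof.
move=> df.
have [||c c01] := @MVT_segment R (fun h : R => f (x + h *: v)) (fun h => 'D_v f (x + h *: v)) 0 1 ler01.
- by move=> t; rewrite in_itv/= => /andP[t0 t1]; apply/is_derive_line/df; rewrite !ltW.
- apply: derivable_within_continuous => t; rewrite in_itv/= => t01.
  by have := is_derive_line (df t t01); case.
rewrite scale1r scale0r addr0 subr0 mulr1 => E; exists c => //.
Qed.

Lemma differentiable_eps (V W : normedModType R) (f : V -> W)
    (D : {linear V -> W}) x : continuous D ->
  (forall e, 0 < e -> \forall h \near 0, `|f (h + x) - f x - D h| <= e * `|h|) ->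
  differentiable f x.
Proof.
move=> cD H.
have E : f \o shift x = cst (f x) + D +o_ 0 id.
  apply/eqaddoP => _/posnumP[e]; near=> h => /=.
  suff -> : (f \o +%R^~ x - (cst (f x) + D)) h = f (h + x) - f x - D h by near: h; exact: H.
  by rewrite -addrA -opprD.
have Dd : 'd f x = D :> (_ -> _) by exact: diff_unique.
by apply/diff_locallyP; rewrite Dd.
Unshelve. all: by end_near. Qed.

(** The increment from x to x + h is split along a path that changes one coordinate at a time; on
    each leg the mean value theorem produces a partial derivative at a point near x. *)
Lemma C1_differentiable n (f : 'rV[R]_n -> R^o) (U : set 'rV[R]_n) x :
  open U -> U x -> (forall y v, U y -> derivable f y v) ->
  (forall v, {for x, continuous ('D_v f)}) ->
  differentiable f x.
Proof.
move=> oU Ux df cf.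
pose D : {linear _ -> _} := dotr (fun i => 'D_(delta_mx 0 i) f x).
apply: (@differentiable_eps _ _ f D); first exact: continuous_dotr.
move=> _/posnumP[e].
  (* The n legs share the error e; [n.+1] keeps the denominator nonzero when n = 0. *)
  have eN : 0 < e%:num / n.+1%:R by rewrite divr_gt0.
  have : \forall y \near x, U y /\ forall i, `|'D_(delta_mx 0 i) f y - 'D_(delta_mx 0 i) f x| <= e%:num / n.+1%:R.
    near=> y; split; first by near: y; apply: open_nbhs_nbhs.
    near: y; apply: filter_forall => i.
    have /cvgrPdist_le /(_ _ eN) := cf (delta_mx 0 i).
    by apply: filterS => y; rewrite distrC.
  move=> /nbhs_ballP[d /= d0 dU].
  apply/nbhs_ballP; exists d => //= h; rewrite -ball_normE /= sub0r normrN => hd.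
  pose p k : 'rV[R]_n := \row_j (if (j < k)%N then h 0 j else 0).
  have pS (i : 'I_n) : p i.+1 = p i + h 0 i *: delta_mx 0 i.
    apply/rowP => j; rewrite !mxE eqxx /= ltnS leq_eqVlt -val_eqE /= eq_sym.
    case: eqVneq => [/val_inj -> | ne]; last by case: ltnP => _; rewrite mulr0 addr0.
    by rewrite ltnn mulr1 add0r.
  have pn : p n = h by apply/rowP => j; rewrite !mxE ltn_ord.
  have p0 : p 0%N = 0 by apply/rowP => j; rewrite !mxE ltn0.
  have Bp (i : 'I_n) t : 0 <= t <= 1 -> ball x d (x + p i + t *: (h 0 i *: delta_mx 0 i)).
    move=> /andP[t0 t1]; rewrite -ball_normE /= -addrA opprD addNKr normrN.
    apply: le_lt_trans hd; apply: norm_rV_le => // j; rewrite !mxE eqxx /=.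
    have [-> |ne] := eqVneq i j.
      by rewrite ltnn add0r mulr1 normrM ger0_norm// (le_trans _ (norm_coord h j))// ler_piMl.
    rewrite !mulr0 addr0; case: ifP => _; rewrite ?normr0//; exact: norm_coord.
rewrite [h + x]addrC.
  have -> : f (x + h) - f x = \sum_(i < n) (f (x + p i.+1) - f (x + p i)).
    rewrite -(big_mkord predT (fun i => f (x + p i.+1) - f (x + p i))).
    by rewrite (telescope_sumr (fun i => f (x + p i))) // pn p0 addr0.
  rewrite /D /dotr -sumrB.
  apply: (le_trans (ler_norm_sum _ _ _)).
  apply: (@le_trans _ _ (\sum_(i < n) (e%:num / n.+1%:R * `|h|))); last first.
    by rewrite -mulr_suml ler_wpM2r// sumr_const card_ord -[_ *+ n]mulr_natr -mulrA ler_piMr// mulrC ler_pdivrMr// mul1r ler_nat.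
  apply: ler_sum => i _; rewrite pS addrA.
  have [t t01|c c01 ->] := @MVT_line _ f (x + p i) (h 0 i *: delta_mx 0 i) _.
    by apply: df; have [] := dU _ (Bp i t t01).
  have dfi : U (x + p i + c *: (h 0 i *: delta_mx 0 i)) /\ _ := dU _ (Bp i c c01).
  have [Uy Dy] := dfi.
  have [_ ->] := is_derive_scale (h 0 i) (df _ (delta_mx 0 i) Uy).
  rewrite scale_regE -mulrBr normrM mulrC ler_pM//; exact: norm_coord.
Unshelve. all: by end_near. Qed.
End EuclideanCalculus.

(** * Smooth functions, chain rule and symmetry of second derivatives *)

Section Smooth.
Context {R : realType}.

Section General.
Context {V W : normedModType R}.
Implicit Types (f g : V -> W) (U : set V).

Lemma iter_derive_rcons (vs : seq V) v f :
  iter_derive (rcons vs v) f = iter_derive vs ('D_v f).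
Proof. by elim: vs => //= w vs ->. Qed.

Lemma smooth_derive U f v : smooth_on U f -> smooth_on U ('D_v f).
Proof. by move=> sf vs x Ux; rewrite -iter_derive_rcons; exact: sf. Qed.

Lemma smooth_continuous U f x : smooth_on U f -> U x -> {for x, continuous f}.
Proof. by move=> sf Ux; have [] := sf [::] x Ux. Qed.

Lemma smooth_derivable U f x v : smooth_on U f -> U x -> derivable f x v.
Proof. by move=> sf Ux; have [_] := sf [::] x Ux. Qed.

Lemma sub_smooth (U U' : set V) f : U' `<=` U -> smooth_on U f -> smooth_on U' f.
Proof. by move=> UU sf vs x Ux; apply: sf; exact: UU. Qed.

Lemma open_near (U : set V) x : open U -> U x -> \forall y \near x, U y.
Proof. by move=> oU Ux; exact: open_nbhs_nbhs. Qed.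

Lemma eq_near (U : set V) f g x : open U -> U x -> (forall y, U y -> f y = g y) ->
  \near x, f x = g x.
Proof. by move=> oU Ux fg; apply: filterS (open_near oU Ux) => y /fg. Qed.

Lemma eq_derive U f g x v : open U -> U x -> (forall y, U y -> f y = g y) ->
  'D_v f x = 'D_v g x.
Proof. by move=> oU Ux fg; apply: near_eq_derive; exact: eq_near fg. Qed.

Lemma eq_derivable U f g x v : open U -> U x -> (forall y, U y -> f y = g y) ->
  derivable f x v -> derivable g x v.
Proof. by move=> oU Ux fg; apply: near_eq_derivable; exact: eq_near fg. Qed.

Lemma eq_continuous_at U f g x : open U -> U x -> (forall y, U y -> f y = g y) ->
  {for x, continuous f} -> {for x, continuous g}.
Proof.
move=> oU Ux fg cf; rewrite /prop_for /continuous_at -(fg _ Ux).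
apply: cvg_trans cf; apply: near_eq_cvg.
by apply: filterS (open_near oU Ux) => y /fg.
Qed.

Lemma eq_iter_derive U f g vs x : open U -> (forall y, U y -> f y = g y) -> U x ->
  iter_derive vs f x = iter_derive vs g x.
Proof.
move=> oU fg; elim: vs x => [|v vs IH] x Ux /=; first exact: fg.
exact: eq_derive oU Ux IH.
Qed.

Lemma eq_smooth U f g : open U -> (forall y, U y -> f y = g y) ->
  smooth_on U f -> smooth_on U g.
Proof.
move=> oU fg sf vs x Ux; have [cf df] := sf vs x Ux.
have E y (Uy : U y) := eq_iter_derive vs oU fg Uy.
by split=> [|v]; [exact: (eq_continuous_at oU Ux E cf)|exact: (eq_derivable oU Ux E (df v))].
Qed.

(** Derivatives of explicit formulas stay in an explicit family only up to equality on U. A class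
    stable in this sense replaces the induction on lists of directions in the later smoothness
    proofs. *)
Lemma smooth_coind U (K : (V -> W) -> Prop) : open U ->
  (forall f, K f -> forall x, U x -> {for x, continuous f} /\ forall v, derivable f x v) ->
  (forall f v, K f -> exists2 g, K g & forall x, U x -> 'D_v f x = g x) ->
  forall f, K f -> smooth_on U f.
Proof.
move=> oU K1 K2 f Kf vs.
have [g Kg E] : exists2 g, K g & forall x, U x -> g x = iter_derive vs f x.
  elim: vs => [|v vs [g Kg E]] /=; first by exists f.
  have [h Kh Eh] := K2 g v Kg; exists h => // x Ux.
  by rewrite -Eh //; exact: eq_derive oU Ux E.
move=> x Ux; have [cg dg] := K1 g Kg x Ux.
by split=> [|v]; [exact: (eq_continuous_at oU Ux E cg)|exact: (eq_derivable oU Ux E (dg v))].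
Qed.

Lemma smooth_local (U : set V) f :
  (forall x, U x -> exists2 U', open U' /\ U' x & smooth_on U' f) -> smooth_on U f.
Proof. by move=> H vs x Ux; have [U' [_ U'x] sf] := H x Ux; exact: sf. Qed.

Lemma smooth_cst U (c : W) : smooth_on U (fun _ => c).
Proof.
move=> vs x Ux.
have -> : iter_derive vs (fun=> c) = cst (if vs is [::] then c else 0).
  elim: vs => [//|v vs IH] /=; rewrite IH; apply/funext => y; exact: derive_cst.
by split=> [|v]; [exact: cst_continuous|exact: derivable_cst].
Qed.

End General.

Section RealValued.
Context {V : normedModType R}.
Implicit Types (f g : V -> R^o) (U : set V).

(** The derivative of a product or a composite is a sum of products, so the class fed to
    [smooth_coind] has to be an algebra; with [smooth_alg] only its generators need checking. *)
Inductive alg_closure (B : (V -> R^o) -> Prop) : (V -> R^o) -> Prop :=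
| alg_base f : B f -> alg_closure B f
| alg_cst (c : R) : alg_closure B (fun _ => c)
| alg_add f g : alg_closure B f -> alg_closure B g -> alg_closure B (fun x => f x + g x)
| alg_mul f g : alg_closure B f -> alg_closure B g -> alg_closure B (fun x => f x * g x).

Lemma smooth_alg U (B : (V -> R^o) -> Prop) : open U ->
  (forall f, B f -> forall x, U x -> {for x, continuous f} /\ forall v, derivable f x v) ->
  (forall f v, B f -> exists2 g, alg_closure B g & forall x, U x -> 'D_v f x = g x) ->
  forall f, alg_closure B f -> smooth_on U f.
Proof.
move=> oU B1 B2.
have K1 f : alg_closure B f -> forall x, U x ->
    {for x, continuous f} /\ forall v, derivable f x v.
  elim=> {f} [f Bf|c|f g _ IHf _ IHg|f g _ IHf _ IHg] x Ux.
  - exact: B1.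
  - by split=> [|v]; [exact: cst_continuous|exact: derivable_cst].
  - have [cf df] := IHf x Ux; have [cg dg] := IHg x Ux; split=> [|v].
      exact: continuousD.
    exact: derivableD.
  - have [cf df] := IHf x Ux; have [cg dg] := IHg x Ux; split=> [|v].
      exact: continuousM.
    exact: derivableM.
apply: smooth_coind => // f v.
elim=> {f} [f Bf|c|f g Kf [f' Kf' Ef] Kg [g' Kg' Eg]|f g Kf [f' Kf' Ef] Kg [g' Kg' Eg]].
- exact: B2.
- by exists (fun=> 0) => [|x Ux]; [exact: alg_cst|exact: derive_cst].
- exists (fun x => f' x + g' x) => [|x Ux]; first exact: alg_add.
  have [_ df] := K1 f Kf x Ux; have [_ dg] := K1 g Kg x Ux.
  by rewrite -Ef// -Eg//; exact: deriveD.
- exists (fun x => f x * g' x + g x * f' x) => [|x Ux].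
    by apply: alg_add; exact: alg_mul.
  have [_ df] := K1 f Kf x Ux; have [_ dg] := K1 g Kg x Ux.
  by rewrite -Ef// -Eg//; exact: deriveM.
Qed.

Lemma smooth_alg_smooth U f : open U -> alg_closure (smooth_on U) f -> smooth_on U f.
Proof.
move=> oU; apply: smooth_alg => // [{}f sf x Ux|{}f v sf].
  by have [] := sf [::] x Ux.
by exists ('D_v f) => //; apply: alg_base; exact: smooth_derive.
Qed.

Lemma smooth_add U f g : open U -> smooth_on U f -> smooth_on U g ->
  smooth_on U (fun x => f x + g x : R^o).
Proof. by move=> oU sf sg; apply: smooth_alg_smooth => //; apply: alg_add; exact: alg_base. Qed.

Lemma smooth_mul U f g : open U -> smooth_on U f -> smooth_on U g ->
  smooth_on U (fun x => f x * g x : R^o).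
Proof. by move=> oU sf sg; apply: smooth_alg_smooth => //; apply: alg_mul; exact: alg_base. Qed.

Lemma smooth_opp U f : open U -> smooth_on U f -> smooth_on U (fun x => - f x : R^o).
Proof.
move=> oU sf; apply: (@eq_smooth _ _ U (fun x => -1 * f x : R^o) _ oU).
  by move=> y _; rewrite mulN1r.
by apply: (smooth_mul oU _ sf); exact: smooth_cst.
Qed.

Lemma smooth_sub U f g : open U -> smooth_on U f -> smooth_on U g ->
  smooth_on U (fun x => f x - g x : R^o).
Proof. by move=> oU sf sg; apply: (smooth_add oU sf); exact: smooth_opp. Qed.

Lemma smooth_sum U (I : Type) (r : seq I) (F : I -> V -> R^o) : open U ->
  (forall i, smooth_on U (F i)) -> smooth_on U (fun x => \sum_(i <- r) F i x : R^o).
Proof.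
move=> oU H; elim: r => [|i r IH].
  by under eq_fun do rewrite big_nil; exact: smooth_cst.
by under eq_fun do rewrite big_cons; exact: (smooth_add oU (H i) IH).
Qed.

End RealValued.

Section Vectors.
Context {n m : nat}.
Implicit Types (U : set 'rV[R]_n) (h : 'rV[R]_n -> 'rV[R]_m).

Lemma continuous_rVP (T : topologicalType) (k : nat) (h : T -> 'rV[R]_k) x :
  {for x, continuous h} <-> forall j, {for x, continuous (fun y => h y 0 j)}.
Proof.
split=> [ch j|H].
  by apply: (@cvg_comp _ _ _ h (fun y => y 0 j) _ _ _ ch); exact: continuous_coord.
apply/cvgrPdist_le => e e0; near=> y.
apply: norm_rV_le; first exact: ltW.
suff D : forall j, `|h x 0 j - h y 0 j| <= e by move=> j; rewrite !mxE.
near: y; apply: filter_forall => j.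
by have /cvgrPdist_le := H j; apply.
Unshelve. all: by end_near. Qed.

Lemma derivable_rVP (V : normedModType R) (k : nat) (h : V -> 'rV[R]_k) x v :
  derivable h x v <-> forall j, derivable (fun y => h y 0 j : R^o) x v.
Proof.
split=> [/derivable_mxP H j|H]; first exact: H.
by apply/derivable_mxP => i j; rewrite ord1.
Qed.

Lemma derive_rV (V : normedModType R) (k : nat) (h : V -> 'rV[R]_k) x v j :
  derivable h x v -> ('D_v h x) 0 j = 'D_v (fun y => h y 0 j : R^o) x.
Proof. by move=> /derive_mx ->; rewrite mxE. Qed.

Lemma smooth_rVP U h : open U ->
  smooth_on U h <-> forall j, smooth_on U (fun x => h x 0 j : R^o).
Proof.
move=> oU; split=> [sh j|H].
  have E vs x : U x -> iter_derive vs h x 0 j = iter_derive vs (fun x => h x 0 j : R^o) x.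
    elim: vs x => [//|v vs IH] x Ux /=.
    by rewrite derive_rV ?(eq_derive v oU Ux IH)//; exact: (sh vs x Ux).2.
  move=> vs x Ux; have [/continuous_rVP/(_ j) c d] := sh vs x Ux.
  split=> [|v]; first exact: eq_continuous_at (E vs) c.
  by move/derivable_rVP: (d v) => /(_ j); exact: eq_derivable (E vs).
have E vs x j : U x -> iter_derive vs h x 0 j = iter_derive vs (fun x => h x 0 j : R^o) x.
  elim: vs x j => [//|v vs IH] x j Ux /=.
  rewrite derive_rV; first by apply: eq_derive oU Ux _ => y Uy; exact: IH.
  apply/derivable_rVP => i; apply: (eq_derivable oU Ux (fun y Uy => esym (IH y i Uy))).
  exact: (H i vs x Ux).2.
move=> vs x Ux; split=> [|v].
  apply/continuous_rVP => j; apply: (eq_continuous_at oU Ux (fun y Uy => esym (E vs y j Uy))).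
  exact: (H j vs x Ux).1.
apply/derivable_rVP => j; apply: (eq_derivable oU Ux (fun y Uy => esym (E vs y j Uy))).
exact: (H j vs x Ux).2.
Qed.

Lemma smooth_differentiable U (f : 'rV[R]_n -> R^o) x : open U -> U x ->
  smooth_on U f -> differentiable f x.
Proof.
move=> oU Ux sf; apply: (C1_differentiable oU Ux) => [y v Uy|v].
  exact: smooth_derivable sf Uy.
exact: (smooth_continuous (smooth_derive v sf)).
Qed.

Lemma smooth_differentiableV U h x : open U -> U x -> smooth_on U h -> differentiable h x.
Proof.
move=> oU Ux /smooth_rVP => /(_ oU) sh.
have -> : h = \sum_(j < m) (fun y => (h y 0 j) *: (delta_mx 0 j : 'rV[R]_m)).
  apply/funext => y; rewrite fct_sumE; exact: row_sum_delta.
apply: differentiable_sum => j; apply: differentiableZl.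
exact: smooth_differentiable (sh j).
Qed.

End Vectors.

Lemma smooth_linear n (f : {linear 'rV[R]_n -> R^o}) U : open U -> smooth_on U f.
Proof.
move=> oU.
have cf : continuous f.
  have -> : f = dotr (fun i => f (delta_mx 0 i)) :> (_ -> _).
    apply/funext => x; rewrite {1}[x]row_sum_delta linear_sum; apply: eq_bigr => i _.
    by rewrite linearZ.
  exact: continuous_dotr.
have df x : differentiable f x by exact: linear_differentiable.
apply: (@smooth_coind _ _ U (fun g => g = f \/ exists c, g = fun=> c)) => //; last by left.
  move=> _ [->|[c ->]] x Ux.
    by split=> [|v]; [exact: cf|exact: diff_derivable].
  by split=> [|v]; [exact: cst_continuous|exact: derivable_cst].
move=> _ v [->|[c ->]].
  exists (fun=> f v); first by right; exists (f v).
  by move=> x Ux; rewrite deriveE// diff_lin.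
exists (fun=> 0); first by right; exists 0.
by move=> x Ux; exact: derive_cst.
Qed.

Lemma smooth_coord n (i : 'I_n) U : open U -> smooth_on U (fun x : 'rV[R]_n => x 0 i : R^o).
Proof.
move=> oU.
have -> : (fun x : 'rV[R]_n => x 0 i : R^o) = dotr (fun j => (j == i)%:R).
  apply/funext => x; rewrite /dotr (bigD1 i)//= eqxx mulr1 big1 ?addr0// => j ji.
  by rewrite (negbTE ji) mulr0.
exact: smooth_linear.
Qed.

Lemma smooth_affine n m (A : 'M[R]_(n, m)) (b : 'rV[R]_m) U : open U ->
  smooth_on U (fun x => x *m A + b).
Proof.
move=> oU; apply/smooth_rVP => // j.
apply: (@eq_smooth _ _ U (fun x => dotr (fun i => A i j) x + b 0 j : R^o)) => //.
  by move=> x _; rewrite !mxE.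
by apply: smooth_add => //; [exact: smooth_linear|exact: smooth_cst].
Qed.

Lemma derive_affine n m (A : 'M[R]_(n, m)) (b : 'rV[R]_m) x v :
  'D_v (fun x => x *m A + b) x = v *m A.
Proof.
have oT : open [set: 'rV[R]_n] by exact: openT.
apply/rowP => j; rewrite derive_rV; last first.
  exact: (smooth_derivable (smooth_affine A b oT)).
have -> : (fun y : 'rV[R]_n => (y *m A + b) 0 j : R^o) = dotr (fun i => A i j) + cst (b 0 j).
  by apply/funext => y; rewrite !mxE.
have dl : differentiable (dotr (fun i => A i j)) x.
  by apply: linear_differentiable; exact: continuous_dotr.
rewrite deriveD; [|exact: diff_derivable|exact: derivable_cst].
rewrite derive_cst addr0 deriveE// diff_lin; last exact: continuous_dotr.
by rewrite mxE.
Qed.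

Lemma derive_lin n (f : 'rV[R]_n -> R^o) x v : differentiable f x ->
  'D_v f x = \sum_i v 0 i * 'D_(delta_mx 0 i) f x.
Proof.
move=> df; rewrite deriveE// {1}[v]row_sum_delta linear_sum; apply: eq_bigr => i _.
by rewrite linearZ deriveE.
Qed.

Section Chain.
Context {n m : nat} (U : set 'rV[R]_n) (U' : set 'rV[R]_m) (h : 'rV[R]_n -> 'rV[R]_m).
Hypotheses (oU : open U) (oU' : open U') (sh : smooth_on U h).
Hypothesis hU : forall x, U x -> U' (h x).

Lemma chain_derivable (f : 'rV[R]_m -> R^o) x v : smooth_on U' f -> U x ->
  derivable (f \o h) x v /\ 'D_v (f \o h) x = 'D_('D_v h x) f (h x).
Proof.
move=> sf Ux.
have dh : differentiable h x by exact: smooth_differentiableV sh.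
have df : differentiable f (h x) by exact: smooth_differentiable (hU Ux) sf.
have dc : differentiable (f \o h) x by exact: differentiable_comp.
split; first exact: diff_derivable.
by rewrite !deriveE// diff_comp.
Qed.

(** By the chain rule a derivative of [f \o h] is a sum of products of coordinates of derivatives of
    h with composites of partial derivatives of f with h. The algebra generated by both kinds of
    functions is therefore stable under derivatives. *)
Lemma smooth_comp (f : 'rV[R]_m -> R^o) : smooth_on U' f -> smooth_on U (f \o h).
Proof.
move=> sf.
pose B (g : 'rV[R]_n -> R^o) := smooth_on U g \/ exists2 f, smooth_on U' f & g = f \o h.
apply: (@smooth_alg _ U B) => //; last by apply: alg_base; right; exists f.
- move=> g [sg|[k sk ->]] x Ux; first by have [] := sg [::] x Ux.
  split=> [|v]; last by have [] := chain_derivable v sk Ux.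
  apply: continuous_comp; first exact: smooth_continuous sh Ux.
  exact: smooth_continuous sk (hU Ux).
- move=> g v [sg|[k sk ->]].
    by exists ('D_v g) => //; apply: alg_base; left; exact: smooth_derive.
  exists (fun x => \sum_j ('D_v h x) 0 j * 'D_(delta_mx 0 j) k (h x)); last first.
    move=> x Ux; have [_ ->] := chain_derivable v sk Ux.
    by apply: derive_lin; exact: smooth_differentiable (hU Ux) sk.
  elim: (index_enum _) => [|j r IH].
    by under eq_fun do rewrite big_nil; exact: alg_cst.
  under eq_fun do rewrite big_cons; apply: alg_add => //; apply: alg_mul; apply: alg_base.
    by left; exact: (smooth_rVP _ oU).1 (smooth_derive v sh) j.
  by right; exists ('D_(delta_mx 0 j) k); [exact: smooth_derive|].
Qed.

End Chain.

Section ChainV.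
Context {n m p : nat} (U : set 'rV[R]_n) (U' : set 'rV[R]_m).
Context (h : 'rV[R]_n -> 'rV[R]_m) (k : 'rV[R]_m -> 'rV[R]_p).
Hypotheses (oU : open U) (oU' : open U') (sh : smooth_on U h) (sk : smooth_on U' k).
Hypothesis hU : forall x, U x -> U' (h x).

Lemma smooth_compV : smooth_on U (k \o h).
Proof.
apply/smooth_rVP => // j.
by apply: (smooth_comp oU oU' sh hU (f := fun y => k y 0 j : R^o)); exact: (smooth_rVP _ oU').1 sk j.
Qed.

Lemma derive_compV x v : U x -> 'D_v (k \o h) x = 'D_('D_v h x) k (h x).
Proof.
move=> Ux; apply/rowP => j.
rewrite derive_rV; last exact: smooth_derivable smooth_compV Ux.
rewrite derive_rV; last exact: smooth_derivable sk (hU Ux).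
have skj : smooth_on U' (fun y => k y 0 j : R^o) by exact: (smooth_rVP _ oU').1 sk j.
by have [_ <-] := chain_derivable oU oU' sh hU v skj Ux.
Qed.

End ChainV.

Lemma open_preim (T S : topologicalType) (f : T -> S) (A : set S) :
  continuous f -> open A -> open (f @^-1` A).
Proof. by move=> /continuousP; exact. Qed.

Lemma near_dist2 (V : normedModType R) (F G : V -> R^o) (U : set V) x e :
  {for x, continuous F} -> {for x, continuous G} -> open U -> U x -> 0 < e ->
  \forall y \near x, [/\ U y, `|F x - F y| <= e & `|G x - G y| <= e].
Proof.
move=> cF cG oU Ux e0; have n1 := open_near oU Ux.
move/cvgrPdist_le : cF => /(_ _ e0) n2; move/cvgrPdist_le : cG => /(_ _ e0) n3.
by move: n1 n2 n3; apply: filterS3.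
Qed.

Lemma close_eq (a b c d e : R) : `|a - c| <= e / 2 -> `|b - d| <= e / 2 -> c = d ->
  `|a - b| <= e.
Proof.
move=> ac bd cd; rewrite -(subrKA c) (splitr e).
by apply: (le_trans (ler_normD _ _)); apply: lerD => //; rewrite cd distrC.
Qed.

Section Schwarz.
Context {n : nat} (U : set 'rV[R]_n) (f : 'rV[R]_n -> R^o).
Hypotheses (oU : open U) (sf : smooth_on U f).

(** The left side is an increment along v of the function [f (y + t *: w) - f y]; the mean value
    theorem along v and then along w turns it into a single value of the mixed derivative. *)
Lemma second_difference (x v w : 'rV[R]_n) (t : R) : 0 < t ->
  (forall a b, 0 <= a <= t -> 0 <= b <= t -> U (x + a *: v + b *: w)) ->
  exists a b, [/\ 0 <= a <= t, 0 <= b <= t &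
   f (x + t *: v + t *: w) - f (x + t *: v) - (f (x + t *: w) - f x)
   = t * (t * 'D_w ('D_v f) (x + a *: v + b *: w))].
Proof.
move=> t0 HU.
have tt : 0 <= t <= t by rewrite lexx ltW.
have zt : 0 <= (0:R) <= t by rewrite lexx ltW.
have ct c : 0 <= c <= 1 -> 0 <= c * t <= t.
  by move=> /andP[c0 c1]; rewrite mulr_ge0 ?(ltW t0)//= ler_piMl ?(ltW t0).
pose g (y : 'rV[R]_n) : R^o := f (y + t *: w) - f y.
have dshift y : U (y + t *: w) -> is_derive y v (fun y => f (y + t *: w)) ('D_v f (y + t *: w)).
  move=> Uy; pose U2 := [set y | U (y + t *: w)].
  have E : (fun y => y + t *: w) = (fun y => y *m 1%:M + t *: w) by apply/funext => z; rewrite mulmx1.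
  have oU2 : open U2.
    apply: (@open_preim _ _ (fun y : 'rV[R]_n => y + t *: w) U _ oU).
    rewrite E => z; exact: smooth_continuous (smooth_affine 1%:M (t *: w) openT) _.
  have sA : smooth_on U2 (fun y => y + t *: w) by rewrite E; exact: smooth_affine.
  have [d1 d2] := @chain_derivable _ _ U2 U _ oU2 oU sA (fun _ h => h) f y v sf Uy.
  apply: DeriveDef; first exact: d1.
  by move: d2; rewrite /comp => ->; rewrite E derive_affine mulmx1.
have dg a : 0 <= a <= t -> is_derive (x + a *: v) v g
    ('D_v f (x + a *: v + t *: w) - 'D_v f (x + a *: v)).
  move=> at_; have [d1 e1] := dshift _ (HU a t at_ tt).
  have d2 : derivable f (x + a *: v) v.
    by apply: smooth_derivable sf _; have := HU a 0 at_ zt; rewrite scale0r addr0.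
  by apply: DeriveDef; [exact: derivableB d1 d2|rewrite (deriveB d1 d2) e1].
have [s s01|c c01 Ec] := @MVT_line R _ g x (t *: v).
  have [d _] := dg _ (ct s s01); rewrite scalerA.
  by have [] := is_derive_scale t d.
have ca := ct c c01; have [dga Ega] := dg _ ca.
have [_ Es] := is_derive_scale t dga.
have sDf : smooth_on U ('D_v f) by exact: smooth_derive.
have [s s01|c' c01' Ec'] := @MVT_line R _ ('D_v f) (x + (c * t) *: v) (t *: w).
  have d : derivable ('D_v f) (x + (c * t) *: v + s *: (t *: w)) w.
    by rewrite scalerA; apply: smooth_derivable sDf _; exact: (HU _ _ ca (ct s s01)).
  by have [] := is_derive_scale t d.
have cb := ct c' c01'.
have dw : derivable ('D_v f) (x + (c * t) *: v + (c' * t) *: w) w.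
  by apply: smooth_derivable sDf _; exact: (HU _ _ ca cb).
have [_ Es'] := is_derive_scale t dw.
exists (c * t), (c' * t); split=> //.
by move: Ec; rewrite /g scalerA Es Ega Ec' scalerA Es'.
Qed.

(** The second difference is symmetric in v and w, so the two mixed derivatives agree at two points
    close to x, one for each; continuity at x does the rest. *)
Lemma schwarz x v w : U x -> 'D_w ('D_v f) x = 'D_v ('D_w f) x.
Proof.
move=> Ux.
have c1 : {for x, continuous ('D_w ('D_v f))}.
  by apply: smooth_continuous Ux; do 2 apply: smooth_derive.
have c2 : {for x, continuous ('D_v ('D_w f))}.
  by apply: smooth_continuous Ux; do 2 apply: smooth_derive.
apply/eqP; rewrite -subr_eq0 -normr_le0; apply/ler_addgt0Pl => e e0; rewrite addr0.
have e2 : 0 < e / 2 by rewrite divr_gt0.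
have := near_dist2 c1 c2 oU Ux e2.
move=> /nbhs_ballP[d /= d0 Hd].
(* With this side the parallelogram spanned at x by t v and t w stays in the ball of radius d; the
   summand 1 covers v = w = 0. *)
pose t := d / 2 / (`|v| + `|w| + 1).
have p0 : 0 < `|v| + `|w| + 1 by rewrite ltr_wpDl// addr_ge0.
have t0 : 0 < t by rewrite /t !divr_gt0.
have HB a b : 0 <= a <= t -> 0 <= b <= t -> ball x d (x + a *: v + b *: w).
  move=> /andP[a0 at_] /andP[b0 bt]; rewrite -ball_normE /= -addrA opprD addNKr normrN.
  apply: (@le_lt_trans _ _ (t * `|v| + t * `|w|)).
    apply: (le_trans (ler_normD _ _)).
    by rewrite !normrZ !ger0_norm// lerD// ler_wpM2r.
  rewrite -mulrDr /t -mulrA mulrC -mulrA [X in _ * X]mulrC.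
  apply: (@le_lt_trans _ _ (d / 2)); last by rewrite ltr_pdivrMr// mulr_natr mulr2n ltrDl.
  by rewrite mulrCA ler_piMr ?divr_ge0 ?ltW// mulrC ltr_pdivrMr// mul1r ltrDl.
have [a [b [ha hb E1]]] := second_difference (x := x) (v := v) (w := w) t0 (fun a b ha hb => let: And3 h _ _ := Hd _ (HB a b ha hb) in h).
have HB' r s : 0 <= r <= t -> 0 <= s <= t -> ball x d (x + r *: w + s *: v).
  by move=> ha' hb'; rewrite addrAC; exact: HB.
have [a' [b' [ha' hb' E2]]] := second_difference (x := x) (v := w) (w := v) t0 (fun a b ha hb => let: And3 h _ _ := Hd _ (HB' a b ha hb) in h).
have EE : 'D_w ('D_v f) (x + a *: v + b *: w) = 'D_v ('D_w f) (x + a' *: w + b' *: v).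
  have XY : f (x + t *: v + t *: w) - f (x + t *: v) - (f (x + t *: w) - f x) =
    f (x + t *: w + t *: v) - f (x + t *: w) - (f (x + t *: v) - f x).
    by rewrite [x + t *: w + t *: v]addrAC !opprB !addrA; ring.
  by have := etrans (esym E1) (etrans XY E2) => /(mulfI (lt0r_neq0 t0)) /(mulfI (lt0r_neq0 t0)).
have [_ H1 _] := Hd _ (HB a b ha hb); have [_ _ H2] := Hd _ (HB' a' b' ha' hb').
exact: (close_eq H1 H2 EE).
Qed.

End Schwarz.
End Smooth.

(** * Alternating forms, exterior derivative and pullback on open sets of R^n *)

Section AlternatingForms.
Context {R : realType}.

Lemma deriveMR (V : normedModType R) (f g : V -> R^o) x v : derivable f x v -> derivable g x v ->
  'D_v (fun y => f y * g y : R^o) x = f x * 'D_v g x + g x * 'D_v f x.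
Proof. exact: deriveM. Qed.

Lemma derive_sumR (V : normedModType R) (l : nat) (f : 'I_l -> V -> R^o) x v :
  (forall j, derivable (f j) x v) ->
  'D_v (fun y => \sum_j f j y : R^o) x = \sum_j 'D_v (f j) x.
Proof.
move=> df; rewrite -derive_sum//; congr (derive _ _ _).
by apply/funext => y; rewrite fct_sumE.
Qed.

Section Rows.
Context {k n : nat}.
Implicit Types (A B : 'M[R]_(k, n)) (i j : 'I_k) (w : 'rV[R]_n).

Definition setrow i w A : 'M[R]_(k, n) :=
  \matrix_(a, b) (if a == i then w 0 b else A a b).

Definition swap_rows i j A : 'M[R]_(k, n) :=
  setrow i (row j A) (setrow j (row i A) A).

(** Replacing the rows of A by those of B one at a time lets multilinear identities be proved by
    induction on s. *)
Definition mix (s : nat) B A : 'M[R]_(k, n) :=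
  \matrix_(a, b) (if (a < s)%N then B a b else A a b).

Lemma row_setrow i w A : row i (setrow i w A) = w.
Proof. by apply/rowP => b; rewrite !mxE eqxx. Qed.

Lemma row_setrow_ne i j w A : i != j -> row i (setrow j w A) = row i A.
Proof. by move=> ij; apply/rowP => b; rewrite !mxE (negbTE ij). Qed.

Lemma setrow_id i A : setrow i (row i A) A = A.
Proof. by apply/matrixP => a b; rewrite !mxE; case: eqVneq => [->|]. Qed.

Lemma setrow_setrow i v w A : setrow i v (setrow i w A) = setrow i v A.
Proof. by apply/matrixP => a b; rewrite !mxE; case: eqVneq. Qed.

Lemma setrowC i j v w A : i != j ->
  setrow i v (setrow j w A) = setrow j w (setrow i v A).
Proof.
move=> ij; apply/matrixP => a b; rewrite !mxE; case: (eqVneq a i) => [->|//].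
by rewrite (negbTE ij).
Qed.

Lemma row'_setrow i w A : row' i (setrow i w A) = row' i A.
Proof. by apply/matrixP => a b; rewrite !mxE eq_sym (negbTE (neq_lift _ _)). Qed.

Lemma mixS (s : 'I_k) B A : mix s.+1 B A = setrow s (row s B) (mix s B A).
Proof.
apply/matrixP => a b; rewrite !mxE ltnS leq_eqVlt.
by case: (eqVneq a s) => [->|ne]; rewrite ?eqxx// -[(a : nat) == s]/(a == s) (negbTE ne).
Qed.

Lemma setrow_mix (s : 'I_k) w B A : setrow s w (mix s B A) = mix s B (setrow s w A).
Proof.
apply/matrixP => a b; rewrite !mxE; case: (eqVneq a s) => [->|//].
by rewrite ltnn.
Qed.

Lemma mix_full B A : mix k B A = B.
Proof. by apply/matrixP => a b; rewrite mxE ltn_ord. Qed.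

Lemma mix0 B A : mix 0 B A = A.
Proof. by apply/matrixP => a b; rewrite mxE ltn0. Qed.

Definition multilinear (f : 'M[R]_(k, n) -> R) := forall i A b c v w,
  f (setrow i (b *: v + c *: w) A) = b * f (setrow i v A) + c * f (setrow i w A).

Section OneForm.
Variable f : 'M[R]_(k, n) -> R.
Hypothesis altf : alternating f.

Lemma alt_multilinear : multilinear f.
Proof.
move=> i A b c v w; apply: (altf.1 i) => //; first by rewrite !row_setrow.
  by rewrite !row'_setrow.
by rewrite !row'_setrow.
Qed.

Lemma alt0 i j A : i != j -> row i A = row j A -> f A = 0.
Proof. exact: altf.2. Qed.

Lemma alt_setrowD i v w A : f (setrow i (v + w) A) = f (setrow i v A) + f (setrow i w A).
Proof. by have := alt_multilinear i A 1 1 v w; rewrite !scale1r !mul1r. Qed.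

Lemma alt_setrowZ i c v A : f (setrow i (c *: v) A) = c * f (setrow i v A).
Proof. by have := alt_multilinear i A c 0 v 0; rewrite scale0r addr0 mul0r addr0. Qed.

Lemma alt_setrow0 i A : f (setrow i 0 A) = 0.
Proof. by have := alt_setrowZ i 0 0 A; rewrite scale0r mul0r. Qed.

Lemma alt_swap i j A : i != j -> f (swap_rows i j A) = - f A.
Proof.
move=> ij.
pose g v w := f (setrow i v (setrow j w A)).
have g0 v : g v v = 0.
  apply: (alt0 ij); rewrite row_setrow row_setrow_ne 1?eq_sym//.
  by rewrite row_setrow.
have gD1 u v w : g (u + v) w = g u w + g v w by exact: alt_setrowD.
have gD2 u v w : g w (u + v) = g w u + g w v.
  by rewrite /g !(setrowC _ _ _ ij); exact: alt_setrowD.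
have := g0 (row i A + row j A); rewrite gD1 !gD2 !g0 add0r addr0.
have -> : g (row i A) (row j A) = f A by rewrite /g setrow_id setrow_id.
by move/eqP; rewrite addrC addr_eq0 => /eqP.
Qed.

(** All the added rows are multiples of one vector w, and a term with w in two rows vanishes; only
    the terms linear in c survive. *)
Lemma alt_add_row w (c : 'I_k -> R) A :
  f (\matrix_(a, b) (A a b + c a * w 0 b)) = f A + \sum_a c a * f (setrow a w A).
Proof.
set B := \matrix_(a, b) _.
have rB a : row a B = row a A + c a *: w by apply/rowP => b; rewrite !mxE.
(* Once w occupies row i, the multiples of w added to the first s rows do not change the value. *)
have H0 (i : 'I_k) (s : nat) : (s <= i)%N -> f (setrow i w (mix s B A)) = f (setrow i w A).
  elim: s => [|s IH] si; first by rewrite mix0.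
  have sk : (s < k)%N by exact: leq_trans si (ltnW (ltn_ord i)).
  pose s' := Ordinal sk; have is' : i != s' by rewrite -val_eqE /= gtn_eqF.
  rewrite -[s.+1]/(s'.+1) mixS setrowC// rB alt_setrowD alt_setrowZ.
  rewrite [X in _ * X](alt0 is') ?mulr0 ?addr0; last first.
    by rewrite row_setrow_ne// !row_setrow.
  rewrite setrowC 1?eq_sym// -IH 1?ltnW//; congr f; congr setrow.
  by rewrite setrow_mix setrow_id.
have H (s : nat) : (s <= k)%N ->
    f (mix s B A) = f A + \sum_(a < k | (a < s)%N) c a * f (setrow a w A).
  elim: s => [_|s IH sk]; first by rewrite mix0 big_pred0 ?addr0.
  pose s' := Ordinal sk.
  rewrite -[s.+1]/(s'.+1) mixS rB alt_setrowD alt_setrowZ H0// setrow_mix setrow_id.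
  rewrite IH 1?ltnW// -addrA; congr (_ + _).
  rewrite [RHS](bigD1 s')/= ?ltnSn// addrC; congr (_ + _); apply: eq_bigl => a.
  by rewrite ltnS [(a <= s)%N]leq_eqVlt -val_eqE /=; case: eqVneq => [->|]; rewrite ?ltnn ?andbF ?andbT.
rewrite -[LHS]/(f B) -(mix_full B A) H//; congr (_ + _).
by apply: eq_bigl => a; rewrite ltn_ord.
Qed.

End OneForm.
End Rows.

Section Insertion.
Context {k n : nat}.

Definition ins_row (i : 'I_k.+1) (w : 'rV[R]_n) (A : 'M[R]_(k, n)) : 'M[R]_(k.+1, n) :=
  \matrix_(a, b) (if unlift i a is Some a' then A a' b else w 0 b).

Lemma row'_ins_row i w A : row' i (ins_row i w A) = A.
Proof. by apply/matrixP => a b; rewrite !mxE liftK. Qed.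

Lemma row_ins_row i w A : row i (ins_row i w A) = w.
Proof. by apply/rowP => b; rewrite !mxE unlift_none. Qed.

Lemma ins_row_row' (i : 'I_k.+1) w (A : 'M[R]_(k.+1, n)) :
  ins_row i w (row' i A) = setrow i w A.
Proof.
apply/matrixP => a b; rewrite !mxE; case: unliftP => [a' ->|->]; last by rewrite eqxx.
by rewrite mxE eq_sym (negbTE (neq_lift _ _)).
Qed.

(** Moving the inserted row one place down exchanges it with its neighbour, which costs a sign. *)
Lemma alt_ins_row (f : 'M[R]_(k.+1, n) -> R) (i : 'I_k.+1) w A : alternating f ->
  f (ins_row i w A) = (-1) ^+ i * f (ins_row ord0 w A).
Proof.
move=> altf; case: i => i ik; elim: i ik => [|i IH] ik.
  by rewrite expr0 mul1r; congr (f (ins_row _ _ _)); exact: val_inj.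
have ik' : (i < k.+1)%N by exact: ltnW.
pose x := Ordinal ik'; pose y := Ordinal ik.
have xy : x != y by rewrite -val_eqE /= ltn_eqF.
have -> : ins_row y w A = swap_rows x y (ins_row x w A).
  apply/matrixP => a b; rewrite !mxE.
  have [->|ax] := eqVneq a x.
    case: unliftP => [a' Ea'|/eqP]; last by rewrite (negbTE xy).
    case: unliftP => [b' Eb'|/eqP]; last by rewrite eq_sym (negbTE xy).
    congr (A _ _); apply: val_inj; move: Ea' Eb' => /(congr1 val) /= Ea' /(congr1 val) /= Eb'.
    by move: Ea' Eb'; rewrite /bump; lia.
  have [->|ay] := eqVneq a y; first by rewrite !unlift_none.
  case: unliftP => [a' Ea'|/eqP]; last by rewrite (negbTE ay).
  case: unliftP => [b' Eb'|/eqP]; last by rewrite (negbTE ax).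
  congr (A _ _); apply: val_inj.
  move: ax ay; rewrite -!val_eqE /=; move: Ea' Eb' => /(congr1 val) /= Ea' /(congr1 val) /= Eb'.
  by move: Ea' Eb'; rewrite /bump; lia.
by rewrite alt_swap// IH exprS mulN1r mulNr.
Qed.

End Insertion.

Lemma sign_flip (p q : nat) : odd p = ~~ odd q -> (-1) ^+ p = - (-1) ^+ q :> R.
Proof. by move=> E; rewrite -signr_odd E signrN signr_odd. Qed.

(** The pairs (i, a) enumerate the ordered pairs of distinct i and j, with j = [lift i a];
    exchanging i and j preserves g and reverses the sign. *)
Lemma altsum0 (k : nat) (g : 'I_k.+1 -> 'I_k.+1 -> R) : (forall i j, g i j = g j i) ->
  \sum_(i < k.+1) \sum_(a < k) (-1) ^+ i * ((-1) ^+ a * g i (lift i a)) = 0.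
Proof.
move=> gC.
pose E (i j : 'I_k.+1) := if i == j then 0 else (-1) ^+ (i + unbump i j) * g i j.
have EC i j : E i j = - E j i.
  rewrite /E eq_sym; case: eqVneq => [_|ne]; first by rewrite oppr0.
  rewrite gC -mulNr; congr (_ * _); apply: sign_flip.
  move: ne; rewrite -val_eqE /= /unbump => ne.
  by have [ij|ji|ij] := ltngtP i j; [lia|lia|rewrite ij eqxx in ne].
have -> : \sum_(i < k.+1) \sum_(a < k) (-1) ^+ i * ((-1) ^+ a * g i (lift i a)) =
    \sum_i \sum_j E i j.
  apply: eq_bigr => i _; rewrite (bigD1_ord i)//= {1}/E eqxx add0r.
  apply: eq_bigr => a _; rewrite /E (negbTE (neq_lift _ _)) mulrA exprD.
  by congr (_ * _ * _); rewrite [unbump _ _](bumpK i a).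
have : \sum_i \sum_j E i j = - \sum_i \sum_j E i j.
  rewrite {1}exchange_big /= -sumrN; apply: eq_bigr => i _.
  by rewrite -sumrN; apply: eq_bigr => j _; rewrite EC.
by move/eqP; rewrite -addr_eq0 -mulr2n mulrn_eq0 => /eqP.
Qed.

Lemma row'_row' (m n : nat) (V : 'M[R]_(m.+2, n)) (i j : 'I_m.+2) (a b : 'I_m.+1) :
  j = lift i a -> i = lift j b -> row' a (row' i V) = row' b (row' j V).
Proof.
move=> /(congr1 val) /= ja /(congr1 val) /= ib; apply/matrixP => c d; rewrite !mxE.
congr (V _ _); apply: val_inj => /=; move: ja ib; rewrite /bump; lia.
Qed.

(** Two rows may be deleted in either order. This is the cancellation behind d d = 0, allowing
    weights that are symmetric in the two deleted indices. *)
Lemma altsum_row' (m n : nat) (V : 'M[R]_(m.+2, n)) (g : 'I_m.+2 -> 'I_m.+2 -> 'M[R]_(m, n) -> R) :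
  (forall i j A, g i j A = g j i A) ->
  \sum_(i < m.+2) \sum_(a < m.+1) (-1) ^+ i * ((-1) ^+ a *
     g i (lift i a) (row' a (row' i V))) = 0.
Proof.
move=> gC.
pose G i j := if unlift i j is Some a then g i j (row' a (row' i V)) else 0.
rewrite -[RHS](@altsum0 m.+1 G).
  apply: eq_bigr => i _; apply: eq_bigr => a _; by rewrite /G liftK.
move=> i j; rewrite /G; case: unliftP => [a ja|ij]; last by rewrite ij unlift_none.
case: unliftP => [b ib|ij]; last by move/eqP: ja; rewrite -ij (negbTE (neq_lift _ _)).
by rewrite (row'_row' V ja ib) gC.
Qed.

(** In [dE_epull] the vector [H i j] is the second derivative of the map along rows i and j; its
    symmetry is the reason why d commutes with pullback. *)
Lemma alt_symmetric_sum (k m : nat) (f : 'M[R]_(k, m) -> R) (V : 'M[R]_(k.+1, m))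
    (H : 'I_k.+1 -> 'I_k.+1 -> 'rV[R]_m) : alternating f -> (forall i j, H i j = H j i) ->
  \sum_(i < k.+1) (-1) ^+ i * (\sum_(a < k) f (setrow a (H i (lift i a)) (row' i V))) = 0.
Proof.
case: k f V H => [|k] f V H altf HC.
  by rewrite big1// => i _; rewrite big_ord0 mulr0.
rewrite -[RHS](altsum_row' V (g := fun i j A => f (ins_row ord0 (H i j) A))).
  apply: eq_bigr => i _; rewrite mulr_sumr; apply: eq_bigr => a _; congr (_ * _).
  by rewrite -alt_ins_row// ins_row_row'.
by move=> i j A; rewrite HC.
Qed.

(** The rows are edge vectors of the oblique face, that is, coordinate vectors minus the common
    vector e_0; [alt_add_row] therefore splits the value into those on the coordinate faces. *)
Lemma alt_slanted_face (k : nat) (f : 'M[R]_(k, k.+1) -> R) : alternating f ->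
  f (\matrix_(a, b) ((b == lift ord0 a)%:R - (b == ord0)%:R)) =
  \sum_(i < k.+1) (-1) ^+ i * f (row' i 1%:M).
Proof.
move=> altf.
have -> : (\matrix_(a, b) ((b == lift ord0 a)%:R - (b == ord0)%:R)) =
   \matrix_(a < k, b < k.+1) (row' ord0 (1%:M : 'M[R]_k.+1) a b + (-1) * (delta_mx 0 0 : 'rV[R]_k.+1) 0 b).
  by apply/matrixP => a b; rewrite !mxE eqxx mulN1r /= [lift _ _ == _]eq_sym.
rewrite (alt_add_row altf (delta_mx 0 0) (fun=> -1)) big_ord_recl expr0 mul1r.
congr (_ + _); apply: eq_bigr => a _.
case: k f altf a => [|k] f altf a; first by case: a.
rewrite -ins_row_row' alt_ins_row// mulrA /= -exprS; congr (_ * f _).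
apply/matrixP => b c; rewrite !mxE.
case: unliftP => [b' ->|->]; rewrite ?mxE /=.
  congr (_ == _)%:R; apply: val_inj; rewrite /= /bump; lia.
by rewrite eq_sym; congr (_ == _)%:R; apply: val_inj; rewrite /= /bump; lia.
Qed.

Section MultilinearDerivative.
Context {k l n : nat} (U : set 'rV[R]_n) (F : 'rV[R]_n -> 'M[R]_(k, l) -> R).
Context (B : 'rV[R]_n -> 'M[R]_(k, l)).
Hypotheses (oU : open U) (mF : forall y, U y -> multilinear (F y)).
Hypothesis sF : forall A, smooth_on U (F ^~ A : _ -> R^o).
Hypothesis sB : forall a b, smooth_on U (fun y => B y a b : R^o).

Lemma multilinear_expand (f : 'M[R]_(k, l) -> R) i w A : multilinear f ->
  f (setrow i w A) = \sum_j w 0 j * f (setrow i (delta_mx 0 j) A).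
Proof.
move=> mf; have Z c v : f (setrow i (c *: v) A) = c * f (setrow i v A).
  by have := mf i A c 0 v 0; rewrite scale0r addr0 mul0r addr0.
have f0 : f (setrow i 0 A) = 0 by have := Z 0 0; rewrite scale0r mul0r.
have D v u : f (setrow i (v + u) A) = f (setrow i v A) + f (setrow i u A).
  by have := mf i A 1 1 v u; rewrite !scale1r !mul1r.
rewrite {1}[w]row_sum_delta (big_morph (fun w => f (setrow i w A)) D f0).
by apply: eq_bigr => j _; exact: Z.
Qed.

Lemma smooth_mix s A : (s <= k)%N -> smooth_on U (fun y => F y (mix s (B y) A) : R^o).
Proof.
elim: s A => [|s IH] A sk.
  by apply: eq_smooth (sF A) => // y _; rewrite mix0.
pose s' := Ordinal sk.
apply: (@eq_smooth _ _ _ U (fun y => \sum_j B y s' j * F y (mix s (B y) (setrow s' (delta_mx 0 j) A)) : R^o)) => //.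
  move=> y Uy; rewrite -[s.+1]/(s'.+1) mixS multilinear_expand//; last exact: mF.
  by apply: eq_bigr => j _; rewrite setrow_mix mxE.
apply: smooth_sum => // j; apply: smooth_mul => //.
exact: IH (ltnW sk).
Qed.

Lemma smooth_multilinear : smooth_on U (fun y => F y (B y) : R^o).
Proof.
apply: eq_smooth (@smooth_mix k 0 (leqnn k)) => // y _.
by rewrite mix_full.
Qed.

Definition drow (v x : 'rV[R]_n) (a : 'I_k) : 'rV[R]_l :=
  \row_b 'D_v (fun y => B y a b : R^o) x.

(** Besides F itself, only the first s rows move with the point. Expanding the last moving row in
    the basis leaves s - 1 moving rows, and the product rule adds one new term. *)
Lemma derive_mix s A x v : (s <= k)%N -> U x ->
  'D_v (fun y => F y (mix s (B y) A) : R^o) x =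
  'D_v (fun y => F y (mix s (B x) A) : R^o) x +
  \sum_(a < k | (a < s)%N) F x (setrow a (drow v x a) (mix s (B x) A)).
Proof.
elim: s A => [|s IH] A sk Ux.
  rewrite big_pred0 ?addr0; last by move=> a; rewrite ltn0.
  by apply: (@eq_derive R _ R^o U) => // y _; rewrite !mix0.
pose s' := Ordinal sk.
pose Aj j := setrow s' (delta_mx 0 j) A.
have E0 z y w A' : U z -> F z (setrow s' w (mix s (B y) A')) =
    \sum_j w 0 j * F z (mix s (B y) (setrow s' (delta_mx 0 j) A')).
  move=> Uz; rewrite multilinear_expand//; last exact: mF.
  by apply: eq_bigr => j _; rewrite setrow_mix.
have dB j : derivable (fun y => B y s' j : R^o) x v by exact: smooth_derivable (sB s' j) Ux.
have dM j : derivable (fun y => F y (mix s (B y) (Aj j)) : R^o) x v.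
  by apply: smooth_derivable Ux; exact: smooth_mix (ltnW sk).
have dF M : derivable (F^~ M : _ -> R^o) x v by exact: smooth_derivable (sF M) Ux.
transitivity ('D_v (fun y => \sum_j B y s' j * F y (mix s (B y) (Aj j)) : R^o) x).
  apply: (@eq_derive R _ R^o U) => // y Uy; rewrite -[s.+1]/(s'.+1) mixS E0//.
  by apply: eq_bigr => j _; rewrite mxE.
rewrite derive_sumR; last by move=> j; apply: derivableM.
transitivity (\sum_j (B x s' j * 'D_v (fun y => F y (mix s (B x) (Aj j)) : R^o) x +
    (B x s' j * (\sum_(a < k | (a < s)%N) F x (setrow a (drow v x a) (mix s (B x) (Aj j)))) +
    drow v x s' 0 j * F x (mix s (B x) (Aj j))))).
  apply: eq_bigr => j _; rewrite (deriveMR (dB j) (dM j)) IH// 1?ltnW//.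
  by rewrite mxE mulrDr addrA; congr (_ + _); rewrite mulrC.
rewrite !big_split /=; congr (_ + _).
  transitivity ('D_v (fun y => \sum_j B x s' j * F y (mix s (B x) (Aj j)) : R^o) x).
    rewrite derive_sumR; last by move=> j; apply: derivableM => //; exact: derivable_cst.
    apply: eq_bigr => j _.
    by rewrite (deriveMR (derivable_cst (B x s' j : R^o) x v) (dF _)) derive_cst mulr0 addr0.
  apply: (@eq_derive R _ R^o U) => // y Uy; rewrite -[s.+1]/(s'.+1) mixS E0//.
  by apply: eq_bigr => j _; rewrite mxE.
rewrite [RHS](bigD1 s')/= ?ltnSn// addrC; congr (_ + _).
  by rewrite -[s.+1]/(s'.+1) mixS setrow_setrow -E0.
under eq_bigr do rewrite mulr_sumr.
rewrite exchange_big /=; apply: eq_big => [a|a as_].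
  by rewrite ltnS [(a <= s)%N]leq_eqVlt -val_eqE /=; case: eqVneq => [->|]; rewrite ?ltnn ?andbF ?andbT.
have as' : a != s' by rewrite -val_eqE /= ltn_eqF.
rewrite -[s.+1]/(s'.+1) mixS setrowC// multilinear_expand; last exact: mF.
apply: eq_bigr => j _; rewrite mxE; congr (_ * F x _).
by rewrite /Aj -(setrow_mix s') setrowC.
Qed.

Lemma derive_multilinear x v : U x ->
  'D_v (fun y => F y (B y) : R^o) x =
  'D_v (fun y => F y (B x) : R^o) x + \sum_a F x (setrow a (drow v x a) (B x)).
Proof.
move=> Ux; transitivity ('D_v (fun y => F y (mix k (B y) 0) : R^o) x).
  by apply: (@eq_derive R _ R^o U) => // y _; rewrite mix_full.
rewrite derive_mix// mix_full; congr (_ + _).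
by apply: eq_bigl => a; rewrite ltn_ord.
Qed.

End MultilinearDerivative.

(** The rows of v are extended to constant vector fields, so the formula for d has no bracket
    terms. *)
Definition dE {n k} (eta : 'rV[R]_n -> 'M[R]_(k, n) -> R) (x : 'rV[R]_n) (v : 'M[R]_(k.+1, n)) : R :=
  \sum_(i < k.+1) (-1) ^+ i * 'D_(row i v) (fun y => eta y (row' i v) : R^o) x.

Section EuclideanForms.
Context {n m : nat}.

Definition Dmx {k} (h : 'rV[R]_n -> 'rV[R]_m) (x : 'rV[R]_n) (v : 'M[R]_(k, n)) : 'M[R]_(k, m) :=
  \matrix_(i < k) 'D_(row i v) h x.

Definition epull {k} (h : 'rV[R]_n -> 'rV[R]_m) (eta : 'rV[R]_m -> 'M[R]_(k, m) -> R)
    (x : 'rV[R]_n) (v : 'M[R]_(k, n)) : R := eta (h x) (Dmx h x v).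

Definition is_eform {l k} (U : set 'rV[R]_l) (eta : 'rV[R]_l -> 'M[R]_(k, l) -> R) :=
  (forall x, U x -> alternating (eta x)) /\
  (forall v, smooth_on U (eta ^~ v : _ -> R^o)).

Lemma row_Dmx k h x (v : 'M[R]_(k, n)) i : row i (Dmx h x v) = 'D_(row i v) h x.
Proof. by rewrite rowK. Qed.

Lemma row'_Dmx k h x (v : 'M[R]_(k.+1, n)) i : row' i (Dmx h x v) = Dmx h x (row' i v).
Proof.
apply/row_matrixP => a; rewrite row_Dmx; apply/rowP => b; rewrite !mxE.
have -> // : row (lift i a) v = row a (row' i v) by apply/rowP => c; rewrite !mxE.
Qed.

Lemma Dmx_jacobian k h x (v : 'M[R]_(k, n)) : differentiable h x -> Dmx h x v = v *m jacobian h x.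
Proof.
by move=> dh; apply/row_matrixP => i; rewrite row_Dmx deriveEjacobian// row_mul.
Qed.

Lemma alternating_mulmx k l (f : 'M[R]_(k, m) -> R) (J : 'M[R]_(l, m)) :
  alternating f -> alternating (fun v : 'M[R]_(k, l) => f (v *m J)).
Proof.
move=> [f1 f2]; split=> [i A B C b c E1 E2 E3|i j A ij E].
  have r' (D : 'M[R]_(k, l)) : row' i (D *m J) = row' i D *m J.
    apply/row_matrixP => a; rewrite row_mul; apply/rowP => q; rewrite !mxE.
    by apply: eq_bigr => z _; rewrite !mxE.
  apply: (f1 i); first by rewrite !row_mul E1 mulmxDl !scalemxAl.
    by rewrite !r' E2.
  by rewrite !r' E3.
by apply: (f2 i j _ ij); rewrite !row_mul E.
Qed.

Section Naturality.
Context (U : set 'rV[R]_n) (U' : set 'rV[R]_m) (h : 'rV[R]_n -> 'rV[R]_m) (k : nat).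
Context (eta : 'rV[R]_m -> 'M[R]_(k, m) -> R).
Hypotheses (oU : open U) (oU' : open U') (sh : smooth_on U h).
Hypotheses (hU : forall x, U x -> U' (h x)) (feta : is_eform U' eta).

Lemma smooth_Dmx (v : 'M[R]_(k, n)) a b : smooth_on U (fun y => Dmx h y v a b : R^o).
Proof.
apply: (@eq_smooth _ _ _ U (fun y => ('D_(row a v) h y) 0 b : R^o)) => //.
  by move=> y _; rewrite mxE.
exact: ((smooth_rVP _ oU).1 (smooth_derive _ sh) b).
Qed.

Lemma epull_eform : is_eform U (epull h eta).
Proof.
split=> [x Ux|v].
  have -> : epull h eta x = fun v => eta (h x) (v *m jacobian h x).
    by apply/funext => v; rewrite /epull Dmx_jacobian//; exact: smooth_differentiableV sh.
  by apply: alternating_mulmx; apply: feta.1; exact: hU.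
apply: (@smooth_multilinear _ _ _ U (fun y => eta (h y)) (fun y => Dmx h y v)) => //.
- by move=> y Uy; apply: alt_multilinear; apply: feta.1; exact: hU.
- by move=> A; exact: (smooth_comp oU oU' sh hU (feta.2 A)).
- exact: smooth_Dmx.
Qed.

Lemma derive2C x v w : U x -> 'D_w ('D_v h) x = 'D_v ('D_w h) x.
Proof.
move=> Ux; apply/rowP => b.
have shb : smooth_on U (fun y => h y 0 b : R^o) by exact: ((smooth_rVP _ oU).1 sh b).
have E u u' : ('D_u' ('D_u h) x) 0 b = 'D_u' ('D_u (fun y => h y 0 b : R^o)) x.
  rewrite derive_rV; last exact: smooth_derivable (smooth_derive u sh) Ux.
  apply: (@eq_derive R _ R^o U) => // y Uy.
  by rewrite derive_rV//; exact: smooth_derivable sh Uy.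
exact: (etrans (E v w) (etrans (schwarz oU shb v w Ux) (esym (E w v)))).
Qed.

Lemma dE_epull x v : U x -> dE (epull h eta) x v = dE eta (h x) (Dmx h x v).
Proof.
move=> Ux.
pose H i j := 'D_(row i v) ('D_(row j v) h) x.
have HC i j : H i j = H j i by exact: derive2C.
(* The zero added here is the alternating sum of the second-derivative terms that the product rule
   produces on the left. *)
rewrite -[RHS]addr0 -(alt_symmetric_sum (Dmx h x v) (feta.1 (h x) (hU Ux)) HC).
rewrite /dE -big_split /=; apply: eq_bigr => i _; rewrite -mulrDr; congr (_ * _).
rewrite row'_Dmx row_Dmx /epull.
rewrite (@derive_multilinear _ _ _ U (fun y => eta (h y)) (fun y => Dmx h y (row' i v))) //.
- congr (_ + _).
    by have [_] := chain_derivable oU oU' sh hU (row i v) (feta.2 (Dmx h x (row' i v))) Ux.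
  apply: eq_bigr => a _; congr (eta _ (setrow _ _ _)).
  apply/rowP => b; rewrite mxE /H derive_rV; last exact: smooth_derivable (smooth_derive _ sh) Ux.
  have -> // : (fun y => Dmx h y (row' i v) a b : R^o) = (fun y => ('D_(row (lift i a) v) h y) 0 b : R^o).
  apply/funext => y; rewrite mxE.
  by have -> // : row a (row' i v) = row (lift i a) v by apply/rowP => c; rewrite !mxE.
- by move=> y Uy; apply: alt_multilinear; apply: feta.1; exact: hU.
- by move=> A; exact: (smooth_comp oU oU' sh hU (feta.2 A)).
- exact: smooth_Dmx.
Qed.

End Naturality.
End EuclideanForms.
End AlternatingForms.

(** * Stokes' theorem on the simplex *)

Section IntegralsOnSegments.
Context {R : realType}.
Local Notation mu := (@lebesgue_measure R).

Definition Jint (b : R) (f : R -> R) : R := (\int[mu]_(t in `]0, b[) f t)%R.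

Section ContinuousFunctions.
Context {T : topologicalType}.
Implicit Types f g : T -> R^o.

Lemma cfunD f g : continuous f -> continuous g -> continuous (fun t => f t + g t : R^o).
Proof. by move=> cf cg t; exact: (continuousD (cf t) (cg t)). Qed.

Lemma cfunB f g : continuous f -> continuous g -> continuous (fun t => f t - g t : R^o).
Proof. by move=> cf cg t; exact: (continuousB (cf t) (cg t)). Qed.

Lemma cfunM f g : continuous f -> continuous g -> continuous (fun t => f t * g t : R^o).
Proof. by move=> cf cg t; exact: (continuousM (cf t) (cg t)). Qed.

Lemma cfunC (c : R) : continuous (fun _ : T => c : R^o).
Proof. by move=> t; exact: cst_continuous. Qed.

End ContinuousFunctions.

(** Only x is confined to K; y may leave K, because f is continuous at the points of K as a function
    on the whole space. *)
Lemma Heine (T : pseudoMetricType R) (K : set T) (f : T -> R^o) : compact K ->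
  (forall x, K x -> {for x, continuous f}) -> forall e, 0 < e ->
  exists2 d, 0 < d & forall x y, K x -> ball x d y -> `|f x - f y| <= e.
Proof.
move=> /compact_near_coveringP/near_covering_withinP cK cf e e0.
have e2 : 0 < e / 2 by rewrite divr_gt0.
have : \forall d \near (0 : R)^'+, K `<=` (fun x => forall y, ball x d y -> `|f x - f y| <= e).
  apply: (cK R (0^'+) (fun d x => forall y, ball x d y -> `|f x - f y| <= e)) => x Kx.
  have /cvgrPdist_le/(_ _ e2)/nbhs_ballP[r /= r0 fr] := cf x Kx.
  have r2 : 0 < r / 2 by rewrite divr_gt0.
  exists (ball x (r / 2), [set d | d <= r / 2]) => /=.
    by split; [exact: nbhsx_ballx|exact: nbhs_right_le].
  move=> [x' d] /= [xx' dr] _ y x'y.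
  have xy : ball x r y.
    by rewrite (splitr r); apply: ball_triangle xx' _; exact: le_ball x'y.
  have xx : ball x r x' by apply: le_ball xx'; rewrite ler_pdivrMr// ler_peMr ?ler1n// ltW.
  rewrite -(subrKA (f x)) (splitr e); apply: (le_trans (ler_normD _ _)); apply: lerD.
    by rewrite distrC; exact: fr.
  exact: fr.
move=> H; have [d [d0 Hd]] : exists d : R, 0 < d /\ K `<=` (fun x => forall y, ball x d y -> `|f x - f y| <= e).
  by near (0:R)^'+ => d; exists d; split; [near: d; exact: nbhs_right_gt|near: d].
by exists d => // x y Kx; exact: Hd.
Unshelve. all: by end_near. Qed.

Lemma continuous_bounded (f : R -> R^o) (b : R) : continuous f ->
  exists2 C, 0 <= C & forall t, 0 <= t <= b -> `|f t| <= C.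
Proof.
move=> cf; have [b0|b0] := leP 0 b; last first.
  by exists 0 => // t /andP[t0 tb]; have := lt_le_trans b0 (le_trans t0 tb); rewrite ltxx.
have [|c _ Hc] := @EVT_max R (fun t => `|f t|) 0 b b0.
  by apply: continuous_subspaceT => x; apply: continuous_comp; [exact: cf|exact: norm_continuous].
by exists `|f c| => // t t01; apply: Hc; rewrite in_itv.
Qed.

Section Segment.
Implicit Types f g F : R -> R^o.

Lemma continuous_integrable f a b : continuous f -> mu.-integrable `[a, b] (EFin \o f).
Proof.
move=> cf; apply: continuous_compact_integrable; first exact: segment_compact.
exact: continuous_subspaceT.
Qed.

Lemma continuous_integrable_oo f a b : continuous f -> mu.-integrable `]a, b[ (EFin \o f).
Proof.
move=> cf; apply: integrableS (continuous_integrable a b cf) => //.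
exact: subset_itv_oo_cc.
Qed.

Lemma Jint_le0 b (f : R -> R) : b <= 0 -> Jint b f = 0.
Proof. by move=> b0; rewrite /Jint set_itv_ge ?Rintegral_set0// bnd_simp -leNgt. Qed.

Lemma eq_Jint b (f g : R -> R) : (forall t, 0 < t < b -> f t = g t) -> Jint b f = Jint b g.
Proof. by move=> fg; apply: eq_Rintegral => t; rewrite inE/= in_itv/= => /fg. Qed.

Lemma JintD b f g : continuous f -> continuous g ->
  Jint b (fun t => f t + g t) = Jint b f + Jint b g.
Proof. by move=> cf cg; apply: RintegralD => //; exact: continuous_integrable_oo. Qed.

Lemma JintZ b c f : continuous f -> Jint b (fun t => c * f t) = c * Jint b f.
Proof. by move=> cf; apply: RintegralZl => //; exact: continuous_integrable_oo. Qed.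

Lemma JintB b f g : continuous f -> continuous g ->
  Jint b (fun t => f t - g t) = Jint b f - Jint b g.
Proof. by move=> cf cg; apply: RintegralB => //; exact: continuous_integrable_oo. Qed.

Lemma antiderivative f (B : R) : continuous f -> exists F : R -> R^o,
  (forall x : R, -1 < x < B -> is_derive x 1 F (f x)) /\
  (forall b : R, 0 <= b < B -> Jint b f = F b - F 0).
Proof.
(* Integration starts at -1 so that the derivative also exists at 0, where [Jint] starts. *)
move=> cf; exists (fun x => (\int[mu]_(t in `[(-1)%R, x]) f t)%R); split.
  move=> x /andP[x1 xB].
  have [dF EF] := @continuous_FTC1_closed R f (-1) x B xB (continuous_integrable _ _ cf) x1 (cf x).
  by apply: DeriveDef; [exact: dF|rewrite -derive1E; exact: EF].
move=> b /andP[b0 bB].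
rewrite (@Rintegral_itvB _ f (BLeft (-1)) (BRight b) 0) ?bnd_simp//; last first.
  by exact: continuous_integrable.
rewrite /Jint -Rintegral_itv_bndo_bndc//; last first.
  apply: integrableS (continuous_integrable 0 b cf) => //.
  exact: subset_itv_oo_cc.
Qed.

Lemma Jint_mean f (b b' : R) : continuous f -> 0 <= b <= b' ->
  exists2 x, b <= x <= b' & Jint b' f - Jint b f = f x * (b' - b).
Proof.
move=> cf /andP[b0 bb']; have [F [dF EF]] := antiderivative (b' + 1) cf.
have dF' x : b <= x <= b' -> is_derive x 1 F (f x).
  by move=> /andP[bx xb]; apply: dF; apply/andP; split; lra.
have cF : {within `[b, b'], continuous F}.
  by apply: derivable_within_continuous => x; rewrite in_itv/= => /dF'[].
have dFo x : x \in `]b, b'[ -> is_derive x 1 F (f x).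
  by rewrite in_itv/= => /andP[bx xb]; apply: dF'; rewrite !ltW.
have [c] := @MVT_segment R F f b b' bb' dFo cF.
rewrite in_itv/= => cb E; exists c => //.
rewrite !EF; [|apply/andP; split; lra..].
by rewrite -E; ring.
Qed.

Lemma Jint0 f : Jint 0 f = 0.
Proof. exact: Jint_le0. Qed.

(** [Jint b] vanishes for b <= 0, so the estimate persists when an endpoint lies to the left of
    0. *)
Lemma Jint_lip f B C (b b' : R) : continuous f -> 0 <= C ->
  (forall t, 0 <= t <= B -> `|f t| <= C) ->
  b <= B -> b' <= B -> `|Jint b' f - Jint b f| <= C * `|b' - b|.
Proof.
move=> cf C0 fC.
wlog bb' : b b' / b <= b' => [H bB b'B|bB b'B].
  by have [|/ltW] := leP b b' => h; [exact: H|rewrite distrC [in leRHS]distrC; exact: H].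
have [b'0|b'0] := leP b' 0.
  by rewrite !Jint_le0 ?subrr ?normr0 ?mulr_ge0// (le_trans bb').
have [b0|b0] := leP b 0.
  rewrite (Jint_le0 _ b0) subr0.
  have [|x /andP[x0 xb]] := @Jint_mean f 0 b' cf; first by rewrite lexx ltW.
  rewrite Jint0 !subr0 => ->; rewrite normrM ler_pM// ?fC ?x0 ?(le_trans xb)//.
  by rewrite !ger0_norm ?(ltW b'0)//; lra.
have [|x /andP[x0 xb] ->] := @Jint_mean f b b' cf; first by rewrite bb' ltW.
by rewrite normrM ler_wpM2r// fC// (le_trans (ltW b0) x0) (le_trans xb).
Qed.

Lemma Jint_bound f C (b : R) : continuous f -> 0 <= C -> 0 <= b ->
  (forall t, 0 <= t <= b -> `|f t| <= C) -> `|Jint b f| <= C * b.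
Proof.
move=> cf C0 b0 fC; have := Jint_lip cf C0 fC b0 (lexx b).
by rewrite Jint0 !subr0 (ger0_norm b0).
Qed.

Lemma Jint_FTC F f (b : R) : continuous f -> {within `[0, b], continuous F} -> 0 <= b ->
  (forall x : R, 0 < x < b -> is_derive x 1 F (f x)) -> Jint b f = F b - F 0.
Proof.
move=> cf cF b0 dF; have [G [dG EG]] := antiderivative (b + 1) cf.
rewrite EG; last by rewrite b0 ltrDl ltr01.
have dG' x : 0 <= x <= b -> is_derive x 1 G (f x).
  by move=> /andP[x0 xb]; apply: dG; apply/andP; split; lra.
have cG : {within `[0, b], continuous G}.
  by apply: derivable_within_continuous => x; rewrite in_itv/= => /dG'[].
have dGF x : x \in `]0, b[ -> is_derive x 1 (fun x => G x - F x) 0.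
  rewrite in_itv/= => /andP[x0 xb].
  have [dGx EGx] := dG' x (introT andP (conj (ltW x0) (ltW xb))).
  have [dFx EFx] := dF x (introT andP (conj x0 xb)).
  apply: DeriveDef; first exact: (derivableB dGx dFx).
  by rewrite (@deriveB _ _ _ G F x 1 dGx dFx) EGx EFx subrr.
have [|c _] := @MVT_segment R (fun x => G x - F x) (fun=> 0) 0 b b0 dGF.
  by move=> x; apply: continuousB; [exact: cG|exact: cF].
by rewrite mul0r => /eqP; rewrite subr_eq0 => /eqP E; lra.
Qed.

Lemma Jint_reflect f (b : R) : continuous f -> Jint b (fun t => f (b - t)) = Jint b f.
Proof.
move=> cf; have [b0|/ltW b0] := leP b 0; first by rewrite !Jint_le0.
have [F [dF EF]] := antiderivative (b + 1) cf.
have cfb : continuous (fun t : R => f (b - t)).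
  move=> t; apply: (@continuous_comp _ _ _ (fun t : R => b - t) f); last exact: cf.
  by apply: (@continuousB _ R^o); [exact: cst_continuous|exact: cvg_id].
have dG (x : R) : 0 <= x <= b -> is_derive x 1 (fun t : R => - F (b + t *: (-1))) (f (b - x)).
  move=> /andP[x0 xb].
  have [dFx EFx] : is_derive (b + x *: (-1)) 1 F (f (b + x *: (-1))).
    by rewrite scale_regE mulrN1; apply: dF; apply/andP; split; lra.
  have [d1 E1] := is_derive_scale (-1) dFx.
  have d2 : derivable F (b + x *: (-1)) (-1) by move: d1; rewrite scaleN1r.
  have [d3 E3] := is_derive_line d2.
  apply: DeriveDef; first exact: (derivableN d3).
  rewrite (deriveN d3) E3; move: E1; rewrite scaleN1r => ->.
  by rewrite EFx scaleN1r opprK scale_regE mulrN1.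
have cG : {within `[0, b], continuous (fun t : R => - F (b + t *: (-1)))}.
  by apply: derivable_within_continuous => x; rewrite in_itv/= => /dG[].
have dGo (x : R) : 0 < x < b -> is_derive x 1 (fun t : R => - F (b + t *: (-1))) (f (b - x)).
  by move=> /andP[x0 xb]; apply: dG; rewrite !ltW.
rewrite (Jint_FTC cfb cG b0 dGo) EF ?b0 ?ltrDl ?ltr01//.
by rewrite !scale_regE mul0r addr0 mulrN1 subrr opprK addrC.
Qed.

End Segment.

Lemma continuous_pair (T X Y : topologicalType) (f : T -> X) (g : T -> Y) t :
  {for t, continuous f} -> {for t, continuous g} -> {for t, continuous (fun t => (f t, g t))}.
Proof. by move=> cf cg; apply: cvg_pair; [exact: cf|exact: cg]. Qed.

(** The increments over N equal steps add up to at most e * B / (B + 1). The hypothesis is a zero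
    derivative in uniform incremental form, which is what the comparison of two iterated integrals
    provides. *)
Lemma flat_constant (K : R -> R) (B : R) : 0 <= B ->
  (forall e, 0 < e -> exists2 d, 0 < d &
    forall b b', 0 <= b -> b <= b' -> b' <= B -> b' - b < d -> `|K b' - K b| <= e * (b' - b)) ->
  K B = K 0.
Proof.
move=> B0 H; apply/eqP; rewrite -subr_eq0 -normr_le0; apply/ler_addgt0Pl => e e0; rewrite addr0.
have B1 : 0 < B + 1 by rewrite ltr_wpDl.
have e1 : 0 < e / (B + 1) by rewrite divr_gt0.
have [d d0 Hd] := H _ e1.
pose N := (Num.bound (B / d)).+1.
have N0 : (0 : R) < N%:R by rewrite ltr0n.
have BN : B / N%:R < d.
  rewrite ltr_pdivrMr// mulrC -ltr_pdivrMr//.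
  have := archi_boundP (divr_ge0 B0 (ltW d0)); move=> /lt_le_trans; apply.
  by rewrite ler_nat.
pose p (i : nat) := i%:R * (B / N%:R).
have p0 : p 0%N = 0 by rewrite /p mul0r.
have pN : p N = B by rewrite /p mulrCA divff ?mulr1// gt_eqF.
have pS i : p i.+1 - p i = B / N%:R by rewrite /p -mulrBl -natrB// subSnn mul1r.
have -> : K B - K 0 = \sum_(i < N) (K (p i.+1) - K (p i)).
  by rewrite -(big_mkord predT (fun i => K (p i.+1) - K (p i))) (telescope_sumr (fun i => K (p i)))// pN p0.
apply: (le_trans (ler_norm_sum _ _ _)).
apply: (@le_trans _ _ (\sum_(i < N) (e / (B + 1) * (B / N%:R)))).
  apply: ler_sum => i _; rewrite -(pS i); apply: Hd.
  - by rewrite /p mulr_ge0// divr_ge0// ltW.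
  - by rewrite -subr_ge0 pS divr_ge0// ltW.
  - rewrite -[leRHS]pN /p ler_wpM2r ?divr_ge0// ?ler_nat//; exact: ltn_ord.
  - by rewrite pS.
rewrite sumr_const card_ord -[_ *+ N]mulr_natr -mulrA divfK ?gt_eqF//.
by rewrite mulrAC ler_pdivrMr// ler_wpM2l ?(ltW e0)// lerDl.
Qed.

Section ParameterDependence.
Context {Z : topologicalType}.

Lemma continuous_section (f : Z -> R -> R^o) z : continuous (fun p : Z * R => f p.1 p.2 : R^o) ->
  continuous (f z).
Proof.
move=> cf t; apply: (@continuous_comp _ _ _ (fun t : R => (z, t)) (fun p => f p.1 p.2)); last exact: cf.
by apply: continuous_pair; [exact: cst_continuous|exact: cvg_id].
Qed.

(** Compactness of the segment [0, B] makes f z uniformly close to f z0 on it for z near z0;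
    [Jint_lip] handles the moving endpoint. *)
Lemma Jint_continuous (f : Z -> R -> R^o) : continuous (fun p : Z * R => f p.1 p.2 : R^o) ->
  continuous (fun p : Z * R => Jint p.2 (f p.1) : R^o).
Proof.
move=> cf [z0 b0] /=; apply/cvgrPdist_le => e e0 /=.
pose B := `|b0| + 1; have B0 : 0 < B by rewrite ltr_wpDl.
have cfz z : continuous (f z) by exact: continuous_section.
have [C C0 HC] := continuous_bounded B (cfz z0).
pose e1 := e / 2 / B; have e10 : 0 < e1 by rewrite !divr_gt0.
pose e2 := e / 2 / (C + 1); have C1 : 0 < C + 1 by rewrite ltr_wpDl.
have e20 : 0 < e2 by rewrite !divr_gt0.
have N1 : \forall z \near z0, `[0, B] `<=` (fun t => `|f z0 t - f z t| <= e1).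
  have /compact_near_coveringP := @segment_compact R 0 B.
  move=> /(_ Z (nbhs z0) (fun z t => `|f z0 t - f z t| <= e1)); apply => t _.
  have e12 : 0 < e1 / 2 by rewrite divr_gt0.
  have /cvgrPdist_le /(_ _ e12) H := cf (z0, t).
  have [[P Q] /= [Pz Qt] PQ] := H.
  exists (Q, P) => // -[t' z] /= [Qt' Pz'].
  have h1 := PQ (z, t') (conj Pz' Qt'); have h2 := PQ (z0, t') (conj (nbhs_singleton Pz) Qt').
  rewrite -(subrKA (f z0 t)) (splitr e1); apply: (le_trans (ler_normD _ _)).
  by apply: lerD => //; rewrite distrC.
have N2 : \forall b \near b0, `|b0 - b| <= e2 /\ b <= B.
  have r0 : 0 < Num.min e2 1 by rewrite lt_min e20 ltr01.
  apply/nbhs_ballP; exists (Num.min e2 1) => //= b; rewrite /ball /= => bb.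
  split; first by rewrite (le_trans (ltW bb))// ge_min lexx.
  have : `|b0 - b| < 1 by rewrite (lt_le_trans bb)// ge_min lexx orbT.
  by rewrite ltr_norml /B; have := ler_norm b0; lra.
exists (fun z => `[0, B] `<=` (fun t => `|f z0 t - f z t| <= e1), fun b => `|b0 - b| <= e2 /\ b <= B) => [|[z b] /= [Hz [Hb1 Hb2]]]; first by split; [exact: N1|exact: N2].
have b0B : b0 <= B by rewrite /B (le_trans (ler_norm _))// lerDl.
rewrite -(subrKA (Jint b (f z0))) (splitr e); apply: (le_trans (ler_normD _ _)); apply: lerD.
  apply: (le_trans (Jint_lip (cfz z0) C0 HC Hb2 b0B)).
  apply: (@le_trans _ _ ((C + 1) * e2)); last by rewrite /e2 mulrC divfK// gt_eqF.
  by apply: ler_pM => //; rewrite lerDl.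
have [bn|bp] := leP b 0; first by rewrite !Jint_le0// subrr normr0 divr_ge0// ltW.
rewrite -JintB; [|exact: cfz..].
apply: (@le_trans _ _ (e1 * b)); last first.
  apply: (@le_trans _ _ (e1 * B)); first by rewrite ler_wpM2l// ltW.
  by rewrite /e1 divfK// gt_eqF.
apply: Jint_bound; rewrite ?ltW//.
  by move=> t; apply: continuousB; exact: cfz.
by move=> t /andP[t0 tb]; apply: Hz => /=; rewrite in_itv/= t0 (le_trans tb).
Qed.

End ParameterDependence.

Lemma ball_between (x y lo hi d : R) : lo <= x -> x <= hi -> lo <= y -> y <= hi -> hi - lo < d ->
  ball x d y.
Proof. by move=> *; rewrite /ball /= ltr_norml; apply/andP; split; lra. Qed.

Lemma three_thirds (e h : R) : e / 3 * h + e / 3 * h + e / 3 * h = e * h.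
Proof. by field. Qed.

Lemma increment_split (G' G J' J P' D p h y g : R) : G' - P' = p * h -> J' - J = y * h ->
  D = P' - G - h * g -> G' - J' - (G - J) = p * h + D - (y - g) * h.
Proof. by move=> <- E ->; rewrite mulrBl -E; ring. Qed.

Section Triangle.
Variable Psi : R -> R -> R^o.
Hypothesis cPsi : continuous (fun p : R * R => Psi p.1 p.2 : R^o).

(** Fubini on the triangle in the coordinates t and s = t + u. Both sides vanish at B = 0, and when
    b grows to b' their increments differ by at most e * (b' - b), uniformly in b; [flat_constant]
    concludes. *)
Lemma triangle_diagonal (B : R) : 0 <= B ->
  Jint B (fun t => Jint (B - t) (Psi t)) = Jint B (fun s => Jint s (fun t => Psi t (s - t))).
Proof.
move=> B0.
pose P c t := Jint c (Psi t); pose g s := Jint s (fun t => Psi t (s - t)).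
have csub (b : R) : continuous (fun t : R => b - t).
  by move=> t; apply: (@continuousB _ R^o); [exact: cst_continuous|exact: cvg_id].
have cPsi1 t : continuous (Psi t) by exact: continuous_section.
have cP2 : continuous (fun p : R * R => P p.2 p.1 : R^o) by exact: Jint_continuous.
have cP b : continuous (fun t => P (b - t) t : R^o).
  move=> t; apply: (@continuous_comp _ _ _ (fun t : R => (t, b - t)) (fun p => P p.2 p.1 : R^o)).
    by apply: continuous_pair; [exact: cvg_id|exact: csub].
  exact: cP2.
have cg2 : continuous (fun p : R * R => Psi p.2 (p.1 - p.2) : R^o).
  move=> p; apply: (@continuous_comp _ _ _ (fun p : R * R => (p.2, p.1 - p.2)) (fun p => Psi p.1 p.2)).
    apply: continuous_pair; first exact: cvg_snd.
    by apply: (@continuousB _ R^o); [exact: cvg_fst|exact: cvg_snd].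
  exact: cPsi.
have cPd b : continuous (fun t => Psi t (b - t)).
  by apply: (@continuous_section R (fun s t => Psi t (s - t)) b).
have cg : continuous (g : R -> R^o).
  move=> s; apply: (@continuous_comp _ _ _ (fun s : R => (s, s))
    (fun p : R * R => Jint p.2 (fun t => Psi t (p.1 - t)) : R^o)).
    by apply: continuous_pair; exact: cvg_id.
  exact: (@Jint_continuous R (fun s t => Psi t (s - t))).
pose G b := Jint b (fun t => P (b - t) t).
suff : G B - Jint B g = G 0 - Jint 0 g.
  by rewrite /G !Jint0 subr0 => /eqP; rewrite subr_eq0 => /eqP.
apply: (@flat_constant (fun b => G b - Jint b g) B B0) => e e0.
have cK2 : compact (`[0, B] `*` `[0, B]) by apply: compact_setX; exact: segment_compact.
have e3 : 0 < e / 3 by rewrite divr_gt0.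
have B1 : 0 < B + 1 by rewrite ltr_wpDl.
have e1 : 0 < e / 3 / (B + 1) by rewrite !divr_gt0.
have cPsiK p : (`[0, B] `*` `[0, B]) p -> {for p, continuous (fun p : R * R => Psi p.1 p.2 : R^o)}.
  by move=> _; exact: cPsi.
have cPK p : (`[0, B] `*` `[0, B]) p -> {for p, continuous (fun p : R * R => P p.2 p.1 : R^o)}.
  by move=> _; exact: cP2.
have cgK s : [set` `[0, B]] s -> {for s, continuous (g : R -> R^o)} by move=> _; exact: cg.
have [d1 d10 H1] := @Heine (R * R)%type _ (fun p => Psi p.1 p.2) cK2 cPsiK _ e1.
have [d2 d20 H2] := @Heine R _ g (@segment_compact R 0 B) cgK _ e3.
have [d3 d30 H3] := @Heine (R * R)%type _ (fun p => P p.2 p.1) cK2 cPK _ e3.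
exists (Num.min d1 (Num.min d2 d3)); first by rewrite !lt_min d10 d20 d30.
move=> b b' b0 bb' b'B; rewrite !lt_min => /and3P[bd1 bd2 bd3].
have b'0 : 0 <= b' by exact: le_trans bb'.
have bB : b <= B by exact: le_trans b'B.
have [x /andP[bx xb] E1] := @Jint_mean (fun t => P (b' - t) t) b b' (cP b') (introT andP (conj b0 bb')).
have [y /andP[by_ yb] E2] := @Jint_mean g b b' cg (introT andP (conj b0 bb')).
(* The increment of G consists of the new strip over [b, b'] and of the widening of the inner
   intervals. D is the error of replacing that widening by its first-order value on the diagonal,
   whose integral is (b' - b) * g b. *)
pose D t : R^o := (P (b' - t) t - P (b - t) t) - (b' - b) * Psi t (b - t).
have cD : continuous D.
  by apply: cfunB; [apply: cfunB; exact: cP|apply: cfunM; [exact: cfunC|exact: cPd]].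
have ED : Jint b D = Jint b (fun t => P (b' - t) t) - Jint b (fun t => P (b - t) t) - (b' - b) * g b.
  rewrite /D JintB ?JintB ?JintZ//.
  - by apply: cfunB; exact: cP.
  - by apply: cfunM; [exact: cfunC|exact: cPd].
have -> : G b' - Jint b' g - (G b - Jint b g) =
    P (b' - x) x * (b' - b) + Jint b D - (g y - g b) * (b' - b).
  exact: increment_split E1 E2 ED.
have hb : 0 <= b' - b by rewrite subr_ge0.
apply: (@le_trans _ _ ((e / 3) * (b' - b) + (e / 3) * (b' - b) + (e / 3) * (b' - b))); last first.
  by rewrite three_thirds.
apply: (le_trans (ler_normB _ _)); apply: lerD; last first.
  rewrite normrM (ger0_norm hb) ler_wpM2r// distrC; apply: H2.
    by rewrite /= in_itv/= b0.
  exact: ball_between (lexx b) bb' by_ yb bd2.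
apply: (le_trans (ler_normD _ _)); apply: lerD.
  rewrite normrM (ger0_norm hb) ler_wpM2r//.
  have := H3 (x, 0) (x, b' - x); rewrite /P /= Jint0 sub0r normrN; apply.
    by split; rewrite /= in_itv/= ?lexx ?B0//; apply/andP; split; [exact: le_trans bx|exact: le_trans b'B].
  split; first exact: ballxx.
  by apply: (@ball_between _ _ 0 (b' - b)) => //; rewrite ?subr_ge0 ?lerD2l ?lerN2 ?subr0.
have bd10 : 0 <= e / 3 / (B + 1) by exact: ltW.
apply: (@le_trans _ _ (e / 3 / (B + 1) * (b' - b) * b)).
  apply: Jint_bound => //; first by rewrite mulr_ge0.
  move=> t /andP[t0 tb].
  have h1 : 0 <= b - t by rewrite subr_ge0.
  have h2 : b - t <= b' - t by rewrite lerD2r.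
  have [z /andP[bz zb] E3] := @Jint_mean (Psi t) (b - t) (b' - t) (cPsi1 t) (introT andP (conj h1 h2)).
  rewrite /D /P E3 [b' - t - _](_ : _ = b' - b); last by rewrite opprB addrA subrK.
  rewrite [_ * Psi _ _]mulrC -mulrBl normrM (ger0_norm hb) ler_wpM2r//.
  rewrite distrC; apply: (H1 (t, b - t) (t, z)).
    split; rewrite /= in_itv/=; apply/andP; split=> //; first exact: le_trans bB.
    by rewrite lerBlDr (le_trans bB)// lerDl.
  split; first exact: ballxx.
  apply: (@ball_between _ _ (b - t) (b' - t)) => //.
  by rewrite opprB addrA subrK.
rewrite mulrAC ler_wpM2r// mulrAC ler_pdivrMr// ler_wpM2l ?(ltW e3)//.
by rewrite (le_trans bB)// lerDl.
Qed.

End Triangle.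

(** On each line t + u = s the reflection of t into s - t exchanges the two variables. *)
Lemma triangle_swap (Psi : R -> R -> R^o) (B : R) :
  continuous (fun p : R * R => Psi p.1 p.2 : R^o) ->
  Jint B (fun t => Jint (B - t) (Psi t)) = Jint B (fun u => Jint (B - u) (Psi ^~ u)).
Proof.
move=> cPsi; have [B0|/ltW B0] := leP B 0; first by rewrite !Jint_le0.
have cPsi' : continuous (fun p : R * R => Psi p.2 p.1 : R^o).
  move=> p; apply: (@continuous_comp _ _ _ (fun p : R * R => (p.2, p.1)) (fun p => Psi p.1 p.2)).
    by apply: continuous_pair; [exact: cvg_snd|exact: cvg_fst].
  exact: cPsi.
rewrite (triangle_diagonal cPsi B0) (@triangle_diagonal (fun u t => Psi t u) cPsi' B B0).
apply: eq_Jint => s _; rewrite -(@Jint_reflect (fun t => Psi t (s - t))).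
  by apply: eq_Jint => t _; rewrite subKr.
move=> t; apply: (@continuous_comp _ _ _ (fun t : R => (t, s - t)) (fun p => Psi p.1 p.2)).
  apply: continuous_pair; first exact: cvg_id.
  by apply: (@continuousB _ R^o); [exact: cst_continuous|exact: cvg_id].
exact: cPsi.
Qed.
End IntegralsOnSegments.

(** * Iterated integrals over the simplex and the divergence formula *)

Section SimplexIntegrals.
Context {R : realType}.

Definition insv {k} (i : 'I_k.+1) (c : R) (u : 'rV[R]_k) : 'rV[R]_k.+1 :=
  \row_j (if unlift i j is Some j' then u 0 j' else c).

Definition swp {k} (x : 'rV[R]_k.+2) : 'rV[R]_k.+2 :=
  \row_j x 0 (if j == 0 then 1 else if j == 1 then 0 else j).

Lemma simplex_integralS k b (f : 'rV[R]_k.+1 -> R) :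
  simplex_integral b f = Jint b (fun t => simplex_integral (b - t) (fun x => f (row_mx t%:M x))).
Proof. by []. Qed.

Lemma row_mxE0 k (t : R) (x : 'rV[R]_k) : (row_mx t%:M x : 'rV[R]_k.+1) = insv ord0 t x.
Proof.
apply/rowP => j; rewrite !mxE; case: unliftP => [j' ->|->].
  case: splitP => [a Ea|a Ea]; first by have := ltn_ord a; rewrite -Ea.
  by congr (x _ _); apply: val_inj; move: Ea => /= [].
case: splitP => [a _|a Ea]; last by have := congr1 (leq 1) Ea.
by rewrite !ord1 mxE eqxx mulr1n.
Qed.

Lemma insv_lift k (i : 'I_k.+1) c (u : 'rV[R]_k) j : insv i c u 0 (lift i j) = u 0 j.
Proof. by rewrite mxE liftK. Qed.

Lemma insv_at k (i : 'I_k.+1) c (u : 'rV[R]_k) : insv i c u 0 i = c.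
Proof. by rewrite mxE unlift_none. Qed.

Lemma insvP k (i : 'I_k.+1) c (u : 'rV[R]_k) (y : 'rV[R]_k.+1) :
  y 0 i = c -> (forall j, y 0 (lift i j) = u 0 j) -> insv i c u = y.
Proof.
move=> yi yl; apply/rowP => j; case: (unliftP i j) => [j' ->|->].
  by rewrite insv_lift.
by rewrite insv_at.
Qed.

Lemma sum_insv k (i : 'I_k.+1) c (u : 'rV[R]_k) : \sum_j insv i c u 0 j = c + \sum_j u 0 j.
Proof.
rewrite (bigD1_ord i)//= insv_at; congr (_ + _); apply: eq_bigr => j _.
by rewrite insv_lift.
Qed.

Lemma sum_swp k (u : 'rV[R]_k.+2) : \sum_j swp u 0 j = \sum_j u 0 j.
Proof.
rewrite !big_ord_recl !mxE /= !addrA; congr (_ + _).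
  by rewrite addrC; congr (u _ _ + u _ _); apply: val_inj.
by apply: eq_bigr => j _; rewrite mxE.
Qed.

Lemma swp_insv01 k (s t : R) (x : 'rV[R]_k) :
  swp (insv ord0 s (insv ord0 t x)) = insv ord0 t (insv ord0 s x).
Proof.
apply/rowP => j; rewrite [LHS]mxE.
case: (unliftP ord0 j) => [j' ->|->].
  rewrite insv_lift; case: (unliftP ord0 j') => [j'' ->|->].
    by rewrite !insv_lift.
  by rewrite /= !insv_at.
rewrite insv_at /=; have -> : (1 : 'I_k.+2) = lift ord0 ord0 by exact: val_inj.
by rewrite insv_lift insv_at.
Qed.

Lemma insv_max_cons k (c t : R) (u : 'rV[R]_k) :
  insv ord_max c (insv ord0 t u) = insv ord0 t (insv ord_max c u).
Proof.
apply: insvP => [|j].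
  have -> : (ord_max : 'I_k.+2) = lift ord0 ord_max by exact: val_inj.
  by rewrite insv_lift insv_at.
case: (unliftP ord0 j) => [j' ->|->].
  have -> : lift ord_max (lift ord0 j') = lift ord0 (lift ord_max j') :> 'I_k.+2.
    by apply: val_inj; rewrite /= /bump; have := ltn_ord j'; lia.
  by rewrite !insv_lift.
have -> : lift ord_max ord0 = ord0 :> 'I_k.+2 by exact: val_inj.
by rewrite !insv_at.
Qed.

Lemma insv_lift_cons k (i : 'I_k.+1) (c t : R) (u : 'rV[R]_k) :
  insv (lift ord0 i) c (insv ord0 t u) = insv ord0 t (insv i c u).
Proof.
apply: insvP => [|j]; first by rewrite insv_lift insv_at.
case: (unliftP ord0 j) => [j' ->|->].
  have -> : lift (lift ord0 i) (lift ord0 j') = lift ord0 (lift i j') :> 'I_k.+2.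
    by apply: val_inj; rewrite /= /bump; lia.
  by rewrite !insv_lift.
have -> : lift (lift ord0 i) ord0 = ord0 :> 'I_k.+2 by exact: val_inj.
by rewrite !insv_at.
Qed.

Lemma insv_split k (x : 'rV[R]_k.+1) : exists t u, x = insv ord0 t u.
Proof.
by exists (x 0 0), (\row_j x 0 (lift ord0 j)); apply/esym/insvP => // j; rewrite mxE.
Qed.

(** The iterated integrals run over open intervals, so interior points suffice; default values on
    and outside the boundary become harmless here. *)
Lemma eq_simplex_integral k (b : R) (f g : 'rV[R]_k -> R) : 0 < b ->
  (forall x : 'rV[R]_k, (forall i, 0 < x 0 i) -> \sum_i x 0 i < b -> f x = g x) ->
  simplex_integral b f = simplex_integral b g.
Proof.
elim: k b f g => [|k IH] b f g b0 fg.
  by rewrite /=; apply: fg => [[]//|]; rewrite big_ord0.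
rewrite !simplex_integralS; apply: eq_Jint => t /andP[t0 tb].
apply: IH => [|x x0 sx]; first by rewrite subr_gt0.
apply: fg => [i|]; rewrite row_mxE0.
  by case: (unliftP ord0 i) => [j ->|->]; rewrite ?insv_lift ?insv_at.
by rewrite sum_insv addrC -ltrBrDr.
Qed.

Lemma continuous_insv (Z : topologicalType) k i (c : Z -> R^o) (u : Z -> 'rV[R]_k) :
  continuous c -> continuous u -> continuous (fun z => insv i (c z) (u z)).
Proof.
move=> cc cu z; apply/continuous_rVP => j.
case: (unliftP i j) => [j' ->|->].
  rewrite (_ : (fun y => _) = (fun y => u y 0 j')); last by apply/funext => y; rewrite insv_lift.
  by apply: (@continuous_comp _ _ _ u (fun x => x 0 j')); [exact: cu|exact: continuous_coord].
rewrite (_ : (fun y => _) = c); last by apply/funext => y; rewrite insv_at.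
exact: cc.
Qed.

Lemma ccomp (X Y W : topologicalType) (f : Y -> W) (g : X -> Y) :
  continuous f -> continuous g -> continuous (fun x => f (g x)).
Proof. by move=> cf cg x; apply: continuous_comp; [exact: cg|exact: cf]. Qed.

Lemma cpair (X Y W : topologicalType) (f : X -> Y) (g : X -> W) :
  continuous f -> continuous g -> continuous (fun x => (f x, g x)).
Proof. by move=> cf cg x; apply: continuous_pair; [exact: cf|exact: cg]. Qed.

Lemma cfst (X Y : topologicalType) : continuous (fun p : X * Y => p.1).
Proof. by move=> x; exact: cvg_fst. Qed.

Lemma csnd (X Y : topologicalType) : continuous (fun p : X * Y => p.2).
Proof. by move=> x; exact: cvg_snd. Qed.

Lemma cid_ (X : topologicalType) : continuous (fun p : X => p).
Proof. by move=> x; exact: cvg_id. Qed.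

Lemma simplex_integral_continuous k (Z : topologicalType) (f : Z -> 'rV[R]_k -> R^o) :
  continuous (fun p : Z * 'rV[R]_k => f p.1 p.2 : R^o) ->
  continuous (fun p : Z * R => simplex_integral p.2 (f p.1) : R^o).
Proof.
elim: k Z f => [|k IH] Z f cf.
  apply: (@ccomp _ _ _ (fun p => f p.1 p.2 : R^o) (fun p : Z * R => (p.1, 0 : 'rV[R]_0))) => //.
  by apply: cpair; [exact: cfst|move=> x; exact: cst_continuous].
have c11 : continuous (fun p : (Z * R) * R => p.1.1) by apply: (ccomp (@cfst _ _)); exact: cfst.
have c12 : continuous (fun p : (Z * R) * R => p.1.2) by apply: (ccomp (@csnd _ _)); exact: cfst.
have H : continuous (fun p : (Z * R) * R =>
    simplex_integral (p.1.2 - p.2) (fun x => f p.1.1 (row_mx p.2%:M x)) : R^o).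
  apply: (@ccomp _ _ _ (fun p : ((Z * R) * R) * R => simplex_integral p.2 (fun x => f p.1.1.1 (row_mx p.1.2%:M x)) : R^o)
      (fun p : (Z * R) * R => (p, p.1.2 - p.2))); last first.
    by apply: cpair; [exact: cid_|apply: cfunB => //; exact: csnd].
  apply: (IH ((Z * R) * R)%type (fun p x => f p.1.1 (row_mx p.2%:M x))).
  have -> : (fun p : (Z * R * R) * 'rV[R]_k => f p.1.1.1 (row_mx p.1.2%:M p.2) : R^o) =
      (fun p => f p.1.1.1 (insv ord0 p.1.2 p.2)) by apply/funext => p; rewrite row_mxE0.
  apply: (@ccomp _ _ _ (fun p => f p.1 p.2 : R^o) (fun p : (Z * R * R) * 'rV[R]_k => (p.1.1.1, insv ord0 p.1.2 p.2))) => //.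
  apply: cpair; first by apply: (ccomp c11); exact: cfst.
  by apply: continuous_insv; [apply: (ccomp (@csnd _ _)); exact: cfst|exact: csnd].
apply: (@ccomp _ _ _ (fun p : (Z * R) * R => Jint p.2 (fun t => simplex_integral (p.1.2 - t) (fun x => f p.1.1 (row_mx t%:M x))) : R^o)
  (fun p : Z * R => (p, p.2))); last by apply: cpair; [exact: cid_|exact: csnd].
exact: (@Jint_continuous R (Z * R)%type (fun p t => simplex_integral (p.2 - t) (fun x => f p.1 (row_mx t%:M x)))).
Qed.

Section FixedDomain.
Implicit Types b : R.

Lemma continuous_slice k (f : 'rV[R]_k.+1 -> R^o) t : continuous f ->
  continuous (fun x => f (row_mx t%:M x)).
Proof.
move=> cf.
have -> : (fun x : 'rV[R]_k => f (row_mx t%:M x)) = (fun x => f (insv ord0 t x)).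
  by apply/funext => x; rewrite row_mxE0.
apply: (ccomp cf); apply: continuous_insv; [exact: cfunC|exact: cid_].
Qed.

Lemma continuous_inner_integral k b (f : 'rV[R]_k.+1 -> R^o) : continuous f ->
  continuous (fun t => simplex_integral (b - t) (fun x => f (row_mx t%:M x)) : R^o).
Proof.
move=> cf.
apply: (@ccomp _ _ _ (fun p : R * R => simplex_integral p.2 (fun x => f (row_mx p.1%:M x)) : R^o)
  (fun t : R => (t, b - t))); last first.
  by apply: cpair; [exact: cid_|apply: cfunB; [exact: cfunC|exact: cid_]].
apply: (@simplex_integral_continuous k R (fun t x => f (row_mx t%:M x))).
have -> : (fun p : R * 'rV[R]_k => f (row_mx p.1%:M p.2) : R^o) = (fun p => f (insv ord0 p.1 p.2)).
  by apply/funext => p; rewrite row_mxE0.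
by apply: (ccomp cf); apply: continuous_insv; [exact: cfst|exact: csnd].
Qed.

Lemma simplex_integralD k b (f g : 'rV[R]_k -> R^o) : continuous f -> continuous g ->
  simplex_integral b (fun x => f x + g x) = simplex_integral b f + simplex_integral b g.
Proof.
elim: k b f g => [|k IH] b f g cf cg //.
rewrite !simplex_integralS -JintD; [|exact: continuous_inner_integral..].
by apply: eq_Jint => t _; apply: IH; exact: continuous_slice.
Qed.

Lemma simplex_integralZ k b c (f : 'rV[R]_k -> R^o) : continuous f ->
  simplex_integral b (fun x => c * f x) = c * simplex_integral b f.
Proof.
elim: k b f => [|k IH] b f cf //.
rewrite !simplex_integralS -JintZ; last exact: continuous_inner_integral.
by apply: eq_Jint => t _; apply: IH; exact: continuous_slice.
Qed.

Lemma simplex_integral0 k b : simplex_integral b (fun _ : 'rV[R]_k => 0) = 0.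
Proof.
have := @simplex_integralZ k b 0 (fun=> 0) (@cfunC _ _ 0).
by rewrite !mul0r.
Qed.

Lemma simplex_integral_sum k b (I : Type) (r : seq I) (f : I -> 'rV[R]_k -> R^o) :
  (forall i, continuous (f i)) ->
  simplex_integral b (fun x => \sum_(i <- r) f i x) = \sum_(i <- r) simplex_integral b (f i).
Proof.
move=> cf; elim: r => [|i r IH].
  rewrite big_nil -[RHS](simplex_integral0 k b); congr simplex_integral.
  by apply/funext => x; rewrite big_nil.
rewrite big_cons -IH -simplex_integralD//.
  by congr simplex_integral; apply/funext => x; rewrite big_cons.
by move=> x; apply: (@cvg_sumr _ R^o _ (nbhs x)) => j; exact: cf.
Qed.

Lemma simplex_integral_swp k b (f : 'rV[R]_k.+2 -> R^o) : continuous f ->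
  simplex_integral b (fun x => f (swp x)) = simplex_integral b f.
Proof.
move=> cf.
pose Psi t u : R^o := simplex_integral (b - t - u) (fun x => f (insv ord0 t (insv ord0 u x))).
have E (g : 'rV[R]_k.+2 -> R^o) : simplex_integral b g =
   Jint b (fun t => Jint (b - t) (fun u => simplex_integral (b - t - u) (fun x => g (insv ord0 t (insv ord0 u x))))).
  rewrite !simplex_integralS; apply: eq_Jint => t _; rewrite simplex_integralS.
  by apply: eq_Jint => u _; congr simplex_integral; apply/funext => x; rewrite !row_mxE0.
have cPsi : continuous (fun p : R * R => Psi p.1 p.2 : R^o).
  apply: (@ccomp _ _ _ (fun p : (R * R) * R => simplex_integral p.2 (fun x => f (insv ord0 p.1.1 (insv ord0 p.1.2 x))) : R^o)
    (fun p : R * R => (p, b - p.1 - p.2))); last first.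
    apply: cpair; first exact: cid_.
    by do 2 ?apply: cfunB; [exact: cfunC|exact: cfst|exact: csnd].
  apply: (@simplex_integral_continuous k (R * R)%type (fun p x => f (insv ord0 p.1 (insv ord0 p.2 x)))).
  apply: (ccomp cf); apply: continuous_insv; first by apply: (ccomp (@cfst _ _)); exact: cfst.
  by apply: continuous_insv; [apply: (ccomp (@csnd _ _)); exact: cfst|exact: csnd].
rewrite !E (@triangle_swap R Psi b cPsi).
apply: eq_Jint => t _; apply: eq_Jint => u _; rewrite /Psi addrAC.
by congr simplex_integral; apply/funext => x; rewrite swp_insv01.
Qed.

(** Integral over the oblique face where the coordinates sum to b; the last coordinate is
    eliminated, and the measure is that of the projection along it. *)
Definition slanted k b (f : 'rV[R]_k.+1 -> R) : R :=
  simplex_integral b (fun u => f (insv ord_max (b - \sum_i u 0 i) u)).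

Lemma continuous_sum_coord k : continuous (fun u : 'rV[R]_k => \sum_i u 0 i : R^o).
Proof. by move=> x; apply: (@cvg_sumr _ R^o _ (nbhs x)) => j; exact: continuous_coord. Qed.

Lemma continuous_slanted k i b : continuous (fun u : 'rV[R]_k => insv i (b - \sum_i u 0 i) u).
Proof.
apply: continuous_insv; last exact: cid_.
by apply: cfunB; [exact: cfunC|exact: continuous_sum_coord].
Qed.

Lemma continuous_swp k : continuous (@swp k).
Proof.
move=> x; apply/continuous_rVP => j; pose j' := if j == 0 then 1 else if j == 1 then 0 else j.
rewrite (_ : (fun y => _) = (fun y : 'rV[R]_k.+2 => y 0 j')); last by apply/funext => y; rewrite mxE.
exact: continuous_coord.
Qed.

Lemma slantedS k b (f : 'rV[R]_k.+2 -> R) :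
  slanted b f = Jint b (fun t => slanted (b - t) (fun x => f (row_mx t%:M x))).
Proof.
rewrite /slanted simplex_integralS; apply: eq_Jint => t _; congr simplex_integral.
apply/funext => u; rewrite !row_mxE0 sum_insv insv_max_cons; congr (f (insv _ _ (insv _ _ _))).
by rewrite opprD addrA.
Qed.

Lemma slanted_swp k b (f : 'rV[R]_k.+2 -> R^o) : continuous f ->
  slanted b (fun x => f (swp x)) = slanted b f.
Proof.
move=> cf; case: k f cf => [|k] f cf.
  rewrite /slanted !simplex_integralS /= -[RHS](@Jint_reflect _ (fun t => f (insv ord_max (b - \sum_i (row_mx t%:M (0 : 'rV[R]_0)) 0 i) (row_mx t%:M (0 : 'rV[R]_0))))).
    apply: eq_Jint => t _; congr f; rewrite !row_mxE0 !sum_insv big_ord0 !addr0 subKr.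
    have E (s r : R) : insv ord_max s (insv ord0 r (0 : 'rV[R]_0)) = insv ord0 r (insv ord0 s 0).
      by rewrite insv_max_cons; congr (insv _ _ (insv _ _ _)); exact: val_inj.
    by rewrite !E swp_insv01.
  apply: (ccomp cf).
  have -> : (fun t => insv ord_max (b - \sum_i (row_mx t%:M (0 : 'rV[R]_0)) 0 i) (row_mx t%:M (0 : 'rV[R]_0))) =
    (fun t : R => insv ord_max (b - t) (insv ord0 t (0 : 'rV[R]_0))).
    by apply/funext => t; rewrite row_mxE0 sum_insv big_ord0 addr0.
  apply: continuous_insv; first by apply: cfunB; [exact: cfunC|exact: cid_].
  by apply: continuous_insv; [exact: cid_|move=> x; exact: cst_continuous].
rewrite /slanted -[RHS]simplex_integral_swp; last by apply: (ccomp cf); exact: continuous_slanted.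
congr simplex_integral; apply/funext => u; congr f; rewrite sum_swp.
have [t [v ->]] := insv_split u; have [s [w ->]] := insv_split v.
by rewrite !swp_insv01 !insv_max_cons swp_insv01.
Qed.

(** The oblique face has the same projected measure along the first axis as along the last: exchange
    the first two coordinates, then slice and use the induction hypothesis. *)
Lemma slanted_first k b (f : 'rV[R]_k.+1 -> R^o) : continuous f ->
  slanted b f = simplex_integral b (fun u => f (insv ord0 (b - \sum_i u 0 i) u)).
Proof.
elim: k b f => [|k IH] b f cf.
  by rewrite /slanted; congr simplex_integral; apply/funext => u; congr (f (insv _ _ _)); exact: val_inj.
rewrite -slanted_swp// slantedS simplex_integralS; apply: eq_Jint => t _.
have cs : continuous (fun x : 'rV[R]_k.+2 => f (swp x)) by apply: (ccomp cf); exact: continuous_swp.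
rewrite (IH _ _ (continuous_slice (t:=t) cs)).
congr simplex_integral; apply/funext => u; congr f; rewrite !row_mxE0 swp_insv01 sum_insv.
by rewrite opprD addrA.
Qed.

Lemma is_derive_along (V W : normedModType R) (f : W -> R^o) (L : V -> W) x v w d :
  (forall h : R, L (h *: v + x) = h *: w + L x) -> is_derive (L x) w f d ->
  is_derive x v (f \o L) d.
Proof.
move=> HL [df Ef].
have E : (fun h : R => h^-1 *: (((f \o L) \o shift x) (h *: v) - (f \o L) x)) =
    (fun h => h^-1 *: ((f \o shift (L x)) (h *: w) - f (L x))).
  by apply/funext => h /=; rewrite HL.
by apply: DeriveDef; rewrite /derivable /derive E.
Qed.

(** Dimension one is the fundamental theorem of calculus. A coordinate other than the first is
    treated slice by slice; the first one is exchanged with the second beforehand. *)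
Lemma simplex_divergence k b (i : 'I_k.+1) (f g : 'rV[R]_k.+1 -> R^o) :
  continuous f -> continuous g -> 0 < b ->
  (forall x : 'rV[R]_k.+1, (forall j, 0 < x 0 j) -> \sum_j x 0 j < b ->
    is_derive x (delta_mx 0 i) f (g x)) ->
  simplex_integral b g = slanted b f - simplex_integral b (fun u => f (insv i 0 u)).
Proof.
elim: k b i f g => [|k IH] b i f g cf cg b0 df.
  rewrite /slanted simplex_integralS /= big_ord0 subr0 !ord1.
  have cfl : continuous (fun t : R => f (insv ord0 t (0 : 'rV[R]_0))).
    by apply: (ccomp cf); apply: continuous_insv; [exact: cid_|move=> z; exact: cst_continuous].
  have cgl : continuous (fun t : R => g (insv ord0 t (0 : 'rV[R]_0))).
    by apply: (ccomp cg); apply: continuous_insv; [exact: cid_|move=> z; exact: cst_continuous].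
  transitivity (Jint b (fun t => g (insv ord0 t (0 : 'rV[R]_0)))).
    by apply: eq_Jint => t _; rewrite row_mxE0.
  have dfl (t : R) : 0 < t < b ->
      is_derive t 1 (fun t : R => f (insv ord0 t (0 : 'rV[R]_0))) (g (insv ord0 t (0 : 'rV[R]_0))).
    move=> /andP[t0 tb].
    apply: (@is_derive_along _ _ f (fun t : R => insv ord0 t (0 : 'rV[R]_0)) t 1 (delta_mx 0 i)).
      move=> h; apply: insvP => [|[]//]; rewrite !mxE unlift_none (ord1 i) !eqxx /=.
      by congr (_ + _).
    apply: df => [j|]; first by rewrite (ord1 j) insv_at.
    by rewrite sum_insv big_ord0 addr0.
  rewrite (Jint_FTC cgl (continuous_subspaceT cfl) (ltW b0) dfl).
  by congr (f (insv _ _ _) - f (insv _ _ _)); exact: val_inj.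
have step (i' : 'I_k.+1) (f' g' : 'rV[R]_k.+2 -> R^o) : continuous f' -> continuous g' ->
    (forall x : 'rV[R]_k.+2, (forall j, 0 < x 0 j) -> \sum_j x 0 j < b ->
      is_derive x (delta_mx 0 (lift ord0 i')) f' (g' x)) ->
    simplex_integral b g' = slanted b f' - simplex_integral b (fun u => f' (insv (lift ord0 i') 0 u)).
  move=> cf' cg' df'.
  rewrite simplex_integralS slantedS simplex_integralS -JintB.
  - apply: eq_Jint => t /andP[t0 tb].
    have b't : 0 < b - t by rewrite subr_gt0.
    have dfs (x : 'rV[R]_k.+1) : (forall j, 0 < x 0 j) -> \sum_j x 0 j < b - t ->
        is_derive x (delta_mx 0 i') (fun x => f' (row_mx t%:M x)) (g' (row_mx t%:M x)).
      move=> x0 sx; apply: (@is_derive_along _ _ f' (fun x : 'rV[R]_k.+1 => row_mx t%:M x) x _ (delta_mx 0 (lift ord0 i'))).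
        move=> h; rewrite !row_mxE0; apply: insvP => [|j].
          by rewrite !mxE unlift_none eqxx /= mulr0 add0r.
        by rewrite !mxE liftK eqxx /= (inj_eq lift_inj).
      apply: df' => [j|]; rewrite row_mxE0.
        by case: (unliftP ord0 j) => [j' ->|->]; rewrite ?insv_lift ?insv_at.
      by rewrite sum_insv addrC -ltrBrDr.
    rewrite (IH _ _ _ _ (continuous_slice cf') (continuous_slice cg') b't dfs).
    by congr (_ - simplex_integral _ _); apply/funext => u; rewrite !row_mxE0 insv_lift_cons.
  - have -> : (fun t => slanted (b - t) (fun x => f' (row_mx t%:M x)) : R^o) =
      (fun t => simplex_integral (b - t) (fun u => (fun y : 'rV[R]_k.+1 => f' (insv ord_max (b - \sum_i y 0 i) y)) (row_mx t%:M u)) : R^o).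
      apply/funext => t; rewrite /slanted; congr simplex_integral; apply/funext => u.
      by rewrite !row_mxE0 sum_insv insv_max_cons opprD addrA.
    apply: (@continuous_inner_integral k b (fun y => f' (insv ord_max (b - \sum_i y 0 i) y))).
    by apply: (ccomp cf'); exact: continuous_slanted.
  - apply: (@continuous_inner_integral k b (fun u => f' (insv (lift ord0 i') 0 u))).
    by apply: (ccomp cf'); apply: continuous_insv; [exact: cfunC|exact: cid_].
case: (unliftP ord0 i) => [i' Ei|Ei]; first by rewrite Ei; apply: step => // x x0 sx; rewrite -Ei; exact: df.
rewrite -simplex_integral_swp//.
have dfs (x : 'rV[R]_k.+2) : (forall j, 0 < x 0 j) -> \sum_j x 0 j < b ->
    is_derive x (delta_mx 0 (lift ord0 ord0)) (fun x => f (swp x)) (g (swp x)).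
  move=> x0 sx.
  apply: (@is_derive_along _ _ f (@swp k) x _ (delta_mx 0 i)).
    move=> h; apply/rowP => j; rewrite !mxE !eqxx Ei /=; congr (h * _%:R + _).
    case: (unliftP ord0 j) => [j' ->|->] //=.
    by case: (unliftP ord0 j') => [j'' ->|->].
  apply: df => [j|]; first by rewrite mxE; exact: x0.
  by rewrite sum_swp.
have cfs : continuous (fun x => f (swp x)) by apply: (ccomp cf); exact: continuous_swp.
have cgs : continuous (fun x => g (swp x)) by apply: (ccomp cg); exact: continuous_swp.
rewrite (step _ _ _ cfs cgs dfs).
rewrite slanted_swp// Ei; congr (_ - simplex_integral _ _); apply/funext => u; congr f.
by have [t [v ->]] := insv_split u; rewrite insv_lift_cons swp_insv01.
Qed.

End FixedDomain.
End SimplexIntegrals.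

(** * Stokes' theorem for forms near the coordinate simplex *)

Section EuclideanStokes.
Context {R : realType}.

Definition csimplex k : set 'rV[R]_k := [set x | (forall i, 0 <= x 0 i) /\ \sum_i x 0 i <= 1].

Arguments csimplex : clear implicits.

(** The integration lemmas ask for continuity on the whole space, while forms are smooth only near
    the simplex. Composing with this retraction, which takes positive parts and rescales when their
    sum exceeds 1, bridges the two. *)
Definition simplex_retract k (x : 'rV[R]_k) : 'rV[R]_k :=
  (Num.max 1 (\sum_i Num.max 0 (x 0 i)))^-1 *: \row_i Num.max 0 (x 0 i).

Lemma simplex_retract_id k x : csimplex k x -> simplex_retract x = x.
Proof.
move=> [x0 x1].
have E i : Num.max 0 (x 0 i) = x 0 i by rewrite max_r.
rewrite /simplex_retract (eq_bigr _ (fun i _ => E i)) (max_l x1) invr1 scale1r.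
by apply/rowP => i; rewrite mxE E.
Qed.

Lemma simplex_retract_in k x : csimplex k (simplex_retract x).
Proof.
set s := \sum_i Num.max 0 (x 0 i).
have m0 : 0 < Num.max 1 s by rewrite lt_max ltr01.
split=> [i|]; first by rewrite !mxE mulr_ge0 ?invr_ge0 ?(ltW m0)// le_max lexx.
under eq_bigr do rewrite !mxE.
by rewrite -mulr_sumr mulrC ler_pdivrMr// mul1r le_max lexx orbT.
Qed.

Lemma simplex_retract_continuous k : continuous (@simplex_retract k).
Proof.
have cm i : continuous (fun x : 'rV[R]_k => Num.max 0 (x 0 i) : R^o).
  move=> x; apply: (@continuous_max R _ (fun=> 0) (fun x : 'rV[R]_k => x 0 i)).
    exact: cst_continuous.
  exact: continuous_coord.
have cs : continuous (fun x : 'rV[R]_k => Num.max 1 (\sum_i Num.max 0 (x 0 i)) : R^o).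
  move=> x; apply: (@continuous_max R _ (fun=> 1) (fun x : 'rV[R]_k => \sum_i Num.max 0 (x 0 i))).
    exact: cst_continuous.
  by apply: (@cvg_sumr _ R^o _ (nbhs x)) => j; exact: cm.
move=> x; apply/continuous_rVP => j.
rewrite (_ : (fun y => _) = (fun y : 'rV[R]_k => (Num.max 1 (\sum_i Num.max 0 (y 0 i)))^-1 * Num.max 0 (y 0 j))); last first.
  by apply/funext => y; rewrite !mxE.
apply: (@continuousM _ _ (fun y : 'rV[R]_k => (Num.max 1 (\sum_i Num.max 0 (y 0 i)))^-1)); last exact: cm.
apply: (@continuousV _ _ (fun y : 'rV[R]_k => Num.max 1 (\sum_i Num.max 0 (y 0 i)))); last exact: cs.
by rewrite gt_eqF// lt_max ltr01.
Qed.

Lemma continuous_retract k (O : set 'rV[R]_k) (f : 'rV[R]_k -> R^o) :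
  csimplex k `<=` O -> (forall x, O x -> {for x, continuous f}) ->
  continuous (fun x => f (simplex_retract x)).
Proof.
move=> sO cf x; apply: (@continuous_comp _ _ _ (@simplex_retract k) f).
  exact: simplex_retract_continuous.
by apply: cf; apply: sO; exact: simplex_retract_in.
Qed.

Definition osimplex k : set 'rV[R]_k := [set x | (forall i, 0 < x 0 i) /\ \sum_i x 0 i < 1].

Arguments osimplex : clear implicits.

Lemma osimplex_csimplex k : osimplex k `<=` csimplex k.
Proof. by move=> x [x0 x1]; split=> [i|]; exact: ltW. Qed.

Lemma norm_lt_sub (a b : R) : `|a - b| < 1 - a -> b < 1.
Proof. by rewrite ltr_norml => /andP[H _]; lra. Qed.

Lemma open_osimplex k : open (osimplex k).
Proof.
rewrite openE => x [x0 x1].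
have h1 : \forall y \near x, forall i, 0 < (y : 'rV[R]_k) 0 i.
  suff H i : \forall y \near x, 0 < (y : 'rV[R]_k) 0 i by exact: filter_forall H.
  have := @continuous_coord R k i x; move/cvgrPdist_lt => /(_ _ (x0 i)).
  by apply: filterS => y; rewrite ltr_norml => /andP[_]; rewrite ltrBlDr ltrDl.
have h2 : \forall y \near x, \sum_i (y : 'rV[R]_k) 0 i < 1.
  have := @continuous_sum_coord R k x; move/cvgrPdist_lt => /(_ (1 - \sum_i x 0 i)).
  rewrite subr_gt0 => /(_ x1); apply: filterS => y.
  exact: norm_lt_sub.
by apply: filterS2 h1 h2 => y; split.
Qed.

Lemma Dmx_affine n m k (A : 'M[R]_(n, m)) (b : 'rV[R]_m) x (v : 'M[R]_(k, n)) :
  Dmx (fun x => x *m A + b) x v = v *m A.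
Proof. by apply/row_matrixP => i; rewrite row_Dmx derive_affine row_mul. Qed.

(** Vertex 0 is the origin of the coordinate simplex. Face 0, opposite to it, is the oblique one,
    and face [lift ord0 i] is the coordinate face where x_i = 0. *)
Definition facemap k (i : 'I_k.+2) (u : 'rV[R]_k) : 'rV[R]_k.+1 :=
  if unlift ord0 i is Some i' then insv i' 0 u else insv ord0 (1 - \sum_j u 0 j) u.

Definition facemx k (i : 'I_k.+2) : 'M[R]_(k, k.+1) :=
  if unlift ord0 i is Some i' then row' i' 1%:M
  else \matrix_(a, b) ((b == lift ord0 a)%:R - (b == ord0)%:R).

Lemma facemap_affine k (i : 'I_k.+2) :
  facemap i = (fun u => u *m facemx i + facemap i 0).
Proof.
apply/funext => u; rewrite /facemap /facemx; case: unliftP => [i' _|_].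
  apply/rowP => j; rewrite !mxE.
  case: unliftP => [j' ->|->].
    rewrite mxE addr0 (bigD1 j')//= !mxE eqxx mulr1 big1 ?addr0// => l lj.
    by rewrite !mxE (inj_eq lift_inj) (negbTE lj) mulr0.
  rewrite addr0 big1// => l _; rewrite !mxE eq_sym (negbTE (neq_lift _ _)) mulr0//.
apply/rowP => j; rewrite !mxE.
case: unliftP => [j' ->|->].
  rewrite mxE addr0 (bigD1 j')//= !mxE eqxx eq_sym (negbTE (neq_lift _ _)) subr0 mulr1.
  rewrite big1 ?addr0// => l lj; rewrite !mxE (inj_eq lift_inj) eq_sym (negbTE lj).
  by rewrite eq_sym (negbTE (neq_lift _ _)) subr0 mulr0.
have -> : \sum_j (0 : 'rV[R]_k) 0 j = 0 by rewrite big1// => l _; rewrite mxE.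
rewrite subr0 addrC; congr (_ + _); rewrite -sumrN; apply: eq_bigr => l _.
by rewrite mxE (negbTE (neq_lift _ _)) eqxx sub0r mulrN1.
Qed.

Lemma facemap_csimplex k (i : 'I_k.+2) (u : 'rV[R]_k) : csimplex k u -> csimplex k.+1 (facemap i u).
Proof.
move=> [u0 u1]; rewrite /facemap; case: unliftP => [i' _|_]; split=> [j|].
- by case: (unliftP i' j) => [j' ->|->]; rewrite ?insv_lift ?insv_at.
- by rewrite sum_insv add0r.
- by case: (unliftP ord0 j) => [j' ->|->]; rewrite ?insv_lift ?insv_at// subr_ge0.
- by rewrite sum_insv subrK.
Qed.

(** By [simplex_divergence] each coefficient of eta contributes one coordinate face and one oblique
    integral; [alt_slanted_face] combines the oblique integrals into face 0. *)
Lemma euclidean_stokes k (O : set 'rV[R]_k.+1) (eta : 'rV[R]_k.+1 -> 'M[R]_(k, k.+1) -> R) :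
  open O -> csimplex k.+1 `<=` O -> is_eform O eta ->
  simplex_integral 1 (fun x => dE eta x 1%:M) =
  \sum_(i < k.+2) (-1) ^+ i * simplex_integral 1 (fun u => epull (facemap i) eta u 1%:M).
Proof.
move=> oO sO [altO smO].
pose f (i : 'I_k.+1) x : R^o := eta x (row' i 1%:M).
have sf i : smooth_on O (f i) by exact: smO.
(* Globally continuous versions of the coefficient and of its derivative. They are related by
   differentiation only in the open simplex, where the retraction is the identity. *)
pose fr i x : R^o := f i (simplex_retract x).
pose gr (i : 'I_k.+1) x : R^o := 'D_(delta_mx 0 i) (f i) (simplex_retract x).
have cfr i : continuous (fr i).
  by apply: (@continuous_retract _ O) => // x Ox; exact: smooth_continuous (sf i) Ox.
have cgr i : continuous (gr i).
  apply: (@continuous_retract _ O ('D_(delta_mx 0 i) (f i)) sO) => x Ox.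
  by apply: smooth_continuous Ox; exact: smooth_derive.
have dfr i (x : 'rV[R]_k.+1) : (forall j, 0 < x 0 j) -> \sum_j x 0 j < 1 ->
    is_derive x (delta_mx 0 i) (fr i) (gr i x).
  move=> x0 x1; have ox : osimplex k.+1 x by [].
  have E y : osimplex k.+1 y -> f i y = fr i y.
    by move=> /osimplex_csimplex/simplex_retract_id; rewrite /fr => ->.
  apply: DeriveDef.
    apply: (eq_derivable (@open_osimplex k.+1) ox E).
    apply: smooth_derivable (sf i) _; apply: sO; exact: osimplex_csimplex.
  rewrite -(@eq_derive R _ R^o _ (f i) (fr i) x _ (@open_osimplex k.+1) ox E).
  by rewrite /gr simplex_retract_id//; exact: osimplex_csimplex.
have L : simplex_integral 1 (fun x => dE eta x 1%:M) =
    \sum_(i < k.+1) (-1) ^+ i * simplex_integral 1 (gr i).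
  under eq_bigr do rewrite -simplex_integralZ//.
  rewrite -simplex_integral_sum; last by move=> i; apply: cfunM; [exact: cfunC|exact: cgr].
  apply: eq_simplex_integral => // x x0 x1; apply: eq_bigr => i _; congr (_ * _).
  have cx : csimplex k.+1 x by apply: osimplex_csimplex.
  by rewrite row1 /gr simplex_retract_id.
have rface (i : 'I_k.+1) : simplex_integral 1 (fun u => fr i (insv i 0 u)) =
    simplex_integral 1 (fun u => epull (facemap (lift ord0 i)) eta u 1%:M).
  apply: eq_simplex_integral => // u u0 u1.
  rewrite /epull {2}facemap_affine Dmx_affine mul1mx /facemx /facemap liftK /fr.
  rewrite simplex_retract_id//; have := @facemap_csimplex _ (lift ord0 i) u.
  by rewrite /facemap liftK; apply; apply: osimplex_csimplex.
pose p0 (u : 'rV[R]_k) := insv ord0 (1 - \sum_j u 0 j) u.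
have face0 : \sum_(i < k.+1) (-1) ^+ i * simplex_integral 1 (fun u => fr i (p0 u)) =
    simplex_integral 1 (fun u => epull (facemap ord0) eta u 1%:M).
  have cp i : continuous (fun u => fr i (p0 u)) by apply: (ccomp (cfr i)); exact: continuous_slanted.
  under eq_bigr do rewrite -simplex_integralZ//.
  rewrite -simplex_integral_sum; last by move=> i; apply: cfunM; [exact: cfunC|exact: cp].
  apply: eq_simplex_integral => // u u0 u1.
  have cu : csimplex k.+1 (p0 u).
    have := @facemap_csimplex _ ord0 u; rewrite /facemap unlift_none; apply.
    exact: osimplex_csimplex.
  rewrite /epull {2}facemap_affine Dmx_affine mul1mx /facemx /facemap unlift_none.
  rewrite alt_slanted_face; last by apply: altO; exact: sO.
  by apply: eq_bigr => i _; rewrite /fr simplex_retract_id.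
rewrite L [RHS]big_ord_recl expr0 mul1r -face0 -big_split.
apply: eq_bigr => i _.
rewrite (simplex_divergence (cfr i) (cgr i) ltr01 (dfr i)) slanted_first// rface.
by rewrite lift0 exprS mulN1r mulNr mulrBr.
Qed.

End EuclideanStokes.

Arguments csimplex R k : clear implicits.
Arguments osimplex R k : clear implicits.

(** * Differential forms on manifolds *)

Section ManifoldForms.
Context {R : realType}.

Lemma open_preim_at (X Y : topologicalType) (O : set X) (g : X -> Y) (A : set Y) : open O ->
  (forall x, O x -> {for x, continuous g}) -> open A -> open (O `&` g @^-1` A).
Proof.
move=> oO cg oA; rewrite openE => x [Ox Agx]; apply: filterI.
  exact: open_nbhs_nbhs.
by apply: (cg x Ox); exact: open_nbhs_nbhs.
Qed.

Section OneManifold.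
Context {n : nat} {M : manifold R n}.
Implicit Types (c : chart (R := R) M n) (W : set M).

Definition chart_image c : set 'rV[R]_n := cto c @` cdom c.

Lemma chart_open c : matlas c -> open (cdom c).
Proof. by move=> /(@m_is_chart R n M)[]. Qed.

Lemma chart_image_open c : matlas c -> open (chart_image c).
Proof. by move=> /(@m_is_chart R n M)[]. Qed.

Lemma cfromK c p : matlas c -> cdom c p -> cfrom c (cto c p) = p.
Proof. by move=> /(@m_is_chart R n M)[_ _ + _ _]; apply. Qed.

Lemma chart_imageP c x : matlas c -> chart_image c x -> cdom c (cfrom c x) /\ cto c (cfrom c x) = x.
Proof. by move=> ac [p cp <-]; rewrite cfromK. Qed.

Lemma cto_continuous c p : matlas c -> cdom c p -> {for p, continuous (cto c)}.
Proof.
move=> ac cp; have [oc _ _ + _] := m_is_chart ac.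
by rewrite (continuous_open_subspace _ oc) => /(_ p); apply; rewrite inE.
Qed.

Lemma cfrom_continuous c x : matlas c -> chart_image c x -> {for x, continuous (cfrom c)}.
Proof.
move=> ac cx; have [_ oc _ _] := m_is_chart ac.
by rewrite (continuous_open_subspace _ oc) => /(_ x); apply; rewrite inE.
Qed.

Lemma mchart_atlas p : matlas (mchart (m:=M) p).
Proof. by have [] := m_chart_at p. Qed.

Lemma mchart_dom p : cdom (mchart (m:=M) p) p.
Proof. by have [] := m_chart_at p. Qed.

Definition chart_sub c W : set 'rV[R]_n := cto c @` (cdom c `&` W).

Lemma chart_subE c W : matlas c -> chart_sub c W = chart_image c `&` cfrom c @^-1` W.
Proof.
move=> ac; apply/seteqP; split=> x.
  by move=> [p [cp Wp] <-]; split; [exists p|rewrite /= cfromK].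
move=> [cx Wx]; have [cp Ex] := chart_imageP ac cx.
by exists (cfrom c x).
Qed.

Lemma chart_sub_open c W : matlas c -> open W -> open (chart_sub c W).
Proof.
move=> ac oW; rewrite chart_subE//; apply: open_preim_at => //.
  exact: chart_image_open.
by move=> x; exact: cfrom_continuous.
Qed.

(** Inverse charts, smooth extensions of simplices and their composites with affine maps are all
    instances, so pullback and Stokes are proved once for all of them. *)
Definition smooth_param {l} (O : set 'rV[R]_l) (g : 'rV[R]_l -> M) :=
  [/\ open O, forall x, O x -> {for x, continuous g} &
   forall c, matlas c -> smooth_on (O `&` g @^-1` cdom c) (cto c \o g)].

Lemma smooth_param_open l (O : set 'rV[R]_l) g c : smooth_param O g -> matlas c ->
  open (O `&` g @^-1` cdom c).
Proof. by move=> [oO cg _] ac; apply: open_preim_at => //; exact: chart_open. Qed.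

Lemma smooth_param_sub l (O O' : set 'rV[R]_l) g : open O' -> O' `<=` O ->
  smooth_param O g -> smooth_param O' g.
Proof.
move=> oO' sO [oO cg sg]; split=> // [x /sO|c ac]; first exact: cg.
apply: sub_smooth (sg c ac) => x [Ox cx]; split=> //; exact: sO.
Qed.

Lemma smooth_param_cfrom c : matlas c -> smooth_param (chart_image c) (cfrom c).
Proof.
move=> ac; split; first exact: chart_image_open.
  by move=> x; exact: cfrom_continuous.
move=> c' ac'; apply: sub_smooth (m_compatible ac ac') => x [[p cp <-]] /=.
by rewrite cfromK// => c'p; exists p.
Qed.

(** One chart around each point is enough, because transition maps are smooth. *)
Lemma smooth_param_intro l (O : set 'rV[R]_l) (g : 'rV[R]_l -> M) : open O ->
  (forall x, O x -> {for x, continuous g}) ->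
  (forall x, O x -> exists c (U : set 'rV[R]_l), [/\ matlas c, open U, U x,
     U `<=` O `&` g @^-1` cdom c & smooth_on U (cto c \o g)]) ->
  smooth_param O g.
Proof.
move=> oO cg H; split=> // c' ac'; apply: smooth_local => x [Ox c'x].
have [c [U [ac oU Ux sU sg]]] := H x Ox.
pose U' := U `&` g @^-1` cdom c'.
have oU' : open U'.
  by apply: open_preim_at => // [y /sU[Oy _]|]; [exact: cg|exact: chart_open].
exists U' => //.
pose V := chart_sub c (cdom c').
have oV : open V by apply: chart_sub_open => //; exact: chart_open.
apply: (@eq_smooth _ _ _ U' ((cto c' \o cfrom c) \o (cto c \o g)) _ oU').
  by move=> y [/sU[_ cy] _] /=; rewrite cfromK.
apply: (smooth_compV oU' oV).
- by apply: sub_smooth sg => y [].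
- exact: (m_compatible ac ac').
- by move=> y [/sU[_ cy] c'y] /=; exists (g y).
Qed.

Lemma smooth_param_comp l l' (O : set 'rV[R]_l) (O' : set 'rV[R]_l') g h :
  smooth_param O g -> open O' -> smooth_on O' h -> (forall x, O' x -> O (h x)) ->
  smooth_param O' (g \o h).
Proof.
move=> [oO cg sg] oO' sh hO.
have ch x : O' x -> {for x, continuous h} by exact: smooth_continuous sh.
split=> // [x Ox|c ac].
  by apply: continuous_comp; [exact: ch|apply: cg; exact: hO].
pose U := O `&` g @^-1` cdom c.
have oU : open U by apply: open_preim_at => //; exact: chart_open.
have oU' : open (O' `&` (g \o h) @^-1` cdom c).
  have -> : O' `&` (g \o h) @^-1` cdom c = O' `&` h @^-1` U.
    by apply/seteqP; split=> x [Ox]; [split=> //; split=> //; exact: hO|move=> [_]].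
  exact: open_preim_at.
apply: (@smooth_compV _ _ _ _ _ U h (cto c \o g)) => //; last by move=> x [Ox cx]; split=> //; exact: hO.
  by apply: sub_smooth sh => x [].
exact: sg.
Qed.

(** Tangent vectors are read in the preferred chart at g x, which jumps with x. Smoothness is
    therefore obtained from a fixed chart, through [pullx_chart]. *)
Definition pullx {l k} (g : 'rV[R]_l -> M) (w : diff_form M k) (x : 'rV[R]_l)
    (v : 'M[R]_(k, l)) : R := w (g x) (Dmx (cto (mchart (g x)) \o g) x v).

Lemma form_in_chartE k (w : diff_form M k) c : form_in_chart w c = pullx (cfrom c) w.
Proof. by []. Qed.

Lemma eq_pullx l k (U : set 'rV[R]_l) (g g' : 'rV[R]_l -> M) (w : diff_form M k) x v :
  open U -> U x -> (forall y, U y -> g y = g' y) -> pullx g w x v = pullx g' w x v.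
Proof.
move=> oU Ux E; rewrite /pullx (E x Ux); congr (w _ _); apply/row_matrixP => i; rewrite [LHS]row_Dmx [RHS]row_Dmx.
by apply: (eq_derive _ oU Ux) => y Uy /=; rewrite E.
Qed.

Lemma derive_chart_change l (O : set 'rV[R]_l) g c c0 x v : smooth_param O g -> O x ->
  matlas c -> matlas c0 -> cdom c (g x) -> cdom c0 (g x) ->
  'D_('D_v (cto c \o g) x) (cto c0 \o cfrom c) (cto c (g x)) = 'D_v (cto c0 \o g) x.
Proof.
move=> sg Ox ac ac0 cx c0x; have [oO cg sgc] := sg.
pose U := O `&` g @^-1` (cdom c `&` cdom c0).
have oU : open U by apply: open_preim_at => //; apply: openI; exact: chart_open.
have Ux : U x by [].
pose V := chart_sub c (cdom c0).
have oV : open V by apply: chart_sub_open => //; exact: chart_open.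
have sU : smooth_on U (cto c \o g) by apply: sub_smooth (sgc c ac) => y [Oy []].
have hV y : U y -> V (cto c (g y)) by move=> [_ cy]; exists (g y).
rewrite -(derive_compV oU oV sU (m_compatible ac ac0) hV v Ux).
by apply: (eq_derive _ oU Ux) => y [_ [cy _]] /=; rewrite cfromK.
Qed.

Lemma pullx_chart l k (O : set 'rV[R]_l) g (w : diff_form M k) c x v : smooth_param O g -> O x ->
  matlas c -> cdom c (g x) -> pullx g w x v = epull (cto c \o g) (form_in_chart w c) x v.
Proof.
move=> sg Ox ac cx; rewrite /epull /form_in_chart /pullx /= (cfromK ac cx).
congr (w _ _); apply/row_matrixP => i; rewrite [LHS]row_Dmx [RHS]rowK row_Dmx.
by rewrite (derive_chart_change _ sg Ox ac (mchart_atlas _) cx (mchart_dom _)).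
Qed.

Lemma chart_eform k (w : diff_form M k) W c : open W -> is_form W w -> matlas c ->
  is_eform (chart_sub c W) (form_in_chart w c).
Proof.
move=> oW [wa ws] ac; split; last exact: ws.
move=> x; rewrite chart_subE// => -[cx Wx].
have [cp Ex] := chart_imageP ac cx.
set c0 := mchart (cfrom c x).
have ac0 : matlas c0 by exact: mchart_atlas.
have d0 : cdom c0 (cfrom c x) by exact: mchart_dom.
pose V := chart_sub c (cdom c0).
have oV : open V by apply: chart_sub_open => //; exact: chart_open.
have Vx : V x by exists (cfrom c x).
have dh : differentiable (cto c0 \o cfrom c) x.
  exact: smooth_differentiableV oV Vx (m_compatible ac ac0).
have -> : form_in_chart w c x = fun v => w (cfrom c x) (v *m jacobian (cto c0 \o cfrom c) x).
  by apply/funext => v; rewrite -Dmx_jacobian.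
by apply: alternating_mulmx; exact: wa.
Qed.

Lemma eq_dE l k (U : set 'rV[R]_l) (eta eta' : 'rV[R]_l -> 'M[R]_(k, l) -> R) x v :
  open U -> U x -> (forall y v, U y -> eta y v = eta' y v) -> dE eta x v = dE eta' x v.
Proof.
move=> oU Ux E; apply: eq_bigr => i _; congr (_ * _).
by apply: (@eq_derive R _ R^o U) => // y Uy; exact: E.
Qed.

Section Pullx.
Context {l k : nat} (O : set 'rV[R]_l) (g : 'rV[R]_l -> M) (w : diff_form M k) (W : set M).
Hypotheses (sg : smooth_param O g) (oW : open W) (fw : is_form W w).
Hypothesis gW : forall x, O x -> W (g x).

Let loc_sub c x : O x -> cdom c (g x) -> chart_sub c W (cto c (g x)).
Proof. by move=> Ox cx; exists (g x) => //; split=> //; exact: gW. Qed.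

Lemma pullx_eform : is_eform O (pullx g w).
Proof.
have H x : O x -> exists U, [/\ open U, U x & is_eform U (pullx g w)].
  move=> Ox; set c := mchart (g x).
  have ac : matlas c by exact: mchart_atlas.
  pose U := O `&` g @^-1` cdom c.
  have oU : open U by exact: smooth_param_open.
  exists U; split=> //; first by split=> //; exact: mchart_dom.
  have [ea es] : is_eform U (epull (cto c \o g) (form_in_chart w c)).
    apply: (@epull_eform _ _ _ U (chart_sub c W)) => //.
    - exact: chart_sub_open.
    - by have [_ _] := sg; apply.
    - by move=> y [Oy cy]; exact: loc_sub.
    - exact: chart_eform.
  have E y v : U y -> epull (cto c \o g) (form_in_chart w c) y v = pullx g w y v.
    by move=> [Oy cy]; rewrite (pullx_chart w v sg Oy ac).
  split=> [y Uy|v].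
    by have -> : pullx g w y = epull (cto c \o g) (form_in_chart w c) y;
      [apply/funext => v; rewrite E|exact: ea].
  by apply: (eq_smooth oU _ (es v)) => y Uy; exact: E.
split=> [x Ox|v]; first by have [U [_ Ux [ea _]]] := H x Ox; exact: ea.
by apply: smooth_local => x Ox; have [U [oU Ux [_ es]]] := H x Ox; exists U.
Qed.

Lemma dE_pullx x v : O x -> dE (pullx g w) x v = pullx g (ext_d w) x v.
Proof.
move=> Ox; set c := mchart (g x).
have ac : matlas c by exact: mchart_atlas.
pose U := O `&` g @^-1` cdom c.
have oU : open U by exact: smooth_param_open.
have Ux : U x by split=> //; exact: mchart_dom.
have E y u : U y -> pullx g w y u = epull (cto c \o g) (form_in_chart w c) y u.
  by move=> [Oy cy]; rewrite (pullx_chart w _ sg Oy ac).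
rewrite (eq_dE _ oU Ux E) (@dE_epull _ _ _ U (chart_sub c W))//.
- exact: chart_sub_open.
- by have [_ _] := sg; apply.
- by move=> y [Oy cy]; exact: loc_sub.
- exact: chart_eform.
Qed.

End Pullx.

Lemma pullx_comp l l' k (O : set 'rV[R]_l) (O' : set 'rV[R]_l') g h (w : diff_form M k) x v :
  smooth_param O g -> open O' -> smooth_on O' h -> (forall x, O' x -> O (h x)) -> O' x ->
  pullx (g \o h) w x v = epull h (pullx g w) x v.
Proof.
move=> sg oO' sh hO Ox; have sgh := smooth_param_comp sg oO' sh hO.
have Ohx := hO x Ox; set c := mchart (g (h x)).
have ac : matlas c by exact: mchart_atlas.
have cx : cdom c (g (h x)) by exact: mchart_dom.
rewrite /epull /pullx /=; congr (w _ _); apply/row_matrixP => i; rewrite [LHS]row_Dmx [RHS]row_Dmx row_Dmx.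
have [oO cg sgc] := sg.
pose U := O `&` g @^-1` cdom c.
have oU : open U by exact: smooth_param_open.
pose U' := O' `&` h @^-1` U.
have oU' : open U' by apply: open_preim_at => // y Oy; exact: smooth_continuous sh Oy.
apply: (@derive_compV _ _ _ _ U' U h (cto c \o g)) => //.
- by apply: sub_smooth sh => y [].
- exact: sgc.
- by move=> y [].
Qed.

End OneManifold.

Section Maps.
Context {m n : nat} {M : manifold R m} {N : manifold R n} (Phi : smooth_map M N).

Lemma smooth_param_map l (O : set 'rV[R]_l) (g : 'rV[R]_l -> M) :
  smooth_param O g -> smooth_param O (Phi \o g).
Proof.
move=> sg; have [oO cg sgc] := sg; apply: smooth_param_intro => // x Ox.
  by apply: continuous_comp; [exact: cg|exact: smap_continuous].
set c := mchart (g x); set d := mchart (Phi (g x)).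
have ac : matlas c by exact: mchart_atlas.
have ad : matlas d by exact: mchart_atlas.
pose W := Phi @^-1` cdom d.
have oW : open W by apply: open_preim; [exact: smap_continuous|exact: chart_open].
exists d, (O `&` g @^-1` (cdom c `&` W)); split=> //.
- by apply: open_preim_at => //; apply: openI => //; exact: chart_open.
- by split=> //; split; exact: mchart_dom.
- by move=> y [Oy [_ dy]].
have oU : open (O `&` g @^-1` (cdom c `&` W)).
  by apply: open_preim_at => //; apply: openI => //; exact: chart_open.
apply: (@eq_smooth _ _ _ _ ((cto d \o Phi \o cfrom c) \o (cto c \o g)) _ oU).
  by move=> y [_ [cy _]] /=; rewrite cfromK.
apply: (smooth_compV oU (chart_sub_open ac oW)).
- by apply: sub_smooth (sgc c ac) => y [Oy []].
- exact: (smap_smooth ac ad).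
- by move=> y [Oy cy] /=; exists (g y).
Qed.

Lemma pullx_map l k (O : set 'rV[R]_l) (g : 'rV[R]_l -> M) (w : diff_form N k) x v :
  smooth_param O g -> O x -> pullx (Phi \o g) w x v = pullx g (pull_form Phi w) x v.
Proof.
move=> sg Ox; have [oO cg sgc] := sg.
rewrite /pullx /pull_form /=; congr (w _ _); apply/row_matrixP => i; rewrite [LHS]row_Dmx [RHS]rowK /tangent_map row_Dmx.
set c := mchart (g x); set d := mchart (Phi (g x)).
have ac : matlas c by exact: mchart_atlas.
have ad : matlas d by exact: mchart_atlas.
pose W := Phi @^-1` cdom d.
have oW : open W by apply: open_preim; [exact: smap_continuous|exact: chart_open].
pose U := O `&` g @^-1` (cdom c `&` W).
have oU : open U by apply: open_preim_at => //; apply: openI => //; exact: chart_open.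
have Ux : U x by split=> //; split; exact: mchart_dom.
have sU : smooth_on U (cto c \o g) by apply: sub_smooth (sgc c ac) => y [Oy []].
have hV y : U y -> chart_sub c W ((cto c \o g) y) by move=> [_ cy]; exists (g y).
rewrite -(derive_compV oU (chart_sub_open ac oW) sU (smap_smooth ac ad) hV _ Ux).
by apply: (eq_derive _ oU Ux) => y [_ [cy _]] /=; rewrite cfromK.
Qed.

Lemma pull_form_chart k (w : diff_form N k) c x v : matlas c -> chart_image c x ->
  form_in_chart (pull_form Phi w) c x v = pullx (Phi \o cfrom c) w x v.
Proof. by move=> ac cx; rewrite (pullx_map _ _ (smooth_param_cfrom ac) cx). Qed.

Lemma pull_form_pullx k (w : diff_form N k) p v : pull_form Phi w p v = pullx (Phi \o cfrom (mchart p)) w (cto (mchart p) p) v.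
Proof.
rewrite /pull_form /pullx /= cfromK; [|exact: mchart_atlas|exact: mchart_dom].
by congr w; apply/row_matrixP => i; rewrite rowK row_Dmx.
Qed.

Section PullForm.
Context {k : nat} (w : diff_form N k) (W : set N).
Hypotheses (oW : open W) (fw : is_form W w).

Let oPW : open (Phi @^-1` W).
Proof. by apply: open_preim => //; exact: smap_continuous. Qed.

Let sparam c : matlas c -> smooth_param (chart_sub c (Phi @^-1` W)) (Phi \o cfrom c).
Proof.
move=> ac; apply: smooth_param_map; apply: smooth_param_sub (smooth_param_cfrom ac).
  exact: chart_sub_open.
by rewrite chart_subE// => x [].
Qed.

Let sparamW c x : matlas c -> chart_sub c (Phi @^-1` W) x -> W ((Phi \o cfrom c) x).
Proof. by move=> ac; rewrite chart_subE// => -[]. Qed.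

Lemma pull_form_is_form : is_form (Phi @^-1` W) (pull_form Phi w).
Proof.
split=> [p Wp|c ac v].
  have ac := mchart_atlas p; have cp := mchart_dom p.
  have [ea _] := pullx_eform (sparam ac) oW fw (fun x => sparamW ac).
  have -> : pull_form Phi w p = pullx (Phi \o cfrom (mchart p)) w (cto (mchart p) p).
    by apply/funext => v; exact: pull_form_pullx.
  by apply: ea; exists p.
have [_ es] := pullx_eform (sparam ac) oW fw (fun x => sparamW ac).
apply: (eq_smooth (chart_sub_open ac oPW) _ (es v)) => x.
by rewrite (chart_subE _ ac) => -[cx _]; exact/esym/(pull_form_chart _ _ ac cx).
Qed.

Lemma ext_d_pull_form p v : W (Phi p) -> ext_d (pull_form Phi w) p v = pull_form Phi (ext_d w) p v.
Proof.
move=> Wp; have ac := mchart_atlas p; have cp := mchart_dom p.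
have Up : chart_sub (mchart p) (Phi @^-1` W) (cto (mchart p) p) by exists p.
transitivity (dE (pullx (Phi \o cfrom (mchart p)) w) (cto (mchart p) p) v).
  apply: (eq_dE _ (chart_sub_open ac oPW) Up) => y u.
  by rewrite (chart_subE _ ac) => -[cy _]; exact: (pull_form_chart _ _ ac cy).
rewrite (dE_pullx (sparam ac) oW fw (fun x => sparamW ac) v Up).
by rewrite pull_form_pullx.
Qed.

End PullForm.
End Maps.
End ManifoldForms.

(** * Singular simplices and integration *)

Section Simplices.
Context {R : realType} {X : topologicalType}.

Lemma singular_eq k (s s' : singular R X k) : (forall t, s t = s' t) -> s = s'.
Proof.
case: s s' => f cf [g cg] /= fg; have {}fg : f = g by exact/funext.
by case: _ / fg cg => cg; congr Singular; exact: Prop_irrelevance.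
Qed.

Lemma simplex_point k (t : set_type (simplex R k)) : simplex R k (set_val t).
Proof. exact: set_valP. Qed.

Definition spoint k (x : 'rV[R]_k.+1) : set_type (simplex R k) := insubd (vertex k) x.

Lemma spointK k x : simplex R k x -> set_val (spoint x) = x.
Proof. by move=> sx; rewrite set_valE /spoint insubdK// inE. Qed.

Lemma spoint_val k (t : set_type (simplex R k)) : spoint (set_val t) = t.
Proof. by rewrite /spoint set_valE valKd. Qed.

Lemma continuous_to_simplex (T : topologicalType) k (f : T -> set_type (simplex R k)) :
  continuous (fun x => set_val (f x)) -> continuous f.
Proof.
move=> c; apply/continuousP => _ [A oA <-].
by move/continuousP : c => /(_ A oA).
Qed.

(* a junk (constant) simplex when f is not continuous *)
Definition mk_sing k (f : set_type (simplex R k) -> X) : singular R X k :=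
  if pselect (continuous f) is left c then Singular c
  else Singular (fun t => @cst_continuous _ _ (f (vertex k)) t).

Lemma mk_singE k f t : continuous f -> @mk_sing k f t = f t.
Proof. by rewrite /mk_sing; case: pselect. Qed.

(** The rows of V are the vertices in the parameter space: a face deletes a row of V, and an affine
    reparametrisation multiplies V on the left. *)
Definition asimp {K l} (h : 'rV[R]_K -> X) (V : 'M[R]_(l.+1, K)) : singular R X l :=
  mk_sing (fun t => h (set_val t *m V)).

Definition hull {K l} (V : 'M[R]_(l.+1, K)) : set 'rV[R]_K := (fun t => t *m V) @` simplex R l.

Lemma row_mulmx_continuous m n (V : 'M[R]_(m, n)) : continuous (fun x : 'rV[R]_m => x *m V).
Proof.
move=> x; apply/continuous_rVP => j.
rewrite (_ : (fun y => _) = (fun y : 'rV[R]_m => \sum_i y 0 i * V i j)); last first.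
  by apply/funext => y; rewrite mxE.
by apply: (@cvg_sumr _ R^o _ (nbhs x)) => i; apply: cvgM; [exact: continuous_coord|exact: cvg_cst].
Qed.

Lemma asimpE K l (h : 'rV[R]_K -> X) (V : 'M[R]_(l.+1, K)) t :
  (forall x, hull V x -> {for x, continuous h}) -> asimp h V t = h (set_val t *m V).
Proof.
move=> ch; rewrite /asimp mk_singE// => {}t.
apply: (@continuous_comp _ _ _ (fun t : set_type (simplex R l) => set_val t *m V) h).
  apply: (@continuous_comp _ _ _ (fun t : set_type (simplex R l) => set_val t) (fun x : 'rV[R]_l.+1 => x *m V)).
    exact: initial_continuous.
  exact: row_mulmx_continuous.
by apply: ch; exists (set_val t) => //; exact: simplex_point.
Qed.

Lemma insv0_mul k K (i : 'I_k.+2) (t : 'rV[R]_k.+1) (V : 'M[R]_(k.+2, K)) :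
  insv i 0 t *m V = t *m row' i V.
Proof.
apply/rowP => b; rewrite !mxE (bigD1_ord i)//= insv_at mul0r add0r; apply: eq_bigr => j _.
by rewrite insv_lift !mxE.
Qed.

Lemma insv0_simplex k (i : 'I_k.+2) (t : 'rV[R]_k.+1) : simplex R k t -> simplex R k.+1 (insv i 0 t).
Proof.
move=> [t0 t1]; split=> [j|]; last by rewrite sum_insv add0r.
by case: (unliftP i j) => [j' ->|->]; rewrite ?insv_lift ?insv_at.
Qed.

Lemma hull_row' K l (V : 'M[R]_(l.+2, K)) i : hull (row' i V) `<=` hull V.
Proof. by move=> _ [t st <-]; exists (insv i 0 t); [exact: insv0_simplex|exact: insv0_mul]. Qed.

Lemma face_asimp K l (h : 'rV[R]_K -> X) (V : 'M[R]_(l.+2, K)) i :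
  (forall x, hull V x -> {for x, continuous h}) -> sing_face i (asimp h V) = asimp h (row' i V).
Proof.
move=> ch; apply: singular_eq => t; rewrite /= asimpE// asimpE; last by move=> x /hull_row'; exact: ch.
by rewrite -insv0_mul set_valE.
Qed.

(** The rows are points of a simplex in barycentric coordinates, so such a matrix is an affine map
    between simplices. *)
Definition stochastic {l k} (S : 'M[R]_(l.+1, k)) := forall a, (forall b, 0 <= S a b) /\ \sum_b S a b = 1.

Lemma simplex_stochastic l k (S : 'M[R]_(l.+1, k.+1)) t : stochastic S -> simplex R l t ->
  simplex R k (t *m S).
Proof.
move=> sS [t0 t1]; split=> [j|].
  by rewrite mxE; apply: sumr_ge0 => i _; rewrite mulr_ge0//; exact: (sS i).1.
under eq_bigr do rewrite mxE.
rewrite exchange_big /= -[RHS]t1; apply: eq_bigr => i _.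
by rewrite -mulr_sumr (sS i).2 mulr1.
Qed.

Lemma stochastic_mul l k K (S : 'M[R]_(l.+1, k.+1)) (S' : 'M[R]_(k.+1, K)) :
  stochastic S -> stochastic S' -> stochastic (S *m S').
Proof.
move=> sS sS' a; split=> [b|].
  by rewrite mxE; apply: sumr_ge0 => i _; rewrite mulr_ge0//; [exact: (sS a).1|exact: (sS' i).1].
under eq_bigr do rewrite mxE.
rewrite exchange_big /= -[RHS](sS a).2; apply: eq_bigr => i _.
by rewrite -mulr_sumr (sS' i).2 mulr1.
Qed.

Lemma stochastic1 k : stochastic (1%:M : 'M[R]_k.+1).
Proof.
move=> a; split=> [b|]; first by rewrite !mxE ler0n.
rewrite (bigD1 a)//= !mxE eqxx big1 ?addr0// => b ba.
by rewrite !mxE eq_sym (negbTE ba).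
Qed.

Lemma stochastic_row' l k (S : 'M[R]_(l.+2, k)) i : stochastic S -> stochastic (row' i S).
Proof.
move=> sS a; have [s0 s1] := sS (lift i a); split=> [b|]; first by rewrite mxE.
by rewrite -[RHS]s1; apply: eq_bigr => b _; rewrite mxE.
Qed.

Lemma hull_mul l k K (S : 'M[R]_(l.+1, k.+1)) (V : 'M[R]_(k.+1, K)) : stochastic S ->
  hull (S *m V) `<=` hull V.
Proof.
by move=> sS _ [t st <-]; exists (t *m S); [exact: simplex_stochastic|rewrite mulmxA].
Qed.

Lemma hull_stochastic l k (S : 'M[R]_(l.+1, k.+1)) : stochastic S -> hull S `<=` simplex R k.
Proof. by move=> sS _ [t st <-]; exact: simplex_stochastic. Qed.

Lemma simplex_facemap0 k (x : 'rV[R]_k) : csimplex R k x -> simplex R k (facemap ord0 x).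
Proof.
move=> [x0 x1]; rewrite /facemap unlift_none; split=> [j|]; last by rewrite sum_insv subrK.
by case: (unliftP ord0 j) => [j' ->|->]; rewrite ?insv_lift ?insv_at// subr_ge0.
Qed.

Definition stail {k} (x : 'rV[R]_k.+1) : 'rV[R]_k := \row_j x 0 (lift ord0 j).

Definition sretract {k} (x : 'rV[R]_k.+1) : 'rV[R]_k.+1 := facemap ord0 (simplex_retract (stail x)).

Lemma sretract_in k (x : 'rV[R]_k.+1) : simplex R k (sretract x).
Proof. by apply: simplex_facemap0; exact: simplex_retract_in. Qed.

Lemma facemap0_stail k (t : 'rV[R]_k.+1) : simplex R k t -> facemap ord0 (stail t) = t.
Proof.
move=> [_ t1]; rewrite /facemap unlift_none; apply: insvP => [|j]; last by rewrite mxE.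
by rewrite -t1 (bigD1_ord ord0)//=; under [X in _ - X]eq_bigr do rewrite mxE; rewrite addrK.
Qed.

Lemma stail_csimplex k (t : 'rV[R]_k.+1) : simplex R k t -> csimplex R k (stail t).
Proof.
move=> [t0 t1]; split=> [i|]; first by rewrite mxE.
by rewrite -t1 [leRHS](bigD1_ord ord0)//=; under eq_bigr do rewrite mxE; rewrite lerDr.
Qed.

Lemma sretract_id k (t : 'rV[R]_k.+1) : simplex R k t -> sretract t = t.
Proof.
by move=> st; rewrite /sretract simplex_retract_id ?facemap0_stail//; exact: stail_csimplex.
Qed.

Lemma continuous_facemap k (i : 'I_k.+2) : continuous (@facemap R k i).
Proof.
rewrite /facemap; case: unliftP => [i' _|_]; last exact: continuous_slanted.
by apply: continuous_insv; [exact: cfunC|exact: cid_].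
Qed.

Lemma sretract_continuous k : continuous (@sretract k).
Proof.
apply: (@ccomp _ _ _ (facemap ord0) (fun x : 'rV[R]_k.+1 => simplex_retract (stail x))); first exact: continuous_facemap.
apply: (@ccomp _ _ _ (@simplex_retract R k) stail); first exact: simplex_retract_continuous.
move=> x; apply/continuous_rVP => j.
rewrite (_ : (fun y => _) = (fun y : 'rV[R]_k.+1 => y 0 (lift ord0 j))); last first.
  by apply/funext => y; rewrite mxE.
exact: continuous_coord.
Qed.

(** Extending s to the ambient space makes each affine reparametrisation of s an instance of
    [asimp], namely [asimp (sext s) S]. *)
Definition sext k (s : singular R X k) (x : 'rV[R]_k.+1) : X := s (spoint (sretract x)).

Lemma sext_continuous k (s : singular R X k) : continuous (sext s).
Proof.
apply: (ccomp (@sing_continuous _ _ _ s)); apply: continuous_to_simplex.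
have -> : (fun x => set_val (spoint (sretract x))) = @sretract k.
  by apply/funext => x; rewrite spointK//; exact: sretract_in.
exact: sretract_continuous.
Qed.

Lemma sextE k (s : singular R X k) t : s t = sext s (set_val t).
Proof. by rewrite /sext sretract_id ?spoint_val//; exact: simplex_point. Qed.

Lemma asimp_sext k (s : singular R X k) : asimp (sext s) 1%:M = s.
Proof.
apply: singular_eq => t; rewrite asimpE ?mulmx1 -?sextE// => x _; exact: sext_continuous.
Qed.

Lemma sext_asimp K k l (h : 'rV[R]_K -> X) (V : 'M[R]_(k.+1, K)) (S : 'M[R]_(l.+1, k.+1)) :
  (forall x, hull V x -> {for x, continuous h}) -> stochastic S ->
  asimp (sext (asimp h V)) S = asimp h (S *m V).
Proof.
move=> ch sS; apply: singular_eq => t.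
rewrite asimpE; last by move=> x _; exact: sext_continuous.
rewrite asimpE; last by move=> x /(hull_mul sS); exact: ch.
rewrite /sext asimpE// spointK; last exact: sretract_in.
by rewrite sretract_id ?mulmxA//; apply: simplex_stochastic => //; exact: simplex_point.
Qed.

Lemma face_sext k (s : singular R X k.+1) i l (S : 'M[R]_(l.+1, k.+1)) : stochastic S ->
  asimp (sext (sing_face i s)) S = asimp (sext s) (S *m row' i 1%:M).
Proof.
move=> sS; have -> : sing_face i s = asimp (sext s) (row' i 1%:M).
  by rewrite -face_asimp ?asimp_sext// => x _; exact: sext_continuous.
by apply: sext_asimp => // x _; exact: sext_continuous.
Qed.

Lemma eq_asimp K l (h h' : 'rV[R]_K -> X) (V : 'M[R]_(l.+1, K)) :
  (forall x, hull V x -> {for x, continuous h}) -> (forall x, hull V x -> {for x, continuous h'}) ->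
  (forall x, hull V x -> h x = h' x) -> asimp h V = asimp h' V.
Proof.
move=> ch ch' E; apply: singular_eq => t; rewrite !asimpE//; apply: E.
by exists (set_val t) => //; exact: simplex_point.
Qed.

Definition simage {k} (s : singular R X k) : set X := range s.

Lemma image_asimp K l (h : 'rV[R]_K -> X) (V : 'M[R]_(l.+1, K)) (U : set X) :
  (forall x, hull V x -> {for x, continuous h}) -> (forall x, hull V x -> U (h x)) ->
  simage (asimp h V) `<=` U.
Proof.
move=> ch hU _ [t _ <-]; rewrite asimpE//; apply: hU.
by exists (set_val t) => //; exact: simplex_point.
Qed.

Lemma image_face k (s : singular R X k.+1) i : simage (sing_face i s) `<=` simage s.
Proof. by move=> _ [t _ <-]; exists (face i t). Qed.

Lemma image_sext k (s : singular R X k) x : simage s (sext s x).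
Proof. by exists (spoint (sretract x)). Qed.

End Simplices.

(** * Integration over affine cells and smooth simplices *)

Section Integration.
Context {R : realType}.

Lemma hull1 k : hull (1%:M : 'M[R]_k.+1) = simplex R k.
Proof.
by apply/seteqP; split=> [_ [t st <-]|t st]; [rewrite mulmx1|exists t; rewrite ?mulmx1].
Qed.

Lemma facemap0_affine k K (V : 'M[R]_(k.+1, K)) :
  (fun x => facemap ord0 x *m V) = (fun x => x *m (facemx ord0 *m V) + facemap ord0 0 *m V).
Proof. by apply/funext => x; rewrite {1}facemap_affine mulmxDl mulmxA. Qed.

Lemma facemap0_hull k K (V : 'M[R]_(k.+1, K)) x : csimplex R k x -> hull V (facemap ord0 x *m V).
Proof. by move=> cx; exists (facemap ord0 x) => //; exact: simplex_facemap0. Qed.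

Definition cellint {k K} (eta : 'rV[R]_K -> 'M[R]_(k, K) -> R) (V : 'M[R]_(k.+1, K)) : R :=
  simplex_integral 1 (fun x => eta (facemap ord0 x *m V) (facemx ord0 *m V)).

Section Eform.
Context {k K : nat} (O : set 'rV[R]_K).
Hypothesis oO : open O.

Lemma facemap_facemap0 i (u : 'rV[R]_k) (V : 'M[R]_(k.+2, K)) :
  facemap ord0 (facemap i u) *m V = facemap ord0 u *m row' i V.
Proof.
rewrite -insv0_mul; congr (_ *m _); rewrite {1 3}/facemap !unlift_none.
case: (unliftP ord0 i) => [i' ->|->]; rewrite /facemap ?liftK ?unlift_none.
  by rewrite sum_insv add0r insv_lift_cons.
by rewrite sum_insv subrK subrr.
Qed.

(** [facemap_facemap0] is an identity between affine maps; this is the equality of their linear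
    parts. *)
Lemma facemx_facemx0 i (V : 'M[R]_(k.+2, K)) :
  facemx i *m (facemx ord0 *m V) = facemx ord0 *m row' i V :> 'M[R]_(k, K).
Proof.
set A := facemx ord0 *m V; set B := _ *m row' i V.
have H (u : 'rV[R]_k) : (u *m facemx i + facemap i 0) *m A + facemap ord0 0 *m V =
    u *m B + facemap ord0 0 *m row' i V.
  have := facemap_facemap0 i u V; have /(congr1 (fun f => f u)) /= -> := @facemap_affine R k i.
  have /(congr1 (fun f => f (u *m facemx i + facemap i 0))) /= -> := facemap0_affine V.
  by have /(congr1 (fun f => f u)) /= -> := facemap0_affine (row' i V).
have E (u : 'rV[R]_k) : u *m (facemx i *m A) = u *m B.
  have := H 0; rewrite !mul0mx !add0r => H0; have := H u.
  by rewrite -H0 mulmxDl mulmxA -addrA => /addIr.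
by apply/row_matrixP => a; rewrite !rowE.
Qed.

Lemma Dmx_facemap0 l (V : 'M[R]_(k.+1, K)) x (v : 'M[R]_(l, k)) :
  Dmx (fun x => facemap ord0 x *m V) x v = v *m (facemx ord0 *m V).
Proof. by rewrite facemap0_affine Dmx_affine. Qed.

Lemma smooth_facemap0 (V : 'M[R]_(k.+1, K)) U : open U -> smooth_on U (fun x : 'rV[R]_k => facemap ord0 x *m V).
Proof. by rewrite facemap0_affine; exact: smooth_affine. Qed.

Lemma preim_facemap0_open (V : 'M[R]_(k.+1, K)) : open ((fun x : 'rV[R]_k => facemap ord0 x *m V) @^-1` O).
Proof.
apply: open_preim => //; apply: (ccomp (@row_mulmx_continuous _ _ _ V)); exact: continuous_facemap.
Qed.

Lemma preim_facemap0_sub (V : 'M[R]_(k.+1, K)) : hull V `<=` O ->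
  csimplex R k `<=` (fun x : 'rV[R]_k => facemap ord0 x *m V) @^-1` O.
Proof. by move=> sV x cx; apply: sV; exact: facemap0_hull. Qed.

Lemma cellint_repr (eta : 'rV[R]_K -> 'M[R]_(k, K) -> R) (V : 'M[R]_(k.+1, K)) : hull V `<=` O ->
  (forall v, smooth_on O (eta ^~ v : _ -> R^o)) -> exists f : 'rV[R]_k -> R^o, continuous f /\
  forall x, csimplex R k x -> f x = eta (facemap ord0 x *m V) (facemx ord0 *m V).
Proof.
move=> sV se.
exists (fun x => eta (facemap ord0 (simplex_retract x) *m V) (facemx ord0 *m V)); split; last first.
  by move=> x cx; rewrite simplex_retract_id.
pose f (x : 'rV[R]_k) : R^o := eta (facemap ord0 x *m V) (facemx ord0 *m V).
apply: (@continuous_retract _ _ _ f (preim_facemap0_sub sV)) => x Ox.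
apply: (@continuous_comp _ _ _ (fun x : 'rV[R]_k => facemap ord0 x *m V) (fun y => eta y (facemx ord0 *m V) : R^o)).
  by apply: (ccomp (@row_mulmx_continuous _ _ _ V)); exact: continuous_facemap.
exact: smooth_continuous (se _) Ox.
Qed.

Lemma eq_cellint (eta eta' : 'rV[R]_K -> 'M[R]_(k, K) -> R) (V : 'M[R]_(k.+1, K)) :
  (forall x v, hull V x -> eta x v = eta' x v) -> cellint eta V = cellint eta' V.
Proof.
move=> E; apply: eq_simplex_integral => // x x0 x1; apply: E; apply: facemap0_hull.
exact: osimplex_csimplex.
Qed.

Lemma cellint_lin (c : R) (eta eta' : 'rV[R]_K -> 'M[R]_(k, K) -> R) (V : 'M[R]_(k.+1, K)) : hull V `<=` O ->
  (forall v, smooth_on O (eta ^~ v : _ -> R^o)) -> (forall v, smooth_on O (eta' ^~ v : _ -> R^o)) ->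
  cellint (fun x v => eta x v + c * eta' x v) V = cellint eta V + c * cellint eta' V.
Proof.
move=> sV se se'; have [f [cf Ef]] := cellint_repr sV se; have [g [cg Eg]] := cellint_repr sV se'.
have E h (h' : 'rV[R]_k -> R) : (forall x, csimplex R k x -> h x = h' x) -> simplex_integral 1 h = simplex_integral 1 h'.
  by move=> hh; apply: eq_simplex_integral => // x x0 x1; apply: hh; exact: osimplex_csimplex.
rewrite /cellint -(E _ _ Ef) -(E _ _ Eg) -simplex_integralZ// -simplex_integralD//; last first.
  by apply: cfunM => //; exact: cfunC.
by apply: E => x cx; rewrite Ef// Eg.
Qed.

End Eform.

Lemma cellint_stokes k K (O : set 'rV[R]_K) (eta : 'rV[R]_K -> 'M[R]_(k, K) -> R) (V : 'M[R]_(k.+2, K)) :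
  open O -> is_eform O eta -> hull V `<=` O ->
  cellint (dE eta) V = \sum_(i < k.+2) (-1) ^+ i * cellint eta (row' i V).
Proof.
move=> oO fe sV.
pose h (x : 'rV[R]_k.+1) := facemap ord0 x *m V.
have oU := @preim_facemap0_open k.+1 K O oO V; have sU := preim_facemap0_sub sV.
have sh : smooth_on (h @^-1` O) h by exact: smooth_facemap0.
have feU : is_eform (h @^-1` O) (epull h eta) by apply: (epull_eform oU oO sh).
transitivity (simplex_integral 1 (fun x => dE (epull h eta) x 1%:M)).
  apply: eq_simplex_integral => // x x0 x1.
  have Ox : (h @^-1` O) x by apply: sU; exact: osimplex_csimplex.
  by rewrite (dE_epull oU oO sh _ fe _ Ox)// Dmx_facemap0 mul1mx.
rewrite (euclidean_stokes oU sU feU); apply: eq_bigr => i _; congr (_ * _).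
apply: eq_simplex_integral => // u u0 u1.
rewrite /epull /h facemap_facemap0 Dmx_facemap0 -facemx_facemx0.
by have -> : Dmx (facemap i) u 1%:M = facemx i by rewrite facemap_affine Dmx_affine mul1mx.
Qed.

End Integration.

Section ManifoldIntegration.
Context {R : realType}.

Section OneManifold.
Context {n : nat} {M : manifold R n}.

Lemma smooth_param_hull l K (O : set 'rV[R]_K) (h : 'rV[R]_K -> M) (V : 'M[R]_(l.+1, K)) :
  smooth_param O h -> hull V `<=` O -> forall x, hull V x -> {for x, continuous h}.
Proof. by move=> [_ ch _] sV x /sV; exact: ch. Qed.

Lemma smooth_simplex_asimp l K (O : set 'rV[R]_K) (h : 'rV[R]_K -> M) (V : 'M[R]_(l.+1, K)) :
  smooth_param O h -> hull V `<=` O -> smooth_simplex (asimp h V).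
Proof.
move=> sh sV; have [oO _ _] := sh.
pose W := (fun x => x *m V) @^-1` O.
have oW : open W by apply: open_preim => //; exact: row_mulmx_continuous.
have sW : smooth_param W (h \o (fun x => x *m V)).
  apply: (smooth_param_comp sh oW) => //.
  have -> : (fun x : 'rV[R]_l.+1 => x *m V) = (fun x => x *m V + 0).
    by apply/funext => x; rewrite addr0.
  exact: smooth_affine.
have [_ cW sc] := sW.
exists W, (h \o (fun x => x *m V)); split=> //.
- by move=> t st; apply: sV; exists t.
- by rewrite (continuous_open_subspace _ oW) => x; rewrite inE; exact: cW.
- by move=> t; rewrite asimpE//; exact: smooth_param_hull sV.
Qed.

Lemma smooth_simplexP k (s : singular R M k) : smooth_simplex s ->
  exists O h, [/\ smooth_param O h, simplex R k `<=` O & s = asimp h 1%:M].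
Proof.
move=> [ O [h [oO sO ch sh E]]].
have sp : smooth_param O h.
  split=> // x Ox; move: ch; rewrite (continuous_open_subspace _ oO) => /(_ x).
  by apply; rewrite inE.
exists O, h; split=> //; apply: singular_eq => t.
by rewrite asimpE ?mulmx1//; apply: smooth_param_hull sp _; rewrite hull1.
Qed.

Lemma smooth_simplex_in k (s : singular R M k) (W : set M) : smooth_simplex s -> open W -> simage s `<=` W ->
  exists O h, [/\ smooth_param O h, simplex R k `<=` O, s = asimp h 1%:M & forall x, O x -> W (h x)].
Proof.
move=> /smooth_simplexP[ O [h [sp sO E]]] oW sW; have [oO ch _] := sp.
have E1 t : simplex R k t -> s (spoint t) = h t.
  move=> st; rewrite E asimpE ?mulmx1 ?spointK//.
  by apply: smooth_param_hull sp _; rewrite hull1.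
exists (O `&` h @^-1` W), h; split=> //.
- by apply: smooth_param_sub sp => [|x []//]; exact: open_preim_at.
- by move=> t st; split; [exact: sO|rewrite /= -E1//; apply: sW; exists (spoint t)].
- by move=> x [].
Qed.

Lemma smooth_simplex_affine k l (s : singular R M k) (S : 'M[R]_(l.+1, k.+1)) :
  smooth_simplex s -> stochastic S -> smooth_simplex (asimp (sext s) S).
Proof.
move=> /smooth_simplexP[ O [h [sp sO ->]]] sS.
have s1 : hull (1%:M : 'M[R]_k.+1) `<=` O by rewrite hull1.
rewrite sext_asimp//; last exact: smooth_param_hull sp s1.
apply: (smooth_simplex_asimp sp); rewrite mulmx1 => x /(hull_stochastic sS); exact: sO.
Qed.

Lemma smooth_simplex_face k (s : singular R M k.+1) i : smooth_simplex s -> smooth_simplex (sing_face i s).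
Proof.
move=> ss; rewrite -[sing_face i s]asimp_sext face_sext; last exact: stochastic1.
by apply: smooth_simplex_affine => //; rewrite mul1mx; apply: stochastic_row'; exact: stochastic1.
Qed.

Lemma pullx_frame l (g : 'rV[R]_l -> M) (w : diff_form M l) (x : 'rV[R]_l) :
  w (g x) (\matrix_(i < l) 'D_(delta_mx 0 i) (cto (mchart (g x)) \o g) x) = pullx g w x 1%:M.
Proof.
have E (f : 'rV[R]_l -> 'rV[R]_n) : \matrix_(i < l) 'D_(delta_mx 0 i) f x = Dmx f x 1%:M.
  by apply/matrixP => i j; rewrite [LHS]mxE [RHS]mxE -row1.
by rewrite E.
Qed.

Lemma integrate_asimp l K (O : set 'rV[R]_K) (h : 'rV[R]_K -> M) (V : 'M[R]_(l.+1, K)) (w : diff_form M l) :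
  smooth_param O h -> hull V `<=` O -> integrate w (asimp h V) = cellint (pullx h w) V.
Proof.
move=> sp sV; have [oO ch _] := sp.
pose f (x : 'rV[R]_l) := facemap ord0 x *m V.
have oU := @preim_facemap0_open _ l K O oO V; have sU := preim_facemap0_sub sV.
(* [sing_coord] takes a default value off the closed simplex, so the derivatives of the two maps are
   compared in the open simplex, where the maps agree near each point. *)
have E y : osimplex R l y -> sing_coord (asimp h V) y = (h \o f) y.
  move=> /osimplex_csimplex cy.
  have -> : sing_coord (asimp h V) y = asimp h V (spoint (facemap ord0 y)).
    by rewrite /sing_coord row_mxE0 /facemap unlift_none.
  rewrite asimpE; last exact: smooth_param_hull sp sV.
  by rewrite spointK//; exact: simplex_facemap0.
apply: (eq_simplex_integral ltr01) => x x0 x1.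
have ox : osimplex R l x by [].
rewrite pullx_frame.
rewrite (eq_pullx w 1%:M (open_osimplex (k:=l)) ox E).
rewrite (pullx_comp w 1%:M sp oU (smooth_facemap0 V oU)) => [|//|]; last first.
  by apply: sU; exact: osimplex_csimplex.
by rewrite /epull Dmx_facemap0 mul1mx.
Qed.

Lemma integrate_stokes k (w : diff_form M k) (W : set M) (s : singular R M k.+1) :
  open W -> is_form W w -> smooth_simplex s -> simage s `<=` W ->
  integrate (ext_d w) s = \sum_(i < k.+2) (-1) ^+ i * integrate w (sing_face i s).
Proof.
move=> oW fw ss sW; have [ O [h [sp sO -> hW]]] := smooth_simplex_in ss oW sW.
have s1 : hull (1%:M : 'M[R]_k.+2) `<=` O by rewrite hull1.
have [oO _ _] := sp.
rewrite (integrate_asimp _ sp s1).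
rewrite (@eq_cellint _ _ _ _ (dE (pullx h w))); last first.
  by move=> x v /s1 Ox; rewrite (dE_pullx sp oW fw hW).
rewrite (cellint_stokes oO (pullx_eform sp oW fw hW) s1); apply: eq_bigr => i _; congr (_ * _).
rewrite face_asimp; last exact: smooth_param_hull sp s1.
by rewrite (integrate_asimp _ sp)// => x /hull_row'; exact: s1.
Qed.

Lemma eq_integrate k (w w' : diff_form M k) (s : singular R M k) :
  (forall p v, simage s p -> w p v = w' p v) -> integrate w s = integrate w' s.
Proof.
move=> E; apply: eq_simplex_integral => // x x0 x1; apply: E.
by exists (insubd (vertex k) (row_mx (1 - \sum_i x 0 i)%:M x)).
Qed.

Lemma integrate_lin k c (w w' : diff_form M k) (W : set M) (s : singular R M k) :
  open W -> is_form W w -> is_form W w' -> smooth_simplex s -> simage s `<=` W ->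
  integrate (fun p v => w p v + c * w' p v) s = integrate w s + c * integrate w' s.
Proof.
move=> oW fw fw' ss sW; have [ O [h [sp sO -> hW]]] := smooth_simplex_in ss oW sW.
have s1 : hull (1%:M : 'M[R]_k.+1) `<=` O by rewrite hull1.
have [oO _ _] := sp.
rewrite !(integrate_asimp _ sp s1).
have [_ sw] := pullx_eform sp oW fw hW; have [_ sw'] := pullx_eform sp oW fw' hW.
exact: (cellint_lin c s1 sw sw').
Qed.

Lemma integrateD k (w w' : diff_form M k) (W : set M) (s : singular R M k) :
  open W -> is_form W w -> is_form W w' -> smooth_simplex s -> simage s `<=` W ->
  integrate (fun p v => w p v + w' p v) s = integrate w s + integrate w' s.
Proof.
move=> oW fw fw' ss sW; rewrite -[X in _ = _ + X]mul1r -(integrate_lin _ oW)//.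
by congr (integrate _ s); apply/funext => p; apply/funext => v; rewrite mul1r.
Qed.

Lemma integrateB k (w w' : diff_form M k) (W : set M) (s : singular R M k) :
  open W -> is_form W w -> is_form W w' -> smooth_simplex s -> simage s `<=` W ->
  integrate (fun p v => w p v - w' p v) s = integrate w s - integrate w' s.
Proof.
move=> oW fw fw' ss sW; rewrite -[X in _ = _ - X]mul1r -mulNr -(integrate_lin _ oW)//.
by congr (integrate _ s); apply/funext => p; apply/funext => v; rewrite mulN1r.
Qed.

Lemma is_form_sub k (w : diff_form M k) (W W' : set M) : W' `<=` W -> is_form W w -> is_form W' w.
Proof.
move=> sW [wa ws]; split=> [p /sW|c ac v]; first exact: wa.
by apply: sub_smooth (ws c ac v) => x [p [cp /sW Wp] <-]; exists p.
Qed.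

Lemma alternating_lin (k : nat) c (f g : 'M[R]_(k, n) -> R) : alternating f -> alternating g ->
  alternating (fun v => f v + c * g v).
Proof.
move=> [f1 f2] [g1 g2]; split=> [i A B C b d E1 E2 E3|i j A ij E].
  by rewrite (f1 i A B C b d)// (g1 i A B C b d)//; ring.
by rewrite (f2 i j)// (g2 i j)// mulr0 addr0.
Qed.

Lemma is_form_lin k c (w w' : diff_form M k) (W : set M) : open W -> is_form W w -> is_form W w' ->
  is_form W (fun p v => w p v + c * w' p v).
Proof.
move=> oW [wa ws] [wa' ws']; split=> [p Wp|d ad v]; first by apply: alternating_lin; [exact: wa|exact: wa'].
have oU := chart_sub_open ad oW.
by apply: smooth_add => //; [exact: ws|apply: smooth_mul => //; [exact: smooth_cst|exact: ws']].
Qed.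

Lemma is_formD k (w w' : diff_form M k) (W : set M) : open W -> is_form W w -> is_form W w' ->
  is_form W (fun p v => w p v + w' p v).
Proof.
move=> oW fw fw'; have := is_form_lin 1 oW fw fw'.
by congr is_form; apply/funext => p; apply/funext => v; rewrite mul1r.
Qed.

Lemma is_formB k (w w' : diff_form M k) (W : set M) : open W -> is_form W w -> is_form W w' ->
  is_form W (fun p v => w p v - w' p v).
Proof.
move=> oW fw fw'; have := is_form_lin (-1) oW fw fw'.
by congr is_form; apply/funext => p; apply/funext => v; rewrite mulN1r.
Qed.

Lemma eq_is_form k (w w' : diff_form M k) (W : set M) : open W -> (forall p v, W p -> w p v = w' p v) ->
  is_form W w -> is_form W w'.
Proof.
move=> oW E [wa ws]; split=> [p Wp|c ac v].
  by have -> : w' p = w p; [apply/funext => v; rewrite -E|exact: wa].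
apply: (eq_smooth (chart_sub_open ac oW) _ (ws c ac v)) => x [p [cp Wp] <-].
by rewrite /form_in_chart E//= cfromK.
Qed.

Lemma eq_ext_d k (w w' : diff_form M k) (W : set M) p v : open W -> W p ->
  (forall p v, W p -> w p v = w' p v) -> ext_d w p v = ext_d w' p v.
Proof.
move=> oW Wp E; have ac := mchart_atlas p; have cp := mchart_dom p.
have Ux : chart_sub (mchart p) W (cto (mchart p) p) by exists p.
apply: (eq_dE v (chart_sub_open ac oW) Ux) => x u; rewrite (chart_subE _ ac) => -[_ Wx].
exact: E.
Qed.

Lemma ext_d_lin k c (w w' : diff_form M k) (W : set M) p v : open W -> is_form W w -> is_form W w' ->
  W p -> ext_d (fun p v => w p v + c * w' p v) p v = ext_d w p v + c * ext_d w' p v.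
Proof.
move=> oW [_ sw] [_ sw'] Wp; have ac := mchart_atlas p; have cp := mchart_dom p.
have Ux : chart_sub (mchart p) W (cto (mchart p) p) by exists p.
rewrite mulr_sumr -big_split /=; apply: eq_bigr => i _.
rewrite mulrCA -mulrDr; congr (_ * _).
set f := fun x => form_in_chart w _ x _; set g := fun x => form_in_chart w' _ x _.
have df := smooth_derivable (v := row i v) (sw _ ac (row' i v)) Ux.
have dg := smooth_derivable (v := row i v) (sw' _ ac (row' i v)) Ux.
by rewrite (@deriveD _ _ _ f (c *: g)) ?deriveZ//; exact: derivableZ.
Qed.

Lemma ext_dB k (w w' : diff_form M k) (W : set M) p v : open W -> is_form W w -> is_form W w' ->
  W p -> ext_d (fun p v => w p v - w' p v) p v = ext_d w p v - ext_d w' p v.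
Proof.
move=> oW fw fw' Wp; rewrite -[X in _ = _ - X]mul1r -mulNr -(ext_d_lin _ _ oW fw fw' Wp).
by congr (ext_d _ p v); apply/funext => q; apply/funext => u; rewrite mulN1r.
Qed.

End OneManifold.

Section Maps.
Context {m n : nat} {M : manifold R m} {N : manifold R n} (Phi : smooth_map M N).

Lemma sing_comp_asimp k K (h : 'rV[R]_K -> M) (V : 'M[R]_(k.+1, K)) :
  (forall x, hull V x -> {for x, continuous h}) -> sing_comp Phi (asimp h V) = asimp (Phi \o h) V.
Proof.
move=> ch; apply: singular_eq => t; rewrite /= asimpE// asimpE// => x hx.
by apply: continuous_comp; [exact: ch|exact: smap_continuous].
Qed.

Lemma sing_comp_smooth k (s : singular R M k) : smooth_simplex s -> smooth_simplex (sing_comp Phi s).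
Proof.
move=> /smooth_simplexP[ O [h [sp sO ->]]].
have s1 : hull (1%:M : 'M[R]_k.+1) `<=` O by rewrite hull1.
rewrite sing_comp_asimp; last exact: smooth_param_hull sp s1.
exact: (smooth_simplex_asimp (smooth_param_map Phi sp) s1).
Qed.

Lemma integrate_map k (w : diff_form N k) (s : singular R M k) : smooth_simplex s ->
  integrate w (sing_comp Phi s) = integrate (pull_form Phi w) s.
Proof.
move=> /smooth_simplexP[ O [h [sp sO ->]]].
have s1 : hull (1%:M : 'M[R]_k.+1) `<=` O by rewrite hull1.
rewrite sing_comp_asimp; last exact: smooth_param_hull sp s1.
rewrite (integrate_asimp _ (smooth_param_map Phi sp) s1) (integrate_asimp _ sp s1).
by apply: eq_cellint => x v /s1 Ox; rewrite (pullx_map _ _ _ sp Ox).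
Qed.

Lemma simage_comp k (s : singular R M k) (U : set M) (V : set N) : simage s `<=` U -> U `<=` Phi @^-1` V ->
  simage (sing_comp Phi s) `<=` V.
Proof. by move=> sU UV _ [t _ <-]; apply: UV; apply: sU; exists t. Qed.

Lemma sing_comp_face k (s : singular R M k.+1) i : sing_comp Phi (sing_face i s) = sing_face i (sing_comp Phi s).
Proof. exact: singular_eq. Qed.

End Maps.
End ManifoldIntegration.

(** * Barycentric subdivision and extension of cochains *)

Section AffineCochains.
Context {R : realType}.

(** G is 0 for equations between real cochains and Z for congruences; the same arguments serve for
    both. *)
Definition subgroup (G : R -> Prop) := G 0 /\ forall a b, G a -> G b -> G (a - b).

Lemma subgroupN G a : subgroup G -> G a -> G (- a).
Proof. by move=> [G0 GB] Ga; rewrite -sub0r; exact: GB. Qed.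

Lemma subgroupD G a b : subgroup G -> G a -> G b -> G (a + b).
Proof. by move=> sG Ga Gb; rewrite -[b]opprK; apply: sG.2 => //; exact: subgroupN. Qed.

Lemma subgroup_sign G (i : nat) a : subgroup G -> G a -> G ((-1) ^+ i * a).
Proof. move=> sG Ga; elim: i => [|i IH]; first by rewrite expr0 mul1r.
by rewrite exprS mulN1r mulNr; exact: subgroupN. Qed.

Lemma subgroup_sum G (I : Type) (r : seq I) (f : I -> R) : subgroup G -> (forall i, G (f i)) ->
  G (\sum_(i <- r) f i).
Proof.
move=> sG Gf; elim: r => [|i r IH]; first by rewrite big_nil; exact: sG.1.
by rewrite big_cons; exact: subgroupD.
Qed.

Lemma subgroup0 : subgroup (fun a : R => a = 0).
Proof. by split=> // a b -> ->; rewrite subr0. Qed.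

Lemma subgroup_int : subgroup (fun a : R => a \is a Num.int).
Proof. by split=> [|a b ia ib]; [rewrite rpred0|rewrite rpredB]. Qed.

Definition dA {l K} (phi : 'M[R]_(l.+1, K) -> R) (V : 'M[R]_(l.+2, K)) : R :=
  \sum_(i < l.+2) (-1) ^+ i * phi (row' i V).

(** Coning with apex b, on cochains: it contracts the affine complex, up to a correction in degree
    0, as [kap_dA] and [kap_dA0] show. *)
Definition kap {l K} (b : 'rV[R]_K) (phi : 'M[R]_(l.+1, K) -> R) (V : 'M[R]_(l, K)) : R :=
  phi (ins_row ord0 b V).

Lemma dAB l K (phi psi : 'M[R]_(l.+1, K) -> R) : dA (fun V => phi V - psi V) = (fun V => dA phi V - dA psi V).
Proof.
by apply/funext => V; rewrite /dA -sumrB; apply: eq_bigr => i _; rewrite mulrBr.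
Qed.

Lemma dA_dA l K (phi : 'M[R]_(l.+1, K) -> R) V : dA (dA phi) V = 0.
Proof.
rewrite -[RHS](altsum_row' V (g := fun _ _ => phi))//; apply: eq_bigr => i _.
by rewrite /dA mulr_sumr.
Qed.

Lemma row'_ins_row0 l K (b : 'rV[R]_K) (V : 'M[R]_(l.+1, K)) i :
  row' (lift ord0 i) (ins_row ord0 b V) = ins_row ord0 b (row' i V).
Proof.
apply/matrixP => a c; rewrite !mxE; case: (unliftP ord0 a) => [a' ->|->].
  have -> : lift (lift ord0 i) (lift ord0 a') = lift ord0 (lift i a') :> 'I_l.+2.
    by apply: val_inj; rewrite /= /bump; lia.
  by rewrite liftK mxE.
have -> : lift (lift ord0 i) ord0 = ord0 :> 'I_l.+2 by exact: val_inj.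
by rewrite unlift_none.
Qed.

Lemma kap_dA l K b (phi : 'M[R]_(l.+2, K) -> R) :
  kap b (dA phi) = (fun V => phi V - dA (kap b phi) V).
Proof.
apply/funext => V; rewrite /kap /dA big_ord_recl expr0 mul1r row'_ins_row; congr (_ + _).
rewrite -sumrN; apply: eq_bigr => i _; rewrite row'_ins_row0.
by rewrite /= /bump /= add1n exprS mulN1r mulNr.
Qed.

Lemma kap_dA0 K b (phi : 'M[R]_(1, K) -> R) : kap b (dA phi) = (fun V => phi V - phi b).
Proof.
apply/funext => V; rewrite /kap /dA big_ord_recl big_ord1 expr0 mul1r row'_ins_row expr1 mulN1r.
congr (_ - phi _); apply/rowP => c; rewrite !mxE (ord1 0).
have -> : lift (lift ord0 ord0) ord0 = ord0 :> 'I_2 by exact: val_inj.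
by rewrite unlift_none.
Qed.

Lemma ins_row_mul l K K' (b : 'rV[R]_K) (V : 'M[R]_(l, K)) (A : 'M[R]_(K, K')) :
  ins_row ord0 b V *m A = ins_row ord0 (b *m A) (V *m A).
Proof.
apply/matrixP => a c; rewrite !mxE; case: unliftP => [a' ->|->].
  by rewrite mxE; apply: eq_bigr => d _; rewrite !mxE liftK.
by apply: eq_bigr => d _; rewrite !mxE unlift_none.
Qed.

Lemma row'_mul l K K' (V : 'M[R]_(l.+1, K)) (A : 'M[R]_(K, K')) i : row' i (V *m A) = row' i V *m A.
Proof.
by apply/matrixP => a c; rewrite !mxE; apply: eq_bigr => d _; rewrite !mxE.
Qed.

(* A natural chain map F of augmentation 0 is null-homotopic: cone the cycle
   F - H d off a point. The operators are written on cochains. *)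
Section ConeHomotopy.
Context {K K' : nat}.
Variables (F : forall l, ('M[R]_(l.+1, K') -> R) -> 'M[R]_(l.+1, K) -> R)
  (b : forall l, 'M[R]_(l.+1, K) -> 'rV[R]_K').

Fixpoint coneH (l : nat) : ('M[R]_(l.+2, K') -> R) -> 'M[R]_(l.+1, K) -> R :=
  match l with
  | 0 => fun phi V => F (kap (b V) phi) V
  | l'.+1 => fun phi V => F (kap (b V) phi) V -
      \sum_(i < l'.+2) (-1) ^+ i * coneH (kap (b V) phi) (row' i V)
  end.

Hypothesis FB : forall l (phi psi : 'M[R]_(l.+1, K') -> R) V,
  F (fun W => phi W - psi W) V = F phi V - F psi V.
Hypothesis FdA : forall l (phi : 'M[R]_(l.+1, K') -> R) V, F (dA phi) V = dA (F phi) V.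
Hypothesis F0 : forall c V, F (l := 0) (fun _ => c) V = 0.

Lemma coneHB l (phi psi : 'M[R]_(l.+2, K') -> R) V :
  coneH (fun W => phi W - psi W) V = coneH phi V - coneH psi V.
Proof.
elim: l phi psi V => [|l IH] phi psi V /=; first exact: FB.
have A (x y z t : R) : x - y - (z - t) = x - z - (y - t) by ring.
have -> : kap (b V) (fun W => phi W - psi W) = (fun W => kap (b V) phi W - kap (b V) psi W) by [].
rewrite FB A -sumrB; congr (_ - _).
by apply: eq_bigr => i _; rewrite -mulrBr -IH.
Qed.

Lemma coneH0 (phi : 'M[R]_(1, K') -> R) V : coneH (dA phi) V = F phi V.
Proof. by rewrite /= kap_dA0 FB F0 subr0. Qed.

(** The homotopy formula in one degree follows from this identity in that degree and yields the
    identity in the next, so the two advance together in one induction. *)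
Let coneH_key l := forall (c : 'M[R]_(l.+1, K') -> R) V, dA (coneH (dA c)) V = dA (F c) V.

Let coneH_step l : coneH_key l -> forall (phi : 'M[R]_(l.+2, K') -> R) V,
  coneH (dA phi) V = F phi V - dA (coneH phi) V.
Proof.
move=> key phi V; rewrite /= kap_dA FB FdA; set c := kap _ phi.
rewrite -[X in _ - X = _]/(dA (coneH (fun W => phi W - dA c W)) V).
have -> : coneH (fun W => phi W - dA c W) = (fun V => coneH phi V - coneH (dA c) V).
  by apply/funext => W; exact: coneHB.
by rewrite dAB key opprB addrA subrK.
Qed.

Let coneH_keyP l : coneH_key l.
Proof.
elim: l => [|l IH] c V.
  by congr (dA _ V); apply/funext => W; exact: coneH0.
have -> : coneH (dA c) = (fun V => F c V - dA (coneH c) V).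
  by apply/funext => W; exact: coneH_step.
by rewrite dAB dA_dA subr0.
Qed.

Lemma coneHS l (phi : 'M[R]_(l.+2, K') -> R) V :
  coneH (dA phi) V + dA (coneH phi) V = F phi V.
Proof. by rewrite coneH_step ?subrK//; exact: coneH_keyP. Qed.

(** [sub V W] bounds the simplices W at which the operator evaluates its argument over V. With G =
    0, applied to a difference, this shows that the operator depends only on these values; with G =
    Z it preserves integrality. *)
Lemma coneH_subgroup (sub : forall l r, 'M[R]_(l.+1, K) -> 'M[R]_(r.+1, K') -> Prop) G :
  subgroup G ->
  (forall l r (V : 'M[R]_(l.+2, K)) i (W : 'M[R]_(r.+1, K')), sub _ _ (row' i V) W -> sub _ _ V W) ->
  (forall l r (V : 'M[R]_(l.+1, K)) (W : 'M[R]_(r.+1, K')), sub _ _ V W -> sub _ _ V (ins_row ord0 (b V) W)) ->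
  (forall l (phi : 'M[R]_(l.+1, K') -> R) V, (forall W, sub _ _ V W -> G (phi W)) -> G (F phi V)) ->
  forall l (phi : 'M[R]_(l.+2, K') -> R) V, (forall W, sub _ _ V W -> G (phi W)) -> G (coneH phi V).
Proof.
move=> sG sub' subb FG; elim=> [|l IH] phi V Gphi /=.
  by apply: FG => W VW; apply: Gphi; exact: subb.
apply: sG.2; first by apply: FG => W VW; apply: Gphi; exact: subb.
apply: subgroup_sum => // i; apply: subgroup_sign => //; apply: IH => W VW.
by apply: Gphi; apply: subb; exact: sub' VW.
Qed.

End ConeHomotopy.

Lemma coneH_natural (K1 K1' K2 K2' : nat) F1 b1 F2 b2 (A : 'M[R]_(K1, K2)) (A' : 'M[R]_(K1', K2')) :
  (forall l (phi : 'M[R]_(l.+1, K2') -> R) (V : 'M[R]_(l.+1, K1)),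
     F1 l (fun W : 'M[R]_(l.+1, K1') => phi (W *m A')) V = F2 l phi (V *m A)) ->
  (forall l (V : 'M[R]_(l.+1, K1)), b1 l V *m A' = b2 l (V *m A)) ->
  forall l (phi : 'M[R]_(l.+2, K2') -> R) (V : 'M[R]_(l.+1, K1)),
   coneH F1 b1 (fun W : 'M[R]_(l.+2, K1') => phi (W *m A')) V = coneH F2 b2 phi (V *m A).
Proof.
move=> FA bA.
have E l (V : 'M[R]_(l.+1, K1)) r (phi' : 'M[R]_(r.+1, K2') -> R) :
    kap (b1 l V) (fun W : 'M[R]_(r.+1, K1') => phi' (W *m A')) =
    (fun W => kap (b2 l (V *m A)) phi' (W *m A')) :> ('M[R]_(r, K1') -> R).
  by apply/funext => W; rewrite /kap ins_row_mul bA.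
elim=> [|l IH] phi V /=.
  by rewrite E (FA 0%N (kap (b2 _ (V *m A)) phi)).
rewrite E (FA _ (kap (b2 _ (V *m A)) phi)); congr (_ - _); apply: eq_bigr => i _; congr (_ * _).
by rewrite row'_mul -IH.
Qed.

Definition bary {l K} (V : 'M[R]_(l.+1, K)) : 'rV[R]_K := const_mx (l.+1%:R^-1) *m V.

(** Barycentric subdivision, dual to the usual chain map: the faces are subdivided and coned off the
    barycentre. *)
Fixpoint Sd (l : nat) {K} : ('M[R]_(l.+1, K) -> R) -> 'M[R]_(l.+1, K) -> R :=
  match l with
  | 0 => fun phi V => phi V
  | l'.+1 => fun phi V => \sum_(i < l'.+2) (-1) ^+ i * Sd (kap (bary V) phi) (row' i V)
  end.

Lemma SdB l K (phi psi : 'M[R]_(l.+1, K) -> R) V :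
  Sd (fun W => phi W - psi W) V = Sd phi V - Sd psi V.
Proof.
elim: l phi psi V => [//|l IH] phi psi V /=.
by rewrite -sumrB; apply: eq_bigr => i _; rewrite -mulrBr -IH.
Qed.

Lemma Sd_dA l K (phi : 'M[R]_(l.+1, K) -> R) V : Sd (dA phi) V = dA (Sd phi) V.
Proof.
elim: l phi V => [|l IH] phi V.
  rewrite [LHS]/= kap_dA0 /dA; transitivity (dA (fun W => phi W - phi (bary V)) V) => //.
  rewrite dAB /dA !big_ord_recl !big_ord0 expr0 !mul1r !addr0 [_ ^+ _]expr1 !mulN1r.
  by rewrite subrr subr0.
rewrite [LHS]/= kap_dA; set c := kap _ phi.
rewrite -[LHS]/(dA (Sd (fun W => phi W - dA c W)) V).
have -> : Sd (fun W => phi W - dA c W) = (fun W => Sd phi W - Sd (dA c) W).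
  by apply/funext => W; exact: SdB.
have -> : Sd (dA c) = dA (Sd c) by apply/funext => W; exact: IH.
by rewrite dAB dA_dA subr0.
Qed.

Lemma Sd_natural l K K' (A : 'M[R]_(K, K')) (phi : 'M[R]_(l.+1, K') -> R) V :
  Sd (fun W => phi (W *m A)) V = Sd phi (V *m A).
Proof.
elim: l phi V => [//|l IH] phi V /=; apply: eq_bigr => i _; congr (_ * _).
rewrite row'_mul -IH; congr (Sd _ _); apply/funext => W.
by rewrite /kap ins_row_mul /bary mulmxA.
Qed.

(** The simplices that occur in the barycentric subdivision of V, without their signs. *)
Inductive sd_piece {K} : forall l, 'M[R]_(l.+1, K) -> 'M[R]_(l.+1, K) -> Prop :=
| sd_piece0 (V : 'M[R]_(1, K)) : sd_piece V V
| sd_pieceS l (V : 'M[R]_(l.+2, K)) i W : sd_piece (row' i V) W -> sd_piece V (ins_row ord0 (bary V) W).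

Lemma Sd_subgroup G l K (phi : 'M[R]_(l.+1, K) -> R) V : subgroup G ->
  (forall W, sd_piece V W -> G (phi W)) -> G (Sd phi V).
Proof.
move=> sG; elim: l phi V => [|l IH] phi V Gphi /=; first by apply: Gphi; exact: sd_piece0.
apply: subgroup_sum => // i; apply: subgroup_sign => //; apply: IH => W VW.
by apply: Gphi; exact: sd_pieceS VW.
Qed.

Definition within_hull {K} l r (V : 'M[R]_(l.+1, K)) (W : 'M[R]_(r.+1, K)) :=
  exists2 S : 'M[R]_(r.+1, l.+1), stochastic S & W = S *m V.

Lemma within_hull_refl K l (V : 'M[R]_(l.+1, K)) : within_hull V V.
Proof. by exists 1%:M; [exact: stochastic1|rewrite mul1mx]. Qed.

Lemma within_hull_row' K l r (V : 'M[R]_(l.+2, K)) i (W : 'M[R]_(r.+1, K)) :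
  within_hull (row' i V) W -> within_hull V W.
Proof.
move=> [S sS ->]; exists (S *m row' i 1%:M); last by rewrite -mulmxA -row'_mul mul1mx.
by apply: stochastic_mul => //; apply: stochastic_row'; exact: stochastic1.
Qed.

Lemma stochastic_ins_row l k (u : 'rV[R]_k) (S : 'M[R]_(l.+1, k)) :
  @stochastic _ 0 _ u -> stochastic S -> stochastic (ins_row ord0 u S).
Proof.
move=> su sS a; case: (unliftP ord0 a) => [a' ->|->].
  have [s0 s1] := sS a'; split=> [b|]; first by rewrite mxE liftK.
  by rewrite -[RHS]s1; apply: eq_bigr => b _; rewrite mxE liftK.
have [s0 s1] := su 0; split=> [b|]; first by rewrite mxE unlift_none.
by rewrite -[RHS]s1; apply: eq_bigr => b _; rewrite mxE unlift_none.
Qed.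

Lemma stochastic_bary l : @stochastic R 0 l.+1 (const_mx (l.+1%:R^-1)).
Proof.
move=> a; split=> [b|]; first by rewrite mxE invr_ge0.
under eq_bigr do rewrite mxE.
by rewrite sumr_const card_ord -[LHS]mulr_natl mulfV// pnatr_eq0.
Qed.

Lemma within_hull_bary K l r (V : 'M[R]_(l.+1, K)) (W : 'M[R]_(r.+1, K)) :
  within_hull V W -> within_hull V (ins_row ord0 (bary V) W).
Proof.
move=> [S sS ->]; exists (ins_row ord0 (const_mx (l.+1%:R^-1)) S); last by rewrite ins_row_mul.
by apply: stochastic_ins_row => //; exact: stochastic_bary.
Qed.

Lemma sd_piece_hull K l (V W : 'M[R]_(l.+1, K)) : sd_piece V W -> within_hull V W.
Proof.
elim=> {l V W} [V|l V i W _ /within_hull_row']; first exact: within_hull_refl.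
exact: within_hull_bary.
Qed.

(** The homotopy between the identity and [Sd]: their difference is natural and vanishes in degree
    0, so coning applies. *)
Definition Td {l K} : ('M[R]_(l.+2, K) -> R) -> 'M[R]_(l.+1, K) -> R :=
  @coneH K K (fun l (phi : 'M[R]_(l.+1, K) -> R) V => phi V - Sd phi V) (fun l V => bary V) l.

Lemma TdP l K (phi : 'M[R]_(l.+2, K) -> R) V : Td (dA phi) V + dA (Td phi) V = phi V - Sd phi V.
Proof.
rewrite /Td coneHS//.
- by move=> r f g W; rewrite SdB; ring.
- by move=> r f W; rewrite Sd_dA dAB.
- by move=> c W; rewrite /= subrr.
Qed.

Lemma Td_natural l K K' (A : 'M[R]_(K, K')) (phi : 'M[R]_(l.+2, K') -> R) (V : 'M[R]_(l.+1, K)) :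
  Td (fun W => phi (W *m A)) V = Td phi (V *m A).
Proof.
apply: (coneH_natural (A' := A)) => r; [move=> f W; rewrite Sd_natural//|move=> W].
by rewrite /bary mulmxA.
Qed.

Lemma Td_subgroup G l K (phi : 'M[R]_(l.+2, K) -> R) V : subgroup G ->
  (forall W, within_hull V W -> G (phi W)) -> G (Td phi V).
Proof.
move=> sG Gphi; apply: (coneH_subgroup (sub := fun l r V W => within_hull V W)) => //.
- by move=> a r V' i W; exact: within_hull_row'.
- by move=> *; exact: within_hull_bary.
move=> r f W Gf; apply: sG.2; first by apply: Gf; exact: within_hull_refl.
by apply: Sd_subgroup => // ? /sd_piece_hull; exact: Gf.
Qed.

End AffineCochains.

(** * Mesh of affine simplices under subdivision *)

Section Mesh.
Context {R : realType}.

(** Barycentric coordinates have norm 1 for this norm, so two points of a simplex are at distance at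
    most 2, and for c = 2 the estimate [mesh_mul] loses nothing. *)
Definition norm1 {K} (u : 'rV[R]_K) : R := \sum_j `|u 0 j|.

Definition mesh_le {l K} (c : R) (V : 'M[R]_(l.+1, K)) := forall a b, norm1 (row a V - row b V) <= c.

Lemma norm1_ge0 K (u : 'rV[R]_K) : 0 <= norm1 u.
Proof. by apply: sumr_ge0 => j _; exact: normr_ge0. Qed.

Lemma norm1D K (u v : 'rV[R]_K) : norm1 (u + v) <= norm1 u + norm1 v.
Proof. by rewrite -big_split; apply: ler_sum => j _; rewrite mxE; exact: ler_normD. Qed.

Lemma norm1Z K c (u : 'rV[R]_K) : norm1 (c *: u) = `|c| * norm1 u.
Proof. by rewrite mulr_sumr; apply: eq_bigr => j _; rewrite mxE normrM. Qed.

Lemma norm1N K (u : 'rV[R]_K) : norm1 (- u) = norm1 u.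
Proof. by apply: eq_bigr => j _; rewrite mxE normrN. Qed.

Lemma norm1_sum K (I : finType) (c : I -> R) (u : I -> 'rV[R]_K) :
  norm1 (\sum_i c i *: u i) <= \sum_i `|c i| * norm1 (u i).
Proof.
apply: (big_rec2 (fun (x : 'rV[R]_K) y => norm1 x <= y)).
  by rewrite /norm1 big1// => j _; rewrite mxE normr0.
by move=> i x y _ H; apply: le_trans (norm1D _ _) _; rewrite norm1Z lerD2l.
Qed.

Lemma sub_combination K l (s : 'I_l -> R) (p : 'rV[R]_K) (V : 'M[R]_(l, K)) (u : 'rV[R]_l) :
  (forall a, u 0 a = s a) -> \sum_a s a = 1 -> p - u *m V = \sum_a s a *: (p - row a V).
Proof.
move=> us s1; rewrite mulmx_sum_row; under [RHS]eq_bigr do rewrite scalerBr.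
by rewrite sumrB -scaler_suml s1 scale1r; congr (_ - _); apply: eq_bigr => a _; rewrite us.
Qed.

Lemma norm1_convex K l c (p : 'rV[R]_K) (V : 'M[R]_(l.+1, K)) (t : 'rV[R]_l.+1) : simplex R l t ->
  (forall a, norm1 (p - row a V) <= c) -> norm1 (p - t *m V) <= c.
Proof.
move=> [t0 t1] H; rewrite (sub_combination _ _ (s := fun a => t 0 a))//.
apply: le_trans (norm1_sum _ _) _.
rewrite -[leRHS]mul1r -t1 mulr_suml; apply: ler_sum => a _.
by rewrite ger0_norm// ler_wpM2l.
Qed.

Lemma mesh_stochastic l k (S : 'M[R]_(l.+1, k)) : stochastic S -> mesh_le 2 S.
Proof.
move=> sS a b; have N c : norm1 (row c S) = 1.
  have [s0 s1] := sS c; rewrite -s1; apply: eq_bigr => j _.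
  by rewrite mxE ger0_norm.
by apply: le_trans (norm1D _ _) _; rewrite norm1N !N.
Qed.

Lemma stochastic_row l k (S : 'M[R]_(l.+1, k.+1)) a : stochastic S -> simplex R k (row a S).
Proof.
move=> sS; have [s0 s1] := sS a; split=> [i|]; first by rewrite mxE.
by rewrite -s1; apply: eq_bigr => i _; rewrite mxE.
Qed.

(** The difference u of two rows of S has coordinate sum 0. Pairing u V with its vector of signs
    gives the sum of the u_i g_i, where the g_i lie in an interval of length d; subtracting the
    midpoint from every g_i changes nothing and leaves terms bounded by d / 2. *)
Lemma mesh_mul l k K c d (S : 'M[R]_(l.+1, k.+1)) (V : 'M[R]_(k.+1, K)) : stochastic S -> 0 <= d ->
  mesh_le c S -> mesh_le d V -> mesh_le (c * d / 2) (S *m V).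
Proof.
move=> sS d0 mS mV a b; rewrite !row_mul -mulmxBl; set u := row a S - row b S.
have u0 : \sum_i u 0 i = 0.
  under eq_bigr do rewrite !mxE.
  by rewrite sumrB (sS a).2 (sS b).2 subrr.
pose eps j : R := Num.sg ((u *m V) 0 j).
pose g i := \sum_j eps j * V i j.
have E : norm1 (u *m V) = \sum_i u 0 i * g i.
  rewrite /norm1; under eq_bigr do rewrite normrEsg -/(eps _) [X in _ * X]mxE mulr_sumr.
  rewrite exchange_big; apply: eq_bigr => i _; rewrite mulr_sumr; apply: eq_bigr => j _.
  by rewrite mulrCA.
have gd i j : `|g i - g j| <= d.
  rewrite /g -sumrB; apply: le_trans (ler_norm_sum _ _ _) _.
  apply: le_trans (mV i j); apply: ler_sum => l' _; rewrite -mulrBr normrM !mxE.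
  by rewrite ler_piMl// normr_sg; case: (_ == 0).
pose M := [arg max_(i > ord0) g i]%O; pose m := [arg min_(i < ord0) g i]%O.
have gM i : g i <= g M by rewrite /M; case: Order.TotalTheory.arg_maxP => // j _ /(_ i); apply.
have gm i : g m <= g i by rewrite /m; case: Order.TotalTheory.arg_minP => // j _ /(_ i); apply.
pose mid := (g M + g m) / 2.
have gmid i : `|g i - mid| <= d / 2.
  have := gd M m; have := gM i; have := gm i; rewrite /mid ler_norml ler_norml => H1 H2 /andP[_ H3].
  by apply/andP; split; lra.
have -> : norm1 (u *m V) = \sum_i u 0 i * (g i - mid).
  rewrite E; under [RHS]eq_bigr do rewrite mulrBr.
  by rewrite sumrB -mulr_suml u0 mul0r subr0.
apply: le_trans (ler_norm _) _; apply: le_trans (ler_norm_sum _ _ _) _.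
rewrite -mulrA; apply: le_trans (_ : norm1 u * (d / 2) <= _).
  by rewrite mulr_suml; apply: ler_sum => i _; rewrite normrM ler_wpM2l.
by rewrite ler_wpM2r ?divr_ge0//; exact: mS.
Qed.

Definition ratio (l : nat) : R := l%:R / l.+1%:R.

Lemma ratio_le l l' : (l <= l')%N -> ratio l <= ratio l'.
Proof.
move=> ll; rewrite /ratio ler_pdivrMr ?ltr0n// mulrAC ler_pdivlMr ?ltr0n// -!natrM ler_nat.
by rewrite !mulnS mulnC leq_add2r.
Qed.

Lemma ratio_ge0 l : 0 <= ratio l. Proof. by rewrite divr_ge0. Qed.

Lemma ratio_lt1 l : ratio l < 1.
Proof. by rewrite ltr_pdivrMr ?ltr0n// mul1r ltr_nat. Qed.

(** The vector from a vertex to the barycentre is the average of l + 1 differences of vertices, one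
    of which is 0; this gives the factor [ratio l]. *)
Lemma sd_piece_mesh l K c (V W : 'M[R]_(l.+1, K)) : 0 <= c -> mesh_le c V -> sd_piece V W ->
  mesh_le (ratio l * c) W.
Proof.
move=> c0 mV vW; elim: vW mV => {l V W} [V|l V i W VW IH] mV.
  by move=> a b; rewrite !ord1 subrr /ratio mul0r mul0r /norm1 big1// => j _; rewrite mxE normr0.
have mV' : mesh_le c (row' i V).
  move=> a b; have H := mV (lift i a) (lift i b); congr (norm1 _ <= _) : H.
  by apply/rowP => j; rewrite !mxE.
have mW := IH mV'.
have d a : norm1 (bary V - row a V) <= ratio l.+1 * c.
  have -> : bary V - row a V = \sum_b (l.+2%:R^-1 * (b != a)%:R) *: (row b V - row a V).
    rewrite -opprB (sub_combination _ _ (s := fun=> l.+2%:R^-1)); last first.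
    - by rewrite sumr_const card_ord -[LHS]mulr_natl mulfV// pnatr_eq0.
    - by move=> b; rewrite mxE.
    rewrite -sumrN; apply: eq_bigr => b _; rewrite -scalerN opprB.
    by case: (eqVneq b a) => [->|_]; rewrite ?subrr ?scaler0// mulr1.
  apply: le_trans (norm1_sum _ _) _.
  apply: le_trans (_ : \sum_(b < l.+2) (l.+2%:R^-1 * (b != a)%:R) * c <= _).
    apply: ler_sum => b _; rewrite ger0_norm; last by rewrite mulr_ge0 ?invr_ge0.
    by rewrite ler_wpM2l ?mulr_ge0 ?invr_ge0//; exact: mV.
  rewrite -mulr_suml ler_wpM2r// -mulr_sumr /ratio mulrC ler_wpM2r ?invr_ge0//.
  by rewrite -natr_sum ler_nat -big_mkcond /= sum1_card cardC1 card_ord.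
have dW a : norm1 (bary V - row a W) <= ratio l.+1 * c.
  have [S sS ->] := within_hull_row' (sd_piece_hull VW).
  by rewrite row_mul; apply: norm1_convex => //; exact: stochastic_row.
have dW' a : norm1 (row a W - bary V) <= ratio l.+1 * c by rewrite -norm1N opprB.
have r0 : (row ord0 (ins_row ord0 (bary V) W)) = bary V by rewrite row_ins_row.
have r1 a : row (lift ord0 a) (ins_row ord0 (bary V) W) = row a W.
  by apply/rowP => j; rewrite !mxE liftK.
move=> a b; case: (unliftP ord0 a) => [a' ->|->]; case: (unliftP ord0 b) => [b' ->|->]; rewrite ?r0 ?r1//.
- by apply: le_trans (mW a' b') _; rewrite ler_wpM2r// ratio_le.
- by rewrite subrr /norm1 big1 ?mulr_ge0 ?ratio_ge0// => j _; rewrite mxE normr0.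
Qed.

End Mesh.

(** * Subdivision of singular cochains *)

Section SingularSubdivision.
Context {R : realType} {X : topologicalType}.

Local Notation delta w := (@coboundary R R X _ w).

(** The cochain w on the affine subsimplices of s. The operators on affine cochains are applied to
    it and evaluated at the identity matrix, that is, at s itself. *)
Definition cells {l k} (w : singular R X l -> R) (s : singular R X k) (V : 'M[R]_(l.+1, k.+1)) : R :=
  w (asimp (sext s) V).

Definition sdX {k} (w : singular R X k -> R) (s : singular R X k) : R := Sd (cells w s) 1%:M.

Definition tX {k} (w : singular R X k.+1 -> R) (s : singular R X k) : R := Td (cells w s) 1%:M.

Lemma face_asimp_sext l k (s : singular R X k) (V : 'M[R]_(l.+2, k.+1)) i :
  sing_face i (asimp (sext s) V) = asimp (sext s) (row' i V).
Proof. by apply: face_asimp => x _; exact: sext_continuous. Qed.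

Lemma asimp_asimp l k m (s : singular R X m) (V : 'M[R]_(l.+1, k.+1)) (S : 'M[R]_(k.+1, m.+1)) : stochastic V ->
  asimp (sext (asimp (sext s) S)) V = asimp (sext s) (V *m S).
Proof. by move=> sV; apply: sext_asimp => // x _; exact: sext_continuous. Qed.

Lemma face_row' k (s : singular R X k.+1) i : sing_face i s = asimp (sext s) (row' i 1%:M).
Proof. by rewrite -face_asimp_sext asimp_sext. Qed.

Lemma cells_delta l k (w : singular R X l -> R) (s : singular R X k) : cells (delta w) s = dA (cells w s).
Proof.
by apply/funext => V; apply: eq_bigr => i _; rewrite /cells face_asimp_sext.
Qed.

Lemma eq_Sd l K (f g : 'M[R]_(l.+1, K) -> R) V :
  (forall W, sd_piece V W -> f W = g W) -> Sd f V = Sd g V.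
Proof.
move=> E; apply/eqP; rewrite -subr_eq0 -SdB; apply/eqP.
apply: (Sd_subgroup (@subgroup0 R)) => W VW; rewrite E// subrr//.
Qed.

Lemma TdB l K (f g : 'M[R]_(l.+2, K) -> R) V : Td (fun W => f W - g W) V = Td f V - Td g V.
Proof. by apply: coneHB => r f' g' W; rewrite SdB; ring. Qed.

Lemma eq_Td l K (f g : 'M[R]_(l.+2, K) -> R) (V : 'M[R]_(l.+1, K)) :
  (forall W, within_hull V W -> f W = g W) -> Td f V = Td g V.
Proof.
move=> E; apply/eqP; rewrite -subr_eq0 -TdB; apply/eqP.
apply: (Td_subgroup (@subgroup0 R)) => W VW; rewrite E// subrr//.
Qed.

(** Naturality under affine maps, used on the pieces that actually occur, lets the subdivision of a
    subsimplex be computed inside s. *)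
Lemma Sd_cells k l (w : singular R X l -> R) (s : singular R X k) (S : 'M[R]_(l.+1, k.+1)) : stochastic S ->
  Sd (cells w s) S = sdX w (asimp (sext s) S).
Proof.
move=> sS; rewrite -[S in LHS]mul1mx -Sd_natural; apply: eq_Sd => W /sd_piece_hull[S' sS'].
by rewrite mulmx1 => ->; rewrite /cells asimp_asimp.
Qed.

Lemma Td_cells k l (w : singular R X l.+1 -> R) (s : singular R X k) (S : 'M[R]_(l.+1, k.+1)) : stochastic S ->
  Td (cells w s) S = tX w (asimp (sext s) S).
Proof.
move=> sS; rewrite -[S in LHS]mul1mx -Td_natural; apply: eq_Td => W [S' sS'].
by rewrite mulmx1 => ->; rewrite /cells asimp_asimp.
Qed.

Lemma sdX_delta k (w : singular R X k -> R) s : sdX (delta w) s = delta (sdX w) s.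
Proof.
rewrite /sdX cells_delta Sd_dA; apply: eq_bigr => i _; rewrite Sd_cells ?face_row'//.
by apply: stochastic_row'; exact: stochastic1.
Qed.

Lemma tX_delta k (w : singular R X k.+1 -> R) s : tX (delta w) s + delta (tX w) s = w s - sdX w s.
Proof.
rewrite /tX cells_delta; have := TdP (cells w s) 1%:M.
rewrite {3}/cells asimp_sext => <-; congr (_ + _); apply: eq_bigr => i _.
rewrite [in RHS]Td_cells -?face_row'//; apply: stochastic_row'; exact: stochastic1.
Qed.

Lemma deltaB k (w w' : singular R X k -> R) s : delta (fun s => w s - w' s) s = delta w s - delta w' s.
Proof. by rewrite /coboundary -sumrB; apply: eq_bigr => i _; rewrite mulrBr. Qed.

Lemma deltaD k (w w' : singular R X k -> R) s : delta (fun s => w s + w' s) s = delta w s + delta w' s.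
Proof. by rewrite /coboundary -big_split; apply: eq_bigr => i _; rewrite mulrDr. Qed.

Lemma deltaK k (w : singular R X k -> R) s : delta (delta w) s = 0.
Proof.
have := dA_dA (cells w s) 1%:M; rewrite -!cells_delta.
by rewrite {1}/cells asimp_sext.
Qed.

Lemma sdX_subgroup G k (w : singular R X k -> R) s : subgroup G ->
  (forall S : 'M[R]_(k.+1, k.+1), stochastic S -> mesh_le (ratio k * 2) S -> G (w (asimp (sext s) S))) ->
  G (sdX w s).
Proof.
move=> sG H; apply: Sd_subgroup => // W pW; apply: H.
  by have [S sS ->] := sd_piece_hull pW; rewrite mulmx1.
apply: sd_piece_mesh pW => //; exact/mesh_stochastic/stochastic1.
Qed.

Lemma tX_subgroup G k (w : singular R X k.+1 -> R) s : subgroup G ->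
  (forall S : 'M[R]_(k.+2, k.+1), stochastic S -> G (w (asimp (sext s) S))) -> G (tX w s).
Proof.
by move=> sG H; apply: Td_subgroup => // W [S sS ->]; rewrite mulmx1; exact: H.
Qed.

Lemma sdXB k (w w' : singular R X k -> R) s : sdX (fun s => w s - w' s) s = sdX w s - sdX w' s.
Proof. exact: SdB. Qed.

Lemma tXB k (w w' : singular R X k.+1 -> R) s : tX (fun s => w s - w' s) s = tX w s - tX w' s.
Proof. exact: TdB. Qed.

Lemma delta_subgroup G k (w : singular R X k -> R) s : subgroup G -> (forall i, G (w (sing_face i s))) ->
  G (delta w s).
Proof. by move=> sG H; apply: subgroup_sum => // i; apply: subgroup_sign. Qed.

Definition cube k : set 'rV[R]_k := [set v | forall i, 0 <= v 0 i <= 1].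

Lemma cube_compact k : compact (@cube k).
Proof.
rewrite (_ : @cube k = [set v | forall i, `[0%R, 1%R]%classic (v ord0 i)]).
  exact: (@rV_compact R k (fun=> `[0%R, 1%R]%classic) (fun=> @segment_compact R 0 1)).
by apply/seteqP; split=> v H i; have := H i; rewrite /= in_itv.
Qed.

Lemma simplex_compact k : compact (simplex R k).
Proof.
have -> : simplex R k = @sretract R k @` @cube k.+1.
  apply/seteqP; split=> [t st|_ [v _ <-]]; last exact: sretract_in.
  exists t; last exact: sretract_id.
  have [t0 t1] := st; move=> i; rewrite t0 -t1 (bigD1 i)//= lerDl.
  by apply: sumr_ge0.
apply: continuous_compact; last exact: cube_compact.
by apply: continuous_subspaceT; exact: sretract_continuous.
Qed.

Lemma norm_le_norm1 k (u : 'rV[R]_k) : `|u| <= norm1 u.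
Proof.
apply: norm_rV_le => [|i]; first exact: norm1_ge0.
by rewrite /norm1 (bigD1 i)//= lerDl; apply: sumr_ge0.
Qed.

(** Compactness makes uniform the radius e for which one member of the cover contains the image of
    the e-ball around a point; a simplex of mesh at most e / 2 lies in the ball around its first
    vertex. *)
Lemma lebesgue_number (I : Type) (U : I -> set X) k (s : singular R X k) :
  (forall i, open (U i)) -> (forall x, exists i, U i x) ->
  exists2 d, 0 < d & forall l (V : 'M[R]_(l.+1, k.+1)), stochastic V -> mesh_le d V ->
    exists i, simage (asimp (sext s) V) `<=` U i.
Proof.
move=> oU cU.
pose P e (y : 'rV[R]_k.+1) := exists i, forall z, `|y - z| < e -> U i (sext s z).
have /compact_near_coveringP/(_ R 0^'+ P _) H := @simplex_compact k.
have : \forall e \near 0^'+, simplex R k `<=` P e.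
  apply: H => x _; have [i Ui] := cU (sext s x).
  have : nbhs x (sext s @^-1` U i).
    by apply: (@sext_continuous R X k s x); exact: open_nbhs_nbhs.
  move=> /nbhs_ballP[e /= e0 He].
  exists ([set y | `|x - y| < e / 2], [set h | h < e / 2]); first split => /=.
  - apply/nbhs_ballP; exists (e / 2) => /=; first by rewrite divr_gt0.
    by move=> y; rewrite -ball_normE.
  - by apply: nbhs_right_lt; rewrite divr_gt0.
  move=> [y h] /= [xy he]; exists i => z yz; apply: He; rewrite -ball_normE /=.
  rewrite -(subrKA y) (splitr e); apply: le_lt_trans (ler_normD _ _) _.
  by rewrite ltrD// (lt_trans yz).
move=> H'; have [d [/= d0 Hd]] := filter_ex (filterI (nbhs_right_gt (0 : R)) H').
exists (d / 2); first by rewrite divr_gt0.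
move=> l V sV mV; have [i Hi] := Hd _ (stochastic_row ord0 sV).
exists i; apply: image_asimp => [x _|x [t st <-]]; first exact: sext_continuous.
apply: Hi; apply: le_lt_trans (norm_le_norm1 _) _; apply: (@le_lt_trans _ _ (d / 2)); last first.
  by rewrite ltr_pdivrMr// ltr_pMr// ltr1n.
by apply: norm1_convex => // a; exact: mV.
Qed.

(** * Extension of cochains from small simplices *)

Section Extension.
Context (I : Type) (U : I -> set X) (C : forall k, singular R X k -> Prop).
Hypotheses (oU : forall i, open (U i)) (cU : forall x, exists i, U i x).
Hypothesis CS : forall k l (s : singular R X k) (S : 'M[R]_(l.+1, k.+1)), C s -> stochastic S ->
  C (asimp (sext s) S).

Definition small {k} (s : singular R X k) := exists i, simage s `<=` U i.

Lemma C_face k (s : singular R X k.+1) i : C s -> C (sing_face i s).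
Proof. by move=> Cs; rewrite face_row'; apply: CS => //; apply: stochastic_row'; exact: stochastic1. Qed.

Lemma small_face k (s : singular R X k.+1) i : small s -> small (sing_face i s).
Proof. by move=> [j sj]; exists j => x /image_face; exact: sj. Qed.

Section Levels.
Variable k : nat.
Let r : R := ratio k.+2.

(** The constant 2 bounds the mesh of a whole simplex in [norm1], and r is the contraction ratio in
    dimension [k.+2], the largest that gets subdivided; hence the pieces of a simplex of level
    [n.+1] have level n. *)
Definition level n {l} (s : singular R X l) := forall m (V : 'M[R]_(m.+1, l.+1)), stochastic V ->
  mesh_le (2 * r ^+ n) V -> small (asimp (sext s) V).

Let r0 : 0 <= r. Proof. exact: ratio_ge0. Qed.

Lemma level_small l (s : singular R X l) : level 0 s -> small s.
Proof.
move=> /(_ _ 1%:M (@stochastic1 _ _)); rewrite asimp_sext expr0 mulr1; apply.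
exact/mesh_stochastic/stochastic1.
Qed.

Lemma level_mono n n' l (s : singular R X l) : (n <= n')%N -> level n s -> level n' s.
Proof.
move=> nn H m V sV mV; apply: H => // a b; apply: le_trans (mV a b) _.
by rewrite ler_wpM2l// ler_wiXn2l// ltW// ratio_lt1.
Qed.

Lemma level_affine n l m (s : singular R X l) (S : 'M[R]_(m.+1, l.+1)) : stochastic S -> level n s ->
  level n (asimp (sext s) S).
Proof.
move=> sS H p V sV mV; rewrite asimp_asimp//; apply: H; first exact: stochastic_mul.
by have := mesh_mul sV (ler0n _ 2) mV (mesh_stochastic sS); rewrite mulfK.
Qed.

Lemma level_piece n l (s : singular R X l) (S : 'M[R]_(l.+1, l.+1)) : (l <= k.+2)%N -> stochastic S ->
  mesh_le (ratio l * 2) S -> level n.+1 s -> level n (asimp (sext s) S).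
Proof.
move=> lk sS mS H p V sV mV; rewrite asimp_asimp//; apply: H; first exact: stochastic_mul.
move=> a b; have := mesh_mul sV _ mV mS; rewrite mulr_ge0 ?ratio_ge0// => /(_ isT a b) /le_trans; apply.
rewrite mulrA mulfK// exprSr mulrA ler_wpM2l ?mulr_ge0 ?exprn_ge0//; exact: ratio_le.
Qed.

Lemma level_face n l (s : singular R X l.+1) i : level n s -> level n (sing_face i s).
Proof.
by rewrite face_row'; apply: level_affine; apply: stochastic_row'; exact: stochastic1.
Qed.

Lemma level_exists l (s : singular R X l) : exists n, level n s.
Proof.
have [d d0 Hd] := lebesgue_number s oU cU.
have : (2 * r ^+ n) @[n --> \oo] --> 0.
  rewrite -(mulr0 2); apply: cvgM; first exact: cvg_cst.
  by apply: cvg_expr; rewrite ger0_norm ?ratio_lt1.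
move=> /cvgrPdist_lt/(_ d d0)[n _ /(_ n (leqnn n))]; rewrite sub0r normrN => rn.
exists n => m V sV mV; apply: Hd => // a b; apply: le_trans (mV a b) _.
by apply: ltW; apply: le_lt_trans rn; exact: ler_norm.
Qed.

Variables (G : R -> Prop) (e : singular R X k.+1 -> R) (c : singular R X k.+2 -> R).
Hypothesis sG : subgroup G.
Hypothesis cocycle : forall s : singular R X k.+3, C s -> G (delta c s).
Hypothesis ec : forall s : singular R X k.+2, C s -> small s -> G (delta e s - c s).

(* On a simplex that becomes small after n subdivisions, the values of ext_seq are stable modulo G from rank n on. *)
Fixpoint ext_seq n : singular R X k.+1 -> R :=
  if n is n'.+1 then fun s => sdX (ext_seq n') s + tX c s +
    delta (fun t : singular R X k => if `[<level n' t>] then tX (ext_seq n') t else 0) s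
  else fun s => if `[<small s>] then e s else 0.

(** Since [tX] is a homotopy between the identity and [sdX], adding [tX c] to the subdivided cochain
    restores the coboundary c, modulo G. The third summand of [ext_seq] is itself a coboundary and
    disappears. *)
Lemma ext_seq_delta n (s : singular R X k.+2) : C s -> level n s -> G (delta (ext_seq n) s - c s).
Proof.
elim: n s => [|n IH] s Cs Ls.
  have := ec Cs (level_small Ls); congr (G (_ - _)); apply: eq_bigr => i _; congr (_ * _) => /=.
  by rewrite asboolT//; apply: small_face; exact: level_small.
rewrite [ext_seq _]/= deltaD deltaD deltaK addr0 -sdX_delta.
have -> : delta (tX c) s = c s - sdX c s - tX (delta c) s by rewrite -tX_delta; ring.
have A (x y z t : R) : x + (y - z - t) - y = x - z - t by ring.
rewrite A -sdXB; apply: sG.2; last by apply: tX_subgroup => // S sS; apply: cocycle; exact: CS.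
apply: sdX_subgroup => // S sS mS; apply: IH; [exact: CS|exact: level_piece].
Qed.

(** The third summand of [ext_seq] exists for this purpose: on simplices of level n it completes the
    homotopy formula for [ext_seq n], with [tX c] in place of [tX] of its coboundary, and these two
    agree modulo G. *)
Lemma ext_seq_stable n (s : singular R X k.+1) : C s -> level n s -> G (ext_seq n.+1 s - ext_seq n s).
Proof.
move=> Cs Ls /=.
have -> : delta (fun t : singular R X k => if `[<level n t>] then tX (ext_seq n) t else 0) s =
    delta (tX (ext_seq n)) s.
  by apply: eq_bigr => i _; rewrite asboolT//; exact: level_face.
have A (x y z t : R) : x + y + z - t = y - (t - x - z) by ring.
rewrite A -tX_delta addrK -opprB -tXB; apply: subgroupN => //.
apply: tX_subgroup => // S sS; apply: ext_seq_delta; [exact: CS|exact: level_affine].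
Qed.

Lemma ext_seq_le n n' (s : singular R X k.+1) : (n <= n')%N -> C s -> level n s -> G (ext_seq n' s - ext_seq n s).
Proof.
move=> /subnK <-; elim: (n' - n)%N => [|d IH] Cs Ls; first by rewrite subrr; exact: sG.1.
rewrite addSn -(subrKA (ext_seq (d + n) s)); apply: subgroupD => //; last exact: IH.
by apply: ext_seq_stable => //; apply: level_mono Ls; exact: leq_addl.
Qed.

(** Each simplex uses a stage at which it is small enough; modulo G the choice of the stage does not
    matter. The third conclusion transports integrality, with H = Z, even when the equations are
    exact, with G = 0. *)
Lemma cochain_extension : exists E : singular R X k.+1 -> R,
  [/\ forall s, C s -> small s -> G (E s - e s),
      forall s, C s -> G (delta E s - c s) &
      forall H, subgroup H -> (forall s, C s -> small s -> H (e s)) -> (forall s, C s -> H (c s)) ->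
        forall s, C s -> H (E s)].
Proof.
pose lev (s : singular R X k.+1) := projT1 (cid (level_exists s)).
have levP s : level (lev s) s by exact: projT2 (cid (level_exists s)).
pose E s := ext_seq (lev s) s.
have EE n s : C s -> level n s -> G (E s - ext_seq n s).
  move=> Cs Ls; rewrite -(subrKA (ext_seq (maxn n (lev s)) s)); apply: subgroupD => //.
    by rewrite -opprB; apply: subgroupN => //; apply: ext_seq_le (leq_maxr _ _) Cs (levP s).
  by apply: ext_seq_le => //; exact: leq_maxl.
exists E; split=> [s Cs [i si]|s Cs|H sH He Hc].
- have L0 : level 0 s.
    by move=> m V sV _; exists i => _ [t _ <-]; rewrite asimpE => [|x _]; [apply: si; exact: image_sext|exact: sext_continuous].
  by have := EE 0%N s Cs L0; rewrite /= asboolT//; exists i.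
- have [n Ln] := level_exists s.
  rewrite -(subrKA (delta (ext_seq n) s)) -deltaB; apply: subgroupD => //; last exact: ext_seq_delta.
  by apply: delta_subgroup => // i; apply: EE; [exact: C_face|exact: level_face].
suff HE n s : C s -> H (ext_seq n s) by move=> s Cs; exact: HE.
elim: n s => [|n IH] s Cs /=; first by case: asboolP => // sm; [exact: He|exact: sH.1].
apply: subgroupD => //; first apply: subgroupD => //.
- by apply: sdX_subgroup => // S sS _; apply: IH; exact: CS.
- by apply: tX_subgroup => // S sS; apply: Hc; exact: CS.
apply: delta_subgroup => // i; case: asboolP => _; last exact: sH.1.
by apply: tX_subgroup => // S sS; apply: IH; apply: CS => //; exact: C_face.
Qed.

End Levels.
End Extension.
End SingularSubdivision.

(** * Chart balls *)

Section Prism.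
Context {R : realType}.

Definition prism_sub {K} l r (V : 'M[R]_(l.+1, K)) (W : 'M[R]_(r.+1, K + 1)) :=
  exists (S : 'M[R]_(r.+1, l.+1)) (c : 'cV[R]_r.+1),
    [/\ stochastic S, forall a, 0 <= c a 0 <= 1 & W = row_mx (S *m V) c].

(** The prism operator as a cone homotopy: F is the difference between the top and the bottom of the
    prism over V, the last column is the time coordinate, and the apex is the barycentre of the
    bottom. *)
Definition prism {l K} : ('M[R]_(l.+2, K + 1) -> R) -> 'M[R]_(l.+1, K) -> R :=
  @coneH R K (K + 1)
    (fun l (phi : 'M[R]_(l.+1, K + 1) -> R) V => phi (row_mx V (const_mx 1)) - phi (row_mx V 0))
    (fun l V => row_mx (bary V) 0) l.

Lemma row'_row_mx l m1 m2 (V : 'M[R]_(l.+1, m1)) (W : 'M[R]_(l.+1, m2)) i :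
  row' i (row_mx V W) = row_mx (row' i V) (row' i W).
Proof. by apply/matrixP => a b; rewrite !mxE; case: (fintype.split b) => j; rewrite mxE. Qed.

Lemma ins_row_row_mx l m1 m2 (u : 'rV[R]_m1) (v : 'rV[R]_m2) (V : 'M[R]_(l, m1)) (W : 'M[R]_(l, m2)) :
  ins_row ord0 (row_mx u v) (row_mx V W) = row_mx (ins_row ord0 u V) (ins_row ord0 v W).
Proof.
apply/matrixP => a b; rewrite [LHS]mxE [RHS]mxE.
by case: unliftP => [a' ->|->]; rewrite mxE; case: (fintype.split b) => j; rewrite mxE ?liftK ?unlift_none.
Qed.

Lemma row'_const l m (x : R) i : row' i (const_mx x : 'M[R]_(l.+1, m)) = const_mx x.
Proof. by apply/matrixP => a b; rewrite !mxE. Qed.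

Let prismB l K (phi psi : 'M[R]_(l.+1, K + 1) -> R) (V : 'M[R]_(l.+1, K)) :
  (phi (row_mx V (const_mx 1)) - psi (row_mx V (const_mx 1))) - (phi (row_mx V 0) - psi (row_mx V 0)) =
  (phi (row_mx V (const_mx 1)) - phi (row_mx V 0)) - (psi (row_mx V (const_mx 1)) - psi (row_mx V 0)).
Proof. by ring. Qed.

Lemma prism_diff l K (phi psi : 'M[R]_(l.+2, K + 1) -> R) (V : 'M[R]_(l.+1, K)) :
  prism (fun W => phi W - psi W) V = prism phi V - prism psi V.
Proof. by apply: coneHB => r f g W; exact: prismB. Qed.

Lemma prismP l K (phi : 'M[R]_(l.+2, K + 1) -> R) (V : 'M[R]_(l.+2, K)) :
  prism (dA phi) V + dA (prism phi) V = phi (row_mx V (const_mx 1)) - phi (row_mx V 0).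
Proof.
rewrite /prism coneHS//.
- move=> r f W; rewrite dAB /dA; congr (_ - _); apply: eq_bigr => i _; congr (_ * _).
    by rewrite row'_row_mx row'_const.
  by rewrite row'_row_mx row'_const.
- by move=> c W; rewrite subrr.
Qed.

Lemma prism_natural l K K' (A : 'M[R]_(K, K')) (phi : 'M[R]_(l.+2, K' + 1) -> R) (V : 'M[R]_(l.+1, K)) :
  prism (fun W => phi (W *m block_mx A 0 0 1%:M)) V = prism phi (V *m A).
Proof.
have E r (W : 'M[R]_(r, K)) (c : 'cV[R]_r) : row_mx W c *m block_mx A 0 0 1%:M = row_mx (W *m A) c.
  by rewrite mul_row_block !mulmx0 addr0 add0r mulmx1.
apply: coneH_natural => [r f W|r W]; first by rewrite !E.
by rewrite E /bary mulmxA.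
Qed.

Lemma prism_subgroup G l K (phi : 'M[R]_(l.+2, K + 1) -> R) (V : 'M[R]_(l.+1, K)) : subgroup G ->
  (forall W, prism_sub V W -> G (phi W)) -> G (prism phi V).
Proof.
move=> sG; apply: (coneH_subgroup (sub := fun l r V W => prism_sub V W)) => //.
- move=> a r V' i W [S [c [sS c01 ->]]]; exists (S *m row' i 1%:M), c; split=> //.
    by apply: stochastic_mul => //; apply: stochastic_row'; exact: stochastic1.
  by rewrite -mulmxA -row'_mul mul1mx.
- move=> a r V' W [S [c [sS c01 ->]]].
  exists (ins_row ord0 (const_mx (a.+1%:R^-1)) S), (ins_row ord0 0 c); split.
  + by apply: stochastic_ins_row => //; exact: stochastic_bary.
  + by move=> i; rewrite mxE; case: unliftP => [i' _|_]; [exact: c01|rewrite mxE lexx ler01].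
  + by rewrite ins_row_row_mx ins_row_mul.
- move=> r f W Gf; apply: sG.2; apply: Gf; exists 1%:M.
    by exists (const_mx 1); split; rewrite ?mul1mx//; [exact: stochastic1|move=> a; rewrite mxE ler01 lexx].
  by exists 0; split; rewrite ?mul1mx//; [exact: stochastic1|move=> a; rewrite mxE ler01 lexx].
Qed.

Lemma eq_prism l K (f g : 'M[R]_(l.+2, K + 1) -> R) (V : 'M[R]_(l.+1, K)) :
  (forall W, prism_sub V W -> f W = g W) -> prism f V = prism g V.
Proof.
move=> E; apply/eqP; rewrite -subr_eq0 -prism_diff; apply/eqP.
by apply: (prism_subgroup (@subgroup0 R)) => W VW; rewrite E// subrr.
Qed.

End Prism.

Section Contraction.
Context {R : realType} {X : topologicalType} (B : set X) (ctr : X -> R -> X) (p0 : X).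

Local Notation delta w := (@coboundary R R X _ w).

Definition ctr_cell {k} (s : singular R X k) (y : 'rV[R]_(k.+1 + 1)) : X :=
  ctr (sext s (lsubmx y)) (rsubmx y 0 0).

Hypothesis ctr_cont : forall p t, B p -> 0 <= t <= 1 -> {for (p, t), continuous (fun q : X * R => ctr q.1 q.2)}.
Hypothesis ctr1 : forall p, B p -> ctr p 1 = p.
Hypothesis ctr0 : forall p, B p -> ctr p 0 = p0.

Variable C : forall k, singular R X k -> Prop.
Hypothesis CB : forall k (s : singular R X k), C s -> simage s `<=` B.
Hypothesis CS : forall k l (s : singular R X k) (S : 'M[R]_(l.+1, k.+1)), C s -> stochastic S ->
  C (asimp (sext s) S).
Hypothesis CP : forall k l (s : singular R X k) (S : 'M[R]_(l.+1, k.+1)) (c : 'cV[R]_l.+1), C s ->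
  stochastic S -> (forall a, 0 <= c a 0 <= 1) -> C (asimp (ctr_cell s) (row_mx S c)).

Lemma sext_face k (s : singular R X k.+1) i x : simplex R k x ->
  sext (sing_face i s) x = sext s (x *m row' i 1%:M).
Proof.
move=> sx; rewrite -{1}(spointK sx) -sextE /= sextE; congr (sext s _).
rewrite -insv0_mul mulmx1.
have -> : set_val (face i (spoint x)) = insv i 0 (set_val (spoint x)) by rewrite !set_valE.
by rewrite spointK.
Qed.

Lemma ctr_cell_continuous k (s : singular R X k) y : C s -> 0 <= rsubmx y 0 0 <= 1 -> {for y, continuous (ctr_cell s)}.
Proof.
move=> Cs y01.
apply: (@continuous_comp _ _ _ (fun y : 'rV[R]_(k.+1 + 1) => (sext s (lsubmx y), rsubmx y 0 0)) (fun q : X * R => ctr q.1 q.2)).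
  apply: (@continuous_pair _ _ _ (fun y : 'rV[R]_(k.+1 + 1) => sext s (lsubmx y)) (fun y : 'rV[R]_(k.+1 + 1) => rsubmx y 0 0)).
    apply: (@continuous_comp _ _ _ (fun y : 'rV[R]_(k.+1 + 1) => lsubmx y) (sext s)); last exact: sext_continuous.
    apply/continuous_rVP => j.
    rewrite (_ : (fun y => _) = (fun y : 'rV[R]_(k.+1 + 1) => y 0 (lshift 1 j))); last by apply/funext => z; rewrite mxE.
    exact: continuous_coord.
  rewrite (_ : (fun y => _) = (fun y : 'rV[R]_(k.+1 + 1) => y 0 (rshift k.+1 0))); last by apply/funext => z; rewrite mxE.
  exact: continuous_coord.
by apply: ctr_cont => //; apply: (CB Cs); exact: image_sext.
Qed.

Lemma hull_prism k l (S : 'M[R]_(l.+1, k.+1)) (c : 'cV[R]_l.+1) y : (forall a, 0 <= c a 0 <= 1) ->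
  hull (row_mx S c) y -> 0 <= rsubmx y 0 0 <= 1.
Proof.
move=> c01 [t [t0 t1] <-]; rewrite mul_mx_row row_mxKr mxE; apply/andP; split.
  by apply: sumr_ge0 => a _; rewrite mulr_ge0//; have /andP[] := c01 a.
rewrite -t1; apply: ler_sum => a _; rewrite ler_piMr//; have /andP[] := c01 a => //.
Qed.

Lemma ctr_cell_hull k l (s : singular R X k) (S : 'M[R]_(l.+1, k.+1)) (c : 'cV[R]_l.+1) : C s -> (forall a, 0 <= c a 0 <= 1) ->
  forall y, hull (row_mx S c) y -> {for y, continuous (ctr_cell s)}.
Proof. by move=> Cs c01 y /(hull_prism c01); exact: ctr_cell_continuous. Qed.

Lemma asimp_ctr k l (s : singular R X k) (S : 'M[R]_(l.+1, k.+1)) (c : 'cV[R]_l.+1) t : C s -> (forall a, 0 <= c a 0 <= 1) ->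
  asimp (ctr_cell s) (row_mx S c) t = ctr (sext s (set_val t *m S)) ((set_val t *m c) 0 0).
Proof.
move=> Cs c01; rewrite asimpE; last exact: ctr_cell_hull.
by rewrite /ctr_cell mul_mx_row row_mxKl row_mxKr.
Qed.

Definition cst_sing k : singular R X k := mk_sing (fun=> p0).

Lemma cst_singE k t : cst_sing k t = p0.
Proof. by rewrite mk_singE// => x; exact: cst_continuous. Qed.

Definition prismX {k} (w : singular R X k.+1 -> R) (s : singular R X k) : R :=
  prism (fun W => w (asimp (ctr_cell s) W)) 1%:M.

Lemma prismX_delta k (w : singular R X k.+1 -> R) (s : singular R X k.+1) : C s ->
  prismX (delta w) s + delta (prismX w) s = w s - w (cst_sing k.+1).
Proof.
move=> Cs; pose phi W := w (asimp (ctr_cell s) W).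
have c1 : forall a, 0 <= (const_mx 1 : 'cV[R]_k.+2) a 0 <= 1 by move=> a; rewrite mxE ler01 lexx.
have c0 : forall a, 0 <= (0 : 'cV[R]_k.+2) a 0 <= 1 by move=> a; rewrite mxE ler01 lexx.
have BS t : B (sext s t) by apply: (CB Cs); exact: image_sext.
have := prismP phi 1%:M.
have -> : phi (row_mx 1%:M (const_mx 1)) = w s.
  congr w; apply: singular_eq => t; rewrite asimp_ctr// mulmx1 sextE.
  have [_ t1] := simplex_point t.
  have -> : (set_val t *m (const_mx 1 : 'cV[R]_k.+2)) 0 0 = 1.
    by rewrite mxE -[RHS]t1; apply: eq_bigr => i _; rewrite mxE mulr1.
  exact: ctr1.
have -> : phi (row_mx 1%:M 0) = w (cst_sing k.+1).
  congr w; apply: singular_eq => t; rewrite asimp_ctr// mulmx1 cst_singE mulmx0 mxE; exact: ctr0.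
move=> <-; congr (_ + _).
  apply: eq_prism => _ [S [c [sS c01 ->]]]; rewrite mulmx1; apply: eq_bigr => i _; congr (_ * w _).
  by rewrite face_asimp//; exact: ctr_cell_hull.
apply: eq_bigr => i _; congr (_ * _).
rewrite /prismX -[row' i _ in RHS]mul1mx -prism_natural; apply: eq_prism => _ [S [c [sS c01 ->]]].
rewrite mulmx1 mul_row_block !mulmx0 addr0 add0r mulmx1; congr w; apply: singular_eq => t.
rewrite asimp_ctr//; last by rewrite face_row'; apply: CS => //; apply: stochastic_row'; exact: stochastic1.
rewrite asimp_ctr// sext_face ?mulmxA//; apply: simplex_stochastic => //; exact: simplex_point.
Qed.

Lemma face_cst k i : sing_face i (cst_sing k.+1) = cst_sing k.
Proof. by apply: singular_eq => t; rewrite /= !cst_singE. Qed.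

Lemma alternating_ones k (x : R) : \sum_(i < k) (-1) ^+ i * x = (odd k)%:R * x.
Proof.
elim: k => [|k IH]; first by rewrite big_ord0 mul0r.
rewrite big_ord_recr /= IH -signr_odd; case: (odd k); rewrite /= ?expr1 ?expr0; lra.
Qed.

(** The contraction compares s with the constant simplex at p0, so w is a coboundary modulo G up to
    the constant a; parity decides how a is removed. *)
Lemma contractible_cocycle G k (w : singular R X k.+1 -> R) : subgroup G ->
  (forall s : singular R X k.+2, C s -> G (delta w s)) ->
  exists u : singular R X k -> R, forall s, C s -> G (w s - delta u s).
Proof.
move=> sG cocycle.
pose a := w (cst_sing k.+1).
(* The coboundary of a constant k-cochain is an alternating sum of [k.+2] equal terms. For odd k it
   returns the constant, which accounts for a; for even k, a itself is the value of [delta w] on a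
   constant simplex and lies in G. *)
exists (fun t => prismX w t + (odd k)%:R * a) => s Cs.
have E : w s = prismX (delta w) s + delta (prismX w) s + a by rewrite prismX_delta// subrK.
have Gp : G (prismX (delta w) s).
  by apply: prism_subgroup => // _ [S [c [sS c01 ->]]]; rewrite mulmx1; apply: cocycle; exact: CP.
rewrite deltaD [X in _ - (_ + X)]alternating_ones /=.
rewrite (_ : w s - _ = prismX (delta w) s + (a - (~~ ~~ odd k)%:R * ((odd k)%:R * a))); last by rewrite E; ring.
rewrite negbK; apply: subgroupD => //; case: (boolP (odd k)) => ok; first by rewrite !mul1r subrr; exact: sG.1.
rewrite mul0r subr0.
have c01 : forall b, 0 <= (0 : 'cV[R]_k.+3) b 0 <= 1 by move=> b; rewrite mxE ler01 lexx.
(* At time 0 everything is contracted to p0, so any stochastic matrix shows that the constant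
   simplex belongs to C. *)
pose S : 'M[R]_(k.+3, k.+2) := \matrix_(b, j) (j == ord0)%:R.
have sS : stochastic S.
  move=> b; split=> [j|]; first by rewrite mxE.
  by rewrite (bigD1 ord0)//= mxE eqxx big1 ?addr0// => j /negbTE j0; rewrite mxE j0.
have := cocycle _ (CP Cs sS c01).
have -> : asimp (ctr_cell s) (row_mx S 0) = cst_sing k.+2.
  apply: singular_eq => t; rewrite asimp_ctr// mulmx0 [_ 0 0]mxE cst_singE; apply: ctr0.
  by apply: (CB Cs); exact: image_sext.
rewrite /coboundary; under eq_bigr do rewrite face_cst.
by rewrite alternating_ones /= negbK ok mul1r.
Qed.

End Contraction.

(** * Radial contraction of a ball in a chart *)

Section ChartBalls.
Context {R : realType} {n : nat} {M : manifold R n}.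

Record chart_ball := ChartBall {
  cb_chart : chart (R := R) M n;
  cb_center : 'rV[R]_n;
  cb_radius : R }.

Definition cb_set (b : chart_ball) : set M :=
  [set p | cdom (cb_chart b) p /\ `|cb_center b - cto (cb_chart b) p| < cb_radius b].

Definition cb_coord (b : chart_ball) : set 'rV[R]_n := [set y | `|cb_center b - y| < cb_radius b].

Record is_chart_ball (b : chart_ball) : Prop := {
  cb_atlas : matlas (cb_chart b);
  cb_pos : 0 < cb_radius b;
  cb_sub : cb_coord b `<=` chart_image (cb_chart b) }.

Lemma open_coord_ball (x : 'rV[R]_n) r : open [set y | `|x - y| < r].
Proof.
rewrite openE => y /= xy; apply/nbhs_ballP; exists (r - `|x - y|) => /=; first by rewrite subr_gt0.
move=> z; rewrite -ball_normE /= => yz; rewrite -(subrKA y).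
by apply: le_lt_trans (ler_normD _ _) _; rewrite -ltrBrDl.
Qed.

Lemma chart_ball_exists (W : set M) p : open W -> W p -> exists b, [/\ is_chart_ball b, cb_set b p & cb_set b `<=` W].
Proof.
move=> oW Wp; set c := mchart p.
have ac : matlas c by exact: mchart_atlas.
have cp : cdom c p by exact: mchart_dom.
have oU := chart_sub_open ac oW.
have Ux : chart_sub c W (cto c p) by exists p.
have /nbhs_ballP[r /= r0 Hr] : nbhs (cto c p) (chart_sub c W) by exact: open_nbhs_nbhs.
exists (ChartBall c (cto c p) r); split.
- split=> //= y /= yr; have /Hr[q [cq _] <-] : ball (cto c p) r y by rewrite -ball_normE.
  by exists q.
- by split=> //=; rewrite subrr normr0.
move=> q [/= cq qr]; have /Hr[q' [cq' Wq'] E] : ball (cto c p) r (cto c q) by rewrite -ball_normE.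
by rewrite -(cfromK ac cq) -E cfromK.
Qed.

Context (b : chart_ball) (hb : is_chart_ball b).
Local Notation c := (cb_chart b).
Local Notation x0 := (cb_center b).
Local Notation r := (cb_radius b).
Local Notation B := (cb_set b).

Let ac := cb_atlas hb.

Lemma cb_open : open B.
Proof.
have -> : B = cdom c `&` cto c @^-1` cb_coord b by [].
apply: open_preim_at; [exact: chart_open|by move=> p; exact: cto_continuous|exact: open_coord_ball].
Qed.

Lemma cb_fromP y : cb_coord b y -> B (cfrom c y) /\ cto c (cfrom c y) = y.
Proof. by move=> yb; have [cy Ey] := chart_imageP ac (cb_sub hb yb); split=> //; split=> //; rewrite Ey. Qed.

Definition radial (y : 'rV[R]_n) (t : R) : 'rV[R]_n := x0 + t *: (y - x0).

Lemma radial_in y t : cb_coord b y -> 0 <= t <= 1 -> cb_coord b (radial y t).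
Proof.
move=> yb /andP[t0 t1]; rewrite /cb_coord /radial /= opprD addrA subrr add0r normrN normrZ distrC ger0_norm//.
by apply: le_lt_trans yb; rewrite ler_piMl.
Qed.

Definition contract (p : M) (t : R) : M := cfrom c (radial (cto c p) t).

Lemma continuous_radial : continuous (fun q : 'rV[R]_n * R => radial q.1 q.2).
Proof.
move=> q; apply: cvgD; first exact: cvg_cst.
apply: cvgZ; first exact: cvg_snd.
by apply: cvgB; [exact: cvg_fst|exact: cvg_cst].
Qed.

Lemma contract_continuous p t : B p -> 0 <= t <= 1 -> {for (p, t), continuous (fun q : M * R => contract q.1 q.2)}.
Proof.
move=> Bp t01; have [cp pb] := Bp.
apply: (@continuous_comp _ _ _ (fun q : M * R => radial (cto c q.1) q.2) (cfrom c)).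
  apply: (@continuous_comp _ _ _ (fun q : M * R => (cto c q.1, q.2)) (fun q : 'rV[R]_n * R => radial q.1 q.2)).
    apply: (@continuous_pair _ _ _ (fun q : M * R => cto c q.1) (fun q : M * R => q.2)); last exact: cvg_snd.
    by apply: (@continuous_comp _ _ _ (fun q : M * R => q.1) (cto c)); [exact: cvg_fst|exact: cto_continuous].
  exact: continuous_radial.
by apply: cfrom_continuous => //; apply: (cb_sub hb); exact: radial_in.
Qed.

Lemma contract1 p : B p -> contract p 1 = p.
Proof. by move=> [cp _]; rewrite /contract /radial scale1r addrC subrK cfromK. Qed.

Lemma contract0 p : B p -> contract p 0 = cfrom c x0.
Proof. by move=> _; rewrite /contract /radial scale0r addr0. Qed.

Definition ball_simplex (k : nat) (s : singular R M k) := smooth_simplex s /\ simage s `<=` B.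

Lemma ball_simplex_affine k l (s : singular R M k) (S : 'M[R]_(l.+1, k.+1)) : ball_simplex s -> stochastic S ->
  ball_simplex (asimp (sext s) S).
Proof.
move=> [ss sB] sS; split; first exact: smooth_simplex_affine.
move=> _ [t _ <-]; rewrite asimpE => [|x _]; [by apply: sB; exact: image_sext|exact: sext_continuous].
Qed.

(** [sext s] is merely continuous off the simplex, so the contracted simplex is rewritten with a
    smooth extension g of s; it then factors through the inverse chart and a map that is smooth in
    both the point and the time. *)
Lemma ball_simplex_contract k l (s : singular R M k) (S : 'M[R]_(l.+1, k.+1)) (a : 'cV[R]_l.+1) :
  ball_simplex s -> stochastic S -> (forall i, 0 <= a i 0 <= 1) ->
  ball_simplex (asimp (ctr_cell contract s) (row_mx S a)).
Proof.
move=> [ss sB] sS a01; have [ O [g [sp sO Es gB]]] := smooth_simplex_in ss cb_open sB.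
have [oO cg sg] := sp.
pose O1 : set 'rV[R]_(k.+1 + 1) := lsubmx @^-1` O.
have clsub : continuous (fun y : 'rV[R]_(k.+1 + 1) => lsubmx y : 'rV[R]_k.+1).
  move=> y; apply/continuous_rVP => j.
  rewrite (_ : (fun y => _) = (fun y : 'rV[R]_(k.+1 + 1) => y 0 (lshift 1 j))); last by apply/funext => z; rewrite mxE.
  exact: continuous_coord.
have oO1 : open O1 by apply: open_preim.
pose f (y : 'rV[R]_(k.+1 + 1)) := radial (cto c (g (lsubmx y))) (rsubmx y 0 0).
have Elsub : (fun y : 'rV[R]_(k.+1 + 1) => lsubmx y : 'rV[R]_k.+1) = (fun y => y *m col_mx 1%:M 0 + 0).
  by apply/funext => y; rewrite addr0 -{2}(hsubmxK y) mul_row_col mulmx1 mulmx0 addr0.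
have slsub : smooth_on O1 (fun y : 'rV[R]_(k.+1 + 1) => lsubmx y : 'rV[R]_k.+1).
  by rewrite Elsub; exact: smooth_affine.
have sgO : smooth_on O (cto c \o g).
  by apply: sub_smooth (sg c ac) => x Ox; split=> //; have [] := gB x Ox.
have sgl : smooth_on O1 ((cto c \o g) \o (fun y : 'rV[R]_(k.+1 + 1) => lsubmx y)).
  by apply: (smooth_compV oO1 oO slsub sgO).
have sf : smooth_on O1 f.
  apply/smooth_rVP => // j.
  apply: (@eq_smooth _ _ _ O1 (fun y : 'rV[R]_(k.+1 + 1) => x0 0 j + y 0 (rshift k.+1 0) * ((cto c (g (lsubmx y))) 0 j - x0 0 j) : R^o)) => //.
    by move=> y _; rewrite !mxE.
  apply: smooth_add => //; first exact: smooth_cst.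
  apply: smooth_mul => //; first exact: smooth_coord.
  apply: smooth_sub => //; last exact: smooth_cst.
  exact: ((smooth_rVP _ oO1).1 sgl j).
pose O2 := O1 `&` f @^-1` cb_coord b.
have oO2 : open O2.
  by apply: open_preim_at => //; [move=> y Oy; exact: smooth_continuous sf Oy|exact: open_coord_ball].
have spG : smooth_param O2 (cfrom c \o f).
  apply: (smooth_param_comp (smooth_param_cfrom ac) oO2); first by apply: sub_smooth sf => y [].
  by move=> y [_ /(cb_sub hb)].
have hullO y : hull (row_mx S a) y -> simplex R k (lsubmx y) /\ O2 y.
  move=> hy; have y01 := hull_prism a01 hy; have [t st Ey] := hy.
  have sy : simplex R k (lsubmx y).
    by rewrite -Ey mul_mx_row row_mxKl; exact: simplex_stochastic.
  have Oy := sO _ sy.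
  by split=> //; split=> //; apply: radial_in => //; have [] := gB _ Oy.
have cc : forall y, hull (row_mx S a) y -> {for y, continuous (ctr_cell contract s)}.
  apply: (@ctr_cell_hull R M B contract contract_continuous (fun k s => simage s `<=` B)) => //.
have -> : asimp (ctr_cell contract s) (row_mx S a) = asimp (cfrom c \o f) (row_mx S a).
  apply: eq_asimp => // [y hy|y hy].
    by apply: (smooth_param_hull spG) hy => z /hullO[].
  have [sy _] := hullO y hy; rewrite /ctr_cell /contract /= /f; congr (cfrom c (radial (cto c _) _)).
  rewrite -{1}(spointK sy) -sextE Es asimpE ?mulmx1 ?spointK//.
  by apply: smooth_param_hull sp _; rewrite hull1.
have sub2 : hull (row_mx S a) `<=` O2 by move=> y /hullO[].
split; first exact: smooth_simplex_asimp spG sub2.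
apply: image_asimp; first exact: smooth_param_hull spG sub2.
by move=> y /sub2[_ /cb_fromP[]].
Qed.

Lemma chart_ball_cocycle G k (w : singular R M k.+1 -> R) : subgroup G ->
  (forall s : singular R M k.+2, smooth_simplex s -> simage s `<=` B -> G (@coboundary R R M _ w s)) ->
  exists u : singular R M k -> R, forall s, smooth_simplex s -> simage s `<=` B ->
    G (w s - @coboundary R R M _ u s).
Proof.
move=> sG cocycle.
have [||u Hu] := @contractible_cocycle R M B contract (cfrom c x0) contract_continuous contract1 contract0
  ball_simplex _ ball_simplex_affine ball_simplex_contract G k w sG.
- by move=> l s [].
- by move=> s [ss sB]; exact: cocycle.
by exists u => s ss sB; exact: Hu.
Qed.

End ChartBalls.

(** * The Poincare lemma on a ball *)

Section Poincare.
Context {R : realType} {n : nat} (x0 : 'rV[R]_n) (r : R).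
Hypothesis r0 : 0 < r.

Let D : set 'rV[R]_n := [set y | `|x0 - y| < r].
Let oD : open D. Proof. exact: open_coord_ball. Qed.

(* Clamping to a closed ball extends functions continuous on D to functions continuous everywhere. *)
Definition clampV (rho : R) (y : 'rV[R]_n) : 'rV[R]_n :=
  \row_j Num.max (x0 0 j - rho) (Num.min (x0 0 j + rho) (y 0 j)).

Lemma clampV_in (rho : R) y : 0 <= rho -> `|x0 - clampV rho y| <= rho.
Proof.
move=> rho0; apply: norm_rV_le => // j; rewrite !mxE ler_norml.
by case: (leP (x0 0 j + rho) (y 0 j)) => H1;
  [case: (leP (x0 0 j - rho) (x0 0 j + rho))|case: (leP (x0 0 j - rho) (y 0 j))] => H2; apply/andP; split; lra.
Qed.

Lemma clampV_id (rho : R) y : `|x0 - y| <= rho -> clampV rho y = y.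
Proof.
move=> H; apply/rowP => j; rewrite mxE.
have := le_trans (norm_coord (x0 - y) j) H; rewrite !mxE ler_norml => /andP[H1 H2].
by rewrite min_r ?max_r//; lra.
Qed.

Lemma clampV_continuous (rho : R) : continuous (clampV rho).
Proof.
move=> y; apply/continuous_rVP => j.
rewrite (_ : (fun y => _) = (fun y : 'rV[R]_n => Num.max (x0 0 j - rho) (Num.min (x0 0 j + rho) (y 0 j)))); last first.
  by apply/funext => z; rewrite mxE.
apply: (@continuous_max R _ (fun=> x0 0 j - rho) (fun y : 'rV[R]_n => Num.min (x0 0 j + rho) (y 0 j))).
  exact: cst_continuous.
apply: (@continuous_min R _ (fun=> x0 0 j + rho) (fun y : 'rV[R]_n => y 0 j)).
  exact: cst_continuous.
exact: continuous_coord.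
Qed.

(** Radial average with weight t^a. A directional derivative raises the exponent by one, and the
    primitive of a form of degree k + 1 has weight t^k. *)
Definition ray (a : nat) (phi : 'rV[R]_n -> R) (x : 'rV[R]_n) : R^o :=
  Jint 1 (fun t => t ^+ a * phi (x0 + t *: (x - x0))).

Lemma D_radius x : D x -> exists2 rho, 0 < rho & `|x0 - x| < rho < r.
Proof.
move=> Dx; exists ((`|x0 - x| + r) / 2).
  by rewrite divr_gt0// ltr_wpDl.
by rewrite /D /= in Dx; apply/andP; split; lra.
Qed.

Lemma D_ray x t : D x -> 0 <= t <= 1 -> D (x0 + t *: (x - x0)).
Proof.
move=> Dx /andP[t0 t1]; rewrite /D /= opprD addrA subrr add0r normrN normrZ distrC ger0_norm//.
by apply: le_lt_trans Dx; rewrite ler_piMl.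
Qed.

Section Clamped.
Context (phi : 'rV[R]_n -> R^o) (rho : R).
Hypotheses (rho0 : 0 < rho) (rhor : rho < r) (cphi : forall x, D x -> {for x, continuous phi}).

Lemma clamped_continuous : continuous (fun y => phi (clampV rho y)).
Proof.
move=> y; apply: (@continuous_comp _ _ _ (clampV rho) phi); first exact: clampV_continuous.
by apply: cphi; rewrite /D /=; apply: le_lt_trans rhor; apply: clampV_in; exact: ltW.
Qed.

Lemma ray_clamped a x : `|x0 - x| <= rho -> ray a phi x = ray a (fun y => phi (clampV rho y)) x.
Proof.
move=> xr; apply: eq_Jint => t /andP[t0 t1]; rewrite clampV_id//.
rewrite opprD addrA subrr add0r normrN normrZ distrC ger0_norm ?(ltW t0)//.
by apply: le_trans xr; rewrite ler_piMl// ltW.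
Qed.

Lemma ray_clamped_integrand a x : continuous (fun t : R => t ^+ a * phi (clampV rho (x0 + t *: (x - x0))) : R^o).
Proof.
apply: cfunM; first by move=> t; exact: exprn_continuous.
apply: (ccomp clamped_continuous) => t; apply: cvgD; first exact: cvg_cst.
by apply: cvgZ; [exact: cvg_id|exact: cvg_cst].
Qed.

End Clamped.

(** A difference quotient that extends continuously to h = 0 has its value there as derivative. This
    stands in for differentiation under the integral sign. *)
Lemma quotient_derive (V : normedModType R) (f : V -> R^o) (x v : V) (P : R -> R^o) :
  (\forall h \near (0 : R), f (h *: v + x) - f x = h * P h) -> {for 0, continuous P} -> is_derive x v f (P 0).
Proof.
move=> H cP.
suff L : (fun h => h^-1 *: ((f \o shift x) (h *: v) - f x)) @ 0^' --> P 0.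
  by apply: DeriveDef; [apply/cvg_ex; exists (P 0)|exact: cvg_lim L].
apply/cvgrPdist_lt => e e0.
have cP' : \forall h \near (0 : R)^', `|P 0 - P h| < e.
  by move/cvgrPdist_lt : cP => /(_ e e0) cP; exact: cvg_within cP.
have H' : \forall h \near (0 : R)^', f (h *: v + x) - f x = h * P h by exact: cvg_within H.
have h0 : \forall h \near (0 : R)^', h != 0 by exact: nbhs_dnbhs_neq.
by apply: filterS3 cP' H' h0 => h ch /= -> h0; rewrite scale_regE mulKf.
Qed.

Lemma continuous_scale (T : topologicalType) (f : T -> R^o) c y : {for y, continuous f} ->
  {for y, continuous (fun y => c * f y : R^o)}.
Proof. by move=> cf; apply: (@cvgM _ _ _ _ (fun=> c) f); [exact: cvg_cst|exact: cf]. Qed.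

Lemma derive_scalar (V : normedModType R) (f : V -> R^o) c x v : derivable f x v ->
  derivable (fun y => c * f y : R^o) x v /\ 'D_v (fun y => c * f y : R^o) x = c * 'D_v f x.
Proof.
by move=> df; have -> : (fun y => c * f y : R^o) = c *: f by []; split; [exact: derivableZ|rewrite deriveZ].
Qed.

Section Rays.
Implicit Types (phi psi : 'rV[R]_n -> R^o) (a : nat).

Lemma eq_ray a phi psi x : (forall y, D y -> phi y = psi y) -> D x -> ray a phi x = ray a psi x.
Proof.
move=> E Dx; apply: eq_Jint => t /andP[t0 t1]; rewrite E//; apply: D_ray => //.
by rewrite !ltW.
Qed.

Lemma ray_lin a c phi psi x : (forall y, D y -> {for y, continuous phi}) ->
  (forall y, D y -> {for y, continuous psi}) -> D x ->
  ray a (fun y => c * phi y + psi y) x = c * ray a phi x + ray a psi x.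
Proof.
move=> cphi cpsi Dx; have [rho rho0 /andP[/ltW xr rr]] := D_radius Dx.
rewrite (ray_clamped (fun y => c * phi y + psi y) a xr) (ray_clamped phi a xr) (ray_clamped psi a xr) /ray.
have c1 := ray_clamped_integrand rho0 rr cphi (a := a) (x := x); have c2 := ray_clamped_integrand rho0 rr cpsi (a := a) (x := x).
rewrite -JintZ// -JintD//; last by apply: cfunM => //; exact: cfunC.
by apply: eq_Jint => t _; ring.
Qed.

Lemma ray0 a x : ray a (fun=> 0) x = 0.
Proof.
rewrite /ray (@eq_Jint _ _ _ (fun=> 0 * 0)) => [|t _]; last by rewrite !mulr0.
by rewrite JintZ ?mul0r//; exact: cfunC.
Qed.

Lemma rayZ a c phi x : (forall y, D y -> {for y, continuous phi}) -> D x ->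
  ray a (fun y => c * phi y) x = c * ray a phi x.
Proof.
move=> cphi Dx; rewrite -[RHS]addr0 -(ray0 a x) -ray_lin//; last by move=> y _; exact: cst_continuous.
by congr ray; apply/funext => y; rewrite addr0.
Qed.

Lemma ray_sum a (I : Type) (s : seq I) (c : I -> R) (phi : I -> 'rV[R]_n -> R^o) x :
  (forall i y, D y -> {for y, continuous (phi i)}) -> D x ->
  ray a (fun y => \sum_(i <- s) c i * phi i y) x = \sum_(i <- s) c i * ray a (phi i) x.
Proof.
move=> cphi Dx; elim: s => [|i s IH].
  rewrite big_nil -[RHS](ray0 a x); congr ray; apply/funext => y; exact: big_nil.
rewrite big_cons -IH -ray_lin//; first by congr ray; apply/funext => y; exact: big_cons.
  exact: cphi.
move=> y Dy; apply: (@cvg_sumr _ R^o _ (nbhs y)) => j.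
by apply: (@cvgM _ _ _ _ (fun=> c j) (phi j)); [exact: cvg_cst|exact: cphi].
Qed.

Lemma ray_continuous a phi x : (forall y, D y -> {for y, continuous phi}) -> D x ->
  {for x, continuous (ray a phi)}.
Proof.
move=> cphi Dx; have [rho rho0 /andP[xr rr]] := D_radius Dx.
pose g (z : 'rV[R]_n) (t : R) : R^o := t ^+ a * phi (clampV rho (x0 + t *: (z - x0))).
apply: (@eq_continuous_at _ _ _ [set y | `|x0 - y| < rho] (fun y => Jint 1 (g y) : R^o)) => //.
- exact: open_coord_ball.
- by move=> y /= /ltW yr; exact/esym/(ray_clamped phi a yr).
have cg : continuous (fun p : 'rV[R]_n * R => g p.1 p.2 : R^o).
  apply: cfunM; first by apply: (@ccomp _ _ _ (fun t : R => t ^+ a : R^o) snd); [move=> t; exact: exprn_continuous|exact: csnd].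
  apply: (ccomp (clamped_continuous rho0 rr cphi)).
  move=> q; apply: cvgD; first exact: cvg_cst.
  by apply: cvgZ; [exact: cvg_snd|apply: cvgB; [exact: cvg_fst|exact: cvg_cst]].
apply: (@ccomp _ _ _ (fun p : 'rV[R]_n * R => Jint p.2 (g p.1) : R^o) (fun z => (z, 1))).
  exact: Jint_continuous.
by apply: cpair; [exact: cid_|move=> z; exact: cst_continuous].
Qed.

Lemma segment_in (rho : R) (z w : 'rV[R]_n) (s : R) : `|x0 - z| <= rho -> `|x0 - (z + w)| <= rho -> 0 <= s <= 1 ->
  `|x0 - (z + s *: w)| <= rho.
Proof.
move=> H0 H1 /andP[s0 s1].
have -> : x0 - (z + s *: w) = (1 - s) *: (x0 - z) + s *: (x0 - (z + w)).
  by apply/rowP => j; rewrite !mxE; ring.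
apply: le_trans (ler_normD _ _) _; rewrite !normrZ (ger0_norm s0) ger0_norm ?subr_ge0//.
have -> : rho = (1 - s) * rho + s * rho by ring.
by apply: lerD; rewrite ler_wpM2l ?subr_ge0.
Qed.

Lemma segment_FTC (rho : R) phi (v z : 'rV[R]_n) c : 0 < rho -> rho < r -> smooth_on D phi ->
  `|x0 - z| <= rho -> `|x0 - (z + c *: v)| <= rho ->
  phi (z + c *: v) - phi z = c * Jint 1 (fun s => 'D_v phi (clampV rho (z + (s * c) *: v))).
Proof.
move=> rho0 rr sphi H0 H1.
have sD := smooth_derive v sphi.
have cD : continuous (fun s : R => 'D_v phi (clampV rho (z + (s * c) *: v)) : R^o).
  apply: (ccomp (clamped_continuous rho0 rr (fun y => smooth_continuous sD))) => s.
  apply: cvgD; first exact: cvg_cst.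
  by apply: cvgZ; [apply: cvgM; [exact: cvg_id|exact: cvg_cst]|exact: cvg_cst].
have Din s : 0 <= s <= 1 -> D (z + s *: (c *: v)).
  by move=> s01; rewrite /D /=; apply: le_lt_trans rr; exact: segment_in.
have dF (s : R) : 0 <= s <= 1 -> is_derive s 1 (fun h : R => phi (z + h *: (c *: v)))
    (c * 'D_v phi (clampV rho (z + (s * c) *: v))).
  move=> s01; have Ds := Din s s01.
  have [d1 E1] := is_derive_scale c (smooth_derivable (v := v) sphi Ds).
  have [d2 E2] := is_derive_line d1; apply: DeriveDef => //.
  rewrite E2 E1 clampV_id; first by rewrite scalerA.
  by rewrite -scalerA; exact: segment_in.
have cc : continuous (fun s : R => c * 'D_v phi (clampV rho (z + (s * c) *: v)) : R^o).
  by apply: cfunM => //; exact: cfunC.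
have cF : {within `[0, 1], continuous (fun h : R => phi (z + h *: (c *: v)))}.
  by apply: derivable_within_continuous => s; rewrite in_itv/= => /dF[].
have dFo (s : R) : 0 < s < 1 -> is_derive s 1 (fun h : R => phi (z + h *: (c *: v)))
    (c * 'D_v phi (clampV rho (z + (s * c) *: v))).
  by move=> /andP[s0 s1]; apply: dF; rewrite !ltW.
by rewrite -(JintZ 1 c cD) (Jint_FTC cc cF ler01 dFo) scale1r scale0r addr0.
Qed.

(** By [segment_FTC] the increment of phi along t h v is t h times an integral of ['D_v phi]; the
    difference quotient of the ray integral is thus an integral P h, continuous in h. *)
Lemma ray_derive a phi x v : smooth_on D phi -> D x -> is_derive x v (ray a phi) (ray a.+1 ('D_v phi) x).
Proof.
move=> sphi Dx; have [rho rho0 /andP[xr rr]] := D_radius Dx.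
have sD := smooth_derive v sphi; set psi := 'D_v phi.
have cpsi := clamped_continuous rho0 rr (fun y => smooth_continuous sD).
have cphi := fun y => smooth_continuous sphi (x := y).
pose Q (h t : R) : R^o := Jint 1 (fun s => psi (clampV rho (x0 + t *: (x - x0) + (s * (t * h)) *: v))).
pose P (h : R) : R^o := Jint 1 (fun t => t ^+ a.+1 * Q h t).
have cQ : continuous (fun p : R * R => Q p.1 p.2 : R^o).
  apply: (@ccomp _ _ _ (fun q : (R * R) * R => Jint q.2 (fun s => psi (clampV rho (x0 + q.1.2 *: (x - x0) + (s * (q.1.2 * q.1.1)) *: v))) : R^o) (fun p => (p, 1))).
    apply: (@Jint_continuous R (R * R)%type (fun p s => psi (clampV rho (x0 + p.2 *: (x - x0) + (s * (p.2 * p.1)) *: v)))).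
    apply: (ccomp cpsi) => q; apply: cvgD.
      apply: cvgD; first exact: cvg_cst.
      by apply: cvgZ; [apply: (@ccomp _ _ _ snd (fun q : (R * R) * R => q.1)); [exact: csnd|exact: cfst]|exact: cvg_cst].
    apply: cvgZ; last exact: cvg_cst.
    apply: cvgM; first exact: cvg_snd.
    by apply: cvgM; [apply: (@ccomp _ _ _ snd (fun q : (R * R) * R => q.1)); [exact: csnd|exact: cfst]|
      apply: (@ccomp _ _ _ fst (fun q : (R * R) * R => q.1)); [exact: cfst|exact: cfst]].
  by apply: cpair; [exact: cid_|move=> z; exact: cst_continuous].
have cP : continuous P.
  apply: (@ccomp _ _ _ (fun p : R * R => Jint p.2 (fun t => t ^+ a.+1 * Q p.1 t) : R^o) (fun h => (h, 1))).
    apply: (@Jint_continuous R R (fun h t => t ^+ a.+1 * Q h t)); apply: cfunM => //.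
    by apply: (@ccomp _ _ _ (fun t : R => t ^+ a.+1 : R^o) snd); [move=> t; exact: exprn_continuous|exact: csnd].
  by apply: cpair; [exact: cid_|move=> z; exact: cst_continuous].
have cQh h : continuous (fun t : R => t ^+ a.+1 * Q h t : R^o).
  apply: cfunM; first by move=> t; exact: exprn_continuous.
  exact: (@continuous_section R R Q h cQ).
have xrW := ltW xr.
have E : ray a.+1 psi x = P 0.
  rewrite (ray_clamped psi a.+1 xrW); apply: eq_Jint => t _; congr (_ * _).
  rewrite /Q; have -> : (fun s : R => psi (clampV rho (x0 + t *: (x - x0) + (s * (t * 0)) *: v))) =
      (fun s => psi (clampV rho (x0 + t *: (x - x0))) * 1).
    by apply/funext => s; rewrite !mulr0 scale0r addr0 mulr1.
  rewrite JintZ; last exact: cfunC.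
  have cF : {within `[0, 1], continuous (fun s : R => s : R^o)} by apply: continuous_subspaceT => z; exact: cvg_id.
  by rewrite (Jint_FTC (@cfunC _ _ 1) cF ler01 (fun s _ => is_derive_id s 1)) subr0 mulr1.
rewrite E; apply: quotient_derive; last exact: cP.
have near_in : \forall h \near (0 : R), `|x0 - (h *: v + x)| < rho.
  have c : {for (0 : R), continuous (fun h : R => h *: v + x)}.
    by apply: cvgD; [apply: cvgZ; [exact: cvg_id|exact: cvg_cst]|exact: cvg_cst].
  apply: (c [set y | `|x0 - y| < rho]); apply: open_nbhs_nbhs; split; first exact: open_coord_ball.
  by rewrite /= scale0r add0r.
apply: filterS near_in => h /ltW hr.
rewrite (ray_clamped phi a hr) (ray_clamped phi a xrW) /ray.
rewrite -JintB; [|exact: (ray_clamped_integrand rho0 rr cphi)..].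
rewrite -JintZ; last exact: cQh.
apply: eq_Jint => t /andP[t0 t1].
have t01 : 0 <= t <= 1 by rewrite !ltW.
have in1 z : `|x0 - z| <= rho -> `|x0 - (x0 + t *: (z - x0))| <= rho.
  move=> zr; rewrite opprD addrA subrr add0r normrN normrZ distrC ger0_norm ?(ltW t0)//.
  by apply: le_trans zr; rewrite ler_piMl// ltW.
rewrite !clampV_id; [|exact: in1..].
have E1 : x0 + t *: (h *: v + x - x0) = x0 + t *: (x - x0) + (t * h) *: v.
  by apply/rowP => j; rewrite !mxE; ring.
have := in1 _ hr; rewrite E1 => in2.
rewrite -mulrBr (segment_FTC rho0 rr sphi (in1 _ xrW) in2) /Q exprS; ring.
Qed.

Lemma smooth_ray a phi : smooth_on D phi -> smooth_on D (ray a phi).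
Proof.
move=> sphi.
pose K (F : 'rV[R]_n -> R^o) := exists a phi, smooth_on D phi /\ F = ray a phi.
apply: (@smooth_coind R _ _ D K oD); last by exists a, phi.
  move=> _ [b [psi [sp ->]]] x Dx; split.
    by apply: ray_continuous => // y; exact: smooth_continuous sp.
  by move=> v; have [] := ray_derive b v sp Dx.
move=> _ v [b [psi [sp ->]]]; exists (ray b.+1 ('D_v psi)).
  by exists b.+1, ('D_v psi); exact: (conj (smooth_derive v sp) erefl).
by move=> x Dx; have [] := ray_derive b v sp Dx.
Qed.

(** Integrate the derivative of t^(a+1) phi (x0 + t (x - x0)) over [0, 1]. *)
Lemma ray_euler a phi x : smooth_on D phi -> D x ->
  a.+1%:R * ray a phi x + ray a.+1 ('D_(x - x0) phi) x = phi x.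
Proof.
move=> sphi Dx; have [rho rho0 /andP[/ltW xr rr]] := D_radius Dx.
set v := x - x0; have sD := smooth_derive v sphi.
rewrite (ray_clamped phi a xr) (ray_clamped ('D_v phi) a.+1 xr) /ray.
have c1 := ray_clamped_integrand rho0 rr (fun y => smooth_continuous sphi (x := y)) (a := a) (x := x).
have c2 := ray_clamped_integrand rho0 rr (fun y => smooth_continuous sD (x := y)) (a := a.+1) (x := x).
rewrite -JintZ// -JintD//; last by apply: cfunM => //; exact: cfunC.
have in1 t : 0 <= t <= 1 -> `|x0 - (x0 + t *: v)| <= rho.
  apply: (@segment_in rho x0 v t); first by rewrite subrr normr0 ltW.
  by have -> : x0 + v = x by rewrite addrC subrK.
have dF (t : R) : 0 <= t <= 1 -> is_derive t 1 (fun t : R => t ^+ a.+1 * phi (x0 + t *: v) : R^o)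
    (a.+1%:R * (t ^+ a * phi (clampV rho (x0 + t *: v))) + t ^+ a.+1 * 'D_v phi (clampV rho (x0 + t *: v))).
  move=> t01; have Dt : D (x0 + t *: v) by rewrite /D /=; apply: le_lt_trans rr; exact: in1.
  have [d1 E1] := is_derive_line (smooth_derivable (v := v) sphi Dt).
  have d2 := @exprn_derivable R a.+1 t 1; have E2 := @exp_derive R a.+1 t 1.
  apply: (@DeriveDef _ _ _ _ _ _ _ (@derivableM R R^o (fun t : R => t ^+ a.+1) _ t 1 d2 d1)).
  by rewrite (deriveMR d2 d1) E1 E2 clampV_id ?in1//= !scale_regE; ring.
have cF : {within `[0, 1], continuous (fun t : R => t ^+ a.+1 * phi (x0 + t *: v) : R^o)}.
  by apply: derivable_within_continuous => s; rewrite in_itv/= => /dF[].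
have dFo (t : R) : 0 < t < 1 -> is_derive t 1 (fun t : R => t ^+ a.+1 * phi (x0 + t *: v) : R^o)
    (a.+1%:R * (t ^+ a * phi (clampV rho (x0 + t *: v))) + t ^+ a.+1 * 'D_v phi (clampV rho (x0 + t *: v))).
  by move=> /andP[s0 s1]; apply: dF; rewrite !ltW.
have cc : continuous (fun t : R => a.+1%:R * (t ^+ a * phi (clampV rho (x0 + t *: v))) + t ^+ a.+1 * 'D_v phi (clampV rho (x0 + t *: v)) : R^o).
  by apply: cfunD => //; apply: cfunM => //; exact: cfunC.
by rewrite (Jint_FTC cc cF ler01 dFo) expr1n mul1r scale1r expr0n /= mul0r subr0 /v addrC subrK.
Qed.

End Rays.

Lemma row_lift_ins_row (l : nat) (i : 'I_l) (w : 'rV[R]_n) (A : 'M[R]_(l, n)) :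
  row (lift ord0 i) (ins_row ord0 w A) = row i A.
Proof. by apply/rowP => z; rewrite !mxE liftK. Qed.

Lemma row'_ins_row_eq (l : nat) (i : 'I_l) (w : 'rV[R]_n) (A B : 'M[R]_(l, n)) : row' i A = row' i B ->
  row' (lift ord0 i) (ins_row ord0 w A) = row' (lift ord0 i) (ins_row ord0 w B).
Proof. by case: l i A B => [[]//|l] i A B E; rewrite !row'_ins_row0 E. Qed.

Section Primitive.
Context (k : nat) (eta : 'rV[R]_n -> 'M[R]_(k.+1, n) -> R).
Hypothesis feta : is_eform D eta.

Let comp (u : 'M[R]_(k, n)) (w y : 'rV[R]_n) : R^o := eta y (ins_row ord0 w u).

(** The homotopy operator of the radial contraction. It is written in components so that smoothness
    is a matter of sums and products; [primitiveE] gives the usual form, with x - x0 inserted as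
    first argument. *)
Definition primitive (x : 'rV[R]_n) (u : 'M[R]_(k, n)) : R :=
  \sum_j (x - x0) 0 j * ray k (comp u (delta_mx 0 j)) x.

Let smooth_comp_ u w : smooth_on D (comp u w).
Proof. by have [_ s] := feta; exact: s. Qed.

Let cont_comp u w y : D y -> {for y, continuous (comp u w)}.
Proof. exact: smooth_continuous. Qed.

Let comp_expand u w y : D y -> comp u w y = \sum_j w 0 j * comp u (delta_mx 0 j) y.
Proof.
move=> Dy; have [alt _] := feta; pose A := ins_row ord0 0 u.
have E v : ins_row ord0 v u = setrow ord0 v A by rewrite -ins_row_row' row'_ins_row.
rewrite /comp E (multilinear_expand _ _ _ (alt_multilinear (alt y Dy))).
by apply: eq_bigr => j _; rewrite E.
Qed.

Let ray_expand a u w x : D x -> ray a (comp u w) x = \sum_j w 0 j * ray a (comp u (delta_mx 0 j)) x.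
Proof.
move=> Dx; rewrite -ray_sum//; last by move=> j y; exact: cont_comp.
by apply: eq_ray => // y; exact: comp_expand.
Qed.

Let derive_comp_expand u v w y : D y -> 'D_v (comp u w) y = \sum_j w 0 j * 'D_v (comp u (delta_mx 0 j)) y.
Proof.
move=> Dy; have dc j : derivable (comp u (delta_mx 0 j)) y v by exact: smooth_derivable (smooth_comp_ _ _) Dy.
have dc' j : derivable (fun y => w 0 j * comp u (delta_mx 0 j) y : R^o) y v by case: (derive_scalar (w 0 j) (dc j)).
rewrite (@eq_derive R _ R^o D _ (fun y => \sum_j w 0 j * comp u (delta_mx 0 j) y)) //; last by move=> z; exact: comp_expand.
by rewrite derive_sumR//; apply: eq_bigr => j _; case: (derive_scalar (w 0 j) (dc j)).
Qed.

Lemma primitiveE x u : D x -> primitive x u = ray k (fun y => eta y (ins_row ord0 (x - x0) u)) x.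
Proof. by move=> Dx; rewrite -/(comp u (x - x0)) ray_expand. Qed.

Lemma primitive_smooth u : smooth_on D (primitive ^~ u : _ -> R^o).
Proof.
apply: smooth_sum => // j; apply: smooth_mul => //; last exact: smooth_ray.
apply: (@eq_smooth _ _ _ D (fun x : 'rV[R]_n => x 0 j - x0 0 j : R^o)) => //.
  by move=> y _; rewrite !mxE.
by apply: smooth_sub => //; [exact: smooth_coord|exact: smooth_cst].
Qed.

Lemma primitive_alternating x : D x -> alternating (primitive x).
Proof.
move=> Dx; have [alt _] := feta; split=> [i A B C b c E1 E2 E3|i j A ij E].
  rewrite /primitive !mulr_sumr -big_split; apply: eq_bigr => j _ /=.
  have -> : ray k (comp A (delta_mx 0 j)) x = b * ray k (comp B (delta_mx 0 j)) x + c * ray k (comp C (delta_mx 0 j)) x.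
    rewrite -(rayZ _ c)//; last by move=> y; exact: cont_comp.
    rewrite -ray_lin//; [|by move=> y; exact: cont_comp|].
      apply: eq_ray => // y Dy; rewrite /comp; apply: (alt y Dy).1 (lift ord0 i) _ _ _ _ _ _ _ _.
      - by rewrite !row_lift_ins_row.
      - exact: row'_ins_row_eq.
      - exact: row'_ins_row_eq.
    by move=> y Dy; apply: continuous_scale; exact: cont_comp.
  by ring.
rewrite /primitive big1// => l _.
rewrite (@eq_ray _ _ (fun=> 0))// ?ray0 ?mulr0// => y Dy.
apply: (alt0 (alt y Dy) (i := lift ord0 i) (j := lift ord0 j)); first by rewrite (inj_eq lift_inj).
by rewrite !row_lift_ins_row.
Qed.

Lemma derive_primitive u w x : D x ->
  'D_w (primitive ^~ u : _ -> R^o) x = ray k (comp u w) x + ray k.+1 ('D_w (comp u (x - x0))) x.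
Proof.
move=> Dx.
pose g j (y : 'rV[R]_n) : R^o := (y - x0) 0 j.
have Eh : (fun y => y - x0) = (fun y : 'rV[R]_n => y *m 1%:M + (- x0)).
  by apply/funext => y; rewrite mulmx1.
have dh : derivable (fun y : 'rV[R]_n => y - x0) x w.
  by rewrite Eh; apply: (smooth_derivable (smooth_affine _ _ openT)).
have dg j : derivable (g j) x w by exact: (derivable_rVP _ _ _).1 dh j.
have Eg j : 'D_w (g j) x = w 0 j by rewrite -derive_rV// Eh derive_affine mulmx1.
have dr j : derivable (ray k (comp u (delta_mx 0 j))) x w.
  by have [] := ray_derive k w (smooth_comp_ u (delta_mx 0 j)) Dx.
have Er j : 'D_w (ray k (comp u (delta_mx 0 j))) x = ray k.+1 ('D_w (comp u (delta_mx 0 j))) x.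
  by have [] := ray_derive k w (smooth_comp_ u (delta_mx 0 j)) Dx.
rewrite (@derive_sumR R _ n (fun j y => g j y * ray k (comp u (delta_mx 0 j)) y : R^o)); last first.
  by move=> j; exact: derivableM.
rewrite ray_expand// -[X in _ + X](@eq_ray _ (fun y => \sum_j (x - x0) 0 j * 'D_w (comp u (delta_mx 0 j)) y))//; last first.
  by move=> y Dy; rewrite -derive_comp_expand.
rewrite ray_sum//; last by move=> j y Dy; exact: smooth_continuous (smooth_derive _ (smooth_comp_ _ _)) Dy.
rewrite -big_split; apply: eq_bigr => j _ /=.
by rewrite deriveMR// Eg Er addrC; congr (_ + _); rewrite mulrC.
Qed.

(** The derivatives of the factor x - x0 give k + 1 copies of the ray of eta. Closedness, applied
    with x - x0 inserted, turns the remaining terms into the ray of the radial derivative, and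
    [ray_euler] adds the two up. *)
Lemma primitive_closed : (forall x v, D x -> dE eta x v = 0) ->
  forall x v, D x -> dE primitive x v = eta x v.
Proof.
move=> closed x v Dx; have [alt sm] := feta; set p := x - x0.
rewrite /dE; under eq_bigr do rewrite derive_primitive// -/p mulrDr.
rewrite big_split /=.
have -> : \sum_(i < k.+1) (-1) ^+ i * ray k (comp (row' i v) (row i v)) x = k.+1%:R * ray k (eta ^~ v) x.
  rewrite -[k.+1 in RHS]card_ord mulr_natl -sumr_const; apply: eq_bigr => i _.
  rewrite -rayZ//; last by move=> y; exact: cont_comp.
  apply: eq_ray => // y Dy.
  by rewrite /comp -(alt_ins_row _ _ _ (alt y Dy)) ins_row_row' setrow_id.
rewrite -ray_sum//; last by move=> i y Dy; exact: smooth_continuous (smooth_derive _ (smooth_comp_ _ _)) Dy.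
rewrite [X in _ + X](@eq_ray k.+1 _ ('D_p (eta ^~ v : _ -> R^o)))//; last first.
  move=> y Dy; have := closed y (ins_row ord0 p v) Dy.
  rewrite /dE big_ord_recl expr0 mul1r row_ins_row row'_ins_row => /eqP; rewrite addrC addr_eq0 => /eqP H.
  apply: oppr_inj; rewrite -H -sumrN; apply: eq_bigr => i _.
  by rewrite row'_ins_row0 lift0 exprS mulN1r mulNr row_lift_ins_row.
exact: ray_euler.
Qed.

Lemma primitive_eform : is_eform D primitive.
Proof. by split; [exact: primitive_alternating|exact: primitive_smooth]. Qed.

End Primitive.
End Poincare.

Section ManifoldPoincare.
Context {R : realType} {n : nat} {M : manifold R n}.

Lemma form_in_chart_at k (w : diff_form M k) p v :
  form_in_chart w (mchart p) (cto (mchart p) p) v = w p v.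
Proof.
set c := mchart p.
have ac : matlas c by exact: mchart_atlas.
have cp : cdom c p by exact: mchart_dom.
rewrite /form_in_chart cfromK//; congr (w _ _); apply/row_matrixP => i; rewrite rowK.
have E y : chart_image c y -> (cto c \o cfrom c) y = y *m 1%:M + 0.
  by move=> /(chart_imageP ac)[_ Ey]; rewrite /= Ey mulmx1 addr0.
have cx : chart_image c (cto c p) by exists p.
by rewrite (eq_derive _ (chart_image_open ac) cx E) derive_affine mulmx1.
Qed.

Context (b : chart_ball (M := M)) (hb : is_chart_ball b).
Local Notation c := (cb_chart b).

Let ac : matlas c := cb_atlas hb.
Let oB := cb_open hb.
Let D := cb_coord b.
Let oD : open D. Proof. exact: open_coord_ball. Qed.

(** The form whose expression in the chart of the ball is P, evaluated on vectors given in the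
    preferred charts. *)
Definition chart_form {k} (P : 'rV[R]_n -> 'M[R]_(k, n) -> R) : diff_form M k := fun p u =>
  P (cto c p) (Dmx (cto c \o cfrom (mchart p)) (cto (mchart p) p) u).

Section ChartForm.
Context {k : nat} (P : 'rV[R]_n -> 'M[R]_(k, n) -> R).
Hypothesis fP : is_eform D P.

Let chart_form_chart c' x v : matlas c' -> chart_sub c' (cb_set b) x ->
  form_in_chart (chart_form P) c' x v = epull (cto c \o cfrom c') P x v.
Proof.
move=> ac' [p [c'p [cp _]] <-]; have sp := smooth_param_cfrom ac'.
have c'x : chart_image c' (cto c' p) by exists p.
have := fun u => derive_chart_change u sp c'x (mchart_atlas _) ac.
rewrite (cfromK ac' c'p) => /(_ p) E.
rewrite /form_in_chart /chart_form /epull.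
rewrite (_ : (cto c \o cfrom c') (cto c' p) = cto c p); last by rewrite /comp (cfromK ac' c'p).
rewrite (cfromK ac' c'p).
congr (P _ _); apply/row_matrixP => i; rewrite [LHS]row_Dmx [RHS]row_Dmx rowK E //; exact: mchart_dom.
Qed.

Let trans_sub c' : matlas c' -> smooth_on (chart_sub c' (cb_set b)) (cto c \o cfrom c').
Proof.
by move=> ac'; apply: sub_smooth (m_compatible ac' ac) => x [p [c'p [cp _]] <-]; exists p.
Qed.

Let trans_in c' x : matlas c' -> chart_sub c' (cb_set b) x -> D ((cto c \o cfrom c') x).
Proof. by move=> ac' [p [c'p [cp pr]] <-]; rewrite /= cfromK. Qed.

Lemma chart_form_is_form : is_form (cb_set b) (chart_form P).
Proof.
split=> [p [cp pr]|c' ac' v].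
  set c0 := mchart p; have ac0 : matlas c0 by exact: mchart_atlas.
  have oU := chart_sub_open ac0 oB.
  have Ux : chart_sub c0 (cb_set b) (cto c0 p) by exists p => //; split=> //; exact: mchart_dom.
  have dh := smooth_differentiableV oU Ux (trans_sub ac0).
  have -> : chart_form P p = fun v => P (cto c p) (v *m jacobian (cto c \o cfrom c0) (cto c0 p)).
    by apply/funext => v; rewrite -Dmx_jacobian.
  by apply: alternating_mulmx; exact: fP.1.
have oU := chart_sub_open ac' oB.
have [_ se] := epull_eform oU oD (trans_sub ac') (fun x => trans_in ac' (x := x)) fP.
apply: (eq_smooth oU _ (se v)) => x Ux.
exact/esym/chart_form_chart.
Qed.

Lemma ext_d_chart_form p v : cb_set b p -> ext_d (chart_form P) p v =
  dE P (cto c p) (Dmx (cto c \o cfrom (mchart p)) (cto (mchart p) p) v).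
Proof.
move=> Bp; have [cp pr] := Bp; set c0 := mchart p; have ac0 : matlas c0 by exact: mchart_atlas.
have c0p : cdom c0 p by exact: mchart_dom.
have oU := chart_sub_open ac0 oB.
have Ux : chart_sub c0 (cb_set b) (cto c0 p) by exists p.
rewrite -[LHS]/(dE (form_in_chart (chart_form P) c0) (cto c0 p) v).
rewrite (eq_dE _ oU Ux (fun y u => chart_form_chart (x := y) u ac0)).
rewrite (dE_epull oU oD (trans_sub ac0) (fun x => trans_in ac0 (x := x)) fP _ Ux).
by rewrite /comp (cfromK ac0 c0p).
Qed.

End ChartForm.

Lemma chart_form_in_chart k (w : diff_form M k) p v : cb_set b p ->
  form_in_chart w c (cto c p) (Dmx (cto c \o cfrom (mchart p)) (cto (mchart p) p) v) = w p v.
Proof.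
move=> [cp pr]; set c0 := mchart p; have ac0 : matlas c0 by exact: mchart_atlas.
have c0p : cdom c0 p by exact: mchart_dom.
have c0x : chart_image c0 (cto c0 p) by exists p.
have cq : cdom c (cfrom c0 (cto c0 p)) by rewrite cfromK.
have := pullx_chart w v (smooth_param_cfrom ac0) c0x ac cq.
rewrite -form_in_chartE form_in_chart_at => ->; rewrite /epull.
by rewrite (_ : (cto c \o cfrom c0) (cto c0 p) = cto c p)// /comp (cfromK ac0 c0p).
Qed.

End ManifoldPoincare.

Lemma poincare (R : realType) (n : nat) (M : manifold R n) (b : chart_ball (M := M)) k (w : diff_form M k.+1) :
  is_chart_ball b -> is_form (cb_set b) w -> (forall p v, cb_set b p -> ext_d w p v = 0) ->
  exists2 A : diff_form M k, is_form (cb_set b) A & forall p v, cb_set b p -> ext_d A p v = w p v.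
Proof.
move=> hb fw closed; have ac := cb_atlas hb; have oB := cb_open hb.
set c := cb_chart b; set D := cb_coord b; pose eta := form_in_chart w c.
have D_sub y : D y -> chart_sub c (cb_set b) y.
  by move=> Dy; have [By Ey] := cb_fromP hb Dy; exists (cfrom c y) => //; split=> //; case: By.
have feta : is_eform D eta.
  have [ea es] := chart_eform oB fw ac; split=> [x /D_sub|v]; first exact: ea.
  exact: sub_smooth (es v).
have sp : smooth_param D (cfrom c).
  by apply: smooth_param_sub (smooth_param_cfrom ac) => //; [exact: open_coord_ball|exact: cb_sub].
have DB y : D y -> cb_set b (cfrom c y) by move=> /(cb_fromP hb)[].
have ceta x v : D x -> dE eta x v = 0.
  by move=> Dx; rewrite /eta form_in_chartE (dE_pullx sp oB fw DB _ Dx) /pullx closed//; exact: DB.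
have fP := primitive_eform (cb_pos hb) feta.
have E := primitive_closed (cb_pos hb) feta ceta; move: fP E.
move: (primitive (cb_center b) eta) => P fP E.
exists (chart_form b P); first exact: chart_form_is_form.
move=> p v Bp; have [cp pr] := Bp; rewrite (ext_d_chart_form hb fP v Bp) E//.
exact: chart_form_in_chart.
Qed.

(** * Holonomy *)

Section Cis.
Context {R : realType}.
Implicit Types (a b r : R) (z : R[i]).

(** The exponential of 2 pi i r: phases are measured in turns, so that the kernel is Z. *)
Definition cis r : R[i] := Complex (cos (2 * pi * r)) (sin (2 * pi * r)).

Definition isint r := r \is a Num.int.

Lemma cis0 : cis 0 = 1.
Proof. by rewrite /cis mulr0 cos0 sin0. Qed.

Lemma cisD a b : cis (a + b) = cis a * cis b.
Proof.
rewrite /cis mulrDr cosD sinD; apply/eqP; rewrite eq_complex /=; apply/andP; split=> //=.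
by rewrite addrC.
Qed.

Lemma cisN a : cis (- a) * cis a = 1.
Proof. by rewrite -cisD addNr cis0. Qed.

Lemma cis_neq0 a : cis a != 0.
Proof. by apply: contraTneq (oner_neq0 R[i]) => E; rewrite -(cisN a) E mulr0 eqxx. Qed.

Lemma cisV a : (cis a)^-1 = cis (- a).
Proof. by apply: (mulIf (cis_neq0 a)); rewrite mulVf ?cis_neq0// cisN. Qed.

Lemma cisB a b : cis (a - b) = cis a / cis b.
Proof. by rewrite cisD cisV. Qed.

Lemma cis_conj a : Num.conj (cis a) = cis (- a).
Proof. by rewrite /cis mulrN cosN sinN. Qed.

Lemma unit_complexE a b : (`|Complex a b| = 1) <-> a ^+ 2 + b ^+ 2 = 1.
Proof.
rewrite normc_def /=; split=> [[/eqP]|->]; last by rewrite sqrtr1.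
rewrite -[X in _ == X]sqrtr1 eqr_sqrt ?addr_ge0 ?sqr_ge0//; first by move/eqP.
Qed.

Lemma norm_cis a : `|cis a| = 1.
Proof. by apply/unit_complexE; exact: cos2Dsin2. Qed.

Lemma cis_nat (n : nat) : cis n%:R = 1.
Proof.
have E : 2 * pi * n%:R = 0 + (pi *+ 2) *+ n :> R by rewrite add0r -[RHS]mulr_natr -[pi *+ 2]mulr_natl.
by rewrite /cis E (periodicn (@cosD2pi R)) (periodicn (@sinD2pi R)) cos0 sin0.
Qed.

Lemma cis_int r : isint r -> cis r = 1.
Proof.
move=> /intrP[[n|n] ->]; first exact: cis_nat.
by apply: (mulIf (cis_neq0 n.+1%:R)); rewrite -cisD NegzE mulrNz addNr cis0 mul1r cis_nat.
Qed.

(** The fractional part d of r has cos (2 pi d) = 1, and cos is injective on [0, pi]; this settles d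
    <= 1/2 directly and the other case through 1 - d. *)
Lemma cis_eq1 r : cis r = 1 -> isint r.
Proof.
move=> H; pose d := r - (Num.floor r)%:~R.
have d01 : 0 <= d < 1.
  have /andP[H1 H2] := floor_itv r.
  by rewrite /d subr_ge0 H1 ltrBlDr addrC -intrD1.
have : cis d = 1.
  by rewrite /d cisB H cis_int ?divr1//; exact: intr_int.
move=> /(congr1 (@complex.Re R)) /= Hd.
have pi0 : 0 < (pi : R) := pi_gt0 R.
suff d0 : d = 0 by have -> : r = (Num.floor r)%:~R; [apply/eqP; rewrite -subr_eq0 -/d d0|exact: intr_int].
have /andP[d0 d1] := d01.
have [dh|dh] := leP d (1 / 2).
  have : 2 * pi * d = 0.
    apply: (@cos_inj R); rewrite ?cos0// in_itv/= ?lexx ?(ltW pi0)//.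
    by rewrite !mulr_ge0 ?(ltW pi0)//=; nra.
  by move/eqP; rewrite !mulf_eq0 (gt_eqF pi0) pnatr_eq0 /= => /eqP.
have : 2 * pi * (1 - d) = 0.
  apply: (@cos_inj R); rewrite ?in_itv/= ?lexx ?(ltW pi0)//.
    by rewrite !mulr_ge0 ?(ltW pi0) ?subr_ge0 ?(ltW d1)//=; nra.
  have -> : 2 * pi * (1 - d) = - (2 * pi * d) + pi *+ 2 by rewrite mulr2n; ring.
  by rewrite cosD2pi cosN Hd cos0.
by move/eqP; rewrite !mulf_eq0 (gt_eqF pi0) pnatr_eq0 /= => /eqP; lra.
Qed.

Lemma cis_eq a b : cis a = cis b -> isint (a - b).
Proof. by move=> E; apply: cis_eq1; rewrite cisB E mulfV ?cis_neq0. Qed.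

Lemma cis_congr a b : isint (a - b) -> cis a = cis b.
Proof. by move=> i; rewrite -[a](subrK b) cisD cis_int ?mul1r. Qed.

Lemma cis_surj z : `|z| = 1 -> exists r, cis r = z.
Proof.
case: z => a b /unit_complexE ab.
have pi0 : (pi : R) != 0 by rewrite gt_eqF// pi_gt0.
have a1 : -1 <= a <= 1.
  by rewrite -ler_norml -(@expr_le1 _ 2)// ?normr_ge0// -normrX ger0_norm ?sqr_ge0// -ab lerDl sqr_ge0.
have E (x : R) : 2 * pi * (x / (2 * pi)) = x by rewrite mulrC divfK// mulf_neq0// pnatr_eq0.
have S : sin (acos a) = `|b| by rewrite sin_acos// -ab addrC addKr sqrtr_sqr.
have C : cos (acos a) = a by rewrite acosK// in_itv.
have [b0|b0] := leP 0 b.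
  by exists (acos a / (2 * pi)); rewrite /cis E C S ger0_norm.
by exists (- acos a / (2 * pi)); rewrite /cis E cosN sinN C S ltr0_norm// opprK.
Qed.

Lemma isintD a b : isint a -> isint b -> isint (a + b). Proof. exact: rpredD. Qed.
Lemma isintB a b : isint a -> isint b -> isint (a - b). Proof. exact: rpredB. Qed.
Lemma isintN a : isint a -> isint (- a). Proof. by rewrite /isint rpredN. Qed.
Lemma isint0 : isint 0. Proof. exact: rpred0. Qed.

Lemma mul_imaginary x a b : Complex 0 x * Complex a b = Complex (- (x * b)) (x * a).
Proof. by apply/eqP; rewrite eq_complex /= !mul0r sub0r add0r !eqxx. Qed.

End Cis.

Section Trigonometric.
Context {R : realType}.

Lemma is_derive_from_line (V : normedModType R) (F : V -> R^o) x v d :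
  is_derive (0 : R) 1 (fun h : R => F (h *: v + x)) d -> is_derive x v F d.
Proof.
move=> [d1 E1].
have E : (fun h : R => h^-1 *: (((fun h : R => F (h *: v + x)) \o shift 0) (h *: 1) - F (0 *: v + x))) =
    (fun h => h^-1 *: ((F \o shift x) (h *: v) - F x)).
  apply/funext => h /=; rewrite scale0r add0r addr0; congr (_ *: (F (_ *: _ + _) - _)).
  exact: mulr1.
by apply: DeriveDef; rewrite /derivable /derive -E.
Qed.

Lemma is_derive_comp1 (V : normedModType R) (g g' : R -> R^o) (f : V -> R^o) x v :
  (forall y : R, is_derive y 1 g (g' y)) -> derivable f x v ->
  is_derive x v (g \o f) (g' (f x) * 'D_v f x).
Proof.
move=> dg df; apply: is_derive_from_line.
have df' : derivable f (0 *: v + x) v by rewrite scale0r add0r.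
have H : is_derive (0 : R) 1 (fun h : R => f (h *: v + x)) ('D_v f x).
  have df'' : derivable f (x + (0 : R) *: v) v by rewrite scale0r addr0.
  have := is_derive_line df''; rewrite scale0r addr0.
  by congr is_derive; apply/funext => h; rewrite addrC.
have := @is_derive1_comp R g (fun h : R => f (h *: v + x)) 0 _ _ (dg _) H.
by rewrite scale0r add0r.
Qed.

Lemma smooth_trig n (U : set 'rV[R]_n) (f : 'rV[R]_n -> R^o) : open U -> smooth_on U f ->
  smooth_on U (fun x => cos (f x) : R^o) /\ smooth_on U (fun x => sin (f x) : R^o).
Proof.
move=> oU sf; pose C x : R^o := cos (f x); pose S x : R^o := sin (f x).
have dC x v : derivable f x v -> is_derive x v C (- sin (f x) * 'D_v f x).
  by move=> df; apply: (@is_derive_comp1 _ (@cos R) (fun y => - sin y) f).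
have dS x v : derivable f x v -> is_derive x v S (cos (f x) * 'D_v f x).
  by move=> df; apply: (@is_derive_comp1 _ (@sin R) (@cos R) f).
pose B (g : 'rV[R]_n -> R^o) := [\/ smooth_on U g, g = C | g = S].
have H g : alg_closure B g -> smooth_on U g.
  apply: (smooth_alg oU) => [f0 [h|->|->] x Ux|f0 v [h|->|->]].
  - by split=> [|v]; [exact: smooth_continuous h Ux|exact: smooth_derivable h Ux].
  - split=> [|v]; last by have [] := dC x v (smooth_derivable sf Ux).
    by apply: (@continuous_comp _ _ _ f (@cos R)); [exact: smooth_continuous sf Ux|exact: continuous_cos].
  - split=> [|v]; last by have [] := dS x v (smooth_derivable sf Ux).
    by apply: (@continuous_comp _ _ _ f (@sin R)); [exact: smooth_continuous sf Ux|exact: continuous_sin].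
  - by exists ('D_v f0) => //; apply: alg_base; apply: Or31; exact: smooth_derive h.
  - exists (fun x => (-1 * S x) * 'D_v f x) => [|x Ux].
      apply: alg_mul; last by apply: alg_base; apply: Or31; exact: smooth_derive.
      by apply: alg_mul; [exact: alg_cst|apply: alg_base; exact: Or33].
    by have [_ ->] := dC x v (smooth_derivable sf Ux); rewrite mulN1r.
  - exists (fun x => C x * 'D_v f x) => [|x Ux].
      by apply: alg_mul; apply: alg_base; [exact: Or32|apply: Or31; exact: smooth_derive].
    by have [_ ->] := dS x v (smooth_derivable sf Ux).
by split; apply: H; apply: alg_base; [apply: Or32|apply: Or33].
Qed.

Lemma derive_trig (V : normedModType R) (f : V -> R^o) x v : derivable f x v ->
  'D_v (fun x => cos (f x) : R^o) x = - sin (f x) * 'D_v f x /\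
  'D_v (fun x => sin (f x) : R^o) x = cos (f x) * 'D_v f x.
Proof.
move=> df; split.
  by have [] := @is_derive_comp1 _ (@cos R) (fun y => - sin y) f x v _ df.
by have [] := @is_derive_comp1 _ (@sin R) (@cos R) f x v _ df.
Qed.

End Trigonometric.

(** * Phases with a given differential along paths *)

Section SegmentHolonomy.
Context {R : realType} {n : nat} {M : manifold R n}.

Definition pt_cochain (phi : M -> R) (s : singular R M 0) : R := phi (s (vertex 0)).

Local Notation delta w := (@coboundary R R M _ w).

(** phi is a primitive of alpha along smooth paths, modulo Z. It may be discontinuous; smoothness of
    [cis (phi p)] is a consequence, proved in [holonomic_smooth]. *)
Definition holonomic (W : set M) (phi : M -> R) (alpha : diff_form M 1) :=
  forall s : singular R M 1, smooth_simplex s -> simage s `<=` W ->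
    isint (delta (pt_cochain phi) s - integrate alpha s).

Definition segmx {K} (x y : 'rV[R]_K) : 'M[R]_(2, K) := ins_row ord0 x (y : 'M[R]_(1, K)).

Lemma segmx_mul K (t : 'rV[R]_2) (x y : 'rV[R]_K) : t *m segmx x y = t 0 0 *: x + t 0 1 *: y.
Proof.
apply/rowP => j; rewrite !mxE !big_ord_recl big_ord0 addr0 !mxE unlift_none; congr (_ + _ * _).
  by congr (t _ _); apply: val_inj.
case: unliftP => [a _|/(congr1 val)//]; congr (y _ _).
by apply/val_inj; rewrite (ord1 a).
Qed.

Lemma row'_segmx0 K (x y : 'rV[R]_K) : row' 0 (segmx x y) = y.
Proof. exact: row'_ins_row. Qed.

Lemma row'_segmx1 K (x y : 'rV[R]_K) : row' 1 (segmx x y) = x.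
Proof.
apply/matrixP => a b; rewrite !mxE (ord1 a).
by have -> : lift 1 (0 : 'I_1) = ord0 :> 'I_2 by [exact: val_inj]; rewrite unlift_none.
Qed.

Lemma cellint_segmx K (eta : 'rV[R]_K -> 'M[R]_(1, K) -> R) x y :
  cellint eta (segmx x y) = Jint 1 (fun t => eta (x + t *: (y - x)) (y - x)).
Proof.
rewrite /cellint simplex_integralS; apply: eq_Jint => t _ /=.
have E u : facemap ord0 u *m segmx x y = x + u 0 0 *: (y - x).
  rewrite segmx_mul /facemap unlift_none insv_at big_ord1.
  have -> : insv ord0 (1 - u 0 0) u 0 1 = u 0 0 by rewrite (_ : 1 = lift ord0 0) ?insv_lift//; exact: val_inj.
  by rewrite scalerBl scale1r scalerBr addrA addrAC.
have F : facemx ord0 *m segmx x y = y - x.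
  have := E 0; rewrite !mxE scale0r addr0 => E0.
  have := E (delta_mx 0 0); have /(congr1 (fun f => f (delta_mx 0 0))) /= -> := facemap0_affine (segmx x y).
  rewrite E0 !mxE !eqxx scale1r addrC => /addrI; rewrite -rowE => <-.
  by apply/matrixP => a j; rewrite (ord1 a) [RHS]mxE.
by rewrite F E; congr (eta (_ + _ *: _) _); rewrite row_mxE0 insv_at.
Qed.

Lemma sum2 (f : 'I_2 -> R) : \sum_i f i = f 0 + f 1.
Proof. by rewrite big_ord_recl big_ord1; congr (_ + f _); exact: val_inj. Qed.

Lemma hull_segmx K (x y z : 'rV[R]_K) : hull (segmx x y) z -> exists2 t, 0 <= t <= 1 & z = x + t *: (y - x).
Proof.
move=> [t [t0 t1] <-]; rewrite sum2 in t1; exists (t 0 1); first by rewrite t0 -t1 lerDr t0.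
rewrite segmx_mul; have -> : t 0 0 = 1 - t 0 1 by rewrite -t1 addrK.
by rewrite scalerBl scale1r scalerBr addrA addrAC.
Qed.

Lemma pt_asimp phi K (h : 'rV[R]_K -> M) (y : 'rV[R]_K) : {for y, continuous h} ->
  pt_cochain phi (asimp h (y : 'M[R]_(1, K))) = phi (h y).
Proof.
move=> ch; have v t : simplex R 0 t -> t *m y = y.
  move=> [_]; rewrite big_ord1 => t1; apply/rowP => j; rewrite mxE big_ord1 t1 mul1r //.
rewrite /pt_cochain asimpE => [|_ [t st <-]]; last by rewrite v.
by rewrite v//; exact: simplex_point.
Qed.

Lemma delta_pt phi K (h : 'rV[R]_K -> M) (x y : 'rV[R]_K) : (forall z, hull (segmx x y) z -> {for z, continuous h}) ->
  delta (pt_cochain phi) (asimp h (segmx x y)) = phi (h y) - phi (h x).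
Proof.
move=> ch; have in0 i : {for (row' i (segmx x y) : 'rV[R]_K), continuous h}.
  apply: ch; apply: (@hull_row' R K 0 _ i).
  exists 1; first by split=> [j|]; rewrite ?big_ord1 !mxE ?(ord1 j) ?eqxx// ler01.
  by rewrite mul1mx.
rewrite /coboundary !big_ord_recl big_ord0 expr0 mul1r addr0 [_ ^+ _]expr1 mulN1r.
rewrite !face_asimp// !pt_asimp// row'_segmx0; congr (_ - phi (h _)).
rewrite -[RHS](row'_segmx1 x y); have -> : lift ord0 ord0 = 1 :> 'I_2 by exact: val_inj.
by [].
Qed.

Lemma ins_row_empty (w : 'rV[R]_n) (u : 'M[R]_(0, n)) : ins_row ord0 w u = w.
Proof. by apply/matrixP => a j; rewrite !mxE (ord1 a) unlift_none. Qed.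

Lemma smooth_phase m (U : set 'rV[R]_m) (F : 'rV[R]_m -> R^o) (a : R) : open U -> smooth_on U F ->
  smooth_on U (fun y => 2 * pi * (a + F y) : R^o).
Proof.
move=> oU sF; have s1 := @smooth_add R _ U (fun=> a) F oU (@smooth_cst R _ R^o U a) sF.
exact: (@smooth_mul R _ U (fun=> 2 * pi) (fun y => a + F y) oU (@smooth_cst R _ R^o U (2 * pi)) s1).
Qed.

Lemma derive_shift (V : normedModType R) (f : V -> R^o) a x v : derivable f x v ->
  derivable (fun y => a + f y : R^o) x v /\ 'D_v (fun y => a + f y : R^o) x = 'D_v f x.
Proof.
have E : (fun h : R => h^-1 *: (((fun y => a + f y : R^o) \o shift x) (h *: v) - (a + f x))) =
    (fun h => h^-1 *: ((f \o shift x) (h *: v) - f x)).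
  by apply/funext => h /=; rewrite opprD addrACA subrr add0r.
by rewrite /derivable /derive E.
Qed.

Section Holonomic.
Context (W : set M) (phi : M -> R) (alpha : diff_form M 1).
Hypotheses (oW : open W) (fa : is_form W alpha) (hol : holonomic W phi alpha).

(** Straight segments starting at x express the phase near x, modulo Z, through the radial integral
    F of alpha. As alpha need not be closed, the differential of F is identified with alpha at x
    alone, which suffices because x is arbitrary. *)
Lemma holonomic_local c x : matlas c -> chart_sub c W x ->
  exists (U : set 'rV[R]_n) (F : 'rV[R]_n -> R^o),
    [/\ open U, U x, U `<=` chart_sub c W & [/\ smooth_on U F,
     forall y, U y -> cis (phi (cfrom c y)) = cis (phi (cfrom c x) + F y), F x = 0 &
     forall v, 'D_v F x = form_in_chart alpha c x v]].
Proof.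
move=> ac Ux; have oU := chart_sub_open ac oW.
have /nbhs_ballP[r /= r0 Hr] : nbhs x (chart_sub c W) by exact: open_nbhs_nbhs.
pose D : set 'rV[R]_n := [set y | `|x - y| < r].
have sD : D `<=` chart_sub c W by move=> y Dy; apply: Hr; rewrite -ball_normE.
have Dx : D x by rewrite /D /= subrr normr0.
have feta : is_eform D (form_in_chart alpha c).
  by have [ea es] := chart_eform oW fa ac; split=> [y /sD|v]; [exact: ea|exact: sub_smooth (es v)].
pose u : 'M[R]_(0, n) := 0.
exists D, (primitive x (form_in_chart alpha c) ^~ u); split=> //.
  exact: open_coord_ball.
split.
- exact: primitive_smooth.
- move=> y Dy.
  have sH z : hull (segmx x y) z -> chart_image c z /\ W (cfrom c z).
    move=> /hull_segmx[t t01 ->]; have /sD := D_ray Dy t01.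
    by rewrite (chart_subE _ ac).
  have ch z : hull (segmx x y) z -> {for z, continuous (cfrom c)}.
    by move=> /sH[cz _]; exact: cfrom_continuous.
  have sp := smooth_param_cfrom ac.
  have sV : hull (segmx x y) `<=` chart_image c by move=> z /sH[].
  have := hol (smooth_simplex_asimp sp sV) (image_asimp ch (fun z hz => (sH z hz).2)).
  rewrite (delta_pt _ ch) (integrate_asimp _ sp sV) cellint_segmx => H.
  apply: cis_congr; rewrite opprD addrA.
  rewrite (primitiveE r0 feta)//; congr (isint (_ - _)) : H.
  by apply: eq_Jint => t _; rewrite expr0 mul1r ins_row_empty.
- by rewrite /primitive big1// => j _; rewrite subrr mxE mul0r.
move=> v; rewrite (derive_primitive r0 feta u v Dx) subrr.
have R0 f : ray x 0 f x = f x.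
  rewrite /ray subrr (@eq_Jint _ _ _ (fun=> f x * 1)) => [|t _]; last by rewrite scaler0 addr0 expr0 mul1r mulr1.
  rewrite JintZ; last exact: cfunC.
  have cF : {within `[0, 1], continuous (fun s : R => s : R^o)} by apply: continuous_subspaceT => z; exact: cvg_id.
  by rewrite (Jint_FTC (@cfunC _ _ 1) cF ler01 (fun s _ => is_derive_id s 1)) subr0 mulr1.
rewrite R0 ins_row_empty -[RHS]addr0; congr (_ + _).
rewrite -[RHS](ray0 x 1 x); apply: (eq_ray (r := r)) => // y Dy.
rewrite (@eq_derive R _ R^o D _ (fun=> 0)) ?derive_cst//; first exact: open_coord_ball.
move=> z Dz; rewrite ins_row_empty; have [ea _] := feta.
have := alt_setrow0 (ea z Dz) 0 (0 : 'M[R]_(1, n)).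
by congr (form_in_chart alpha c z _ = 0); apply/matrixP => a j; rewrite !mxE; case: ifP.
Qed.

Lemma holonomic_smooth : smooth_cfun W (fun p => cis (phi p)).
Proof.
split=> c ac; apply: smooth_local => x Ux; have [U [F [oU Ux' sU [sF E _ _]]]] := holonomic_local ac Ux;
  (exists U; [exact: (conj oU Ux')|]); have [sC sS] := smooth_trig oU (smooth_phase (phi (cfrom c x)) oU sF).
  by apply: (eq_smooth oU _ sC) => y Uy; exact: esym (congr1 (@complex.Re R) (E y Uy)).
by apply: (eq_smooth oU _ sS) => y Uy; exact: esym (congr1 (@complex.Im R) (E y Uy)).
Qed.

Lemma holonomic_diff p v : W p ->
  diff_cfun (fun p => cis (phi p)) p v = Complex 0 (2 * pi * alpha p v) * cis (phi p).
Proof.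
move=> Wp; have ac := mchart_atlas p; have cp := mchart_dom p.
have Ux : chart_sub (mchart p) W (cto (mchart p) p) by exists p.
have [U [F [oU Ux' sU [sF E F0 DF]]]] := holonomic_local ac Ux.
pose f y : R^o := 2 * pi * (phi p + F y).
have dF : derivable F (cto (mchart p) p) v by exact: smooth_derivable sF Ux'.
have sf : smooth_on U f := smooth_phase (phi p) oU sF.
have Df : 'D_v f (cto (mchart p) p) = 2 * pi * alpha p v.
  have [dcF EF] := derive_shift (phi p) dF; have [_ E2] := derive_scalar (2 * pi) dcF.
  by rewrite -(form_in_chart_at alpha p v) -DF -EF -E2.
have [D1 D2] := derive_trig (smooth_derivable (v := v) sf Ux').
rewrite cfromK// in E.
rewrite /diff_cfun /diff_fun.
rewrite (@eq_derive R _ R^o U _ (fun y => cos (f y) : R^o) _ v oU Ux' (fun y Uy => congr1 (@complex.Re R) (E y Uy))).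
rewrite (@eq_derive R _ R^o U _ (fun y => sin (f y) : R^o) _ v oU Ux' (fun y Uy => congr1 (@complex.Im R) (E y Uy))).
rewrite D1 D2 Df /f F0 addr0 /cis mul_imaginary mulNr.
by congr (Complex (- _) _); rewrite mulrC.
Qed.

End Holonomic.
End SegmentHolonomy.

Section SmoothFunctions.
Context {R : realType} {n : nat} {M : manifold R n}.
Implicit Types (W : set M) (f g : M -> R) (h k : M -> R[i]).

Lemma smooth_fun_mul W f g : open W -> smooth_fun W f -> smooth_fun W g -> smooth_fun W (fun p => f p * g p).
Proof. by move=> oW sf sg c ac; exact: smooth_mul (chart_sub_open ac oW) (sf c ac) (sg c ac). Qed.

Lemma smooth_fun_add W f g : open W -> smooth_fun W f -> smooth_fun W g -> smooth_fun W (fun p => f p + g p).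
Proof. by move=> oW sf sg c ac; exact: smooth_add (chart_sub_open ac oW) (sf c ac) (sg c ac). Qed.

Lemma smooth_fun_opp W f : open W -> smooth_fun W f -> smooth_fun W (fun p => - f p).
Proof. by move=> oW sf c ac; exact: smooth_opp (chart_sub_open ac oW) (sf c ac). Qed.

Lemma eq_smooth_fun W f g : open W -> (forall p, W p -> f p = g p) -> smooth_fun W f -> smooth_fun W g.
Proof.
move=> oW E sf c ac; apply: (eq_smooth (chart_sub_open ac oW) _ (sf c ac)) => x.
by move=> [p [cp Wp] <-]; rewrite /= cfromK//; exact: E.
Qed.

Lemma sub_smooth_fun W W' f : W' `<=` W -> smooth_fun W f -> smooth_fun W' f.
Proof. by move=> sW sf c ac; apply: sub_smooth (sf c ac) => x [p [cp /sW Wp] <-]; exists p. Qed.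

Lemma smooth_fun_derivable W f p v : W p -> smooth_fun W f ->
  derivable (f \o cfrom (mchart p) : 'rV[R]_n -> R^o) (cto (mchart p) p) v.
Proof.
move=> Wp sf; have Up : chart_sub (mchart p) W (cto (mchart p) p) by exists p => //; split=> //; exact: mchart_dom.
exact: smooth_derivable (sf _ (mchart_atlas p)) Up.
Qed.

Lemma eq_diff_fun W f g p v : open W -> W p -> (forall q, W q -> f q = g q) -> diff_fun f p v = diff_fun g p v.
Proof.
move=> oW Wp E; have ac := mchart_atlas p; have oU := chart_sub_open ac oW.
have Up : chart_sub (mchart p) W (cto (mchart p) p) by exists p => //; split=> //; exact: mchart_dom.
apply: (eq_derive _ oU Up) => x [q [cq Wq] <-]; rewrite /= cfromK//; exact: E.
Qed.

Lemma diff_funM W f g p v : W p -> smooth_fun W f -> smooth_fun W g ->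
  diff_fun (fun p => f p * g p) p v = diff_fun f p v * g p + f p * diff_fun g p v.
Proof.
move=> Wp sf sg; have df := smooth_fun_derivable (v := v) Wp sf; have dg := smooth_fun_derivable (v := v) Wp sg.
rewrite -[LHS]/('D_v (fun x => (f \o cfrom (mchart p)) x * (g \o cfrom (mchart p)) x : R^o) _).
rewrite (deriveMR df dg) /= cfromK; [|exact: mchart_atlas|exact: mchart_dom].
by rewrite addrC [g p * _]mulrC.
Qed.

Lemma deriveDR (V : normedModType R) (a b : V -> R^o) x v : derivable a x v -> derivable b x v ->
  'D_v (fun y => a y + b y : R^o) x = 'D_v a x + 'D_v b x.
Proof. by move=> da db; exact: deriveD. Qed.

Lemma deriveNR (V : normedModType R) (a : V -> R^o) x v : derivable a x v ->
  'D_v (fun y => - a y : R^o) x = - 'D_v a x.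
Proof. by move=> da; exact: deriveN. Qed.

Lemma diff_funD W f g p v : W p -> smooth_fun W f -> smooth_fun W g ->
  diff_fun (fun p => f p + g p) p v = diff_fun f p v + diff_fun g p v.
Proof.
by move=> Wp sf sg; exact: deriveDR (smooth_fun_derivable (v := v) Wp sf) (smooth_fun_derivable (v := v) Wp sg).
Qed.

Lemma diff_funN W f p v : W p -> smooth_fun W f -> diff_fun (fun p => - f p) p v = - diff_fun f p v.
Proof. by move=> Wp sf; exact: deriveNR (smooth_fun_derivable (v := v) Wp sf). Qed.

Definition zero_form f : diff_form M 0 := fun p _ => f p.

Lemma zero_form_is_form W f : smooth_fun W f -> is_form W (zero_form f).
Proof. by move=> sf; split=> [p _|c ac v]; [split=> [[]|[]]|exact: sf]. Qed.

Lemma ext_d_zero_form f p (v : 'M[R]_(1, n)) : ext_d (zero_form f) p v = diff_fun f p v.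
Proof. by rewrite /ext_d big_ord1 expr0 mul1r row_id. Qed.

Lemma alternating_one (g : 'M[R]_(1, n) -> R) : (forall b c u v, g (b *: u + c *: v) = b * g u + c * g v) ->
  alternating g.
Proof.
move=> gl; split=> [i A B C b c|i j A]; last by rewrite !ord1.
by rewrite (ord1 i) !row_id => -> _ _; exact: gl.
Qed.

Lemma diff_form_is_form W f : open W -> smooth_fun W f -> is_form W (fun p (v : 'M[R]_(1, n)) => diff_fun f p v).
Proof.
move=> oW sf; have fz := zero_form_is_form sf; split=> [p Wp|c ac v].
  apply: alternating_one => b c u v.
  have ac := mchart_atlas p; have oU := chart_sub_open ac oW.
  have Up : chart_sub (mchart p) W (cto (mchart p) p) by exists p => //; split=> //; exact: mchart_dom.
  have df := smooth_differentiable oU Up (sf _ ac).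
  by rewrite /diff_fun !derive_lin// !mulr_sumr -big_split; apply: eq_bigr => i _; rewrite /= !mxE; ring.
have oU := chart_sub_open ac oW.
apply: (eq_smooth oU _ (smooth_derive v (sf c ac))) => x Ux.
have sp : smooth_param (chart_sub c W) (cfrom c).
  by apply: smooth_param_sub (smooth_param_cfrom ac) => // y; rewrite chart_subE// => -[].
have cW y : chart_sub c W y -> W (cfrom c y) by rewrite chart_subE// => -[].
have := dE_pullx sp oW fz cW v Ux; rewrite /dE big_ord1 expr0 mul1r row_id.
rewrite /form_in_chart /pullx ext_d_zero_form => ->.
by [].
Qed.

Lemma is_form_scale W f m (w : diff_form M m) : open W -> smooth_fun W f -> is_form W w ->
  is_form W (fun p v => f p * w p v).
Proof.
move=> oW sf [wa ws]; split=> [p Wp|c ac v].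
  have [w1 w2] := wa p Wp; split=> [i A B C b c E1 E2 E3|i j A ij E].
    by rewrite (w1 i A B C b c)//; ring.
  by rewrite (w2 i j)// mulr0.
exact: smooth_mul (chart_sub_open ac oW) (sf c ac) (ws c ac v).
Qed.

Lemma complexM (a b : R[i]) : a * b = Complex (complex.Re a * complex.Re b - complex.Im a * complex.Im b)
  (complex.Re a * complex.Im b + complex.Im a * complex.Re b).
Proof. by case: a b => [a a'] [b b']. Qed.

Lemma complexD (a b : R[i]) : a + b = Complex (complex.Re a + complex.Re b) (complex.Im a + complex.Im b).
Proof. by case: a b => [a a'] [b b']. Qed.

Lemma conjcE (a : R[i]) : Num.conj a = Complex (complex.Re a) (- complex.Im a).
Proof. by case: a. Qed.

Lemma smooth_cfun_mul W h k : open W -> smooth_cfun W h -> smooth_cfun W k -> smooth_cfun W (fun p => h p * k p).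
Proof.
move=> oW [h1 h2] [k1 k2]; split.
  have H := smooth_fun_add oW (smooth_fun_mul oW h1 k1) (smooth_fun_opp oW (smooth_fun_mul oW h2 k2)).
  by apply: (eq_smooth_fun oW _ H) => p _; rewrite complexM.
have H := smooth_fun_add oW (smooth_fun_mul oW h1 k2) (smooth_fun_mul oW h2 k1).
by apply: (eq_smooth_fun oW _ H) => p _; rewrite complexM.
Qed.

Lemma smooth_cfun_add W h k : open W -> smooth_cfun W h -> smooth_cfun W k -> smooth_cfun W (fun p => h p + k p).
Proof.
move=> oW [h1 h2] [k1 k2]; split.
  by apply: (eq_smooth_fun oW _ (smooth_fun_add oW h1 k1)) => p _; rewrite complexD.
by apply: (eq_smooth_fun oW _ (smooth_fun_add oW h2 k2)) => p _; rewrite complexD.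
Qed.

Lemma smooth_cfun_conj W h : open W -> smooth_cfun W h -> smooth_cfun W (fun p => Num.conj (h p)).
Proof.
move=> oW [h1 h2]; split; first by apply: (eq_smooth_fun oW _ h1) => p _; rewrite conjcE.
by apply: (eq_smooth_fun oW _ (smooth_fun_opp oW h2)) => p _; rewrite conjcE.
Qed.

Lemma eq_smooth_cfun W h k : open W -> (forall p, W p -> h p = k p) -> smooth_cfun W h -> smooth_cfun W k.
Proof.
by move=> oW E [h1 h2]; split; [apply: (eq_smooth_fun oW _ h1)|apply: (eq_smooth_fun oW _ h2)] => p Wp; rewrite E.
Qed.

Lemma sub_smooth_cfun W W' h : W' `<=` W -> smooth_cfun W h -> smooth_cfun W' h.
Proof. by move=> sW [h1 h2]; split; exact: sub_smooth_fun sW _. Qed.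

Lemma eq_diff_cfun W h k p v : open W -> W p -> (forall q, W q -> h q = k q) -> diff_cfun h p v = diff_cfun k p v.
Proof.
by move=> oW Wp E; congr Complex; apply: (eq_diff_fun _ oW Wp) => q Wq; rewrite E.
Qed.

Lemma diff_cfunM W h k p v : open W -> W p -> smooth_cfun W h -> smooth_cfun W k ->
  diff_cfun (fun p => h p * k p) p v = diff_cfun h p v * k p + h p * diff_cfun k p v.
Proof.
move=> oW Wp [h1 h2] [k1 k2]; rewrite [RHS]complexD !complexM /diff_cfun /=.
rewrite (@eq_diff_fun W (fun p => complex.Re (h p * k p)) (fun p => complex.Re (h p) * complex.Re (k p) + - (complex.Im (h p) * complex.Im (k p))) p v oW Wp); last first.
  by move=> q _; rewrite complexM.
rewrite (@eq_diff_fun W (fun p => complex.Im (h p * k p)) (fun p => complex.Re (h p) * complex.Im (k p) + complex.Im (h p) * complex.Re (k p)) p v oW Wp); last first.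
  by move=> q _; rewrite complexM.
have s1 := smooth_fun_mul oW h1 k1; have s2 := smooth_fun_mul oW h2 k2.
have s3 := smooth_fun_mul oW h1 k2; have s4 := smooth_fun_mul oW h2 k1.
rewrite (diff_funD _ Wp s1 (smooth_fun_opp oW s2)) (diff_funN _ Wp s2) (diff_funD _ Wp s3 s4).
rewrite (diff_funM _ Wp h1 k1) (diff_funM _ Wp h2 k2) (diff_funM _ Wp h1 k2) (diff_funM _ Wp h2 k1).
by congr Complex; ring.
Qed.

Lemma diff_cfunD W h k p v : open W -> W p -> smooth_cfun W h -> smooth_cfun W k ->
  diff_cfun (fun p => h p + k p) p v = diff_cfun h p v + diff_cfun k p v.
Proof.
move=> oW Wp [h1 h2] [k1 k2]; rewrite [RHS]complexD /diff_cfun /=.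
rewrite (@eq_diff_fun W (fun p => complex.Re (h p + k p)) (fun p => complex.Re (h p) + complex.Re (k p)) p v oW Wp); last first.
  by move=> q _; rewrite complexD.
rewrite (@eq_diff_fun W (fun p => complex.Im (h p + k p)) (fun p => complex.Im (h p) + complex.Im (k p)) p v oW Wp); last first.
  by move=> q _; rewrite complexD.
by rewrite (diff_funD _ Wp h1 k1) (diff_funD _ Wp h2 k2).
Qed.

Lemma diff_cfun_conj W h p v : open W -> W p -> smooth_cfun W h ->
  diff_cfun (fun p => Num.conj (h p)) p v = Num.conj (diff_cfun h p v).
Proof.
move=> oW Wp [h1 h2]; rewrite [RHS]conjcE /diff_cfun /=; congr Complex.
  by apply: (eq_diff_fun _ oW Wp) => q _; rewrite conjcE.
by rewrite -(diff_funN _ Wp h2); apply: (eq_diff_fun _ oW Wp) => q _; rewrite conjcE.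
Qed.

Lemma diff_cfun_cst c p v : diff_cfun (fun _ : M => c) p v = 0.
Proof.
by congr Complex; exact: (@derive_cst R _ R^o).
Qed.

End SmoothFunctions.

(** * The line bundle with connection of a given holonomy *)

Section HolonomyBundle.
Context {R : realType} {n : nat} {M : manifold R n}.
Local Notation delta w := (@coboundary R R M _ w).
Implicit Types (W U : set M) (phi : M -> R) (alpha : diff_form M 1) (y : singular R M 1 -> R).

Lemma conjM (a b : R[i]) : Num.conj (a * b) = Num.conj a * Num.conj b.
Proof. exact: rmorphM. Qed.

Lemma conjD (a b : R[i]) : Num.conj (a + b) = Num.conj a + Num.conj b.
Proof. exact: rmorphD. Qed.

Lemma conjK' (a : R[i]) : Num.conj (Num.conj a) = a.
Proof. by rewrite !conjcE /= opprK; case: a. Qed.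

Lemma smooth_fun_cst W (c : R) : smooth_fun W (fun _ : M => c).
Proof. by move=> d ad; exact: (@smooth_cst R _ R^o). Qed.

(** Like [holonomic], but with the path cochain y as a defect. Defects add up in sums and
    differences, and a combination with total defect 0 is holonomic. *)
Definition twisted W phi alpha y := forall s : singular R M 1, smooth_simplex s -> simage s `<=` W ->
  isint (delta (pt_cochain phi) s - integrate alpha s + y s).

Lemma delta_ptD phi phi' s : delta (pt_cochain (fun p => phi p + phi' p)) s =
  delta (pt_cochain phi) s + delta (pt_cochain phi') s.
Proof. by rewrite -deltaD. Qed.

Lemma delta_ptB phi phi' s : delta (pt_cochain (fun p => phi p - phi' p)) s =
  delta (pt_cochain phi) s - delta (pt_cochain phi') s.
Proof. by rewrite -deltaB. Qed.

Lemma twistedD W W1 W2 phi alpha y phi' alpha' y' : open W -> W `<=` W1 -> W `<=` W2 ->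
  is_form W1 alpha -> is_form W2 alpha' -> twisted W1 phi alpha y -> twisted W2 phi' alpha' y' ->
  twisted W (fun p => phi p + phi' p) (fun p v => alpha p v + alpha' p v) (fun s => y s + y' s).
Proof.
move=> oW s1 s2 f1 f2 t1 t2 s ss sW; rewrite delta_ptD.
rewrite (integrateD oW (is_form_sub s1 f1) (is_form_sub s2 f2) ss sW).
have := isintD (t1 s ss (subset_trans sW s1)) (t2 s ss (subset_trans sW s2)).
by congr isint; ring.
Qed.

Lemma twistedB W W1 W2 phi alpha y phi' alpha' y' : open W -> W `<=` W1 -> W `<=` W2 ->
  is_form W1 alpha -> is_form W2 alpha' -> twisted W1 phi alpha y -> twisted W2 phi' alpha' y' ->
  twisted W (fun p => phi p - phi' p) (fun p v => alpha p v - alpha' p v) (fun s => y s - y' s).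
Proof.
move=> oW s1 s2 f1 f2 t1 t2 s ss sW; rewrite delta_ptB.
rewrite (integrateB oW (is_form_sub s1 f1) (is_form_sub s2 f2) ss sW).
have := isintB (t1 s ss (subset_trans sW s1)) (t2 s ss (subset_trans sW s2)).
by congr isint; ring.
Qed.

Lemma twisted_holonomic W phi alpha y : (forall s, y s = 0) -> twisted W phi alpha y -> holonomic W phi alpha.
Proof. by move=> y0 t s ss sW; rewrite -[_ - _]addr0 -(y0 s); exact: t. Qed.

Section Bundle.
Variables (U : set M) (y : singular R M 1 -> R) (w : diff_form M 2).

(* Local frames of the bundle with holonomy y along paths: modulo Z, the phase changes by the integral of the potential
   minus y. The phase itself need not be continuous. *)
Record hframe := HFrame {
  hf_dom : set M;
  hf_A : diff_form M 1;
  hf_f : M -> R;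
  hf_open : open hf_dom;
  hf_sub : hf_dom `<=` U;
  hf_form : is_form hf_dom hf_A;
  hf_d : forall p v, hf_dom p -> ext_d hf_A p v = w p v;
  hf_twisted : twisted hf_dom hf_f hf_A y }.

(** Fibre by fibre this is the product with C; the bundle is encoded entirely in the choice of the
    discontinuous phases that count as smooth frames. *)
Definition hol_bundle : line_bundle M := @LineBundle R n M (fun _ => R[i]^o : vectType R[i])
  (fun p u v => (u : R[i]) * Num.conj (v : R[i])) hframe hf_dom (fun a p => cis (hf_f a p)).

Hypotheses (oU : open U) (fw : is_form U w) (dw : forall p v, U p -> ext_d w p v = 0).
Hypothesis yw : forall s : singular R M 2, smooth_simplex s -> simage s `<=` U -> isint (delta y s - integrate w s).

(** On a chart ball w has a primitive A, and the integral of A minus y is a cocycle modulo Z on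
    paths; a primitive of this cocycle is the phase of a frame. *)
Lemma hframe_exists p : U p -> exists a, hf_dom a p.
Proof.
move=> Up; have [b [hb bp bU]] := chart_ball_exists oU Up.
have oB := cb_open hb.
have [A fA dA] := poincare hb (is_form_sub bU fw) (fun q v bq => dw v (bU q bq)).
have [f Hf] : exists u : singular R M 0 -> R, forall s, smooth_simplex s -> simage s `<=` cb_set b ->
    isint (integrate A s - y s - delta u s).
  apply: (chart_ball_cocycle hb (@subgroup_int R)) => s ss sB.
  rewrite deltaB; have <- : integrate w s = delta (integrate A) s.
    rewrite -[RHS](integrate_stokes oB fA ss sB); apply: eq_integrate => q v /sB bq.
    by rewrite dA.
  by rewrite -opprB; apply: isintN; apply: yw => // q /sB/bU.
(* A 0-cochain becomes a function through its values on constant simplices. *)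
have tw : twisted (cb_set b) (fun q => f (cst_sing q 0)) A y.
  move=> s ss sB; have := isintN (Hf s ss sB); congr isint.
  suff -> : delta (pt_cochain (fun q => f (cst_sing q 0))) s = delta f s by ring.
  apply: eq_bigr => i _; congr (_ * f _); apply: singular_eq => t; rewrite cst_singE.
  congr (sing_face i s _); apply: val_inj; apply/rowP => j.
  have := simplex_point t; have := simplex_point (vertex (R := R) 0); rewrite /simplex /= !big_ord1 !set_valE.
  by rewrite (ord1 j) => -[_ ->] [_ ->].
by exists (HFrame oB bU fA dA tw).
Qed.

Lemma frame_unit (a : R) : cis a * Num.conj (cis a) = 1.
Proof. by rewrite cis_conj -cisD subrr cis0. Qed.

Lemma frame_ratio (a b : R) : cis a * Num.conj (cis b) = cis (a - b).
Proof. by rewrite cis_conj -cisD. Qed.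

(** Both phases have the same defect y, which cancels in the difference; transition functions are
    therefore smooth although the phases need not be. *)
Lemma hframe_holonomic (a b : hframe) :
  holonomic (hf_dom a `&` hf_dom b) (fun p => hf_f b p - hf_f a p) (fun p v => hf_A b p v - hf_A a p v).
Proof.
have oW := openI (hf_open a) (hf_open b).
apply: (@twisted_holonomic _ _ _ (fun s => y s - y s)); first by move=> s; rewrite subrr.
by apply: (twistedB oW _ _ (hf_form b) (hf_form a) (@hf_twisted b) (@hf_twisted a)) => q [].
Qed.

Lemma hframe_diff_form (a b : hframe) :
  is_form (hf_dom a `&` hf_dom b) (fun p v => hf_A b p v - hf_A a p v).
Proof.
have oW := openI (hf_open a) (hf_open b).
by apply: is_formB => //; [apply: is_form_sub (hf_form b)|apply: is_form_sub (hf_form a)] => q [].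
Qed.

Lemma hol_bundle_is : is_line_bundle U hol_bundle.
Proof.
split=> /=.
- by move=> p _; rewrite dimvf.
- by move=> p _ a u v z; rewrite mulrDl -mulrA.
- have E (u v : R[i]) : u * Num.conj v = Num.conj (v * Num.conj u) by rewrite conjM conjK' mulrC.
  by move=> p _ u v; exact: E.
- by move=> p _ u u0; rewrite mul_conjC_gt0.
- by move=> a; split; [exact: hf_open|exact: hf_sub].
- exact: hframe_exists.
- by move=> a p _; rewrite /unit_vector /=; exact: frame_unit.
move=> a b; have oW := openI (hf_open a) (hf_open b).
apply: (eq_smooth_cfun oW _ (holonomic_smooth oW (hframe_diff_form a b) (@hframe_holonomic a b))).
by move=> p _; rewrite frame_ratio.
Qed.

Definition coef (s : forall p, fib hol_bundle p) (a : hframe) (q : M) : R[i] :=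
  (s q : R[i]) * Num.conj (cis (hf_f a q)).

Definition hol_at (s : forall p, fib hol_bundle p) (a : hframe) p (v : 'rV[R]_n) : R[i] :=
  (diff_cfun (coef s a) p v + Complex 0 (2 * pi * hf_A a p v) * coef s a p) * cis (hf_f a p).

Definition hol_connection : connection hol_bundle := fun s p v =>
  if frame_at hol_bundle p is Some a then hol_at s a p v else 0.

(** The potentials of two frames differ by the logarithmic differential of the transition function,
    which is [holonomic_diff]. *)
Lemma hol_at_change W s (a b : hframe) p v : open W -> smooth_section W s -> W p -> hf_dom a p -> hf_dom b p ->
  hol_at s a p v = hol_at s b p v.
Proof.
move=> oW ss Wp ap bp; have oV := openI (hf_open a) (hf_open b).
pose z q : R[i] := cis (hf_f b q - hf_f a q).
have sz : smooth_cfun (hf_dom a `&` hf_dom b) z := holonomic_smooth oV (hframe_diff_form a b) (@hframe_holonomic a b).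
have dz : diff_cfun z p v = Complex 0 (2 * pi * (hf_A b p v - hf_A a p v)) * z p.
  exact: (holonomic_diff oV (hframe_diff_form a b) (@hframe_holonomic a b)).
pose V := W `&` (hf_dom a `&` hf_dom b).
have oV' : open V by exact: openI.
have sb : smooth_cfun V (coef s b) by apply: sub_smooth_cfun (ss b) => q [? []].
have E q : V q -> coef s a q = coef s b q * z q.
  move=> _; rewrite /coef /z cisB -mulrA; congr (_ * _).
  by rewrite mulrA [_ * cis _]mulrC frame_unit mul1r cisV cis_conj.
rewrite /hol_at (eq_diff_cfun v oV' _ E)// (E p)//.
rewrite (diff_cfunM _ oV' _ sb (sub_smooth_cfun _ sz))//; last by move=> q [].
rewrite dz.
have -> : cis (hf_f b p) = z p * cis (hf_f a p) by rewrite /z -cisD subrK.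
have -> : Complex 0 (2 * pi * (hf_A b p v - hf_A a p v)) = Complex 0 (2 * pi * hf_A b p v) - Complex 0 (2 * pi * hf_A a p v).
  by apply/eqP; rewrite eq_complex /= subrr mulrBr !eqxx.
ring.
Qed.

Lemma hol_connectionE W s (a : hframe) p v : open W -> smooth_section W s -> W p -> hf_dom a p ->
  hol_connection s p v = hol_at s a p v.
Proof.
move=> oW ss Wp ap; rewrite /hol_connection /frame_at.
case: pselect => [h|[]]; last by exists a.
exact: (hol_at_change v oW ss Wp (projT2 (cid h)) ap).
Qed.

Lemma frame_section (a : hframe) : smooth_section (hf_dom a) (frame (l := hol_bundle) a).
Proof. by move=> b; have := lb_smooth hol_bundle_is b a; rewrite setIC. Qed.

Lemma hol_frame (a : hframe) p v : hf_dom a p ->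
  hol_connection (frame (l := hol_bundle) a) p v = Complex 0 (2 * pi * hf_A a p v) * cis (hf_f a p).
Proof.
move=> ap; have E q : coef (frame (l := hol_bundle) a) a q = 1 by exact: frame_unit.
rewrite (hol_connectionE v (hf_open a) (@frame_section a) ap ap) /hol_at.
by rewrite (@eq_diff_cfun _ _ _ (hf_dom a) _ (fun=> 1) p v (hf_open a) ap (fun q _ => E q)) diff_cfun_cst E add0r mulr1.
Qed.

Lemma potential_value (a r : R) : complex.Im (Complex 0 (2 * pi * a) * cis r * Num.conj (cis r)) / (2 * pi) = a.
Proof. by rewrite -mulrA frame_unit mulr1 /= mulrC mulKf// mulf_neq0 ?pnatr_eq0// gt_eqF// pi_gt0. Qed.

Lemma hol_potential (a : hframe) p v : hf_dom a p -> conn_potential hol_connection a p v = hf_A a p v.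
Proof. by move=> ap; rewrite /conn_potential hol_frame//; exact: potential_value. Qed.

Lemma hol_curv p v : U p -> curv hol_connection p v = w p v.
Proof.
move=> Up; rewrite /curv /frame_at; case: pselect => [h|[]]; last exact: hframe_exists.
set a := projT1 (cid h); have ap : hf_dom a p := projT2 (cid h).
by rewrite (eq_ext_d v (hf_open a) ap (fun q u aq => hol_potential u aq)) hf_d.
Qed.

Lemma hol_connection_is : is_connection U hol_connection.
Proof.
split.
- move=> W s oW sW ss a; have oV : open (W `&` hf_dom a) := openI oW (hf_open a).
  pose h := coef s a; have [sh1 sh2] : smooth_cfun (W `&` hf_dom a) h := ss a.
  have fA : is_form (W `&` hf_dom a) (hf_A a) by apply: is_form_sub (hf_form a) => q [].
  have f2 : is_form (W `&` hf_dom a) (fun p v => 2 * pi * hf_A a p v).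
    exact: (@is_form_scale R n M _ (fun=> 2 * pi) _ _ oV (@smooth_fun_cst _ _) fA).
  have E p v : (W `&` hf_dom a) p -> herm (hol_connection s p v) (frame (l := hol_bundle) a p) =
      diff_cfun h p v + Complex 0 (2 * pi * hf_A a p v) * h p.
    by move=> [Wp ap]; rewrite (hol_connectionE v oW ss Wp ap) /= /hol_at -mulrA frame_unit mulr1.
  split.
    apply: (@eq_is_form _ _ _ _ (fun p v => diff_fun (fun q => complex.Re (h q)) p v -
      complex.Im (h p) * (2 * pi * hf_A a p v)) _ _ oV).
      by move=> p v Vp; rewrite (E p v Vp) complexD [X in _ + complex.Re X]complexM /=; ring.
    exact: is_formB oV (diff_form_is_form oV sh1) (is_form_scale oV sh2 f2).
  apply: (@eq_is_form _ _ _ _ (fun p v => diff_fun (fun q => complex.Im (h q)) p v +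
      complex.Re (h p) * (2 * pi * hf_A a p v)) _ _ oV).
    by move=> p v Vp; rewrite (E p v Vp) complexD [X in _ + complex.Im X]complexM /=; ring.
  exact: is_formD oV (diff_form_is_form oV sh2) (is_form_scale oV sh1 f2).
- move=> W s t oW sW ss st E p v Wp; have [a ap] := hframe_exists (sW p Wp).
  rewrite (hol_connectionE v oW ss Wp ap) (hol_connectionE v oW st Wp ap) /hol_at /coef (E p Wp).
  rewrite (eq_diff_cfun v oW Wp (k := fun q => t q * Num.conj (cis (hf_f a q))))// => q Wq.
  by rewrite (E q Wq).
- move=> W s t oW sW ss st p v Wp; have [a ap] := hframe_exists (sW p Wp).
  have Est q : coef (fun q => s q + t q) a q = coef s a q + coef t a q by rewrite /coef mulrDl.
  have sst : smooth_section W (fun q => s q + t q).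
    move=> b; apply: (eq_smooth_cfun (openI oW (hf_open b)) _ (smooth_cfun_add (openI oW (hf_open b)) (ss b) (st b))).
    by move=> q _ /=; rewrite mulrDl.
  have oV : open (W `&` hf_dom a) := openI oW (hf_open a).
  rewrite (hol_connectionE v oW ss Wp ap) (hol_connectionE v oW st Wp ap) (hol_connectionE v oW sst Wp ap) /hol_at.
  rewrite (eq_diff_cfun v oV (conj Wp ap) (fun q _ => Est q)) Est.
  rewrite (diff_cfunD v oV (conj Wp ap) (ss a) (st a)).
  have alg (d1 d2 z c1 c2 e : R[i]) : (d1 + d2 + z * (c1 + c2)) * e = (d1 + z * c1) * e + (d2 + z * c2) * e by ring.
  exact: alg.
- move=> W s f oW sW ss sf p v Wp; have [a ap] := hframe_exists (sW p Wp).
  have Est q : coef (fun q => f q *: s q) a q = f q * coef s a q by rewrite /coef -mulrA.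
  have sfs : smooth_section W (fun q => f q *: s q).
    move=> b; have oV : open (W `&` hf_dom b) := openI oW (hf_open b).
    have sfb : smooth_cfun (W `&` hf_dom b) f by apply: sub_smooth_cfun sf => q [].
    apply: (eq_smooth_cfun oV _ (smooth_cfun_mul oV sfb (ss b))).
    by move=> q _ /=; rewrite -mulrA.
  have oV : open (W `&` hf_dom a) := openI oW (hf_open a).
  have sfa : smooth_cfun (W `&` hf_dom a) f by apply: sub_smooth_cfun sf => q [].
  rewrite (hol_connectionE v oW ss Wp ap) (hol_connectionE v oW sfs Wp ap) /hol_at.
  rewrite (eq_diff_cfun v oV (conj Wp ap) (fun q _ => Est q)) Est.
  rewrite (diff_cfunM v oV (conj Wp ap) sfa (ss a)).
  have Es : s p = coef s a p * cis (hf_f a p).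
    by rewrite /coef -mulrA [Num.conj _ * _]mulrC frame_unit mulr1.
  rewrite {2}Es.
  have alg (df fp d z c e : R[i]) : (df * c + fp * d + z * (fp * c)) * e = df * (c * e) + fp * ((d + z * c) * e) by ring.
  exact: alg.
move=> W s t oW sW ss st p v Wp; have [a ap] := hframe_exists (sW p Wp).
have oV : open (W `&` hf_dom a) := openI oW (hf_open a).
have E q : herm (s q) (t q) = coef s a q * Num.conj (coef t a q).
  by rewrite /= /coef conjM conjK' mulrACA [Num.conj (cis _) * _]mulrC frame_unit mulr1.
rewrite (hol_connectionE v oW ss Wp ap) (hol_connectionE v oW st Wp ap).
rewrite (eq_diff_cfun v oV (conj Wp ap) (fun q _ => E q)).
rewrite (diff_cfunM v oV (conj Wp ap) (ss a) (smooth_cfun_conj oV (st a))).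
rewrite (diff_cfun_conj v oV (conj Wp ap) (st a)).
have Es (r : forall q, fib hol_bundle q) : r p = coef r a p * cis (hf_f a p).
  by rewrite /coef -mulrA [Num.conj _ * _]mulrC frame_unit mulr1.
set e := cis (hf_f a p) in Es; set z := Complex 0 (2 * pi * hf_A a p v).
have zN : Num.conj z = - z by rewrite conjcE; apply/eqP; rewrite eq_complex /= oppr0 !eqxx.
have ee : e * Num.conj e = 1 by exact: frame_unit.
transitivity (((diff_cfun (coef s a) p v + z * coef s a p) * e) * Num.conj (coef t a p * e) +
  (coef s a p * e) * Num.conj ((diff_cfun (coef t a) p v + z * coef t a p) * e)); last first.
  by rewrite -(Es s) -(Es t).
rewrite -[LHS]/(diff_cfun (coef s a) p v * Num.conj (coef t a p) + coef s a p * Num.conj (diff_cfun (coef t a) p v)).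
move: (coef s a p) (coef t a p) (diff_cfun (coef s a) p v) (diff_cfun (coef t a) p v) => hs ht ds dt.
rewrite !conjM conjD conjM zN.
have alg (ce cht cdt : R[i]) : (ds + z * hs) * e * (cht * ce) + hs * e * ((cdt + - z * cht) * ce) =
  (ds * cht + hs * cdt) * (e * ce) by ring.
by rewrite alg ee mulr1.
Qed.

End Bundle.
End HolonomyBundle.

(** * From integral forms to relative gerbes *)

Section Realization.
Context {R : realType}.

Section Phases.
Context {n : nat} {M : manifold R n}.
Local Notation delta w := (@coboundary R R M _ w).

(** The component, in the unit vectors z1, z2, z3, of the section of the triple tensor product that
    equals 1 in the product fibres. *)
Definition phase3 (z1 z2 z3 : R[i]) : R[i] := (z1 * z2^-1 * z3)^-1.

Lemma phase3_cis a b c : phase3 (cis a) (cis b) (cis c) = cis (- (a - b + c)).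
Proof. by rewrite /phase3 !cisV -!cisD cisV. Qed.

Lemma phase3M (z1 z2 z3 u1 u2 u3 : R[i]) :
  phase3 (z1 * u1) (z2 * u2) (z3 * u3) = z1^-1 * z2 * z3^-1 * phase3 u1 u2 u3.
Proof. by rewrite /phase3 !invfM !invrK; ring. Qed.

Lemma norm_unit (u : R[i]) : u * Num.conj u = 1 -> `|u| = 1.
Proof. by move=> E; apply/eqP; rewrite -(@pexpr_eq1 _ _ 2)// normCK E. Qed.

Lemma norm_phase3 (u1 u2 u3 : R[i]) : `|u1| = 1 -> `|u2| = 1 -> `|u3| = 1 -> `|phase3 u1 u2 u3| = 1.
Proof. by move=> E1 E2 E3; rewrite /phase3 normfV !normrM normfV E1 E2 E3 invr1 !mulr1 invr1. Qed.

(** The three defects cancel by assumption, so the total phase is holonomic for the total potential;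
    the section 1 is then smooth and parallel. *)
Lemma phase3_smooth (W : set M) (f1 f2 f3 : M -> R) (a1 a2 a3 : diff_form M 1) (y1 y2 y3 : singular R M 1 -> R) :
  open W -> is_form W a1 -> is_form W a2 -> is_form W a3 ->
  twisted W f1 a1 y1 -> twisted W f2 a2 y2 -> twisted W f3 a3 y3 -> (forall s, y1 s - y2 s + y3 s = 0) ->
  smooth_cfun W (fun p => phase3 (cis (f1 p)) (cis (f2 p)) (cis (f3 p))) /\
  forall p v, W p -> diff_cfun (fun p => phase3 (cis (f1 p)) (cis (f2 p)) (cis (f3 p))) p v +
    Complex 0 (2 * pi * (a1 p v - a2 p v + a3 p v)) * phase3 (cis (f1 p)) (cis (f2 p)) (cis (f3 p)) = 0.
Proof.
move=> oW fa1 fa2 fa3 t1 t2 t3 y0.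
have id_ : W `<=` W by [].
have f0 : is_form W (fun (p : M) (v : 'M[R]_(1, n)) => (0 : R)).
  by have := is_formB oW fa1 fa1; apply: eq_is_form => // p v _; rewrite subrr.
have t0 : twisted W (fun=> 0) (fun (p : M) (v : 'M[R]_(1, n)) => (0 : R)) (fun=> 0).
  have := twistedB oW id_ id_ fa1 fa1 t1 t1; move=> H s ss sW; have := H s ss sW.
  rewrite !subrr; congr (isint (_ - integrate _ s + _)); last by apply/funext => p; apply/funext => v; rewrite subrr.
  by rewrite delta_ptB subrr /coboundary big1// => i _; rewrite /pt_cochain mulr0.
have t12 := twistedB oW id_ id_ fa1 fa2 t1 t2; have f12 := is_formB oW fa1 fa2.
have t123 := twistedD oW id_ id_ f12 fa3 t12 t3; have f123 := is_formD oW f12 fa3.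
have t := twistedB oW id_ id_ f0 f123 t0 t123; have f := is_formB oW f0 f123.
have hol : holonomic W (fun p => 0 - (f1 p - f2 p + f3 p)) (fun p v => 0 - (a1 p v - a2 p v + a3 p v)).
  by apply: twisted_holonomic t => s; rewrite y0 subrr.
have E : (fun p => phase3 (cis (f1 p)) (cis (f2 p)) (cis (f3 p))) = (fun p => cis (0 - (f1 p - f2 p + f3 p))).
  by apply/funext => p; rewrite phase3_cis sub0r.
split; first by rewrite E; exact: holonomic_smooth oW f hol.
move=> p v Wp; have E' : phase3 (cis (f1 p)) (cis (f2 p)) (cis (f3 p)) = cis (0 - (f1 p - f2 p + f3 p)).
  by rewrite phase3_cis sub0r.
rewrite E E' (holonomic_diff oW f hol v Wp) -mulrDl.
have -> : Complex 0 (2 * pi * (0 - (a1 p v - a2 p v + a3 p v))) + Complex 0 (2 * pi * (a1 p v - a2 p v + a3 p v)) = 0 :> R[i].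
  by apply/eqP; rewrite eq_complex /= addr0 eqxx /= sub0r mulrN addNr.
by rewrite mul0r.
Qed.

Lemma twisted_sub (W W' : set M) f a y : W' `<=` W -> twisted W f a y -> twisted W' f a y.
Proof. by move=> sW t s ss sW'; apply: t => //; exact: subset_trans sW. Qed.

Lemma phase3_hframes (U1 U2 U3 : set M) (y1 y2 y3 : singular R M 1 -> R) (w1 w2 w3 : diff_form M 2)
    (a : hframe U1 y1 w1) (b : hframe U2 y2 w2) (c : hframe U3 y3 w3)
    (W := hf_dom a `&` hf_dom b `&` hf_dom c) :
  (forall s, y1 s - y2 s + y3 s = 0) ->
  smooth_cfun W (fun p => phase3 (cis (hf_f a p)) (cis (hf_f b p)) (cis (hf_f c p))) /\
  forall p v, W p -> diff_cfun (fun p => phase3 (cis (hf_f a p)) (cis (hf_f b p)) (cis (hf_f c p))) p v +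
    Complex 0 (2 * pi * (hf_A a p v - hf_A b p v + hf_A c p v)) *
      phase3 (cis (hf_f a p)) (cis (hf_f b p)) (cis (hf_f c p)) = 0.
Proof.
have oW : open W := openI (openI (hf_open a) (hf_open b)) (hf_open c).
have Wa : W `<=` hf_dom a by move=> p [[]].
have Wb : W `<=` hf_dom b by move=> p [[]].
have Wc : W `<=` hf_dom c by move=> p [].
apply: (phase3_smooth oW (is_form_sub Wa (hf_form a)) (is_form_sub Wb (hf_form b)) (is_form_sub Wc (hf_form c))).
- exact: twisted_sub Wa (hf_twisted (h := a)).
- exact: twisted_sub Wb (hf_twisted (h := b)).
- exact: twisted_sub Wc (hf_twisted (h := c)).
Qed.

End Phases.

Section Pull.
Context {m n : nat} {M : manifold R m} {N : manifold R n} (Phi : smooth_map M N).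

Lemma twisted_pull (W : set N) f a y : twisted W f a y ->
  twisted (Phi @^-1` W) (f \o Phi) (pull_form Phi a) (fun s => y (sing_comp Phi s)).
Proof.
move=> t s ss sW; have := t _ (sing_comp_smooth Phi ss) (simage_comp sW (fun p => id)).
by rewrite integrate_map.
Qed.

Lemma open_Phi (W : set N) : open W -> open (Phi @^-1` W).
Proof. by apply: open_preim; exact: smap_continuous. Qed.

Lemma pull_row (a : diff_form N 1) p (v : 'rV[R]_m) : a (Phi p) (tangent_map Phi p v) = pull_form Phi a p v.
Proof.
by rewrite /pull_form; congr (a _ _); apply/row_matrixP => i; rewrite rowK (ord1 i) !row_id.
Qed.

(** [pull_connection] works with whichever frame b is picked at Phi p; the pulled-back transition
    phase between a and b accounts for the difference of their potentials. *)
Lemma pull_potential (U : set N) y w (hU : open U) (fw : is_form U w)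
    (dw : forall p v, U p -> ext_d w p v = 0)
    (yw : forall s : singular R N 2, smooth_simplex s -> simage s `<=` U ->
       isint (@coboundary R R N _ y s - integrate w s))
    (a : hframe U y w) p v : hf_dom a (Phi p) ->
  conn_potential (pull_connection Phi (@hol_connection R n N U y w)) a p v = pull_form Phi (hf_A a) p v.
Proof.
move=> ap; set L := hol_bundle U y w.
have [b bp Eb] : exists2 b : hframe U y w, hf_dom b (Phi p) & frame_at L (Phi p) = Some b.
  rewrite /frame_at; case: pselect => [h|[]]; last by exists a.
  by exists (projT1 (cid h)) => //; exact: projT2 (cid h).
pose W := hf_dom b `&` hf_dom a; have oW : open W := openI (hf_open b) (hf_open a).
have oV := open_Phi oW.
pose z (q : M) : R[i] := cis (hf_f a (Phi q) - hf_f b (Phi q)).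
have hol : holonomic (Phi @^-1` W) (fun q => hf_f a (Phi q) - hf_f b (Phi q)) (pull_form Phi (fun q v => hf_A a q v - hf_A b q v)).
  move=> s ss sW; rewrite -(integrate_map _ _ ss).
  exact: (hframe_holonomic (a := b) (b := a) (sing_comp_smooth Phi ss) (simage_comp sW (fun p => id))).
have fz := pull_form_is_form Phi oW (hframe_diff_form b a).
have Wp : (Phi @^-1` W) p by [].
have E q : (frame (l := L) a (Phi q) : R[i]) * Num.conj (frame (l := L) b (Phi q) : R[i]) = z q by exact: frame_ratio.
rewrite /conn_potential.
have -> : pull_connection Phi (@hol_connection R n N U y w) (frame (l := pull_bundle Phi L) a) p v =
    Complex 0 (2 * pi * pull_form Phi (hf_A a) p v) * cis (hf_f a (Phi p)).
  rewrite /pull_connection Eb.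
  have H : diff_cfun (fun q => (frame (l := L) a (Phi q) : R[i]) * Num.conj (frame (l := L) b (Phi q) : R[i])) p v =
      Complex 0 (2 * pi * (pull_form Phi (hf_A a) p v - pull_form Phi (hf_A b) p v)) * z p.
    rewrite (eq_diff_cfun v oV Wp (fun q _ => E q)).
    by rewrite (holonomic_diff oV fz hol v Wp).
  have F : hol_connection (frame (l := L) b) (Phi p) (tangent_map Phi p v) =
      Complex 0 (2 * pi * pull_form Phi (hf_A b) p v) * cis (hf_f b (Phi p)).
    by rewrite (hol_frame hU fw dw yw _ bp) pull_row.
  have alg : Complex 0 (2 * pi * (pull_form Phi (hf_A a) p v - pull_form Phi (hf_A b) p v)) * z p * cis (hf_f b (Phi p)) +
     z p * (Complex 0 (2 * pi * pull_form Phi (hf_A b) p v) * cis (hf_f b (Phi p))) =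
     Complex 0 (2 * pi * pull_form Phi (hf_A a) p v) * cis (hf_f a (Phi p)).
    rewrite -[hf_f a (Phi p)](subrK (hf_f b (Phi p))) cisD -/(z p).
    have -> : Complex 0 (2 * pi * (pull_form Phi (hf_A a) p v - pull_form Phi (hf_A b) p v)) =
       Complex 0 (2 * pi * pull_form Phi (hf_A a) p v) - Complex 0 (2 * pi * pull_form Phi (hf_A b) p v) :> R[i].
      by apply/eqP; rewrite eq_complex /= subrr mulrBr !eqxx.
    ring.
  rewrite -alg -H -F -(E p); reflexivity.
exact: potential_value.
Qed.

End Pull.

(** * Construction of the relative gerbe *)

Section Existence.
Context {m n : nat} {M : manifold R m} {N : manifold R n} (Phi : smooth_map M N).
Variables (tau : diff_form M 2) (kappa : diff_form N 3).
Hypotheses (ftau : is_form setT tau) (fkappa : is_form setT kappa).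
Hypothesis closed : closed_relative_form Phi tau kappa.
Variables (al : singular R M 1 -> R) (be : singular R N 2 -> R).
Hypothesis tau_int : forall s : singular R M 2, smooth_simplex s ->
  isint (integrate tau s - (be (sing_comp Phi s) - @coboundary R R M _ al s)).
Hypothesis kappa_int : forall s : singular R N 3, smooth_simplex s ->
  isint (integrate kappa s - @coboundary R R N _ be s).

(** The cover of N is indexed by N itself, with one ball around each point; its preimages cover M,
    so the refinement map can be the identity. *)
Let ball (j : N) := projT1 (cid (chart_ball_exists (W := setT) (p := j) openT I)).
Let ballP j : is_chart_ball (ball j) /\ cb_set (ball j) j.
Proof. by have [] := projT2 (cid (chart_ball_exists (W := setT) (p := j) openT I)). Qed.

Let V j : set N := cb_set (ball j).
Let oV j : open (V j) := cb_open (ballP j).1.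

Let varpi_ex j : exists2 A : diff_form N 2, is_form (V j) A & forall p v, V j p -> ext_d A p v = kappa p v.
Proof.
apply: (poincare (ballP j).1); first by apply: is_form_sub fkappa.
by move=> p v _; exact: closed.2.
Qed.
Let varpi j := projT1 (cid2 (varpi_ex j)).
Let fvarpi j : is_form (V j) (varpi j). Proof. exact: (s2valP (cid2 (varpi_ex j))). Qed.
Let dvarpi j p v : V j p -> ext_d (varpi j) p v = kappa p v.
Proof. exact: (s2valP' (cid2 (varpi_ex j))). Qed.

Let y_ex j : exists u : singular R N 1 -> R, forall s, smooth_simplex s -> simage s `<=` V j ->
  isint (integrate (varpi j) s - be s - @coboundary R R N _ u s).
Proof.
apply: (chart_ball_cocycle (ballP j).1 (@subgroup_int R)) => s ss sV; rewrite deltaB.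
have := kappa_int ss; congr isint; congr (_ - _).
rewrite -[RHS](integrate_stokes (oV j) (fvarpi j) ss sV); apply: eq_integrate => p v /sV Vp.
by rewrite dvarpi.
Qed.
Let y j := projT1 (cid (y_ex j)).
Let yP j : forall s, smooth_simplex s -> simage s `<=` V j ->
  isint (integrate (varpi j) s - be s - @coboundary R R N _ (y j) s) := projT2 (cid (y_ex j)).

Let oVV i j : open (V i `&` V j) := openI (oV i) (oV j).

Let w i j : diff_form N 2 := fun p v => varpi j p v - varpi i p v.
Let yy i j s := y j s - y i s.

Let fvarpiI i j : is_form (V i `&` V j) (varpi i) /\ is_form (V i `&` V j) (varpi j).
Proof. by split; [apply: is_form_sub (fvarpi i)|apply: is_form_sub (fvarpi j)] => p []. Qed.

Let fw i j : is_form (V i `&` V j) (w i j).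
Proof. by have [fi fj] := fvarpiI i j; exact: is_formB. Qed.

Let dw i j p v : (V i `&` V j) p -> ext_d (w i j) p v = 0.
Proof.
move=> Vp; have [fi fj] := fvarpiI i j; rewrite (ext_dB v (oVV i j) fj fi Vp).
by case: Vp => Vi Vj; rewrite !dvarpi// subrr.
Qed.

Let yw i j (s : singular R N 2) : smooth_simplex s -> simage s `<=` V i `&` V j ->
  isint (@coboundary R R N _ (yy i j) s - integrate (w i j) s).
Proof.
move=> ss sV; have [fi fj] := fvarpiI i j; rewrite deltaB (integrateB (oVV i j) fj fi ss sV).
have Hi := yP ss (fun p sp => (sV p sp).1); have Hj := yP ss (fun p sp => (sV p sp).2).
have alg (a b c d e : R) : isint (a - e - b) -> isint (c - e - d) -> isint (d - b - (c - a)).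
  move=> h1 h2; have -> : d - b - (c - a) = (a - e - b) - (c - e - d) by ring.
  exact: isintB.
exact: alg Hi Hj.
Qed.

Let UE i : set M := Phi @^-1` V i.
(** The curvature that E_i must have for the relative curvature to be tau. It is closed exactly
    because d tau is the pullback of kappa. *)
Let wE i : diff_form M 2 := fun p v => pull_form Phi (varpi i) p v - tau p v.
Let yE i (s : singular R M 1) := y i (sing_comp Phi s) + al s.
Let oUE i : open (UE i) := open_Phi Phi (oV i).
Let fpull i : is_form (UE i) (pull_form Phi (varpi i)) := pull_form_is_form Phi (oV i) (fvarpi i).
Let ftauU i : is_form (UE i) tau. Proof. exact: is_form_sub ftau. Qed.
Let fwE i : is_form (UE i) (wE i). Proof. exact: is_formB. Qed.

Let dwE i p v : UE i p -> ext_d (wE i) p v = 0.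
Proof.
move=> Up; rewrite (ext_dB v (oUE i) (fpull i) (ftauU i) Up) (ext_d_pull_form (oV i) (fvarpi i) v Up).
rewrite -[RHS](closed.1 p v); congr (_ - _); exact: dvarpi.
Qed.

Let ywE i (s : singular R M 2) : smooth_simplex s -> simage s `<=` UE i ->
  isint (@coboundary R R M _ (yE i) s - integrate (wE i) s).
Proof.
move=> ss sU; rewrite deltaD (integrateB (oUE i) (fpull i) (ftauU i) ss sU) -(integrate_map _ _ ss).
have H := yP (sing_comp_smooth Phi ss) (simage_comp sU (fun p => id)).
have -> : @coboundary R R M _ (fun s => y i (sing_comp Phi s)) s = @coboundary R R N _ (y i) (sing_comp Phi s).
  by apply: eq_bigr => a _; rewrite sing_comp_face.
have alg (t b a p q : R) : isint (t - (b - a)) -> isint (p - b - q) -> isint (q + a - (p - t)).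
  move=> h1 h2; have -> : q + a - (p - t) = (t - (b - a)) - (p - b - q) by ring.
  exact: isintB.
exact: alg (tau_int ss) H.
Qed.

(** The path cochains satisfy y_jk - y_ik + y_ij = 0 exactly, so the section 1 serves as theta and
    its cocycle condition is an algebraic identity; psi is obtained in the same way below. *)
Let G : gerbe_data N := @GerbeData R n N N V (fun i j => hol_bundle (V i `&` V j) (yy i j) (w i j))
  (fun i j k p u1 u2 u3 => phase3 u1 u2 u3).

Let D : gerbe_connection_data G := @GerbeConnectionData R n N G
  (fun i j => @hol_connection R n N (V i `&` V j) (yy i j) (w i j)) varpi.

Let unit_ (u : R[i]) : u * Num.conj u = 1 -> u != 0.
Proof. by move=> E; apply: contra_eq_neq E => ->; rewrite mul0r eq_sym oner_neq0. Qed.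

Let yy0 i j k s : yy j k s - yy i k s + yy i j s = 0.
Proof. by rewrite /yy; ring. Qed.

Let G_is : is_gerbe G.
Proof.
split=> /=.
- by split=> [j|p]; [exact: oV|exists p; have [] := ballP p].
- by move=> i j; exact: (hol_bundle_is (oVV i j) (fw i j) (@dw i j) (@yw i j)).
- move=> i j; exists (fun p u v => (u : R[i]) * (v : R[i])); split=> /=.
  + by move=> p _ a u v x; rewrite mulrDl -mulrA.
  + by move=> p _ a u v x; rewrite mulrDr mulrCA.
  + by move=> p _ u v hu hv; rewrite normrM (norm_unit hu) (norm_unit hv) mulr1.
  move=> a b.
  have oW : open (hf_dom a `&` hf_dom b) := openI (hf_open a) (hf_open b).
  have fa : is_form (hf_dom a `&` hf_dom b) (hf_A a) by apply: is_form_sub (hf_form a) => p [].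
  have fb : is_form (hf_dom a `&` hf_dom b) (hf_A b) by apply: is_form_sub (hf_form b) => p [].
  have t := twistedD oW (fun p h => h.1) (fun p h => h.2) (hf_form a) (hf_form b) (@hf_twisted _ _ _ _ _ _ a) (@hf_twisted _ _ _ _ _ _ b).
  have hol : holonomic (hf_dom a `&` hf_dom b) (fun p => hf_f a p + hf_f b p) (fun p v => hf_A a p v + hf_A b p v).
    by apply: twisted_holonomic t => s; rewrite /yy; ring.
  have oW' : open (V i `&` V j `&` hf_dom a `&` hf_dom b) := openI (openI (oVV i j) (hf_open a)) (hf_open b).
  apply: (eq_smooth_cfun oW' _ (sub_smooth_cfun _ (holonomic_smooth oW (is_formD oW fa fb) hol))).
    by move=> p _; rewrite cisD.
  by move=> p [[_ pa] pb].
- move=> i j k; split=> /=.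
  + by move=> p _ z1 z2 z3 u1 u2 u3 _ _ _ _ _ _; exact: phase3M.
  + by move=> p _ u1 u2 u3 h1 h2 h3; apply: norm_phase3; exact: norm_unit.
  + move=> a b c; have [sm _] := phase3_hframes a b c (yy0 i j k).
    by apply: sub_smooth_cfun sm => p [[[_ pa] pb] pc].
move=> i j k l p _ _ _ _ uij uik uil ujk ujl ukl h1 h2 h3 h4 h5 h6.
have := unit_ h1; have := unit_ h2; have := unit_ h3; have := unit_ h4; have := unit_ h5; have := unit_ h6.
rewrite /phase3 !invrK => n6 n5 n4 n3 n2 n1.
have alg (a1 a2 a3 a4 a5 a6 : R[i]) : a1 != 0 -> a2 != 0 -> a3 != 0 -> a4 != 0 -> a5 != 0 -> a6 != 0 ->
   (a6 * a5^-1 * a4)^-1 * (a6 * a3^-1 * a2) * (a5 * a3^-1 * a1)^-1 * (a4 * a2^-1 * a1) = 1.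
  by move=> b1 b2 b3 b4 b5 b6; field; rewrite ?b1 ?b2 ?b3 ?b4 ?b5 ?b6.
exact: alg.
Qed.

Let D_is : is_gerbe_connection D.
Proof.
split=> /=.
- by move=> i j; exact: (hol_connection_is (oVV i j) (fw i j) (@dw i j) (@yw i j)).
- move=> i j k a b c p v _ pa pb pc; have [_ E] := phase3_hframes a b c (yy0 i j k).
  have -> : conn_potential (@hol_connection R n N (V j `&` V k) (yy j k) (w j k)) a p v = hf_A a p v.
    exact: (hol_potential (oVV j k) (fw j k) (@dw j k) (@yw j k)).
  have -> : conn_potential (@hol_connection R n N (V i `&` V k) (yy i k) (w i k)) b p v = hf_A b p v.
    exact: (hol_potential (oVV i k) (fw i k) (@dw i k) (@yw i k)).
  have -> : conn_potential (@hol_connection R n N (V i `&` V j) (yy i j) (w i j)) c p v = hf_A c p v.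
    exact: (hol_potential (oVV i j) (fw i j) (@dw i j) (@yw i j)).
  exact: E.
- exact: fvarpi.
by move=> i j p v Vi Vj; rewrite (hol_curv (oVV i j) (fw i j) (@dw i j) (@yw i j)).
Qed.

Let PG := pull_gerbe Phi UE (id : N -> g_idx G).
Let Q : quasi_line_data PG := @QuasiLineData R m M PG (fun i => hol_bundle (UE i) (yE i) (wE i))
  (fun i j p u1 u2 u3 => phase3 u1 u2 u3).

Let Q_phase i j (a : hframe (UE i) (yE i) (wE i)) (b : hframe (UE j) (yE j) (wE j))
    (c : hframe (V i `&` V j) (yy i j) (w i j)) (W := hf_dom a `&` hf_dom b `&` Phi @^-1` hf_dom c) :
  smooth_cfun W (fun p => phase3 (cis (hf_f a p)) (cis (hf_f b p)) (cis (hf_f c (Phi p)))) /\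
  forall p v, W p -> diff_cfun (fun p => phase3 (cis (hf_f a p)) (cis (hf_f b p)) (cis (hf_f c (Phi p)))) p v +
    Complex 0 (2 * pi * (hf_A a p v - hf_A b p v + pull_form Phi (hf_A c) p v)) *
      phase3 (cis (hf_f a p)) (cis (hf_f b p)) (cis (hf_f c (Phi p))) = 0.
Proof.
have oc := open_Phi Phi (hf_open c).
have oW : open W := openI (openI (hf_open a) (hf_open b)) oc.
have Wa : W `<=` hf_dom a by move=> p [[]].
have Wb : W `<=` hf_dom b by move=> p [[]].
have Wc : W `<=` Phi @^-1` hf_dom c by move=> p [].
apply: (phase3_smooth (f3 := hf_f c \o Phi) (y3 := fun s => yy i j (sing_comp Phi s)) oW (is_form_sub Wa (hf_form a)) (is_form_sub Wb (hf_form b))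
  (is_form_sub Wc (pull_form_is_form Phi (hf_open c) (hf_form c)))).
- exact: twisted_sub Wa (hf_twisted (h := a)).
- exact: twisted_sub Wb (hf_twisted (h := b)).
- apply: (twisted_sub Wc); apply: (@twisted_pull _ _ _ _ Phi _ _ _ (yy i j)); exact: (hf_twisted (h := c)).
by move=> s; rewrite /yE /yy; ring.
Qed.

Let Q_is : is_quasi_line Q.
Proof.
split=> /=.
- by move=> i; exact: (hol_bundle_is (oUE i) (fwE i) (@dwE i) (@ywE i)).
- move=> i j; split=> /=.
  + by move=> p _ z1 z2 z3 u1 u2 u3 _ _ _ _ _ _; exact: phase3M.
  + by move=> p _ u1 u2 u3 h1 h2 h3; apply: norm_phase3; exact: norm_unit.
  + move=> a b c; have [sm _] := Q_phase a b c.
    by apply: sub_smooth_cfun sm => p [[[_ pa] pb] pc].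
move=> i j k p _ _ _ ei ej ek uij uik ujk h1 h2 h3 h4 h5 h6.
have := unit_ h1; have := unit_ h2; have := unit_ h3; have := unit_ h4; have := unit_ h5; have := unit_ h6.
rewrite /phase3 !invrK => n6 n5 n4 n3 n2 n1.
have alg (a1 a2 a3 a4 a5 a6 : R[i]) : a1 != 0 -> a2 != 0 -> a3 != 0 -> a4 != 0 -> a5 != 0 -> a6 != 0 ->
   (a2 * a3^-1 * a6)^-1 * (a1 * a3^-1 * a5) * (a1 * a2^-1 * a4)^-1 = (a6 * a5^-1 * a4)^-1.
  by move=> b1 b2 b3 b4 b5 b6; field; rewrite ?b1 ?b2 ?b3 ?b4 ?b5 ?b6.
exact: alg.
Qed.

Let DE i : connection (q_line Q i) := @hol_connection R m M (UE i) (yE i) (wE i).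

Let DE_is : is_quasi_line_connection (pull_gerbe_connection Phi UE D (id : N -> g_idx G)) DE.
Proof.
split=> /=.
- by move=> i; exact: (hol_connection_is (oUE i) (fwE i) (@dwE i) (@ywE i)).
move=> i j a b c p v _ pa pb pc; have [_ E] := Q_phase a b c.
have -> : conn_potential (@hol_connection R m M (UE i) (yE i) (wE i)) a p v = hf_A a p v.
  exact: (hol_potential (oUE i) (fwE i) (@dwE i) (@ywE i)).
have -> : conn_potential (@hol_connection R m M (UE j) (yE j) (wE j)) b p v = hf_A b p v.
  exact: (hol_potential (oUE j) (fwE j) (@dwE j) (@ywE j)).
have -> : conn_potential (pull_connection Phi (@hol_connection R n N (V i `&` V j) (yy i j) (w i j))) c p v =
    pull_form Phi (hf_A c) p v.
  exact: (pull_potential (oVV i j) (fw i j) (@dw i j) (@yw i j)).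
exact: E.
Qed.

Let cover_UE : open_cover UE.
Proof. by split=> [i|p]; [exact: oUE|exists (Phi p); have [] := ballP (Phi p)]. Qed.

Let refines_UE i : Phi @` UE i `<=` g_cover (g := G) i.
Proof. by move=> q [p Up <-]. Qed.

Lemma relative_gerbe_exists : exists X : relative_gerbe Phi, has_curvature X tau kappa.
Proof.
exists (@RelativeGerbe R m n M N Phi G D N UE id Q DE G_is D_is cover_UE refines_UE Q_is DE_is); split=> /=.
  move=> i p v Up; rewrite /DE (hol_curv (oUE i) (fwE i) (@dwE i) (@ywE i) v Up).
  by rewrite /wE; move: (pull_form _ _ _ _) (tau _ _) => a b; rewrite opprB addrC subrK.
by move=> j q v Vq; rewrite dvarpi.
Qed.

End Existence.

Theorem integral_relative_gerbe m n (M : manifold R m) (N : manifold R n) (Phi : smooth_map M N)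
    (tau : diff_form M 2) (kappa : diff_form N 3) :
  is_form setT tau -> is_form setT kappa -> closed_relative_form Phi tau kappa ->
  integral_relative_form Phi tau kappa -> exists X : relative_gerbe Phi, has_curvature X tau kappa.
Proof.
move=> ftau fkappa cl [z [[_ [b0 [t0 k0]]] [zi [_ [b1 [t1 k1]]]]]].
(* al and be add up two relative coboundaries: one between the integrals and z, the other between z
   and the integer cocycle. *)
apply: (relative_gerbe_exists ftau fkappa cl (al := fun s => b0.1 s + b1.1 s) (be := fun s => b0.2 s + b1.2 s)) => s ss.
  rewrite (t0 s ss) t1 /= deltaD.
  have alg (a b c d e : R) : isint a -> isint (a + (b - c) + (d - e) - (d + b - (e + c))).
    by move=> h; have -> : a + (b - c) + (d - e) - (d + b - (e + c)) = a by ring.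
  by apply: alg; exact: intr_int.
rewrite (k0 s ss) k1 /= deltaD.
have alg (a b c : R) : isint a -> isint (a + b + c - (c + b)).
  by move=> h; have -> : a + b + c - (c + b) = a by ring.
by apply: alg; exact: intr_int.
Qed.

End Realization.

(** * From relative gerbes to integral forms *)

Lemma derive_wronskian (R : realType) (V : normedModType R) (C S c s : V -> R^o) x v :
  derivable C x v -> derivable S x v -> derivable c x v -> derivable s x v ->
  'D_v (fun y => C y * s y - S y * c y : R^o) x =
    'D_v C x * s x + C x * 'D_v s x - ('D_v S x * c x + S x * 'D_v c x) /\
  derivable (fun y => C y * s y - S y * c y : R^o) x v.
Proof.
move=> dC dS dc ds.
have d1 : derivable (fun y => C y * s y : R^o) x v by exact: (derivableM dC ds).
have d2 : derivable (fun y => S y * c y : R^o) x v by exact: (derivableM dS dc).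
have d3 : derivable (fun y => - (S y * c y) : R^o) x v by exact: (derivableN d2).
split; last exact: (derivableD d1 d3).
rewrite (deriveDR d1 d3) (deriveNR d2) (deriveMR dC ds) (deriveMR dS dc).
move: ('D__ _ _) ('D__ _ _) ('D__ _ _) ('D__ _ _) (C x : R) (S x : R) (c x : R) (s x : R) => *; ring.
Qed.

Lemma alternating_sum2 (R : realType) (f : 'I_2 -> R) : \sum_(i < 2) (-1) ^+ i * f i = f 0 - f 1.
Proof. by rewrite sum2 expr0 mul1r expr1 mulN1r. Qed.

Section Phases.
Context {R : realType} {n : nat} {M : manifold R n}.
Local Notation delta w := (@coboundary R R M _ w).
Implicit Types (W : set M) (phi : M -> R) (A : diff_form M 1).

(** The differential counterpart of [holonomic]: A is the logarithmic differential, divided by 2 pi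
    i, of the circle-valued function with phase phi. *)
Definition phased W phi A := smooth_cfun W (fun p => cis (phi p)) /\
  forall p v, W p -> diff_cfun (fun q => cis (phi q)) p v = Complex 0 (2 * pi * A p v) * cis (phi p).

Lemma phased_sub W W' phi A : W' `<=` W -> phased W phi A -> phased W' phi A.
Proof. by move=> sW [sm d]; split=> [|p v /sW]; [exact: sub_smooth_cfun sm|exact: d]. Qed.

Lemma phasedD W phi phi' A A' : open W -> phased W phi A -> phased W phi' A' ->
  phased W (fun p => phi p + phi' p) (fun p v => A p v + A' p v).
Proof.
move=> oW [s1 d1] [s2 d2].
have E : (fun p => cis (phi p + phi' p)) = (fun p => cis (phi p) * cis (phi' p)) by apply/funext => p; rewrite cisD.
rewrite /phased E; split=> [|p v Wp]; first exact: smooth_cfun_mul.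
rewrite (diff_cfunM v oW Wp s1 s2) d1// d2//.
have -> : Complex 0 (2 * pi * (A p v + A' p v)) = Complex 0 (2 * pi * A p v) + Complex 0 (2 * pi * A' p v).
  by apply/eqP; rewrite eq_complex /= addr0 mulrDr !eqxx.
rewrite cisD; move: (Complex _ _) (Complex _ _) (cis _) (cis _) => a b c d; ring.
Qed.

Lemma phasedN W phi A : open W -> phased W phi A -> phased W (fun p => - phi p) (fun p v => - A p v).
Proof.
move=> oW [s1 d1].
have E : (fun p => cis (- phi p)) = (fun p => Num.conj (cis (phi p))) by apply/funext => p; rewrite cis_conj.
rewrite /phased E; split=> [|p v Wp]; first exact: smooth_cfun_conj.
rewrite (diff_cfun_conj v oW Wp s1) d1// conjM -cis_conj; congr (_ * _).
by rewrite conjcE /= mulrN.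
Qed.

Lemma phasedB W phi phi' A A' : open W -> phased W phi A -> phased W phi' A' ->
  phased W (fun p => phi p - phi' p) (fun p v => A p v - A' p v).
Proof. by move=> oW h h'; exact: phasedD oW h (phasedN oW h'). Qed.

Lemma eq_phased W phi phi' A A' : open W -> (forall p, W p -> isint (phi p - phi' p)) ->
  (forall p v, W p -> A p v = A' p v) -> phased W phi A -> phased W phi' A'.
Proof.
move=> oW E EA [s1 d1]; have E1 p : W p -> cis (phi p) = cis (phi' p) by move=> Wp; apply: cis_congr; exact: E.
split=> [|p v Wp]; first exact: eq_smooth_cfun oW E1 s1.
by rewrite -(eq_diff_cfun v oW Wp E1) d1// EA// E1.
Qed.

Lemma phased_fun W phi A p v : W p -> phased W phi A ->
  diff_fun (fun q => complex.Re (cis (phi q))) p v = - (2 * pi * A p v) * complex.Im (cis (phi p)) /\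
  diff_fun (fun q => complex.Im (cis (phi q))) p v = 2 * pi * A p v * complex.Re (cis (phi p)).
Proof.
move=> Wp [_ d1]; have := d1 p v Wp; case: (cis (phi p)) => a b; rewrite mul_imaginary => -[-> ->].
by rewrite mulNr.
Qed.

Lemma form_in_chart_diff W (f : M -> R) c y (v : 'M[R]_(1, n)) : open W -> smooth_fun W f -> matlas c -> chart_sub c W y ->
  form_in_chart (fun p (u : 'M[R]_(1, n)) => diff_fun f p u) c y v = 'D_v (f \o cfrom c : 'rV[R]_n -> R^o) y.
Proof.
move=> oW sf ac Uy.
have [Iy Wy] : chart_image c y /\ W (cfrom c y) by move: Uy; rewrite chart_subE.
have sp := smooth_param_sub (chart_sub_open ac oW) _ (smooth_param_cfrom ac).
have {}sp : smooth_param (chart_sub c W) (cfrom c) by apply: sp => z; rewrite chart_subE// => -[].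
have sW z : chart_sub c W z -> W (cfrom c z) by rewrite chart_subE// => -[].
have -> : (fun p (u : 'M[R]_(1, n)) => diff_fun f p u) = ext_d (zero_form (M := M) f).
  by apply/funext => p; apply/funext => u; rewrite ext_d_zero_form.
rewrite form_in_chartE -(dE_pullx sp oW (zero_form_is_form sf) sW v Uy).
by rewrite /dE big_ord1 expr0 mul1r row_id.
Qed.

(** With C and S the real and imaginary parts of [cis \o phi], A is (C dS - S dC) / (2 pi). Symmetry
    of second derivatives leaves a multiple of the wedge of dC and dS in its differential, and this
    vanishes because dC and dS are both multiples of A. *)
Lemma phased_closed W phi A p v : open W -> phased W phi A -> W p -> ext_d A p v = 0.
Proof.
move=> oW hp Wp; have [[sC sS] _] := hp; set c := mchart p; set x := cto c p.
have ac : matlas c := mchart_atlas p.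
have oU := chart_sub_open ac oW.
have Ux : chart_sub c W x by exists p => //; split=> //; exact: mchart_dom.
pose C : 'rV[R]_n -> R^o := fun y => complex.Re (cis (phi (cfrom c y))).
pose S : 'rV[R]_n -> R^o := fun y => complex.Im (cis (phi (cfrom c y))).
have sC' : smooth_on (chart_sub c W) C := sC c ac.
have sS' : smooth_on (chart_sub c W) S := sS c ac.
have CS y : C y * C y + S y * S y = 1.
  by rewrite /C /S /cis /= -!expr2 cos2Dsin2.
pose a y (u : 'M[R]_(1, n)) := form_in_chart A c y u.
have Wy y : chart_sub c W y -> W (cfrom c y) by rewrite chart_subE// => -[].
have DC y (u : 'M[R]_(1, n)) : chart_sub c W y -> 'D_u C y = - (2 * pi * a y u) * S y.
  move=> Uy; rewrite -(form_in_chart_diff u oW sC ac Uy).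
  exact: (phased_fun _ (Wy y Uy) hp).1.
have DS y (u : 'M[R]_(1, n)) : chart_sub c W y -> 'D_u S y = 2 * pi * a y u * C y.
  move=> Uy; rewrite -(form_in_chart_diff u oW sS ac Uy).
  exact: (phased_fun _ (Wy y Uy) hp).2.
pose eta y (u : 'M[R]_(1, n)) : R := C y * 'D_u S y - S y * 'D_u C y.
have pi0 : 2 * pi != 0 :> R by rewrite mulf_neq0// ?pnatr_eq0// gt_eqF// pi_gt0.
have E y (u : 'M[R]_(1, n)) : chart_sub c W y -> a y u = (2 * pi)^-1 * eta y u.
  move=> Uy; apply: (mulfI pi0); rewrite mulrA mulfV// mul1r /eta DC// DS//.
  move: (CS y); move: (C y : R) (S y : R) (a y u) (pi : R) => C0 S0 a0 p0 E1.
  by rewrite -[LHS]mulr1 -E1; ring.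
have DE (v0 v1 : 'M[R]_(1, n)) : 'D_v0 (eta^~ v1 : 'rV[R]_n -> R^o) x =
    'D_v0 C x * 'D_v1 S x + C x * 'D_v0 ('D_v1 S) x - ('D_v0 S x * 'D_v1 C x + S x * 'D_v0 ('D_v1 C) x).
  have dC := smooth_derivable (v := v0) sC' Ux; have dS := smooth_derivable (v := v0) sS' Ux.
  have dC1 := smooth_derivable (v := v0) (smooth_derive v1 sC') Ux.
  have dS1 := smooth_derivable (v := v0) (smooth_derive v1 sS') Ux.
  exact: (derive_wronskian dC dS dC1 dS1).1.
rewrite [LHS](alternating_sum2 (fun i => 'D_(row i v) (fun y => form_in_chart A c y (row' i v) : R^o) x)).
have H (v0 v1 : 'M[R]_(1, n)) : 'D_v0 (fun y => form_in_chart A c y v1 : R^o) x = (2 * pi)^-1 * 'D_v0 (eta^~ v1 : 'rV[R]_n -> R^o) x.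
  rewrite (@eq_derive R _ R^o _ _ (fun y => (2 * pi)^-1 *: (eta y v1 : R^o)) _ _ oU Ux (fun y Uy => E y v1 Uy)).
  have -> : (fun y => (2 * pi)^-1 *: (eta y v1 : R^o)) = (2 * pi)^-1 *: (eta^~ v1 : 'rV[R]_n -> R^o) by [].
  have dC := smooth_derivable (v := v0) sC' Ux; have dS := smooth_derivable (v := v0) sS' Ux.
  have dC1 := smooth_derivable (v := v0) (smooth_derive v1 sC') Ux.
  have dS1 := smooth_derivable (v := v0) (smooth_derive v1 sS') Ux.
  exact: deriveZ (derive_wronskian dC dS dC1 dS1).2.
have r0 : row' 0 v = row 1 v.
  apply/rowP => j; rewrite [LHS]mxE [RHS]mxE; congr (v _ j); exact: val_inj.
have r1 : row' 1 v = row 0 v.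
  apply/rowP => j; rewrite [LHS]mxE [RHS]mxE; congr (v _ j); exact: val_inj.
rewrite r0 r1; set u := row 0 v; set w := row 1 v.
have K v0 v1 := etrans (H v0 v1) (congr1 ( *%R (2 * pi)^-1) (DE v0 v1)).
apply: (etrans (congr2 (fun a b : R => a - b) (K u w) (K w u))).
rewrite (schwarz oU sS' w u Ux).
rewrite (schwarz oU sC' w u Ux).
rewrite (DC x u Ux) (DC x w Ux) (DS x u Ux) (DS x w Ux).
move: ('D_w _ _) ('D_w _ _) (C x : R) (S x : R) (a x u) (a x w) (pi : R) (2^-1 : R) => *; ring.
Qed.

Lemma integrate_zero_form (f : M -> R) (s : singular R M 0) : integrate (zero_form f) s = pt_cochain f s.
Proof.
rewrite /integrate /= /zero_form /sing_coord /pt_cochain; congr (f (s _)).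
apply: val_inj; apply/rowP => j.
have := simplex_point (insubd (vertex 0) (row_mx (1 - \sum_(i < 0) (0 : 'rV[R]_0) 0 i)%:M 0 : 'rV[R]_1)).
have := simplex_point (vertex (R := R) 0); rewrite /simplex /= !big_ord1 !set_valE (ord1 j).
by move=> [_ ->] [_ ->].
Qed.

(** Stokes along the radial segment that joins the centre to the point. *)
Lemma chart_ball_cst (b : chart_ball (M := M)) (f : M -> R) : is_chart_ball b -> smooth_fun (cb_set b) f ->
  (forall p v, cb_set b p -> diff_fun f p v = 0) ->
  forall p, cb_set b p -> f p = f (cfrom (cb_chart b) (cb_center b)).
Proof.
move=> hb sf df p bp; have [cp bp'] := bp; have ac := cb_atlas hb; have oB := cb_open hb.
set c := cb_chart b; set x0 := cb_center b; set y := cto c p.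
have in_b z : hull (segmx x0 y) z -> chart_image c z /\ cb_set b (cfrom c z).
  move=> /hull_segmx[t t01 ->]; have H : cb_coord b (radial b y t) by apply: radial_in.
  by split; [exact: cb_sub hb _ H|exact: (cb_fromP hb H).1].
have ch z : hull (segmx x0 y) z -> {for z, continuous (cfrom c)}.
  by move=> /in_b[cz _]; exact: cfrom_continuous.
have sp := smooth_param_cfrom ac.
have sV : hull (segmx x0 y) `<=` chart_image c by move=> z /in_b[].
have ss := smooth_simplex_asimp sp sV; have sB := image_asimp ch (fun z hz => (in_b z hz).2).
have /eqP := delta_pt f ch; rewrite -{2}/c (cfromK ac cp).
suff -> : delta (pt_cochain f) (asimp (cfrom c) (segmx x0 y)) = 0 by rewrite eq_sym subr_eq0 => /eqP.
transitivity (integrate (ext_d (zero_form f)) (asimp (cfrom c) (segmx x0 y))).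
  rewrite (integrate_stokes oB (zero_form_is_form sf) ss sB).
  by apply: eq_bigr => i _; rewrite integrate_zero_form.
have fz := zero_form_is_form (@smooth_fun_cst R n M (cb_set b) 0).
rewrite (@eq_integrate _ _ _ _ _ (ext_d (zero_form (M := M) (fun=> 0)))) => [|q v /sB bq].
  rewrite (integrate_stokes oB fz ss sB) big1// => i _.
  by rewrite integrate_zero_form /pt_cochain mulr0.
by rewrite !ext_d_zero_form df// /diff_fun; apply: esym; exact: (@derive_cst R _ R^o).
Qed.

Lemma smooth_fun_continuous W f p : open W -> smooth_fun W f -> W p -> {for p, continuous f}.
Proof.
move=> oW sf Wp; have ac := mchart_atlas p; have cp := mchart_dom p; set c := mchart p.
have Ux : chart_sub c W (cto c p) by exists p.
have cf : {for cto c p, continuous (f \o cfrom c : 'rV[R]_n -> R)} := smooth_continuous (sf c ac) Ux.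
have cg : {for p, continuous ((f \o cfrom c) \o cto c)}.
  by apply: continuous_comp => //; exact: cto_continuous.
move: cg; rewrite /prop_for /continuous_at /= (cfromK ac cp); apply: cvg_trans; apply: near_eq_cvg.
have : \forall q \near p, cdom c q by exact: open_nbhs_nbhs (conj (chart_open ac) cp).
by apply: filterS => q cq; rewrite /= cfromK.
Qed.

(** A is closed, hence has a primitive I on a ball. There cis (phi - I) has zero differential, so it
    is constant, and shifting I by a phase of this constant gives a real lift of phi. *)
Lemma phase_potential W phi A p0 : open W -> is_form W A -> phased W phi A -> W p0 ->
  exists (B : set M) (lam : M -> R), [/\ open B, B p0, B `<=` W &
   [/\ forall p, B p -> isint (lam p - phi p),
     forall s, smooth_simplex s -> simage s `<=` B -> integrate A s = delta (pt_cochain lam) s &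
     forall p q, B p -> B q -> `|lam p - lam q| < 8^-1]].
Proof.
move=> oW fA hp Wp0; have [b [hb bp bW]] := chart_ball_exists oW Wp0; have oB := cb_open hb.
have [I sI dI] : exists2 I : M -> R, smooth_fun (cb_set b) I & forall p v, cb_set b p -> ext_d (zero_form I) p v = A p v.
  have [A0 fA0 dA0] := poincare hb (is_form_sub bW fA) (fun q v bq => phased_closed v oW hp (bW q bq)).
  have [I EA0] : exists I, A0 = zero_form I.
    exists (fun p => A0 p 0); apply/funext => p; apply/funext => v.
    by congr (A0 p _); apply/matrixP => i; have := ltn_ord i.
  rewrite EA0 in fA0 dA0; exists I => //; have [_ sA] := fA0; move=> c ac; exact: sA c ac 0.
have stokes s : smooth_simplex s -> simage s `<=` cb_set b -> integrate A s = delta (pt_cochain I) s.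
  move=> ss sb; transitivity (integrate (ext_d (zero_form I)) s).
    by apply: eq_integrate => p v /sb bp'; rewrite dI.
  rewrite (integrate_stokes oB (zero_form_is_form sI) ss sb).
  by apply: eq_bigr => i _; rewrite integrate_zero_form.
have fAb := is_form_sub bW fA.
have hI : phased (cb_set b) I A.
  have hol : holonomic (cb_set b) I A by move=> s ss sb; rewrite stokes// subrr; exact: isint0.
  by split=> [|p v bp']; [exact: holonomic_smooth oB fAb hol|exact: (holonomic_diff oB fAb hol v bp')].
have hz := phasedB oB (phased_sub bW hp) hI.
set x0 := cfrom (cb_chart b) (cb_center b).
have H p : cb_set b p -> isint ((phi p - I p) - (phi x0 - I x0)).
  move=> bp'; apply: cis_eq.
  have [[sC sS] _] := hz.
  have [EC ES] : complex.Re (cis (phi p - I p)) = complex.Re (cis (phi x0 - I x0)) /\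
     complex.Im (cis (phi p - I p)) = complex.Im (cis (phi x0 - I x0)).
    split; [apply: (chart_ball_cst hb sC _ bp') => q v bq; rewrite (phased_fun v bq hz).1
           |apply: (chart_ball_cst hb sS _ bp') => q v bq; rewrite (phased_fun v bq hz).2];
      by rewrite subrr mulr0 ?oppr0 mul0r.
  by apply/eqP; rewrite eq_complex EC ES !eqxx.
have cI := smooth_fun_continuous oB sI bp.
(* Values within 1/16 of I p0 have mutual distance below 1/8. *)
pose P := [set q | `|I p0 - I q| < 16^-1].
have nP : nbhs p0 (cb_set b `&` P).
  apply: filterI; first exact: open_nbhs_nbhs.
  by have := @cvgr_dist_lt _ _ _ _ _ _ _ cI 16^-1; apply; rewrite invr_gt0.
have [B [oB' Bp0] sB] : exists2 B, open_nbhs p0 B & B `<=` cb_set b `&` P by move: nP; rewrite nbhsE.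
exists B, (fun p => I p + (phi x0 - I x0)); split=> //; first by move=> p /sB[/bW].
split.
- move=> p /sB[/H h _]; have -> : I p + (phi x0 - I x0) - phi p = - ((phi p - I p) - (phi x0 - I x0)) by ring.
  exact: isintN.
- move=> s ss sB'; rewrite stokes//; last by move=> q /sB'/sB[].
  rewrite delta_ptD -[LHS]addr0; congr (_ + _).
  by rewrite /coboundary sum2 /pt_cochain expr0 mul1r expr1 mulN1r subrr.
move=> p q /sB[_ Pp] /sB[_ Pq]; rewrite opprD addrACA subrr addr0.
rewrite -(subrKA (I p0)); apply: le_lt_trans (ler_normD _ _) _.
have -> : 8^-1 = 16^-1 + 16^-1 :> R by rewrite -mulr2n -mulr_natr; field.
by apply: ltrD => //; rewrite distrC.
Qed.

End Phases.

(** * Refinement of open covers *)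

Section Refinement.
Context {R : realType} {n : nat} {N : manifold R n}.

Lemma finite_open_nbhs (k : nat) (p : N) (Q : nat -> set N -> Prop) :
  (forall m (W W' : set N), W' `<=` W -> Q m W -> Q m W') ->
  (forall m, (m < k)%N -> exists W, [/\ open W, W p & Q m W]) ->
  exists W, [/\ open W, W p & forall m, (m < k)%N -> Q m W].
Proof.
move=> mono; elim: k => [|k IH] H; first by exists setT; split=> //; exact: openT.
have [W [oW Wp QW]] := IH (fun m mk => H m (ltnW mk)); have [W' [oW' Wp' QW']] := H k (ltnSn k).
exists (W `&` W'); split; [exact: openI|by []|move=> m].
rewrite ltnS leq_eqVlt => /orP[/eqP->|mk]; first exact: mono QW'.
by apply: (mono _ W); [exact: subIsetl|exact: QW].
Qed.

(** The smallest sets O' will cover, the sets O will define ranks, and the complements of D' and D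
    will supply open sets that avoid unwanted members. The closed sets are compact balls of a chart,
    closed in the manifold by the Hausdorff property. *)
Lemma shrunk_nbhs (W : set N) (p : N) : open W -> W p ->
  exists O' D' O D : set N, [/\ open O', O' p, O' `<=` D' & closed D'] /\ [/\ D' `<=` O, open O, O `<=` D, closed D & D `<=` W].
Proof.
move=> oW Wp; have [b [hb bp bW]] := chart_ball_exists oW Wp; have ac := cb_atlas hb; set c := cb_chart b in ac *.
have r0 := cb_pos hb.
have [cp pr] := bp; set r := cb_radius b in r0 pr *.
pose d q := `|cb_center b - cto c q|.
pose O (rho : R) := cdom c `&` [set q | d q < rho]; pose D (rho : R) := cdom c `&` [set q | d q <= rho].
have oO rho : open (O rho).
  have -> : O rho = cdom c `&` cto c @^-1` [set y | `|cb_center b - y| < rho] by [].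
  apply: open_preim_at; [exact: chart_open|by move=> q; exact: cto_continuous|exact: open_coord_ball].
have cD (rho : R) : 0 <= rho -> rho < r -> closed (D rho).
  move=> rho0 rr; apply: compact_closed; first exact: m_hausdorff.
  have -> : D rho = cfrom c @` [set y | `|cb_center b - y| <= rho].
    apply/seteqP; split=> [q [cq dq]|_ [y /= dy <-]]; first by exists (cto c q) => //; rewrite cfromK.
    have [cy Ey] := chart_imageP ac (cb_sub hb (le_lt_trans dy rr)).
    by split=> //; rewrite /= /d Ey.
  apply: continuous_compact.
    apply: continuous_in_subspaceT => y; rewrite inE /= => dy; apply: cfrom_continuous => //.
    by apply: (cb_sub hb); exact: le_lt_trans dy rr.
  apply: bounded_closed_compact.
    exists (`|cb_center b| + rho); split=> [|x bx y /= dy]; first by rewrite num_real.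
    apply: le_trans _ (ltW bx); rewrite -[y](subKr (cb_center b)).
    by apply: le_trans (ler_normB _ _) _; rewrite lerD2l.
  rewrite -[X in closed X]setCK; apply: open_closedC; rewrite openE => y /= /negP; rewrite -ltNge => dy.
  apply/nbhs_ballP; exists (`|cb_center b - y| - rho) => /=; first by rewrite subr_gt0.
  move=> z; rewrite -ball_normE /= => yz; apply/negP; rewrite -ltNge.
  have := ler_normD (cb_center b - z) (z - y); rewrite subrKA [`|z - y|]distrC => h.
  by rewrite ltrBrDr in yz; rewrite -(ltrD2r `|y - z|) addrC; exact: lt_le_trans yz h.
have dp : d p < r by [].
have d0 : 0 <= d p by exact: normr_ge0.
(* Two radii that cut the interval from d p to r into thirds. *)
pose s1 := (2 * d p + r) / 3; pose s2 := (d p + 2 * r) / 3.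
have h1 : d p < s1 by rewrite /s1; lra.
have h2 : s1 < s2 by rewrite /s1 /s2; lra.
have h3 : s2 < r by rewrite /s2; lra.
exists (O s1), (D s1), (O s2), (D s2); split; split=> //.
- by move=> q [cq]; split=> //; exact: ltW.
- by apply: cD; [exact: le_trans d0 (ltW h1)|exact: lt_trans h3].
- by move=> q [cq dq]; split=> //; exact: le_lt_trans dq h2.
- by move=> q [cq]; split=> //; exact: ltW.
- by apply: cD => //; exact: le_trans d0 (ltW (lt_trans h1 h2)).
by move=> q [cq dq]; apply: bW; split=> //; exact: le_lt_trans dq h3.
Qed.

Section Cover.
Variables (J : Type) (V : J -> set N) (P : J -> J -> J -> set N -> Prop).
Hypotheses (oV : forall j, open (V j)) (cV : forall p, exists j, V j p).
Hypothesis mono : forall i j k (W W' : set N), W' `<=` W -> P i j k W -> P i j k W'.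
Hypothesis loc : forall i j k p, V i p -> V j p -> V k p -> exists W, [/\ open W, W p & P i j k W].

(* If p lies in D' c, the sets B q meeting B p have rank at most that of c; hence B p has only finitely many local
   conditions to satisfy. *)
Lemma refined_cover : exists (a : N -> J) (B : N -> set N),
  (forall p, [/\ open (B p), B p p & B p `<=` V (a p)]) /\
  forall p q r, B p `&` B q !=set0 -> B p `&` B r !=set0 -> P (a p) (a q) (a r) (B p).
Proof.
have /choice[aj Haj] := cV.
have /choice[ O' /choice[D' /choice[ O /choice[D HF]]]] := fun c => shrunk_nbhs (oV (aj c)) (Haj c).
(* Second countability gives countably many centres whose sets O' cover: each basic open set
   contained in some O' contributes one centre, placed at the number of that basic set. *)
have [s Hs] : exists s : nat -> option N, forall x, exists m c, s m = Some c /\ O' c x.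
  have [BB cB bB] := @m_second_countable _ _ N.
  have [g gi] := countable_injP _ cB.
  exists (fun m => if pselect (exists c U, [/\ BB U, g U = m & U `<=` O' c]) is left h then Some (projT1 (cid h)) else None).
  move=> x; have [[oO xO _ _] _] := HF x.
  have [U [BU xU] UO] : exists2 U, BB U /\ U x & U `<=` O' x.
    have [_ /(_ x)] := bB => /(_ (O' x)) []; first exact: open_nbhs_nbhs.
    by move=> U [BU xU] UO; exists U.
  exists (g U); case: pselect => [h|[]]; last by exists x, U.
  exists (projT1 (cid h)); split=> //; have [U' [BU' EU UO']] := projT2 (cid h).
  by apply: UO'; rewrite (gi U' U) ?inE.
(* The rank of p is the first place in the enumeration whose set O contains p; the member of V
   attached to p is that of the centre found there. *)
have /choice[rk Hrk] : forall p, exists t : nat * N, [/\ s t.1 = Some t.2, O t.2 p &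
    forall m c, (m < t.1)%N -> s m = Some c -> ~ O c p].
  move=> p; have ex : exists m, `[< exists2 c, s m = Some c & O c p >].
    have [m [c [sm Oc]]] := Hs p; exists m; apply/asboolP; exists c => //.
    by have [[_ _ h1 _] [h2 _ _ _ _]] := HF c; apply: h2; apply: h1.
  case: (ex_minnP ex) => m /asboolP[c sm Oc] min; exists (m, c); split=> //= m' c' lt sm' Oc'.
  have /min : `[< exists2 c : N, s m' = Some c & O c p >] by apply/asboolP; exists c'.
  by rewrite leqNgt lt.
pose a p := aj (rk p).2.
(* B p lies in some O' of place mp and in the O that defines the rank of p, avoids D' at all smaller
   places, and for each two places up to mp either misses one of the two sets O or satisfies P. *)
have /choice[B HB] : forall p, exists W, [/\ open W, W p & exists mp,
   [/\ exists c, s mp = Some c /\ W `<=` O' c, W `<=` O (rk p).2,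
     forall m c, (m < (rk p).1)%N -> s m = Some c -> forall x, W x -> ~ D' c x &
     forall l l', (l < mp.+1)%N -> (l' < mp.+1)%N -> forall c c', s l = Some c -> s l' = Some c' ->
       [\/ W `&` O c = set0, W `&` O c' = set0 | P (a p) (aj c) (aj c') W]]].
  move=> p; have [mp [cp [smp Op]]] := Hs p; have [sr Or rmin] := Hrk p.
  have [W1 [oW1 W1p H1]] : exists W, [/\ open W, W p & forall m, (m < (rk p).1)%N ->
      forall c, s m = Some c -> forall x, W x -> ~ D' c x].
    apply: finite_open_nbhs => [m W W' sW h c sm x /sW|m mr]; first exact: h.
    case sm: (s m) => [c|]; last by exists setT; split=> //; exact: openT.
    have [[_ _ _ cD] [DO _ _ _ _]] := HF c.
    exists (~` D' c); split; [exact: closed_openC|by move=> /DO; exact: rmin sm|by move=> c' [<-]].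
  have [W2 [oW2 W2p H2]] : exists W, [/\ open W, W p & forall l, (l < mp.+1)%N -> forall l', (l' < mp.+1)%N ->
      forall c c', s l = Some c -> s l' = Some c' ->
      [\/ W `&` O c = set0, W `&` O c' = set0 | P (a p) (aj c) (aj c') W]].
    have sub0 (W W' : set N) c : W' `<=` W -> W `&` O c = set0 -> W' `&` O c = set0.
      by move=> sW e; apply/seteqP; split=> // x [/sW Wx Ox]; rewrite -e.
    apply: finite_open_nbhs => [l W W' sW h l' lt c c' sl sl'|l _].
      by case: (h l' lt c c' sl sl') => h'; [apply: Or31; exact: sub0 h'|apply: Or32; exact: sub0 h'|apply: Or33; exact: mono h'].
    apply: finite_open_nbhs => [l' W W' sW h c c' sl sl'|l' _].
      by case: (h c c' sl sl') => h'; [apply: Or31; exact: sub0 h'|apply: Or32; exact: sub0 h'|apply: Or33; exact: mono h'].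
    case sl: (s l) => [c|]; last by exists setT; split=> //; exact: openT.
    case sl': (s l') => [c'|]; last by exists setT; split=> //; exact: openT.
    have far e : ~ D e p -> exists W, [/\ open W, W p & W `&` O e = set0].
      have [_ [_ _ OD cD _]] := HF e; exists (~` D e); split=> //; first exact: closed_openC.
      by apply/seteqP; split=> // x [h /OD].
    have near_ e : D e p -> V (aj e) p by have [_ [_ _ _ _ DV]] := HF e; exact: DV.
    have Vap : V (a p) p by apply: near_; have [_ [_ _ OD _ _]] := HF (rk p).2; exact: OD.
    case: (pselect (D c p)) => [/near_ Vc|/far[W [oW Wp W0]]]; last first.
      by exists W; split=> // d d' [<-] _; exact: Or31.
    case: (pselect (D c' p)) => [/near_ Vc'|/far[W [oW Wp W0]]]; last first.
      by exists W; split=> // d d' _ [<-]; exact: Or32.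
    have [W [oW Wp PW]] := loc Vap Vc Vc'.
    by exists W; split=> // d d' [<-] [<-]; exact: Or33.
  have [[oO' _ _ _] _] := HF cp; have [_ [_ oO _ _ _]] := HF (rk p).2.
  exists (W1 `&` W2 `&` (O' cp `&` O (rk p).2)); split.
  - by apply: openI; apply: openI.
  - by [].
  exists mp; split.
  - by exists cp; split=> // x [_ []].
  - by move=> x [_ []].
  - by move=> m c lt sm x [[/(H1 m lt c sm)]].
  move=> l l' lt lt' c c' sl sl'.
  have sW : W1 `&` W2 `&` (O' cp `&` O (rk p).2) `<=` W2 by move=> x [[]].
  case: (H2 l lt l' lt' c c' sl sl') => h.
  - by apply: Or31; apply/seteqP; split=> // x [/sW Wx Ox]; rewrite -h.
  - by apply: Or32; apply/seteqP; split=> // x [/sW Wx Ox]; rewrite -h.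
  - by apply: Or33; exact: mono h.
exists a, B; split=> [p|p q r].
  have [oB Bp [mp [_ BO _ _]]] := HB p; split=> //.
  by have [_ [_ _ h1 _ h2]] := HF (rk p).2; move=> x /BO/h1/h2.
have key p' q' : B p' `&` B q' !=set0 -> forall mp, (exists c, s mp = Some c /\ B p' `<=` O' c) ->
    ((rk q').1 < mp.+1)%N /\ B p' `&` O (rk q').2 <> set0.
  move=> [x [xp xq]] mp [c [sm Bc]]; have [_ _ [mq [_ BO Bm _]]] := HB q'; split.
    rewrite ltnS leqNgt; apply/negP => lt; apply: (Bm _ _ lt sm _ xq).
    by have [[_ _ h _] _] := HF c; apply: h; apply: Bc.
  by apply/eqP/set0P; exists x; split=> //; apply: BO.
move=> pq pr; have [oB Bp [mp [h1 _ _ h2]]] := HB p.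
have [lq nq] := key _ _ pq mp h1; have [lr nr] := key _ _ pr mp h1.
have [sq _ _] := Hrk q; have [sr _ _] := Hrk r.
by have [/nq|/nr|] := h2 _ _ lq lr _ _ sq sr.
Qed.
End Cover.
End Refinement.

(** * Frames, potentials and phases of a given line bundle *)

Section LineBundleFrames.
Context {R : realType} {n : nat} {M : manifold R n}.

Section Bundle.
Context (U : set M) (L : line_bundle M).
Hypothesis hL : is_line_bundle U L.

Lemma unit_neq0 p (u : fib L p) : U p -> unit_vector u -> u != 0.
Proof.
move=> Up; apply: contra_eq_neq => ->.
have := lb_linear hL Up 0 0 0 (0 : fib L p); rewrite scale0r addr0 mul0r add0r /unit_vector => _.
have := lb_linear hL Up (-1) 0 0 (0 : fib L p); rewrite scaler0 addr0 mulN1r addNr => ->.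
by rewrite eq_sym oner_neq0.
Qed.

Lemma line_colinear p (u v : fib L p) : U p -> u != 0 -> exists z, v = z *: u.
Proof.
move=> Up u0; have d1 := lb_line hL Up.
have /eqP E : (<[u]> == fullv)%VS by rewrite eqEdim subvf d1 dim_vline u0.
by have /vlineP : (v \in <[u]>)%VS by rewrite E memvf.
Qed.

Lemma hermZl p (z : R[i]) (u w : fib L p) : U p -> herm (z *: u) w = z * herm u w.
Proof.
move=> Up; have h0 : herm 0 w = 0.
  by have := lb_linear hL Up (-1) 0 0 w; rewrite scaler0 addr0 mulN1r addNr.
by rewrite -[z *: u]addr0 (lb_linear hL Up) h0 addr0.
Qed.

Lemma unit_scale p (u v : fib L p) : U p -> unit_vector u -> unit_vector v ->
  exists z, `|z| = 1 /\ v = z *: u.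
Proof.
move=> Up hu hv; have [z E] := line_colinear v Up (unit_neq0 Up hu); exists z; split=> //.
have : herm v v = 1 by []. 
rewrite {1}E hermZl// (lb_conj hL Up) E hermZl// conjM -(lb_conj hL Up) hu mulr1 => /norm_unit.
exact.
Qed.

Lemma scale_unit p (u : fib L p) (z : R[i]) : U p -> unit_vector u -> `|z| = 1 -> unit_vector (z *: u).
Proof.
move=> Up hu z1; rewrite /unit_vector hermZl// (lb_conj hL Up) hermZl// conjM -(lb_conj hL Up) hu mulr1.
by rewrite -normCK z1 expr1n.
Qed.

Lemma frame_open (a : frame_idx L) : open (frame_dom a). Proof. by have [] := lb_dom hL a. Qed.
Lemma frame_sub (a : frame_idx L) : frame_dom a `<=` U. Proof. by have [] := lb_dom hL a. Qed.

Lemma smooth_frame (a : frame_idx L) : smooth_section (frame_dom a) (frame a).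
Proof. by move=> b; have := lb_smooth hL b a; rewrite setIC. Qed.

Variable D : connection L.
Hypothesis hD : is_connection U D.

Lemma potential_is_form (a : frame_idx L) : is_form (frame_dom a) (conn_potential D a).
Proof.
have [_ fI] := conn_form hD (frame_open a) (frame_sub (a := a)) (smooth_frame a) a.
rewrite setIid in fI; have := is_form_scale (frame_open a) (smooth_fun_cst (2 * pi)^-1) fI.
by apply: eq_is_form (frame_open a) _ => p v _; rewrite mulrC.
Qed.

(** The fibre is a line, so the derivative of the frame is a multiple of it; compatibility with the
    metric makes the factor purely imaginary. *)
Lemma connection_frame (a : frame_idx L) p v : frame_dom a p ->
  D (frame a) p v = Complex 0 (2 * pi * conn_potential D a p v) *: frame a p.
Proof.
move=> ap; have Up := frame_sub ap; have ua := lb_unitary hL ap.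
have [z E] := line_colinear (D (frame a) p v) Up (unit_neq0 Up ua).
have zE : herm (D (frame a) p v) (frame a p) = z by rewrite E hermZl// [herm _ _]ua mulr1.
have := conn_metric hD (frame_open a) (frame_sub (a := a)) (smooth_frame a) (smooth_frame a) v ap.
rewrite (lb_conj hL Up (frame a p)) zE (eq_diff_cfun (k := fun=> 1) v (frame_open a) ap (fun q aq => lb_unitary hL aq)).
rewrite diff_cfun_cst conjcE [_ + _]complexD /= subrr => -[/esym/eqP].
rewrite -mulr2n mulrn_eq0 /= => /eqP z0.
rewrite E /conn_potential zE; congr (_ *: _); apply/eqP; rewrite eq_complex /= z0 eqxx /=.
by rewrite mulrC divfK// mulf_neq0// ?pnatr_eq0// gt_eqF// pi_gt0.
Qed.

Lemma connection_change (a b : frame_idx L) (z : M -> R[i]) p v : smooth_cfun (frame_dom a `&` frame_dom b) z ->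
  (forall q, frame_dom a q -> frame_dom b q -> frame a q = z q *: frame b q) -> frame_dom a p -> frame_dom b p ->
  D (frame a) p v = diff_cfun z p v *: frame b p + z p *: D (frame b) p v.
Proof.
move=> sz E ap bp; have oW := openI (frame_open a) (frame_open b).
have WU : frame_dom a `&` frame_dom b `<=` U by move=> q [/frame_sub].
have Wp : (frame_dom a `&` frame_dom b) p by [].
have sa : smooth_section (frame_dom a `&` frame_dom b) (frame a).
  by move=> c; apply: sub_smooth_cfun (smooth_frame a c) => q [[]].
have sb : smooth_section (frame_dom a `&` frame_dom b) (frame b).
  by move=> c; apply: sub_smooth_cfun (smooth_frame b c) => q [[]].
have E' q : (frame_dom a `&` frame_dom b) q -> frame a q = z q *: frame b q by move=> [aq bq]; exact: E.
have szb : smooth_section (frame_dom a `&` frame_dom b) (fun q => z q *: frame b q).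
  move=> c; have oW' := openI oW (frame_open c).
  by apply: (eq_smooth_cfun oW' _ (sa c)) => q [Wq _]; rewrite E'.
rewrite (conn_local hD oW WU sa szb E' v Wp).
exact: (conn_leibniz hD oW WU sb sz v Wp).
Qed.

Section Phase.
Variable u : forall p, fib L p.
Hypothesis hu : forall p, U p -> unit_vector (u p).

(* an arbitrary choice, in general discontinuous *)
Definition frame_phase (a : frame_idx L) (p : M) : R :=
  if pselect (exists r, frame a p = cis r *: u p) is left h then projT1 (cid h) else 0.

Lemma frame_phaseE a p : frame_dom a p -> frame a p = cis (frame_phase a p) *: u p.
Proof.
move=> ap; have Up := frame_sub ap; rewrite /frame_phase; case: pselect => [h|[]]; first exact: projT2 (cid h).
have [z [z1 ->]] := unit_scale Up (hu Up) (lb_unitary hL ap).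
by have [r <-] := cis_surj z1; exists r.
Qed.

(** The reference vectors u cancel in the difference of two phases, which is thus a phase of the
    smooth transition function; the Leibniz rule gives its logarithmic differential. *)
Lemma frame_change_phased (a b : frame_idx L) : phased (frame_dom a `&` frame_dom b)
  (fun p => frame_phase a p - frame_phase b p) (fun p v => conn_potential D a p v - conn_potential D b p v).
Proof.
have oW := openI (frame_open a) (frame_open b).
have E p : frame_dom a p -> frame_dom b p -> frame a p = cis (frame_phase a p - frame_phase b p) *: frame b p.
  by move=> ap bp; rewrite !frame_phaseE// scalerA -cisD subrK.
have EH p : (frame_dom b `&` frame_dom a) p -> herm (frame a p) (frame b p) = cis (frame_phase a p - frame_phase b p).
  move=> [bp ap]; have Up := frame_sub ap; rewrite E// hermZl//.
  by have := lb_unitary hL bp; rewrite /unit_vector => ->; rewrite mulr1.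
have sz : smooth_cfun (frame_dom a `&` frame_dom b) (fun p => cis (frame_phase a p - frame_phase b p)).
  by rewrite setIC in oW *; exact: eq_smooth_cfun oW EH (lb_smooth hL b a).
split=> // p v [ap bp]; have := connection_change v sz E ap bp.
rewrite !connection_frame// {1}E// !scalerA -scalerDl => H.
have /(congr1 (fun x => herm x (frame b p))) := H; rewrite !hermZl//; try exact: frame_sub ap.
have := lb_unitary hL bp; rewrite /unit_vector => ->; rewrite !mulr1.
have -> : Complex 0 (2 * pi * (conn_potential D a p v - conn_potential D b p v)) =
    Complex 0 (2 * pi * conn_potential D a p v) - Complex 0 (2 * pi * conn_potential D b p v).
  by apply/eqP; rewrite eq_complex /= subrr mulrBr !eqxx.
have alg (x y c d : R[i]) : x * c = d + c * y -> d = (x - y) * c by move=> h; rewrite mulrBl h; ring.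
exact: alg.
Qed.

(** [curv] uses a frame picked at p; its potential differs from that of a by a closed form, by
    [frame_change_phased] and [phased_closed]. *)
Lemma curv_potential (a : frame_idx L) p v : frame_dom a p -> curv D p v = ext_d (conn_potential D a) p v.
Proof.
move=> ap; have Up := frame_sub ap; rewrite /curv /frame_at; case: pselect => [h|[]]; last by exists a.
set b := projT1 (cid h); have bp : frame_dom b p := projT2 (cid h).
have oW := openI (frame_open b) (frame_open a).
have fb : is_form (frame_dom b `&` frame_dom a) (conn_potential D b) := is_form_sub (@subIsetl _ _ _) (potential_is_form b).
have fa : is_form (frame_dom b `&` frame_dom a) (conn_potential D a) := is_form_sub (@subIsetr _ _ _) (potential_is_form a).
have Wp : (frame_dom b `&` frame_dom a) p by [].
apply/eqP; rewrite -subr_eq0 -(ext_dB v oW fb fa Wp); apply/eqP.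
exact: (phased_closed v oW (frame_change_phased b a) Wp).
Qed.

End Phase.
End Bundle.

Lemma smooth_cfun_pull m (M' : manifold R m) (Phi : smooth_map M' M) (W : set M) (f : M -> R[i]) : open W ->
  smooth_cfun W f -> smooth_cfun (Phi @^-1` W) (f \o Phi) /\
  forall p v, W (Phi p) -> diff_cfun (f \o Phi) p v = diff_cfun f (Phi p) (tangent_map Phi p v).
Proof.
move=> oW; have H (g : M -> R) : smooth_fun W g -> smooth_fun (Phi @^-1` W) (g \o Phi) /\
    forall p v, W (Phi p) -> diff_fun (g \o Phi) p v = diff_fun g (Phi p) (tangent_map Phi p v).
  move=> sg; have fg := zero_form_is_form sg; split=> [c ac|p v Wp].
    by have [_ s] := pull_form_is_form Phi oW fg; exact: s c ac 0.
  rewrite -ext_d_zero_form -[RHS]ext_d_zero_form (pull_row Phi) -(ext_d_pull_form oW fg _ Wp).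
  by congr (ext_d _ p v).
by move=> [/H[s1 d1] /H[s2 d2]]; split=> // p v Wp; rewrite /diff_cfun -d1// -d2.
Qed.

End LineBundleFrames.

Section PullbackFrames.
Context {R : realType} {m n : nat} {M : manifold R m} {N : manifold R n} (Phi : smooth_map M N).

Lemma phased_pull (W : set N) phi (A : diff_form N 1) : open W -> phased W phi A ->
  phased (Phi @^-1` W) (phi \o Phi) (pull_form Phi A).
Proof.
move=> oW [sc d]; have [sc' d'] := smooth_cfun_pull Phi oW sc; split=> // p v Wp.
by rewrite [LHS]d'// d// pull_row.
Qed.

Lemma pull_connection_frame (U : set N) (L : line_bundle N) (D : connection L) (a : frame_idx L) p v :
  is_line_bundle U L -> is_connection U D -> frame_dom a (Phi p) ->
  conn_potential (pull_connection Phi D) a p v = pull_form Phi (conn_potential D a) p v.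
Proof.
move=> hL hD ap; rewrite /conn_potential -[in RHS]pull_row /=.
suff -> : pull_connection Phi D (frame (l := pull_bundle Phi L) a) p v = D (frame a) (Phi p) (tangent_map Phi p v) by [].
rewrite /pull_connection /frame_at; case: pselect => [h|[]]; last by exists a.
set b := projT1 (cid h); have bp : frame_dom b (Phi p) := projT2 (cid h).
pose z q := herm (frame a q) (frame b q).
have E q : frame_dom a q -> frame_dom b q -> frame a q = z q *: frame b q.
  move=> aq bq; have Uq := frame_sub hL aq; have ub := lb_unitary hL bq.
  have [c Ec] := line_colinear hL (frame a q) Uq (unit_neq0 hL Uq ub).
  by rewrite /z Ec (hermZl hL)//; move: ub; rewrite /unit_vector => ->; rewrite mulr1.
have oW := openI (frame_open hL a) (frame_open hL b).
have sz : smooth_cfun (frame_dom a `&` frame_dom b) z.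
  by have := lb_smooth hL b a; rewrite setIC.
rewrite (connection_change hL hD (tangent_map Phi p v) sz E ap bp).
have [_ d] := smooth_cfun_pull Phi oW sz.
by rewrite -d.
Qed.

End PullbackFrames.

Section ParallelSections.
Context {R : realType} {n : nat} {M : manifold R n}.

(** Where the unit vectors make t equal to 1, the component of t in the frames is
    [cis (- (q1 - q2 + q3))]; parallelism is then the differential equation of this phase. *)
Lemma parallel_phased (W0 W : set M) (L1 L2 L3 : line_bundle M) (D1 : connection L1) (D2 : connection L2)
    (D3 : connection L3) (t : tensor_section L1 L2 L3) (a : frame_idx L1) (b : frame_idx L2) (c : frame_idx L3)
    (q1 q2 q3 : M -> R) (u1 : forall p, fib L1 p) (u2 : forall p, fib L2 p) (u3 : forall p, fib L3 p) :
  open W -> W `<=` W0 `&` frame_dom a `&` frame_dom b `&` frame_dom c ->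
  unitary_section W0 t -> parallel W0 D1 D2 D3 t ->
  (forall p, W p -> unit_vector (u1 p) /\ frame a p = cis (q1 p) *: u1 p) ->
  (forall p, W p -> unit_vector (u2 p) /\ frame b p = cis (q2 p) *: u2 p) ->
  (forall p, W p -> unit_vector (u3 p) /\ frame c p = cis (q3 p) *: u3 p) ->
  (forall p, W p -> t p (u1 p) (u2 p) (u3 p) = 1) ->
  phased W (fun p => q1 p - q2 p + q3 p)
    (fun p v => conn_potential D1 a p v - conn_potential D2 b p v + conn_potential D3 c p v).
Proof.
move=> oW sW ut pt h1 h2 h3 t1.
have E p : W p -> frame_component t a b c p = cis (- (q1 p - q2 p + q3 p)).
  move=> Wp; have [[[W0p _] _] _] := sW p Wp; have [hu1 e1] := h1 p Wp; have [hu2 e2] := h2 p Wp.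
  have [hu3 e3] := h3 p Wp; rewrite /frame_component e1 e2 e3.
  rewrite (us_tensor ut W0p (norm_cis _) (norm_cis _) (norm_cis _) hu1 hu2 hu3) t1// mulr1.
  by rewrite !cisV -!cisD; congr cis; ring.
have sE := eq_smooth_cfun oW E (sub_smooth_cfun sW (us_smooth ut a b c)).
have hN : phased W (fun p => - (q1 p - q2 p + q3 p))
    (fun p v => - (conn_potential D1 a p v - conn_potential D2 b p v + conn_potential D3 c p v)).
  split=> // p v Wp; have [[[W0p ap] bp] cp] := sW p Wp.
  have := pt a b c p v W0p ap bp cp; rewrite (eq_diff_cfun v oW Wp E) E// => /eqP.
  rewrite addr_eq0 => /eqP ->; rewrite -mulNr; congr (_ * _).
  by apply/eqP; rewrite eq_complex /= mulrN oppr0 !eqxx.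
apply: eq_phased oW _ _ (phasedN oW hN) => [p _|p v _]; last by rewrite opprK.
by rewrite opprK subrr; exact: isint0.
Qed.

End ParallelSections.

(** * Pointwise trivialisation and Cech data *)

Section GerbeTrivialization.
Context {R : realType} {n : nat} {N : manifold R n} (G : gerbe_data N) (hG : is_gerbe G).

Lemma unit_vector_exists (U : set N) (L : line_bundle N) p : is_line_bundle U L -> U p -> exists u : fib L p, unit_vector u.
Proof. by move=> hL Up; have [a ap] := lb_cover hL Up; exists (frame a p); exact: (lb_unitary hL ap). Qed.

Definition gerbe_trivial (u : forall (j k : g_idx G) p, fib (g_line j k) p) :=
  (forall j k p, g_cover j p -> g_cover k p -> unit_vector (u j k p)) /\
  forall i j k p, g_cover i p -> g_cover j p -> g_cover k p -> g_theta G i j k p (u j k p) (u i k p) (u i j p) = 1.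

(** Over a single point a gerbe is trivial: fix an index z p and rescale the unit vector of L_jk by
    theta for the indices z p, j, k. The cocycle condition for z p, i, j, k then gives theta_ijk =
    1. The choice of z p may be discontinuous. *)
Lemma gerbe_trivialization : exists u, gerbe_trivial u.
Proof.
have [_ cV] := gerbe_cover hG; have /choice[z Hz] := cV.
pose w j k p : fib (g_line (g := G) j k) p :=
  if pselect (exists u : fib (g_line j k) p, unit_vector u) is left h then projT1 (cid h) else 0.
have hw j k p : g_cover j p -> g_cover k p -> unit_vector (w j k p).
  move=> Vj Vk; rewrite /w; case: pselect => [h|[]]; first exact: projT2 (cid h).
  exact: unit_vector_exists (gerbe_line hG j k) (conj Vj Vk).
pose th j k p := g_theta G (z p) j k p (w j k p) (w (z p) k p) (w (z p) j p).
pose u j k p : fib (g_line (g := G) j k) p := th j k p *: w j k p.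
have th1 j k p : g_cover j p -> g_cover k p -> `|th j k p| = 1.
  by move=> Vj Vk; apply: (us_unitary (gerbe_theta hG (z p) j k)); [split; [split|]|exact: hw..].
have hu j k p : g_cover j p -> g_cover k p -> unit_vector (u j k p).
  by move=> Vj Vk; apply: (scale_unit (gerbe_line hG j k)) => //; [exact: hw|exact: th1].
have base j k p : g_cover j p -> g_cover k p -> g_theta G (z p) j k p (u j k p) (w (z p) k p) (w (z p) j p) = 1.
  move=> Vj Vk; have Vz := Hz p.
  rewrite -[w (z p) k p]scale1r -[w (z p) j p]scale1r.
  rewrite (us_tensor (gerbe_theta hG (z p) j k) _ (th1 _ _ _ Vj Vk) (normr1 _) (normr1 _))//; [|exact: hw..].
  by rewrite invr1 !mulr1 mulVf// -normr_eq0 th1// oner_neq0.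
exists u; split=> // i j k p Vi Vj Vk; have Vz := Hz p.
have := gerbe_cocycle hG Vz Vi Vj Vk (hw _ _ _ Vz Vi) (hw _ _ _ Vz Vj) (hw _ _ _ Vz Vk)
  (hu _ _ _ Vi Vj) (hu _ _ _ Vi Vk) (hu _ _ _ Vj Vk).
by rewrite !base// invr1 !mulr1.
Qed.

End GerbeTrivialization.

Section QuasiTrivialization.
Context {R : realType} {m n : nat} {M : manifold R m} {N : manifold R n} (Phi : smooth_map M N) (X : relative_gerbe Phi).
Local Notation G := (rg_gerbe X).
Local Notation r := (@rg_ref _ _ _ _ _ _ X).
Variable u : forall (j k : g_idx G) p, fib (g_line j k) p.
Hypothesis hu : gerbe_trivial u.

Let hQ := rg_is_quasi X.
Let PG := pull_gerbe Phi (@rg_cover _ _ _ _ _ _ X) r.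

(** Rescale by psi from an index fixed at each point; [quasi_delta] takes the place of the cocycle
    condition. *)
Lemma quasi_trivialization : exists e : forall (i : rg_idx X) p, fib (q_line (rg_quasi X) i) p,
  (forall i p, rg_cover i p -> unit_vector (e i p)) /\
  forall i j p, rg_cover i p -> rg_cover j p -> q_psi (rg_quasi X) i j p (e i p) (e j p) (u (r i) (r j) (Phi p)) = 1.
Proof.
have [_ cU] := rg_is_cover X; have /choice[z Hz] := cU.
pose w (i : rg_idx X) p : fib (q_line (rg_quasi X) i) p :=
  if pselect (exists u : fib (q_line (rg_quasi X) i) p, unit_vector u) is left h then projT1 (cid h) else 0.
have hw i p : rg_cover i p -> unit_vector (w i p).
  move=> Ui; rewrite /w; case: pselect => [h|[]]; first exact: projT2 (cid h).
  exact: unit_vector_exists (quasi_line hQ i) Ui.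
have rV i p : rg_cover i p -> g_cover (r i) (Phi p) by move=> Ui; apply: (rg_refines (i := i)); exists p.
have hu' i j p : rg_cover i p -> rg_cover j p -> unit_vector (L := g_line (g := PG) i j) (p := p) (u (r i) (r j) (Phi p)).
  by move=> Ui Uj; apply: hu.1; exact: rV.
pose ps i p := q_psi (rg_quasi X) (z p) i p (w (z p) p) (w i p) (u (r (z p)) (r i) (Phi p)).
have ps1 i p : rg_cover i p -> `|ps i p| = 1.
  move=> Ui; exact: (us_unitary (quasi_psi hQ (z p) i) (conj (Hz p) Ui) (hw _ _ (Hz p)) (hw _ _ Ui) (hu' _ _ _ (Hz p) Ui)).
pose e i p := (ps i p)^-1 *: w i p.
have ps1' i p : rg_cover i p -> `|(ps i p)^-1| = 1 by move=> Ui; rewrite normfV ps1// invr1.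
have he i p : rg_cover i p -> unit_vector (e i p).
  by move=> Ui; apply: (scale_unit (quasi_line hQ i)) => //; [exact: hw|exact: ps1'].
have base i p : rg_cover i p -> q_psi (rg_quasi X) (z p) i p (w (z p) p) (e i p) (u (r (z p)) (r i) (Phi p)) = 1.
  move=> Ui; have Uz := Hz p; have := us_tensor (quasi_psi hQ (z p) i) (conj Uz Ui) (normr1 _) (ps1' _ _ Ui) (normr1 _)
    (hw _ _ Uz) (hw _ _ Ui) (hu' _ _ _ Uz Ui).
  by rewrite !scale1r => ->; rewrite invr1 mul1r mulr1 mulVf// -normr_eq0 ps1// oner_neq0.
exists e; split=> // i j p Ui Uj; have Uz := Hz p.
have := quasi_delta hQ Uz Ui Uj (hw _ _ Uz) (he _ _ Ui) (he _ _ Uj) (hu' _ _ _ Uz Ui) (hu' _ _ _ Uz Uj) (hu' _ _ _ Ui Uj).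
by rewrite !base// invr1 !mulr1 => ->; apply: hu.2; exact: rV.
Qed.

End QuasiTrivialization.

Section LocalLift.
Context {R : realType} {n : nat} {M : manifold R n}.
Local Notation delta w := (@coboundary R R M _ w).

(* lam is a real lift of the circle-valued function with phase phi and logarithmic differential A. As its oscillation is
   below 1/8, an alternating sum of four lifts that takes integer values is constant. *)
Definition lifted (W : set M) (phi : M -> R) (A : singular R M 1 -> R) (lam : M -> R) :=
  [/\ forall p, W p -> isint (lam p - phi p),
      forall s, smooth_simplex s -> simage s `<=` W -> A s = delta (pt_cochain lam) s &
      forall p q, W p -> W q -> `|lam p - lam q| < 8^-1].

Lemma lifted_sub (W W' : set M) phi A lam : W' `<=` W -> lifted W phi A lam -> lifted W' phi A lam.
Proof.
move=> sW [h1 h2 h3]; split=> [p /sW|s ss sW'|p q /sW Wp /sW]; [exact: h1|apply: h2 => // p /sW'/sW//|exact: h3].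
Qed.

Lemma phased_lift (W : set M) (phi : M -> R) (A : diff_form M 1) p0 : open W -> is_form W A -> phased W phi A -> W p0 ->
  exists B : set M, [/\ open B, B p0, B `<=` W & exists lam, lifted B phi (integrate A) lam].
Proof.
move=> oW fA hp Wp0; have [B [lam [oB Bp sB H]]] := phase_potential oW fA hp Wp0.
by exists B; split=> //; exists lam; case: H.
Qed.

End LocalLift.

Section GerbeCocycle.
Context {R : realType} {n : nat} {N : manifold R n} (G : gerbe_data N) (D : gerbe_connection_data G).
Hypotheses (hG : is_gerbe G) (hD : is_gerbe_connection D).
Variable u : forall (j k : g_idx G) p, fib (g_line j k) p.
Hypothesis hu : gerbe_trivial u.
Local Notation delta w := (@coboundary R R N _ w).

Lemma gerbe_frame_phase i j (a : frame_idx (g_line (g := G) i j)) p : frame_dom a p ->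
  unit_vector (u i j p) /\ frame a p = cis (frame_phase (u i j) a p) *: u i j p.
Proof.
move=> ap; have [Vi Vj] := frame_sub (gerbe_line hG i j) ap; split; first exact: hu.1.
by apply: (frame_phaseE (gerbe_line hG i j)) => // q [qi qj]; exact: hu.1.
Qed.

Lemma gerbe_curv i j (a : frame_idx (g_line (g := G) i j)) p v : frame_dom a p ->
  ext_d (conn_potential (g_nabla D i j) a) p v = g_varpi D j p v - g_varpi D i p v.
Proof.
move=> ap; have [Vi Vj] := frame_sub (gerbe_line hG i j) ap; rewrite (gconn_curv hD)//.
apply: esym; apply: (curv_potential (gerbe_line hG i j) (gconn_nabla hD i j) (u := u i j)) => // q [qi qj]; exact: hu.1.
Qed.

Lemma gerbe_phased i j k (a : frame_idx (g_line (g := G) j k)) (b : frame_idx (g_line (g := G) i k))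
    (c : frame_idx (g_line (g := G) i j)) :
  phased (frame_dom a `&` frame_dom b `&` frame_dom c)
    (fun p => frame_phase (u j k) a p - frame_phase (u i k) b p + frame_phase (u i j) c p)
    (fun p v => conn_potential (g_nabla D j k) a p v - conn_potential (g_nabla D i k) b p v +
       conn_potential (g_nabla D i j) c p v).
Proof.
set W := _ `&` _.
have oW : open W by do ?apply: openI; exact: frame_open (gerbe_line hG _ _) _.
have sV p : W p -> [/\ g_cover i p, g_cover j p & g_cover k p].
  by move=> [[ap bp] cp]; have [? ?] := frame_sub (gerbe_line hG _ _) ap; have [? ?] := frame_sub (gerbe_line hG _ _) bp.
apply: (parallel_phased (u1 := u j k) (u2 := u i k) (u3 := u i j) oW _ (gerbe_theta hG i j k)
  (@gconn_theta _ _ _ _ _ hD i j k)).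
- by move=> p Wp; have [? ? ?] := sV p Wp; case: Wp => [[ap bp] cp].
- by move=> p [[ap _] _]; exact: gerbe_frame_phase.
- by move=> p [[_ bp] _]; exact: gerbe_frame_phase.
- by move=> p [_ cp]; exact: gerbe_frame_phase.
by move=> p /sV[Vi Vj Vk]; exact: hu.2.
Qed.

Definition framed (B : set N) i j (f : N -> R) (A : diff_form N 1) := exists a : frame_idx (g_line (g := G) i j),
  [/\ B `<=` frame_dom a, f = frame_phase (u i j) a & A = conn_potential (g_nabla D i j) a].

(** The Cech data after refinement, with cover indexed by points of N: where two members meet, a
    phase and a potential of one frame, defined on the whole first member; where three meet, a real
    lift of the coboundary of the phases. *)
Record gerbe_cocycle_data := GerbeCocycle {
  gc_idx : N -> g_idx G;
  gc_cover : N -> set N;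
  gc_phase : N -> N -> N -> R;
  gc_form : N -> N -> diff_form N 1;
  gc_lift : N -> N -> N -> N -> R;
  gc_open : forall x, open (gc_cover x);
  gc_mem : forall x, gc_cover x x;
  gc_sub : forall x, gc_cover x `<=` g_cover (gc_idx x);
  gc_framed : forall x y, gc_cover x `&` gc_cover y !=set0 ->
    framed (gc_cover x) (gc_idx x) (gc_idx y) (gc_phase x y) (gc_form x y);
  gc_lifted : forall x y z, gc_cover x `&` gc_cover y `&` gc_cover z !=set0 ->
    lifted (gc_cover x `&` gc_cover y `&` gc_cover z)
      (fun p => gc_phase y z p - gc_phase x z p + gc_phase x y p)
      (fun s => integrate (gc_form y z) s - integrate (gc_form x z) s + integrate (gc_form x y) s)
      (gc_lift x y z) }.

(** [refined_cover] is applied twice, because lifts on triple overlaps can be formed only after the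
    frames on double overlaps are fixed; the second cover is subordinate to the first. *)
Lemma gerbe_cocycle_exists : inhabited gerbe_cocycle_data.
Proof.
have [oV cV] := gerbe_cover hG.
have [a [B [HB HP]]] : exists (a : N -> g_idx G) (B : N -> set N),
  (forall p, [/\ open (B p), B p p & B p `<=` g_cover (a p)]) /\
  forall p q r, B p `&` B q !=set0 -> B p `&` B r !=set0 -> exists t : (N -> R) * diff_form N 1, framed (B p) (a p) (a q) t.1 t.2.
  apply: (@refined_cover R n N (g_idx G) (@g_cover _ _ _ G) (fun i j k W => exists t, framed W i j t.1 t.2) oV cV).
    by move=> i j k W W' sW [t [b [h1 h2 h3]]]; exists t, b; split=> // p /sW; exact: h1.
  move=> i j k p Vi Vj Vk; have [b bp] := lb_cover (gerbe_line hG i j) (conj Vi Vj).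
  exists (frame_dom b); split=> //; first exact: frame_open (gerbe_line hG _ _) _.
  by exists (frame_phase (u i j) b, conn_potential (g_nabla D i j) b); exists b; split.
have /choice[t Ht] : forall x : N * N, exists t : (N -> R) * diff_form N 1, B x.1 `&` B x.2 !=set0 ->
    framed (B x.1) (a x.1) (a x.2) t.1 t.2.
  move=> [x y] /=; case: (pselect (B x `&` B y !=set0)) => [xy|nxy]; last by exists (fun=> 0, fun _ _ => 0) => /nxy.
  by have [t ft] := HP x y y xy xy; exists t.
pose f x y := (t (x, y)).1; pose A x y := (t (x, y)).2.
have fr x y : B x `&` B y !=set0 -> framed (B x) (a x) (a y) (f x y) (A x y) := Ht (x, y).
have oB x : open (B x) by have [] := HB x.
pose T x y z := B x `&` B y `&` B z.
have oT x y z : open (T x y z) by apply: openI => //; exact: openI.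
have ph x y z p : T x y z p -> is_form (T x y z) (A y z) /\ is_form (T x y z) (A x z) /\ is_form (T x y z) (A x y) /\
    phased (T x y z) (fun p => f y z p - f x z p + f x y p) (fun p v => A y z p v - A x z p v + A x y p v).
  move=> [[xp yp] zp].
  have [b1 [s1 -> ->]] : framed (B y) (a y) (a z) (f y z) (A y z) by apply: fr; exists p.
  have [b2 [s2 -> ->]] : framed (B x) (a x) (a z) (f x z) (A x z) by apply: fr; exists p.
  have [b3 [s3 -> ->]] : framed (B x) (a x) (a y) (f x y) (A x y) by apply: fr; exists p.
  split; [|split; [|split]].
  - by apply: is_form_sub (potential_is_form (gerbe_line hG _ _) (gconn_nabla hD _ _) b1) => q [[_ /s1]].
  - by apply: is_form_sub (potential_is_form (gerbe_line hG _ _) (gconn_nabla hD _ _) b2) => q [[/s2]].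
  - by apply: is_form_sub (potential_is_form (gerbe_line hG _ _) (gconn_nabla hD _ _) b3) => q [[/s3]].
  by apply: phased_sub (gerbe_phased b1 b2 b3) => q [[xq yq] zq]; split; [split|]; [exact: s1|exact: s2|exact: s3].
pose I x y z s := integrate (A y z) s - integrate (A x z) s + integrate (A x y) s.
pose P x y z W := W `<=` T x y z /\ exists lam, lifted W (fun p => f y z p - f x z p + f x y p) (I x y z) lam.
have [b [C [HC HQ]]] : exists (b : N -> N) (C : N -> set N),
  (forall p, [/\ open (C p), C p p & C p `<=` B (b p)]) /\
  forall p q r, C p `&` C q !=set0 -> C p `&` C r !=set0 -> P (b p) (b q) (b r) (C p).
  apply: refined_cover => [|p|x y z W W' sW [WT [lam h]]|x y z p xp yp zp].
  - exact: oB.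
  - by exists p; have [] := HB p.
  - by split; [exact: subset_trans WT|exists lam; exact: lifted_sub h].
  have Tp : T x y z p by [].
  have [f1 [f2 [f3 hp]]] := ph x y z p Tp.
  have [W [oW Wp sW [lam [h1 h2 h3]]]] := phased_lift (oT x y z) (is_formD (oT x y z) (is_formB (oT x y z) f1 f2) f3) hp Tp.
  exists W; split=> //; split=> //; exists lam; split=> // s ss sW'; rewrite -h2//.
  have sT := subset_trans sW' sW.
  by rewrite (integrateD (oT x y z) (is_formB (oT x y z) f1 f2) f3 ss sT) (integrateB (oT x y z) f1 f2 ss sT).
have /choice[lam Hlam] : forall x : N * N * N, exists lam, C x.1.1 `&` C x.1.2 `&` C x.2 !=set0 ->
    lifted (C x.1.1) (fun p => f (b x.1.2) (b x.2) p - f (b x.1.1) (b x.2) p + f (b x.1.1) (b x.1.2) p)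
      (I (b x.1.1) (b x.1.2) (b x.2)) lam.
  move=> [[x y] z] /=; case: (pselect (C x `&` C y `&` C z !=set0)) => [xyz|nxy]; last by exists (fun=> 0) => /nxy.
  have xy : C x `&` C y !=set0 by case: xyz => p [[xp yp] zp]; exists p.
  have xz : C x `&` C z !=set0 by case: xyz => p [[xp yp] zp]; exists p.
  by have [_ [l hl]] := HQ x y z xy xz; exists l.
apply: inhabits; apply: (@GerbeCocycle (a \o b) C (fun x y => f (b x) (b y)) (fun x y => A (b x) (b y)) (fun x y z => lam (x, y, z))).
- by move=> x; have [] := HC x.
- by move=> x; have [] := HC x.
- by move=> x p Cp; have [_ _ sC] := HC x; have [_ _ sB] := HB (b x); apply: sB; exact: sC.
- move=> x y [p [xp yp]]; have [_ _ sCx] := HC x; have [_ _ sCy] := HC y.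
  have [|c [h1 h2 h3]] := fr (b x) (b y); first by exists p; split; [exact: sCx|exact: sCy].
  by exists c; split=> //; exact: subset_trans sCx h1.
move=> x y z xyz; apply: lifted_sub (Hlam (x, y, z) xyz) => p [[xp _] _]; exact: xp.
Qed.

End GerbeCocycle.

Lemma ext_dD (R : realType) n (M : manifold R n) k (w w' : diff_form M k) (W : set M) p v : open W -> is_form W w ->
  is_form W w' -> W p -> ext_d (fun p v => w p v + w' p v) p v = ext_d w p v + ext_d w' p v.
Proof.
move=> oW fw fw' Wp; rewrite -[X in _ = _ + X]mul1r -(ext_d_lin 1 v oW fw fw' Wp).
by congr (ext_d _ p v); apply/funext => q; apply/funext => x; rewrite mul1r.
Qed.

Section RelativeCocycle.
Context {R : realType} {m n : nat} {M : manifold R m} {N : manifold R n} (Phi : smooth_map M N) (X : relative_gerbe Phi).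
Local Notation G := (rg_gerbe X).
Local Notation r := (@rg_ref _ _ _ _ _ _ X).
Local Notation D := (rg_conn X).
Variable u : forall (j k : g_idx G) p, fib (g_line j k) p.
Hypothesis hu : gerbe_trivial u.
Variable c : gerbe_cocycle_data D u.
Variable tau : diff_form M 2.
Hypothesis curv_tau : forall (i : rg_idx X) p v, rg_cover i p ->
     tau p v = pull_form Phi (g_varpi D (r i)) p v - curv (rg_quasi_conn X i) p v.

Let hG := rg_is_gerbe X.
Let hD := rg_is_conn X.
Let hQ := rg_is_quasi X.
Let hE := rg_is_quasi_conn X.

Record relative_cocycle_data := RelativeCocycle {
  rc_idx : M -> N;
  rc_cover : M -> set M;
  rc_phase : M -> M -> R;
  rc_form : M -> diff_form M 1;
  rc_lift : M -> M -> M -> R;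
  rc_open : forall x, open (rc_cover x);
  rc_mem : forall x, rc_cover x x;
  rc_sub : forall x, rc_cover x `<=` Phi @^-1` gc_cover c (rc_idx x);
  rc_is_form : forall x, is_form (rc_cover x) (rc_form x);
  rc_tau : forall x p v, rc_cover x p ->
    ext_d (rc_form x) p v = pull_form Phi (g_varpi D (gc_idx c (rc_idx x))) p v - tau p v;
  rc_lifted : forall x y, rc_cover x `&` rc_cover y !=set0 ->
    lifted (rc_cover x `&` rc_cover y)
      (fun p => rc_phase y p - rc_phase x p - gc_phase c (rc_idx x) (rc_idx y) (Phi p))
      (fun s => integrate (rc_form y) s - integrate (rc_form x) s -
         integrate (gc_form c (rc_idx x) (rc_idx y)) (sing_comp Phi s))
      (rc_lift x y) }.

(** The quasi-line bundle uses the indices r i, the refined gerbe its own. Near z the bundle E_i is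
    therefore tensored with the line bundle L from r i to the index attached to Phi z, which adds
    the phases and the potentials. *)
Lemma relative_cocycle_exists : inhabited relative_cocycle_data.
Proof.
have [e [he e1]] := quasi_trivialization hu.
have [oU cU] := rg_is_cover X.
have rV i p : rg_cover i p -> g_cover (r i) (Phi p) by move=> Ui; apply: (rg_refines (i := i)); exists p.
pose chartd z (t : set M * (M -> R) * diff_form M 1) :=
  t.1.1 z /\ exists (i : rg_idx X) (a : frame_idx (q_line (rg_quasi X) i)) (l : frame_idx (g_line (r i) (gc_idx c (Phi z)))),
   [/\ t.1.1 = frame_dom a `&` Phi @^-1` (frame_dom l `&` gc_cover c (Phi z)),
       t.1.2 = (fun p => frame_phase (e i) a p + frame_phase (u (r i) (gc_idx c (Phi z))) l (Phi p)) &
       t.2 = (fun p v => conn_potential (rg_quasi_conn X i) a p v +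
                pull_form Phi (conn_potential (g_nabla D (r i) (gc_idx c (Phi z))) l) p v)].
have /choice[t Ht] : forall z, exists t, chartd z t.
  move=> z; have [i Ui] := cU z; have [a az] := lb_cover (quasi_line hQ i) Ui.
  have Vz : g_cover (gc_idx c (Phi z)) (Phi z) by apply: gc_sub; exact: gc_mem.
  have [l lz] := lb_cover (gerbe_line hG (r i) (gc_idx c (Phi z))) (conj (rV _ _ Ui) Vz).
  eexists (_, _, _); split; last by exists i, a, l; split; reflexivity.
  by split=> //; split=> //; exact: gc_mem.
pose V z := (t z).1.1; pose g z := (t z).1.2; pose C z := (t z).2.
have HV z : V z z /\ exists (i : rg_idx X) (a : frame_idx (q_line (rg_quasi X) i)) (l : frame_idx (g_line (r i) (gc_idx c (Phi z)))),
   [/\ V z = frame_dom a `&` Phi @^-1` (frame_dom l `&` gc_cover c (Phi z)),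
       g z = (fun p => frame_phase (e i) a p + frame_phase (u (r i) (gc_idx c (Phi z))) l (Phi p)) &
       C z = (fun p v => conn_potential (rg_quasi_conn X i) a p v +
                pull_form Phi (conn_potential (g_nabla D (r i) (gc_idx c (Phi z))) l) p v)] := Ht z.
have oV z : open (V z).
  have [_ [i [a [l [-> _ _]]]]] := HV z; apply: openI; first exact: frame_open (quasi_line hQ i) _.
  by apply: open_Phi; apply: openI; [exact: frame_open (gerbe_line hG _ _) _|exact: gc_open].
have VB z : V z `<=` Phi @^-1` gc_cover c (Phi z) by have [_ [i [a [l [-> _ _]]]]] := HV z; move=> p [_ []].
have fpull j k (l : frame_idx (g_line (g := G) j k)) : is_form (Phi @^-1` frame_dom l) (pull_form Phi (conn_potential (g_nabla D j k) l)).
  exact: (pull_form_is_form Phi (frame_open (gerbe_line hG _ _) l) (potential_is_form (gerbe_line hG _ _) (gconn_nabla hD _ _) l)).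
have fC z : is_form (V z) (C z).
  have [_ [i [a [l [EV _ ->]]]]] := HV z.
  apply: (is_formD (oV z)); rewrite EV.
    by apply: is_form_sub (potential_is_form (quasi_line hQ i) (qconn_nabla hE i) a) => p [].
  by apply: is_form_sub (fpull _ _ l) => p [_ []].
have dC z p v : V z p -> ext_d (C z) p v = pull_form Phi (g_varpi D (gc_idx c (Phi z))) p v - tau p v.
  have [_ [i [a [l [EV _ ->]]]]] := HV z; move=> Vp.
  have [ap [lp _]] : (frame_dom a `&` Phi @^-1` (frame_dom l `&` gc_cover c (Phi z))) p by rewrite -EV.
  have Ui := frame_sub (quasi_line hQ i) ap.
  have fa : is_form (V z) (conn_potential (rg_quasi_conn X i) a).
    by rewrite EV; apply: is_form_sub (potential_is_form (quasi_line hQ i) (qconn_nabla hE i) a) => q [].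
  have fl : is_form (V z) (pull_form Phi (conn_potential (g_nabla D (r i) (gc_idx c (Phi z))) l)).
    by rewrite EV; apply: is_form_sub (fpull _ _ l) => q [_ []].
  rewrite (ext_dD v (oV z) fa fl Vp) (curv_tau v Ui).
  rewrite (curv_potential (quasi_line hQ i) (qconn_nabla hE i) (he i) v ap).
  rewrite (ext_d_pull_form (frame_open (gerbe_line hG _ _) l) (potential_is_form (gerbe_line hG _ _) (gconn_nabla hD _ _) l) v lp).
  have -> : pull_form Phi (ext_d (conn_potential (g_nabla D (r i) (gc_idx c (Phi z))) l)) p v =
     pull_form Phi (g_varpi D (gc_idx c (Phi z))) p v - pull_form Phi (g_varpi D (r i)) p v.
    exact: (gerbe_curv hG hD hu _ lp).
  move: (ext_d _ _ _) (pull_form _ _ _ _) (pull_form _ _ _ _) => x y z0; ring.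
have loc z w p : V z p -> V w p -> exists W : set M, [/\ open W, W p & exists lam,
    lifted W (fun q => g w q - g z q - gc_phase c (Phi z) (Phi w) (Phi q))
      (fun s => integrate (C w) s - integrate (C z) s - integrate (gc_form c (Phi z) (Phi w)) (sing_comp Phi s)) lam].
  move=> zp wp; have fz := fC z; have fw := fC w.
  have [f0 [sf0 Ef EA]] : framed D u (gc_cover c (Phi z)) (gc_idx c (Phi z)) (gc_idx c (Phi w))
      (gc_phase c (Phi z) (Phi w)) (gc_form c (Phi z) (Phi w)).
    by apply: gc_framed; exists (Phi p); split; apply: VB.
  have [_ [i [a [l [EV Eg EC]]]]] := HV z; have [_ [j [a' [l' [EV' Eg' EC']]]]] := HV w.
  have [ap [lp Bp]] : (frame_dom a `&` Phi @^-1` (frame_dom l `&` gc_cover c (Phi z))) p by rewrite -EV.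
  have [ap' [lp' Bp']] : (frame_dom a' `&` Phi @^-1` (frame_dom l' `&` gc_cover c (Phi w))) p by rewrite -EV'.
  have Vi := rV _ _ (frame_sub (quasi_line hQ i) ap); have Vj := rV _ _ (frame_sub (quasi_line hQ j) ap').
  (* Auxiliary frames of L from r i to r j and from r i to the index attached to Phi w. They link
     psi to two instances of theta, and both cancel in the final combination of the three phased
     identities. *)
  have [c0 c0p] := lb_cover (gerbe_line hG (r i) (r j)) (conj Vi Vj).
  have [c1 c1p] := lb_cover (gerbe_line hG (r i) (gc_idx c (Phi w))) (conj Vi (gc_sub Bp')).
  pose W := V z `&` V w `&` Phi @^-1` (frame_dom c0 `&` frame_dom c1).
  have oW : open W.
    apply: openI; first exact: openI.
    by apply: open_Phi; apply: openI; exact: frame_open (gerbe_line hG _ _) _.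
  have Wp : W p by [].
  have inW q : W q -> [/\ frame_dom a q, frame_dom a' q, frame_dom c0 (Phi q) & frame_dom c1 (Phi q)] /\
      [/\ frame_dom l (Phi q), frame_dom l' (Phi q) & frame_dom f0 (Phi q)].
    by rewrite /W EV EV' => -[[[? [? ?]] [? [? ?]]] [? ?]]; split; split=> //; exact: sf0.
  have h1 : phased W (fun q => frame_phase (e i) a q - frame_phase (e j) a' q + frame_phase (u (r i) (r j)) c0 (Phi q))
      (fun q v => conn_potential (rg_quasi_conn X i) a q v - conn_potential (rg_quasi_conn X j) a' q v +
         conn_potential (pull_connection Phi (g_nabla D (r i) (r j))) c0 q v).
    apply: (@parallel_phased R m M (@rg_cover _ _ _ _ _ _ X i `&` @rg_cover _ _ _ _ _ _ X j) W
      (q_line (rg_quasi X) i) (q_line (rg_quasi X) j) (pull_bundle Phi (g_line (r i) (r j)))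
      (rg_quasi_conn X i) (rg_quasi_conn X j) (pull_connection Phi (g_nabla D (r i) (r j)))
      (q_psi (rg_quasi X) i j) a a' c0 (frame_phase (e i) a) (frame_phase (e j) a')
      (fun q => frame_phase (u (r i) (r j)) c0 (Phi q)) (e i) (e j) (fun q => u (r i) (r j) (Phi q)) oW _ (quasi_psi hQ i j)
      (@qconn_psi _ _ _ _ _ _ _ hE i j)).
    - move=> q Wq; have [[aq aq' c0q c1q] _] := inW q Wq.
      have Ui := frame_sub (quasi_line hQ i) aq; have Uj := frame_sub (quasi_line hQ j) aq'.
      by split; [split; [split; [split|]|]|].
    - move=> q /inW[[aq _ _ _] _]; split; first exact: he (frame_sub (quasi_line hQ i) aq).
      exact: (frame_phaseE (quasi_line hQ i) (he i) aq).
    - move=> q /inW[[_ aq _ _] _]; split; first exact: he (frame_sub (quasi_line hQ j) aq).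
      exact: (frame_phaseE (quasi_line hQ j) (he j) aq).
    - by move=> q /inW[[_ _ cq _] _]; exact: (gerbe_frame_phase hG hu cq).
    by move=> q /inW[[aq aq' _ _] _]; exact: e1 (frame_sub (quasi_line hQ i) aq) (frame_sub (quasi_line hQ j) aq').
  have odom j1 k1 (b1 : frame_idx (g_line (g := G) j1 k1)) : open (frame_dom b1) := frame_open (gerbe_line hG _ _) b1.
  have sW2 : W `<=` Phi @^-1` (frame_dom l' `&` frame_dom c1 `&` frame_dom c0) by move=> q /inW[[_ _ ? ?] [_ ? _]].
  have h2 := phased_sub sW2 (phased_pull Phi (openI (openI (odom _ _ l') (odom _ _ c1)) (odom _ _ c0)) (gerbe_phased hG hD hu l' c1 c0)).
  have sW3 : W `<=` Phi @^-1` (frame_dom f0 `&` frame_dom c1 `&` frame_dom l) by move=> q /inW[[_ _ ? ?] [? _ ?]].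
  have h3 := phased_sub sW3 (phased_pull Phi (openI (openI (odom _ _ f0) (odom _ _ c1)) (odom _ _ l)) (gerbe_phased hG hD hu f0 c1 l)).
  have h := phasedB oW (phasedB oW h2 h1) h3.
  have fW x : V x p -> W `<=` V x -> is_form W (C x) by move=> _ sW; exact: is_form_sub sW (fC x).
  have fz' : is_form W (C z) by apply: fW => // q [[]].
  have fw' : is_form W (C w) by apply: fW => // q [[]].
  have ff : is_form W (pull_form Phi (gc_form c (Phi z) (Phi w))).
    by rewrite EA; apply: is_form_sub (fpull _ _ f0) => q /inW[_ [_ _]].
  have {}h : phased W (fun q => g w q - g z q - gc_phase c (Phi z) (Phi w) (Phi q))
      (fun q v => C w q v - C z q v - pull_form Phi (gc_form c (Phi z) (Phi w)) q v).
    apply: (eq_phased oW _ _ h) => [q Wq|q v Wq].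
      rewrite Eg Eg' Ef /=.
      have alg (x1 x2 x3 x4 x5 x6 x7 : R) : isint (x1 - x2 + x3 - (x4 - x5 + x3) - (x6 - x2 + x7) - (x5 + x1 - (x4 + x7) - x6)).
        by rewrite (_ : _ - _ = 0) ?isint0//; ring.
      exact: alg.
    have [[_ _ c0q _] _] := inW q Wq.
    rewrite EC EC' EA (pull_connection_frame v (gerbe_line hG _ _) (gconn_nabla hD _ _) c0q).
    have alg (x1 x2 x3 x4 x5 x6 x7 : R) : x1 - x2 + x3 - (x4 - x5 + x3) - (x6 - x2 + x7) = x5 + x1 - (x4 + x7) - x6 by ring.
    exact: alg.
  have [B [oB Bp0 sB [lam [m1 m2 m3]]]] := phased_lift oW (is_formB oW (is_formB oW fw' fz') ff) h Wp.
  exists B; split=> //; exists lam; split=> // s ss sB'; rewrite -m2//; have sW := subset_trans sB' sB.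
  by rewrite (integrateB oW (is_formB oW fw' fz') ff ss sW) (integrateB oW fw' fz' ss sW) integrate_map.
have [b [B [HB HP]]] : exists (b : M -> M) (B : M -> set M),
  (forall p, [/\ open (B p), B p p & B p `<=` V (b p)]) /\
  forall p q k, B p `&` B q !=set0 -> B p `&` B k !=set0 -> exists lam,
    lifted (B p) (fun x => g (b q) x - g (b p) x - gc_phase c (Phi (b p)) (Phi (b q)) (Phi x))
      (fun s => integrate (C (b q)) s - integrate (C (b p)) s - integrate (gc_form c (Phi (b p)) (Phi (b q))) (sing_comp Phi s)) lam.
  apply: (@refined_cover _ _ _ _ V (fun z w _ W => exists lam, lifted W (fun q => g w q - g z q - gc_phase c (Phi z) (Phi w) (Phi q))
      (fun s => integrate (C w) s - integrate (C z) s - integrate (gc_form c (Phi z) (Phi w)) (sing_comp Phi s)) lam)).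
  - exact: oV.
  - by move=> p; exists p; have [] := Ht p.
  - by move=> z w k W W' sW [lam h]; exists lam; exact: lifted_sub h.
  by move=> z w k p zp wp _; exact: loc.
have /choice[lam Hlam] : forall x : M * M, exists lam, B x.1 `&` B x.2 !=set0 ->
    lifted (B x.1) (fun p => g (b x.2) p - g (b x.1) p - gc_phase c (Phi (b x.1)) (Phi (b x.2)) (Phi p))
      (fun s => integrate (C (b x.2)) s - integrate (C (b x.1)) s - integrate (gc_form c (Phi (b x.1)) (Phi (b x.2))) (sing_comp Phi s)) lam.
  move=> [x y] /=; case: (pselect (B x `&` B y !=set0)) => [xy|nxy]; last by exists (fun=> 0) => /nxy.
  by have [l hl] := HP x y y xy xy; exists l.
apply: inhabits; apply: (@RelativeCocycle (fun x => Phi (b x)) B (fun x => g (b x)) (fun x => C (b x)) (fun x y => lam (x, y))).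
- by move=> x; have [] := HB x.
- by move=> x; have [] := HB x.
- by move=> x p Bp; have [_ _ sB] := HB x; apply: VB; exact: sB.
- by move=> x; have [_ _ sB] := HB x; exact: is_form_sub sB (fC _).
- by move=> x p v Bp; have [_ _ sB] := HB x; apply: dC; exact: sB.
by move=> x y xy; apply: lifted_sub (Hlam (x, y) xy) => p [].
Qed.

End RelativeCocycle.

(** * The Cech-singular zigzag on small simplices *)

Section Indices.
Context {R : realType} {n : nat} {M : manifold R n} (B : M -> set M).
Local Notation delta w := (@coboundary R R M _ w).

(** The choices for a simplex and for its faces are unrelated; the Cech identities absorb the
    difference. *)
Definition pick_index {k} (s : singular R M k) : M :=
  if pselect (small B s) is left h then projT1 (cid h) else s (vertex k).

Lemma pick_indexP k (s : singular R M k) : small B s -> simage s `<=` B (pick_index s).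
Proof. by rewrite /pick_index; case: pselect => // h _; exact: projT2 (cid h). Qed.

Lemma face_sub k (s : singular R M k.+1) i (W : set M) : simage s `<=` W -> simage (sing_face i s) `<=` W.
Proof. by move=> sW p /image_face/sW. Qed.

Lemma eq_delta k (c c' : singular R M k -> R) s : (forall i, c (sing_face i s) = c' (sing_face i s)) -> delta c s = delta c' s.
Proof. by move=> E; apply: eq_bigr => i _; rewrite E. Qed.

Definition endpoint (s : singular R M 1) i : M := sing_face i s (vertex 0).

Lemma endpoint_in s i : simage s (endpoint s i).
Proof. by apply: (image_face (i := i)); exists (vertex 0). Qed.

Lemma delta_endpoints (phi : M -> R) s : delta (pt_cochain phi) s = phi (endpoint s 0) - phi (endpoint s 1).
Proof. exact: alternating_sum2 (fun i => phi (endpoint s i)). Qed.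

Lemma isint_small (a b : R) : isint a -> isint b -> `|a - b| < 1 -> a = b.
Proof.
move=> ia ib; have := isintB ia ib; rewrite /isint => /intrP[z E]; rewrite E -intr_norm ltrz1 => h.
by apply/eqP; rewrite -subr_eq0 E intr_eq0; move: h; lia.
Qed.

Lemma norm_sum4 (a b c d a' b' c' d' : R) : `|a - a'| < 8^-1 -> `|b - b'| < 8^-1 -> `|c - c'| < 8^-1 -> `|d - d'| < 8^-1 ->
  `|(a - b + c - d) - (a' - b' + c' - d')| < 1.
Proof. by rewrite !ltr_norml => /andP[? ?] /andP[? ?] /andP[? ?] /andP[? ?]; apply/andP; split; lra. Qed.

End Indices.

Section Zigzag.
Context {R : realType} {n : nat} {N : manifold R n} (G : gerbe_data N) (D : gerbe_connection_data G).
Hypotheses (hG : is_gerbe G) (hD : is_gerbe_connection D).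
Variable u : forall (j k : g_idx G) p, fib (g_line j k) p.
Hypothesis hu : gerbe_trivial u.
Variable c : gerbe_cocycle_data D u.
Local Notation delta w := (@coboundary R R N _ w).
Local Notation B := (gc_cover c).
Local Notation f := (gc_phase c).
Local Notation pick := (pick_index B).

(* The Cech-singular zigzag: [pick s] gives the contracting homotopy of the Cech complex of small singular simplices. *)
Definition lift_int x y z p : R := gc_lift c x y z p - (f y z p - f x z p + f x y p).

Lemma lift_int_isint x y z p : B x p -> B y p -> B z p -> isint (lift_int x y z p).
Proof.
move=> xp yp zp; have h : (B x `&` B y `&` B z) p by [].
by have [h1 _ _] := gc_lifted (ex_intro _ p h); exact: h1.
Qed.

(** In the alternating sum over four indices the phases cancel, so it equals the alternating sum of
    the real lifts, to which the bound on oscillation applies. *)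
Lemma lift_int_cst x y z t p q : (B x `&` B y `&` B z `&` B t) p -> (B x `&` B y `&` B z `&` B t) q ->
  lift_int y z t p - lift_int x z t p + lift_int x y t p - lift_int x y z p =
  lift_int y z t q - lift_int x z t q + lift_int x y t q - lift_int x y z q.
Proof.
move=> [[[xp yp] zp] tp] [[[xq yq] zq] tq]; apply: isint_small.
- by apply: isintB; [apply: isintD; [apply: isintB|]|]; exact: lift_int_isint.
- by apply: isintB; [apply: isintD; [apply: isintB|]|]; exact: lift_int_isint.
have E r : lift_int y z t r - lift_int x z t r + lift_int x y t r - lift_int x y z r =
    gc_lift c y z t r - gc_lift c x z t r + gc_lift c x y t r - gc_lift c x y z r by rewrite /lift_int; ring.
have V a b d : B a p -> B b p -> B d p -> B a q -> B b q -> B d q -> `|gc_lift c a b d p - gc_lift c a b d q| < 8^-1.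
  move=> *; have h : (B a `&` B b `&` B d) p by [].
  by have [_ _ h1] := gc_lifted (ex_intro _ p h); exact: h1.
by rewrite !E; apply: norm_sum4; exact: V.
Qed.

Definition edge_int x y (s : singular R N 1) := delta (pt_cochain (lift_int (pick s) x y)) s.

Lemma edge_int_isint x y s : simage s `<=` B x `&` B y -> isint (edge_int x y s).
Proof.
move=> sB; have hp := pick_indexP (ex_intro _ x (fun p h => (sB p h).1)).
rewrite /edge_int delta_endpoints; apply: isintB; apply: lift_int_isint; do ?[exact: (hp _ (endpoint_in _ _))|exact: (sB _ (endpoint_in _ _)).1|exact: (sB _ (endpoint_in _ _)).2].
Qed.

(** Take the picked index as the fourth one in [lift_int_cst] and compare the two endpoints. *)
Lemma edge_int_cech x y z s : simage s `<=` B x `&` B y `&` B z ->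
  edge_int y z s - edge_int x z s + edge_int x y s = delta (pt_cochain (lift_int x y z)) s.
Proof.
move=> sB; have hp := pick_indexP (ex_intro _ x (fun p h => (sB p h).1.1)).
have in4 i : (B (pick s) `&` B x `&` B y `&` B z) (endpoint s i).
  have h := endpoint_in s i; have [[? ?] ?] := sB _ h; have := hp _ h; by [].
have alg (a a' b b' d d' e e' : R) : a - b + d - e = a' - b' + d' - e' -> (b - b') - (d - d') + (e - e') = a - a' by lra.
by rewrite /edge_int !delta_endpoints; exact: alg (lift_int_cst (in4 0) (in4 1)).
Qed.

Definition tri_int x (s : singular R N 2) := delta (edge_int (pick s) x) s.

Lemma tri_int_isint x s : simage s `<=` B x -> isint (tri_int x s).
Proof.
move=> sB; have hp := pick_indexP (ex_intro _ x sB).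
apply: (@delta_subgroup R N _ _ _ _ (@subgroup_int R)) => i; apply: edge_int_isint => p h; split.
  exact: face_sub hp _ h.
exact: face_sub sB _ h.
Qed.

Lemma tri_int_cech x y s : simage s `<=` B x `&` B y -> tri_int y s - tri_int x s = delta (edge_int x y) s.
Proof.
move=> sB; have hp := pick_indexP (ex_intro _ x (fun p h => (sB p h).1)).
have E : delta (fun t => edge_int x y t - edge_int (pick s) y t + edge_int (pick s) x t) s = 0.
  rewrite (@eq_delta _ _ _ _ _ (delta (pt_cochain (lift_int (pick s) x y)))) ?deltaK// => i.
  apply: edge_int_cech => p h; split; [split; first exact: face_sub hp _ h|];
    by have [? ?] := face_sub sB h.
move: E; rewrite deltaD deltaB /tri_int; lra.
Qed.

(** The integral 3-cocycle on small simplices that represents the Dixmier-Douady class. *)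
Definition tet_int (s : singular R N 3) := delta (tri_int (pick s)) s.

Lemma tet_int_isint s : small B s -> isint (tet_int s).
Proof.
move=> ss; apply: (@delta_subgroup R N _ _ _ _ (@subgroup_int R)) => i; apply: tri_int_isint.
exact: face_sub (pick_indexP ss).
Qed.

(** Any member of the cover containing s may replace the picked one. A small 4-simplex lies in one
    member that serves all its faces, which makes [tet_int] a cocycle. *)
Lemma tet_intE x s : simage s `<=` B x -> tet_int s = delta (tri_int x) s.
Proof.
move=> sB; have hp := pick_indexP (ex_intro _ x sB).
apply/eqP; rewrite eq_sym -subr_eq0 -deltaB (@eq_delta _ _ _ _ _ (delta (edge_int (pick s) x))) ?deltaK// => i.
by apply: tri_int_cech => p h; split; [exact: face_sub hp _ h|exact: face_sub sB _ h].
Qed.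

Lemma delta_tet_int s : small B s -> delta tet_int s = 0.
Proof.
move=> [x sB]; rewrite (@eq_delta _ _ _ _ _ (delta (tri_int x))) ?deltaK// => i.
by apply: tet_intE; exact: face_sub sB.
Qed.

(** The real companion of [edge_int]: the integral of the potential along the edge, less the change
    of phase and less the integer part. *)
Definition edge_real x y (s : singular R N 1) :=
  integrate (gc_form c x y) s - edge_int x y s - delta (pt_cochain (f x y)) s.

(** The increment of the lift equals the integral of the alternating sum of potentials; once the
    phases and the integers are subtracted, nothing remains. *)
Lemma edge_real_cech x y z s : smooth_simplex s -> simage s `<=` B x `&` B y `&` B z ->
  edge_real y z s - edge_real x z s + edge_real x y s = 0.
Proof.
move=> ss sB; have := edge_int_cech sB.
have h : B x `&` B y `&` B z !=set0 by exists (endpoint s 0); apply: sB; exact: endpoint_in.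
have [_ /(_ s ss sB) + _] := gc_lifted h.
rewrite /edge_real !delta_endpoints /lift_int.
move: (integrate _ _) (integrate _ _) (integrate _ _) (edge_int _ _ _) (edge_int _ _ _) (edge_int _ _ _) => a1 a2 a3 b1 b2 b3.
lra.
Qed.

Definition edge_base x (s : singular R N 1) := edge_real (pick s) x s.

Lemma edge_base_cech x y s : smooth_simplex s -> simage s `<=` B x `&` B y ->
  edge_base y s - edge_base x s = edge_real x y s.
Proof.
move=> ss sB; have hp := pick_indexP (ex_intro _ x (fun p h => (sB p h).1)).
have sB' : simage s `<=` B (pick s) `&` B x `&` B y by move=> p h; have [? ?] := sB p h; split; [split; first exact: hp|].
have := edge_real_cech ss sB'; rewrite /edge_base; move: (edge_real _ _ _) (edge_real _ _ _) (edge_real _ _ _) => a b d; lra.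
Qed.

Local Notation varpi x := (g_varpi D (gc_idx c x)).

Lemma varpi_is_form x : is_form (B x) (varpi x).
Proof. exact: is_form_sub (gc_sub (g:=c) (x:=x)) (gconn_varpi hD _). Qed.

Lemma stokes_edge x y s : smooth_simplex s -> simage s `<=` B x `&` B y ->
  integrate (varpi y) s - integrate (varpi x) s = delta (integrate (gc_form c x y)) s.
Proof.
move=> ss sB; have oW : open (B x `&` B y) by apply: openI; exact: gc_open.
have [a [sa _ EA]] : framed D u (B x) (gc_idx c x) (gc_idx c y) (f x y) (gc_form c x y).
  apply: gc_framed; exists (s (vertex 2)); apply: sB; by exists (vertex 2).
have fA : is_form (B x `&` B y) (gc_form c x y).
  by rewrite EA; apply: is_form_sub (potential_is_form (gerbe_line hG _ _) (gconn_nabla hD _ _) a) => p [/sa].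
rewrite -[RHS](integrate_stokes oW fA ss sB) -(integrateB oW (is_form_sub (@subIsetr _ _ _) (varpi_is_form y)) (is_form_sub (@subIsetl _ _ _) (varpi_is_form x)) ss sB).
by apply: eq_integrate => p v /sB[/sa ap _]; rewrite EA (gerbe_curv hG hD hu _ ap).
Qed.

Definition tri_real x (s : singular R N 2) := integrate (varpi x) s - tri_int x s - delta (edge_base x) s.

(** By Stokes the integral of varpi changes from x to y by the coboundary of the integral of the
    potential on the overlap; the changes of [tri_int] and [edge_base] compensate it. *)
Lemma tri_real_cech x y s : smooth_simplex s -> simage s `<=` B x `&` B y -> tri_real x s = tri_real y s.
Proof.
move=> ss sB; have h1 := stokes_edge ss sB; have h2 := tri_int_cech sB.
have h3 : delta (fun t => edge_base y t - edge_base x t) s = delta (edge_real x y) s.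
  by apply: eq_delta => i; apply: edge_base_cech; [exact: smooth_simplex_face|exact: face_sub sB].
have h4 : delta (edge_real x y) s = delta (integrate (gc_form c x y)) s - delta (edge_int x y) s - 0.
  by rewrite /edge_real !deltaB deltaK.
have alg (a b a' b' e e' d d' : R) : a - b = d -> a' - b' = d' -> e - e' = d - d' - 0 -> b - b' - e' = a - a' - e.
  move=> e1 e2 e3; apply/eqP; rewrite -subr_eq0.
  have -> : b - b' - e' - (a - a' - e) = (e - e') - ((a - b) - (a' - b')) by ring.
  by rewrite e3 e1 e2 subr0 subrr.
by apply: (alg _ _ _ _ _ _ _ _ h1 h2); rewrite -h4 -h3 deltaB.
Qed.

Definition tri_base (s : singular R N 2) := tri_real (pick s) s.

Lemma tri_baseE x s : smooth_simplex s -> simage s `<=` B x -> tri_base s = tri_real x s.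
Proof.
move=> ss sB; have hp := pick_indexP (ex_intro _ x sB).
by apply: tri_real_cech => // p h; split; [exact: hp|exact: sB].
Qed.

(** All faces of s lie in one member x of the cover, so [tri_real x] computes each of them and its
    exact summand drops out. *)
Lemma delta_tri_base (kappa : diff_form N 3) s : (forall j q v, g_cover j q -> kappa q v = ext_d (g_varpi D j) q v) ->
  smooth_simplex s -> small B s -> delta tri_base s = integrate kappa s - tet_int s.
Proof.
move=> hk ss [x sB]; rewrite (tet_intE sB) (@eq_delta _ _ _ _ _ (tri_real x)) => [|i].
  have -> : integrate kappa s = delta (integrate (varpi x)) s.
    rewrite -[RHS](integrate_stokes (gc_open c x) (varpi_is_form x) ss sB); apply: eq_integrate => p v /sB xp.
    by apply: hk; exact: gc_sub.
  by rewrite /tri_real !deltaB deltaK subr0.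
by apply: tri_baseE; [exact: smooth_simplex_face|exact: face_sub sB].
Qed.

End Zigzag.

(** * The zigzag on the source of the map *)

Section RelativeZigzag.
Context {R : realType} {m n : nat} {M : manifold R m} {N : manifold R n} (Phi : smooth_map M N) (X : relative_gerbe Phi).
Local Notation G := (rg_gerbe X).
Local Notation D := (rg_conn X).
Variable u : forall (j k : g_idx G) p, fib (g_line j k) p.
Hypothesis hu : gerbe_trivial u.
Variable c : gerbe_cocycle_data D u.
Variable tau : diff_form M 2.
Hypothesis ftau : is_form setT tau.
Variable rc : relative_cocycle_data c tau.
Local Notation delta w := (@coboundary R R M _ w).
Local Notation B := (rc_cover rc).
Local Notation idx := (rc_idx rc).
Local Notation pick := (pick_index B).
Local Notation Phi_ s := (sing_comp Phi s).

Let hG := rg_is_gerbe X.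
Let hD := rg_is_conn X.

Lemma delta_comp k (w : singular R N k -> R) (s : singular R M k.+1) :
  delta (fun t => w (Phi_ t)) s = @coboundary R R N _ w (Phi_ s).
Proof. by apply: eq_bigr => i _; rewrite sing_comp_face. Qed.

Lemma comp_sub x k (s : singular R M k) : simage s `<=` B x -> simage (Phi_ s) `<=` gc_cover c (idx x).
Proof. by move=> sB; apply: simage_comp sB _ => p; exact: rc_sub. Qed.

Lemma comp_sub2 x y k (s : singular R M k) : simage s `<=` B x `&` B y ->
  simage (Phi_ s) `<=` gc_cover c (idx x) `&` gc_cover c (idx y).
Proof. by move=> sB; apply: simage_comp sB _ => p [xp yp]; split; exact: rc_sub. Qed.

Lemma comp_sub3 x y z k (s : singular R M k) : simage s `<=` B x `&` B y `&` B z ->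
  simage (Phi_ s) `<=` gc_cover c (idx x) `&` gc_cover c (idx y) `&` gc_cover c (idx z).
Proof. by move=> sB; apply: simage_comp sB _ => p [[xp yp] zp]; split; [split|]; exact: rc_sub. Qed.

Definition rlift_int x y p : R := rc_lift rc x y p - (rc_phase rc y p - rc_phase rc x p - gc_phase c (idx x) (idx y) (Phi p)).

Lemma rlift_int_isint x y p : B x p -> B y p -> isint (rlift_int x y p).
Proof.
move=> xp yp; have h : (B x `&` B y) p by [].
by have [h1 _ _] := rc_lifted (ex_intro _ p h); exact: h1.
Qed.

(** The phases of the gerbe occurring in the three relative terms cancel against those in the
    pulled-back [lift_int]; what remains is again an alternating sum of four real lifts. *)
Lemma rlift_int_cst x y z p q : (B x `&` B y `&` B z) p -> (B x `&` B y `&` B z) q ->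
  rlift_int y z p - rlift_int x z p + rlift_int x y p + lift_int c (idx x) (idx y) (idx z) (Phi p) =
  rlift_int y z q - rlift_int x z q + rlift_int x y q + lift_int c (idx x) (idx y) (idx z) (Phi q).
Proof.
move=> [[xp yp] zp] [[xq yq] zq].
have I r : B x r -> B y r -> B z r ->
    isint (rlift_int y z r - rlift_int x z r + rlift_int x y r + lift_int c (idx x) (idx y) (idx z) (Phi r)).
  move=> xr yr zr; apply: isintD; last by apply: lift_int_isint; exact: rc_sub.
  by apply: isintD; [apply: isintB|]; exact: rlift_int_isint.
apply: isint_small; [exact: I|exact: I|].
have E r : rlift_int y z r - rlift_int x z r + rlift_int x y r + lift_int c (idx x) (idx y) (idx z) (Phi r) =
    rc_lift rc y z r - rc_lift rc x z r + rc_lift rc x y r - - gc_lift c (idx x) (idx y) (idx z) (Phi r).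
  by rewrite /rlift_int /lift_int; ring.
have V a b : B a p -> B b p -> B a q -> B b q -> `|rc_lift rc a b p - rc_lift rc a b q| < 8^-1.
  move=> *; have h : (B a `&` B b) p by [].
  by have [_ _ h1] := rc_lifted (ex_intro _ p h); exact: h1.
rewrite !E; apply: norm_sum4; do ?exact: V.
rewrite opprK addrC distrC.
have h : (gc_cover c (idx x) `&` gc_cover c (idx y) `&` gc_cover c (idx z)) (Phi p) by split; [split|]; exact: rc_sub.
have [_ _ h1] := gc_lifted (ex_intro _ (Phi p) h).
by apply: h1 => //; split; [split|]; exact: rc_sub.
Qed.

Definition redge_int x y (s : singular R M 1) := delta (pt_cochain (rlift_int x y)) s + edge_int c (idx x) (idx y) (Phi_ s).

Lemma redge_int_isint x y s : simage s `<=` B x `&` B y -> isint (redge_int x y s).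
Proof.
move=> sB; apply: isintD.
  by rewrite delta_endpoints; apply: isintB; apply: rlift_int_isint;
    do ?[exact: (sB _ (endpoint_in _ _)).1|exact: (sB _ (endpoint_in _ _)).2].
by apply: edge_int_isint; exact: comp_sub2.
Qed.

Lemma redge_int_cech x y z s : simage s `<=` B x `&` B y `&` B z ->
  redge_int y z s - redge_int x z s + redge_int x y s = 0.
Proof.
move=> sB; have sB' := comp_sub3 sB.
have h1 := edge_int_cech sB'.
have h2 := rlift_int_cst (sB _ (endpoint_in s 0)) (sB _ (endpoint_in s 1)).
move: h1; rewrite /redge_int !delta_endpoints.
rewrite -[endpoint (Phi_ s) 0]/(Phi (endpoint s 0)) -[endpoint (Phi_ s) 1]/(Phi (endpoint s 1)).
have alg (a a' b b' d d' e e' x1 x2 x3 : R) : a - b + d + e = a' - b' + d' + e' -> x1 - x2 + x3 = e - e' ->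
  (a - a' + x1) - (b - b' + x2) + (d - d' + x3) = 0 by lra.
exact: alg h2.
Qed.

Definition redge_base x (s : singular R M 1) := redge_int (pick s) x s.

Lemma redge_base_cech x y s : simage s `<=` B x `&` B y -> redge_base y s - redge_base x s = redge_int x y s.
Proof.
move=> sB; have hp := pick_indexP (ex_intro _ x (fun p h => (sB p h).1)).
have sB' : simage s `<=` B (pick s) `&` B x `&` B y by move=> p h; have [? ?] := sB p h; split; [split; first exact: hp|].
have := redge_int_cech sB'; rewrite /redge_base; move: (redge_int _ _ _) (redge_int _ _ _) (redge_int _ _ _) => a b d; lra.
Qed.

Lemma redge_base_isint x s : simage s `<=` B x -> isint (redge_base x s).
Proof.
move=> sB; have hp := pick_indexP (ex_intro _ x sB).
by apply: redge_int_isint => p h; split; [exact: hp|exact: sB].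
Qed.

Definition rtri_int x (s : singular R M 2) := tri_int c (idx x) (Phi_ s) - delta (redge_base x) s.

Lemma rtri_int_cech x y s : simage s `<=` B x `&` B y -> rtri_int x s = rtri_int y s.
Proof.
move=> sB; have sB' := comp_sub2 sB.
have h1 := tri_int_cech sB'.
have h2 : delta (fun t => redge_base y t - redge_base x t) s = delta (redge_int x y) s.
  by apply: eq_delta => i; apply: redge_base_cech; exact: face_sub sB.
have h3 : delta (redge_int x y) s = @coboundary R R N _ (edge_int c (idx x) (idx y)) (Phi_ s).
  by rewrite /redge_int deltaD deltaK add0r delta_comp.
have alg (a b d a' b' : R) : b - a = d -> b' - a' = d -> a - a' = b - b' by lra.
by apply: (alg _ _ _ _ _ h1); rewrite -deltaB h2 h3.
Qed.

(** Together with [tet_int] this is the integral relative cocycle on small simplices. *)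
Definition rtri_base (s : singular R M 2) := rtri_int (pick s) s.

Lemma rtri_baseE x s : simage s `<=` B x -> rtri_base s = rtri_int x s.
Proof.
move=> sB; have hp := pick_indexP (ex_intro _ x sB).
by apply: rtri_int_cech => p h; split; [exact: hp|exact: sB].
Qed.

Lemma rtri_base_isint s : small B s -> isint (rtri_base s).
Proof.
move=> [x sB]; rewrite (rtri_baseE sB); apply: isintB; first by apply: tri_int_isint; exact: comp_sub.
apply: (@delta_subgroup R M _ _ _ _ (@subgroup_int R)) => i; apply: redge_base_isint; exact: face_sub sB.
Qed.

Lemma delta_rtri_base s : small B s -> delta rtri_base s = tet_int c (Phi_ s).
Proof.
move=> [x sB]; rewrite (tet_intE (comp_sub sB)) -delta_comp.
rewrite (@eq_delta _ _ _ _ _ (rtri_int x)) => [|i]; first by rewrite /rtri_int deltaB deltaK subr0.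
by apply: rtri_baseE; exact: face_sub sB.
Qed.

Definition redge_real x (s : singular R M 1) :=
  integrate (rc_form rc x) s - delta (pt_cochain (rc_phase rc x)) s - edge_base c (idx x) (Phi_ s) - redge_base x s.

Lemma redge_real_cech x y s : smooth_simplex s -> simage s `<=` B x `&` B y -> redge_real x s = redge_real y s.
Proof.
move=> ss sB; have sB' := comp_sub2 sB.
have h1 := edge_base_cech (sing_comp_smooth Phi ss) sB'.
have h2 := redge_base_cech sB.
have h : B x `&` B y !=set0 by exists (endpoint s 0); apply: sB; exact: endpoint_in.
have [_ /(_ s ss sB) h3 _] := rc_lifted h.
move: h1 h2 h3; rewrite /redge_real /edge_real /redge_int !delta_endpoints /rlift_int.
rewrite -[endpoint (Phi_ s) 0]/(Phi (endpoint s 0)) -[endpoint (Phi_ s) 1]/(Phi (endpoint s 1)).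
have alg (Cx Cy A hx hy dx dy E f0 f1 l0 l1 gx0 gx1 gy0 gy1 : R) :
  hy - hx = A - E - (f0 - f1) -> dy - dx = l0 - (gy0 - gx0 - f0) - (l1 - (gy1 - gx1 - f1)) + E ->
  Cy - Cx - A = l0 - l1 -> Cx - (gx0 - gx1) - hx - dx = Cy - (gy0 - gy1) - hy - dy by lra.
exact: alg.
Qed.

(** Together with [tri_base] this is the relative cochain that compares the integrals of (tau,
    kappa) with the integral cocycle on small smooth simplices, up to sign in this component. *)
Definition redge_form (s : singular R M 1) := redge_real (pick s) s.

Lemma redge_formE x s : smooth_simplex s -> simage s `<=` B x -> redge_form s = redge_real x s.
Proof.
move=> ss sB; have hp := pick_indexP (ex_intro _ x sB).
by apply: redge_real_cech => // p h; split; [exact: hp|exact: sB].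
Qed.

Lemma delta_redge_form s : smooth_simplex s -> small B s ->
  delta redge_form s = rtri_base s + tri_base c (Phi_ s) - integrate tau s.
Proof.
move=> ss [x sB]; have ss' := sing_comp_smooth Phi ss; have sB' := comp_sub sB.
rewrite (rtri_baseE sB) (tri_baseE hG hD hu ss' sB').
rewrite (@eq_delta _ _ _ _ _ (redge_real x)) => [|i]; last first.
  by apply: redge_formE; [exact: smooth_simplex_face|exact: face_sub sB].
have h1 : delta (redge_real x) s = delta (integrate (rc_form rc x)) s - 0 -
    @coboundary R R N _ (edge_base c (idx x)) (Phi_ s) - delta (redge_base x) s.
  by rewrite -(delta_comp (edge_base c (idx x))) /redge_real !deltaB deltaK.
have fv := pull_form_is_form Phi (gc_open c (idx x)) (varpi_is_form hD c (idx x)).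
have h2 : delta (integrate (rc_form rc x)) s = integrate (g_varpi D (gc_idx c (idx x))) (Phi_ s) - integrate tau s.
  rewrite (integrate_map _ _ ss) -[LHS](integrate_stokes (rc_open rc x) (rc_is_form rc x) ss sB).
  rewrite -(integrateB (rc_open rc x) (is_form_sub (rc_sub (r := rc) (x := x)) fv) (is_form_sub (fun _ _ => I) ftau) ss sB).
  by apply: eq_integrate => p v /sB; exact: rc_tau.
have alg (v t e d w : R) : v - t - 0 - e - d = w - d + (v - w - e) - t by ring.
by rewrite h1 h2; exact: alg.
Qed.

End RelativeZigzag.

(** * Integrality of the curvature *)

Section Integrality.
Context {R : realType} {m n : nat} {M : manifold R m} {N : manifold R n} (Phi : smooth_map M N).
Local Notation deltaM w := (@coboundary R R M _ w).
Local Notation deltaN w := (@coboundary R R N _ w).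

Lemma integral_lift (Y : topologicalType) k (w : singular R Y k -> R) : (forall s, isint (w s)) ->
  exists wi : singular R Y k -> int, forall s, w s = (wi s)%:~R.
Proof.
move=> hw; have /choice[wi E] : forall s, exists z : int, w s = z%:~R by move=> s; exact/intrP/hw.
by exists wi.
Qed.

Lemma coboundary_intr (Y : topologicalType) k (w : singular R Y k -> int) s :
  (coboundary w s)%:~R = @coboundary R R Y k (fun t => (w t)%:~R) s.
Proof. by rewrite /coboundary rmorph_sum; apply: eq_bigr => i _; rewrite /= rmorphM rmorphXn rmorphN1. Qed.

Lemma integrate_eq0 l (Y : manifold R l) k (w : diff_form Y k) (s : singular R Y k) : smooth_simplex s ->
  (forall p v, simage s p -> w p v = 0) -> integrate w s = 0.
Proof.
move=> ss w0; have f0 : is_form setT (fun (p : Y) (v : 'M[R]_(k, l)) => 0 : R).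
  split=> [p _|d ad v]; last exact: (@smooth_cst R _ R^o).
  by split=> // i A A' A'' b b' _ _ _; rewrite !mulr0 addr0.
rewrite (eq_integrate (w' := fun p v => 0 - 0)) => [|p v /w0 ->]; last by rewrite subr0.
by rewrite (integrateB openT f0 f0 ss (fun _ _ => I)) subrr.
Qed.

(** The integral cocycle is extended to all singular simplices and the comparison cochains only with
    respect to smooth ones. Each time N comes before M, because the equation on M involves the
    cochain already extended on N. *)
Theorem relative_gerbe_integral (tau : diff_form M 2) (kappa : diff_form N 3) (X : relative_gerbe Phi) :
  is_form setT tau -> is_form setT kappa -> closed_relative_form Phi tau kappa -> has_curvature X tau kappa ->
  integral_relative_form Phi tau kappa.
Proof.
move=> ftau fkappa [ct ck] [ht hk].
have hG := rg_is_gerbe X; have hD := rg_is_conn X.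
have [u hu] := gerbe_trivialization hG.
have [c] := gerbe_cocycle_exists hG hD hu.
have [rc] := relative_cocycle_exists hu c ht.
have cN (p : N) : exists x, gc_cover c x p by exists p; exact: gc_mem.
have cM (p : M) : exists x, rc_cover rc x p by exists p; exact: rc_mem.
have subN (s : singular R M 3) : small (rc_cover rc) s -> small (gc_cover c) (sing_comp Phi s).
  by move=> [x sB]; exists (rc_idx rc x); exact: comp_sub.
have dcomp k (w : singular R N k -> R) (s : singular R M k.+1) :
    deltaM (fun t => w (sing_comp Phi t)) s = deltaN w (sing_comp Phi s) := delta_comp Phi w s.
have [Z2 [Z2e Z2c Z2i]] : exists Z2 : singular R N 3 -> R,
    [/\ forall s, small (gc_cover c) s -> Z2 s = tet_int c s, forall s, deltaN Z2 s = 0 & forall s, isint (Z2 s)].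
  have [||E [E1 E2 E3]] := cochain_extension (C := fun _ _ => True) (gc_open c) cN (fun _ _ _ _ _ _ => I)
    (@subgroup0 R) (k := 2) (e := tet_int c) (c := fun=> 0).
  - by move=> s _; rewrite /coboundary big1// => i _; rewrite mulr0.
  - by move=> s _ ss; rewrite subr0; exact: delta_tet_int.
  exists E; split=> [s ss|s|s].
  - by apply/eqP; rewrite -subr_eq0; apply/eqP; exact: E1.
  - by have := E2 s I; rewrite subr0.
  apply: (E3 _ (@subgroup_int R)) => // t _; exact: tet_int_isint.
have [Z1 [Z1e Z1c Z1i]] : exists Z1 : singular R M 2 -> R,
    [/\ forall s, small (rc_cover rc) s -> Z1 s = rtri_base rc s, forall s, deltaM Z1 s = Z2 (sing_comp Phi s) & forall s, isint (Z1 s)].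
  have [||E [E1 E2 E3]] := cochain_extension (C := fun _ _ => True) (rc_open rc) cM (fun _ _ _ _ _ _ => I)
    (@subgroup0 R) (k := 1) (e := rtri_base rc) (c := fun s => Z2 (sing_comp Phi s)).
  - by move=> s _; rewrite dcomp.
  - by move=> s _ ss; rewrite delta_rtri_base// Z2e ?subrr//; exact: subN.
  exists E; split=> [s ss|s|s].
  - by apply/eqP; rewrite -subr_eq0; apply/eqP; exact: E1.
  - by apply/eqP; rewrite -subr_eq0; apply/eqP; exact: E2.
  apply: (E3 _ (@subgroup_int R)) => // t _; [exact: rtri_base_isint|exact: Z2i].
have [be [beE bec]] : exists be : singular R N 2 -> R,
    (forall s, smooth_simplex s -> small (gc_cover c) s -> be s = tri_base c s) /\
    forall s, smooth_simplex s -> deltaN be s = integrate kappa s - Z2 s.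
  have [||E [E1 E2 _]] := cochain_extension (C := fun k s => smooth_simplex s) (gc_open c) cN
    (fun k l s S => @smooth_simplex_affine _ _ _ _ _ s S)
    (@subgroup0 R) (k := 1) (e := tri_base c) (c := fun s => integrate kappa s - Z2 s).
  - move=> s ss; rewrite deltaB Z2c subr0 -[LHS](integrate_stokes openT fkappa ss (fun _ _ => I)).
    by apply: integrate_eq0 => // p v _; exact: ck.
  - by move=> s ss sm; rewrite (delta_tri_base hG hD hu hk ss sm) Z2e// subrr.
  exists E; split=> [s ss sm|s ss].
  - by apply/eqP; rewrite -subr_eq0; apply/eqP; exact: E1.
  - by apply/eqP; rewrite -subr_eq0; apply/eqP; exact: E2.
have [al alc] : exists al : singular R M 1 -> R,
    forall s, smooth_simplex s -> deltaM al s = Z1 s + be (sing_comp Phi s) - integrate tau s.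
  have [||E [E1 E2 _]] := cochain_extension (C := fun k s => smooth_simplex s) (rc_open rc) cM
    (fun k l s S => @smooth_simplex_affine _ _ _ _ _ s S)
    (@subgroup0 R) (k := 0) (e := redge_form rc) (c := fun s => Z1 s + be (sing_comp Phi s) - integrate tau s).
  - move=> s ss; rewrite deltaB deltaD Z1c dcomp bec; last exact: sing_comp_smooth.
    rewrite -[X in _ - X = 0](integrate_stokes openT ftau ss (fun _ _ => I)) integrate_map//.
    rewrite [X in X - _]addrC subrK; apply/eqP; rewrite subr_eq0; apply/eqP; apply: eq_integrate => p v _.
    by apply/eqP; rewrite -subr_eq0; apply/eqP; exact: ct.
  - move=> s ss sm; rewrite (delta_redge_form hu ftau ss sm) Z1e// beE ?subrr//.
      exact: sing_comp_smooth.
    by case: sm => x sB; exists (rc_idx rc x); exact: comp_sub.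
  exists E => s ss.
  by apply/eqP; rewrite -subr_eq0; apply/eqP; exact: E2.
have [z1 Ez1] := integral_lift Z1i; have [z2 Ez2] := integral_lift Z2i.
have EZ1 : Z1 = fun s => (z1 s)%:~R by apply/funext.
have EZ2 : Z2 = fun s => (z2 s)%:~R by apply/funext.
have D0 (Y : topologicalType) k (s : singular R Y k.+1) : @coboundary R R Y k (fun=> 0) s = 0.
  by rewrite /coboundary big1// => i _; rewrite mulr0.
exists (Z1, Z2); split.
  split; first by split=> s /=; rewrite ?Z1c ?subrr ?Z2c.
  exists (al, be); split=> s ss /=; first by rewrite alc//; ring.
  by rewrite bec//; ring.
exists (z1, z2); split.
  split=> s /=; apply/eqP; rewrite -(@intr_eq0 R) ?rmorphB /= coboundary_intr; apply/eqP.
    by rewrite -EZ1 Z1c Ez2 subrr.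
  by rewrite -EZ2 Z2c.
(* The real representative is integer-valued from the start, so no further coboundary separates it
   from the integer cocycle. *)
by exists (fun=> 0, fun=> 0); split=> s /=; rewrite ?D0 ?subr0 ?addr0.
Qed.

End Integrality.

Theorem theorem4p3p1 (R : realType) (m n : nat) (M : manifold R m)
    (N : manifold R n) (Phi : smooth_map M N)
    (tau : diff_form M 2) (kappa : diff_form N 3)
    (htau : is_form setT tau) (hkappa : is_form setT kappa)
    (hclosed : closed_relative_form Phi tau kappa) :
  (exists X : relative_gerbe Phi, has_curvature X tau kappa) <->
  integral_relative_form Phi tau kappa.
Proof.
split=> [[X hX]|]; first exact: relative_gerbe_integral htau hkappa hclosed hX.
exact: integral_relative_gerbe.
Qed.
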